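(* Let $Q$ be a Buchsbaum pseudo-cell complex of dimension $n$, $S=S_Q$, let $\rho\colon Y\to Q$ be a principal $T^N$-bundle and $\lambda$ a characteristic map over $\Bbbk$. Let $\mathcal H_0$ be the structure sheaf, $\mathcal I$ the sheaf of ideals and $\widehat\Pi$ the cosheaf of ideals on $S$ associated with these data. Then for every $k$ there exists an isomorphism $$H^k(S;\mathcal H_0\otimes\mathcal I)\cong H_{n-1-k}(S;\widehat\Pi)$$ which respects the gradings of $\mathcal I$ and $\widehat\Pi$ (by degree in the exterior algebra).
   Context: The ground ring $\Bbbk$ is a field or $\mathbb Z$; all homology is with coefficients in $\Bbbk$ unless stated otherwise. Simplicial posets. A finite poset $S$ is simplicial if it has a least element $\varnothing$ and every lower interval $S_{\leqslant I}$ is isomorphic to a Boolean lattice $2^{[k]}$; then $|I|=k$, $\dim I=|I|-1$. Vertices are elements of rank 1; $\mathrm{Vert}(S)$ is their set. $I<_1J$ means $I<J$, $|J|=|I|+1$. Fix a sign convention: $[J:I]=\pm1$ for $I<_1J$ with $[J:J'][J':I]+[J:J''][J'':I]=0$ whenever $I<_1J',J''<_1J$, $J'\ne J''$. Sheaves and cosheaves. A sheaf $\mathcal A$ on $S$ is a covariant functor from the poset category of $S$ (including $\varnothing$) to $\Bbbk$-modules; $C^i(S;\mathcal A)=\bigoplus_{\dim I=i}\mathcal A(I)$, $i\geqslant-1$, with differential the sum of $[I':I]\mathcal A(I\leqslant I')$ over $I<_1I'$, and $H^*(S;\mathcal A)$ is its cohomology. A cosheaf $\widehat{\mathcal A}$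 is a contravariant functor; $C_i(S;\widehat{\mathcal A})=\bigoplus_{\dim I=i}\widehat{\mathcal A}(I)$ with differential the sum of $[I:I']\widehat{\mathcal A}(I\geqslant I')$ over $I>_1I'$, and $H_*(S;\widehat{\mathcal A})$ is its homology. Tensor products are taken componentwise. Pseudo-cell complexes. A $k$-dimensional pseudo-cell is a CW-pair $(F,\partial F)$ with $F$ compact and connected, $\dim F=k$, $\dim\partial F\leqslant k-1$. A pseudo-cell complex $Q$ is a union of subspaces $\varnothing=Q_{-1}\subset Q_0\subset Q_1\subset\cdots$, where $Q_k$ is obtained from $Q_{k-1}$ by attaching finitely many $k$-dimensional pseudo-cells along injective maps $\partial F\to Q_{k-1}$; it is assumed that the boundary of each pseudo-cell is a union of lower dimensional pseudo-cells. $S_Q$ is the poset of pseudo-cells ordered by reversed inclusion; $F_I$ is the pseudo-cell corresponding to $I$, $F_I^\circ=F_I\setminus\partial F_I$. $Q$ is simple of dimension $n$ if $S_Q$ is a simplicial poset of dimension $n-1$ and $\dim F_I=n-|I|$ for all $I$. A simple $Q$ is Buchsbaum if for every $I\neq\varnothing$ the space $F_I$ is acyclic over $\mathbb Z$ and $H_i(F_I,\partial F_I)=0$ for $i\neq\dim F_I$. Structure sheaf. $\mathcal H_0(I)=H_{\dim F_I}(F_I,\partial F_I)$, and for $I<_1J$, $\mathcal H_0(I<J)=[J:I]m_{I,J}$, where $m_{I,J}$ is the composition $H_{\dim F_I}(F_I,\partial F_I)\to H_{\dim F_I-1}(\partial F_I)\to H_{\dim F_I-1}(\partial F_I,\partial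 F_I\setminus F_J^\circ)\cong H_{\dim F_J}(F_J,\partial F_J)$; for general $I<J$ compose along any saturated chain. Torus data. For $I\neq\varnothing$ the bundle over $F_I$ is trivial since $F_I$ is acyclic over $\mathbb Z$; fix trivializations $\xi_I\colon\rho^{-1}(F_I)\cong F_I\times T^N$, and write $T^N(I)$ for the torus factor. For $\varnothing\ne I\leqslant J$ comparison of $\xi_I$ (restricted over $F_J$) and $\xi_J$ gives transition homeomorphisms $\mathrm{tr}_{I\leqslant J}\colon T^N(I)\to T^N(J)$, carrying one-dimensional subtori to one-dimensional subtori. $\mathcal L$ is the sheaf with $\mathcal L(I)=H_*(T^N(I))$ for $I\neq\varnothing$, $\mathcal L(\varnothing)=0$, with restriction maps (isomorphisms of exterior algebras) induced by $\mathrm{tr}$; it is graded by homological degree. $\widehat{\mathcal L}$ is the cosheaf with the same values and inverse maps. A characteristic map $\lambda$ over $\Bbbk$ is a choice of a one-dimensional subtorus $\lambda(i)\subset T^N(i)$ for each $i\in\mathrm{Vert}(S)$ such that for every $I\ne\varnothing$ with vertices $i_1,\ldots,i_k$ the map from $H_1$ of the product of the subtori $\mathrm{tr}_{i_s\leqslant I}\lambda(i_s)$ to $H_1(T^N(I);\Bbbk)$ is injective and splits. For $i\leqslant I$ let $\omega_i\in\mathcal L(I)^{(1)}=H_1(T^N(I))$ be the image of the fundamental class of $\lambda(i)\cong T^1$ (defined up to sign; signs are irrelevant below). Ideals. For $I\ne\varnothing$ with vertices $i_1,\dots,i_k$, $\mathcal I(I)=(\omega_{i_1},\ldots,\omega_{i_k})\subset\mathcal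 L(I)$ is the ideal generated by these linear forms, $\mathcal I(\varnothing)=0$; this is a graded subsheaf of $\mathcal L$. $\widehat\Pi(I)\subset\widehat{\mathcal L}(I)$ is the principal ideal generated by $\omega_{i_1}\wedge\dots\wedge\omega_{i_k}$, $\widehat\Pi(\varnothing)=0$; this is a graded subcosheaf of $\widehat{\mathcal L}$. *)

(* Defs.v *)
From HB Require Import structures.
From mathcomp Require Import all_boot all_order all_algebra.
From mathcomp Require Import generic_quotient ring_quotient.
From mathcomp Require Import all_classical all_reals all_analysis.
From mathcomp Require Import complex.
From mathcomp.multinomials Require Import freeg.

Set Implicit Arguments.
Unset Strict Implicit.
Unset Printing Implicit Defensive.

Import Order.TTheory GRing.Theory Num.Theory.
Import numFieldNormedType.Exports.

Local Open Scope classical_set_scope.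
Local Open Scope ring_scope.

Record submod (k : comUnitRingType) (M : lmodType k) := Submod {
  submod_set :> M -> Prop;
  submod_set0 : submod_set 0;
  submod_setP : forall a x y,
    submod_set x -> submod_set y -> submod_set (a *: x + y) }.

Section Submodules.
Context {k : comUnitRingType}.
Implicit Types M N : lmodType k.

Definition submod_pred M (U : submod M) : {pred M} := fun x => `[< U x >].

Lemma submod_pred_closed M (U : submod M) :
  GRing.subsemimod_closed (submod_pred U).
Proof.
split; first split.
- exact/asboolP/submod_set0.
- move=> x y /asboolP Ux /asboolP Uy; apply/asboolP.
  by rewrite -[x]scale1r; exact: submod_setP.
- move=> a x /asboolP Ux; apply/asboolP; rewrite -[a *: x]addr0.
  by apply: submod_setP => //; exact: submod_set0.
Qed.
HB.instance Definition _ M (U : submod M) :=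
  GRing.isSubmodClosed.Build k M (submod_pred U) (submod_pred_closed U).

Definition submod_type M (U : submod M) : Type := {x : M | x \in submod_pred U}.
HB.instance Definition _ M (U : submod M) := SubChoice.on (submod_type U).
HB.instance Definition _ M (U : submod M) :=
  [SubChoice_isSubLmodule of submod_type U by <:].

Program Definition submod0 M : submod M := @Submod k M [set 0] _ _.
Next Obligation. by []. Qed.
Next Obligation. by move=> M a x y /= -> ->; rewrite scaler0 addr0. Qed.

Program Definition submod_span M (A : set M) : submod M :=
  @Submod k M (fun x => forall U : submod M, A `<=` submod_set U -> U x) _ _.
Next Obligation. by move=> M A U _; exact: submod_set0. Qed.
Next Obligation.
by move=> M A a x y Ax Ay U AU; apply: submod_setP; [exact: Ax|exact: Ay].
Qed.

Program Definition submod_cap M (U V : submod M) : submod M :=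
  @Submod k M (fun x => U x /\ V x) _ _.
Next Obligation. by move=> M U V; split; exact: submod_set0. Qed.
Next Obligation.
by move=> M U V a x y [? ?] [? ?]; split; exact: submod_setP.
Qed.

Program Definition submod_add M (U V : submod M) : submod M :=
  @Submod k M [set z | exists x y, [/\ U x, V y & z = x + y]] _ _.
Next Obligation.
by move=> M U V; exists 0, 0; rewrite addr0; split=> //; exact: submod_set0.
Qed.
Next Obligation.
move=> M U V a _ _ [x [y [Ux Vy ->]]] [x' [y' [Ux' Vy' ->]]].
exists (a *: x + x'), (a *: y + y').
by split; [exact: submod_setP|exact: submod_setP|rewrite scalerDr addrACA].
Qed.

Program Definition submod_preim M N (f : {linear M -> N}) (V : submod N) :
  submod M := @Submod k M (fun x => V (f x)) _ _.
Next Obligation. by move=> M N f V /=; rewrite linear0; exact: submod_set0. Qed.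
Next Obligation.
by move=> M N f V a x y /= Vx Vy; rewrite linearP; exact: submod_setP.
Qed.

Program Definition submod_im M N (f : {linear M -> N}) (U : submod M) :
  submod N := @Submod k N (f @` (submod_set U)) _ _.
Next Obligation.
by move=> M N f U; exists 0; [exact: submod_set0|exact: linear0].
Qed.
Next Obligation.
move=> M N f U a _ _ [x Ux <-] [y Uy <-]; exists (a *: x + y).
  exact: submod_setP.
by rewrite linearP.
Qed.

Definition quot_mod M (B : submod M) : Type :=
  Quotient.quot (submod_pred B : zmodClosed M).
HB.instance Definition _ M (B : submod M) :=
  GRing.Zmodule.copy (quot_mod B) (Quotient.quot (submod_pred B : zmodClosed M)).
Definition quot_pi M (B : submod M) (x : M) : quot_mod B :=
  (\pi_(Quotient.quot (submod_pred B : zmodClosed M)) x)%qT.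
Definition quot_repr M (B : submod M) (q : quot_mod B) : M :=
  generic_quotient.repr
    (q : Quotient.quot (submod_pred B : zmodClosed M)).

Lemma quot_reprK M (B : submod M) : cancel (@quot_repr M B) (@quot_pi M B).
Proof. exact: generic_quotient.reprK. Qed.

Lemma quot_eqP M (B : submod M) x y : quot_pi B x = quot_pi B y <-> B (x - y).
Proof.
split=> [/eqP h|h].
  by apply/asboolP; move: h; rewrite /quot_pi -Quotient.idealrBE.
by apply/eqP; rewrite /quot_pi -Quotient.idealrBE; exact/asboolP.
Qed.

Lemma quot_piD M (B : submod M) x y :
  quot_pi B (x + y) = quot_pi B x + quot_pi B y.
Proof. by rewrite /quot_pi !piE. Qed.

Definition quot_scale M (B : submod M) (a : k) (q : quot_mod B) : quot_mod B :=
  quot_pi B (a *: quot_repr q).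

Lemma quot_piZ M (B : submod M) a x :
  quot_pi B (a *: x) = quot_scale a (quot_pi B x).
Proof.
apply/quot_eqP; rewrite -scalerBr -[_ *: _]addr0; apply: submod_setP.
  by apply/quot_eqP; rewrite quot_reprK.
exact: submod_set0.
Qed.

Lemma quot_scaleA M (B : submod M) a b (q : quot_mod B) :
  quot_scale a (quot_scale b q) = quot_scale (a * b) q.
Proof. by rewrite -(quot_reprK q) -!quot_piZ scalerA. Qed.
Lemma quot_scale1 M (B : submod M) : left_id 1 (@quot_scale M B).
Proof. by move=> q; rewrite -(quot_reprK q) -quot_piZ scale1r. Qed.
Lemma quot_scaleDr M (B : submod M) : right_distributive (@quot_scale M B) +%R.
Proof.
move=> a p q; rewrite -(quot_reprK p) -(quot_reprK q).
by rewrite -quot_piD -!quot_piZ scalerDr quot_piD.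
Qed.
Lemma quot_scaleDl M (B : submod M) (q : quot_mod B) :
  {morph (@quot_scale M B)^~ q : a b / a + b}.
Proof.
by move=> a b; rewrite -(quot_reprK q) -!quot_piZ scalerDl quot_piD.
Qed.
HB.instance Definition _ M (B : submod M) :=
  GRing.Zmodule_isLmodule.Build k (quot_mod B)
    (@quot_scaleA M B) (@quot_scale1 M B) (@quot_scaleDr M B)
    (@quot_scaleDl M B).

End Submodules.

Section Subquotients.
Context {k : comUnitRingType}.
Implicit Types M N : lmodType k.

(* Z / (Z `&` B) *)
Definition subquot M (Z B : submod M) : lmodType k :=
  quot_mod (submod_preim (val : {linear submod_type Z -> M}) B).

(* The class of x in Z / (Z `&` B); it is 0 when x is not in Z. *)
Definition cls M (Z B : submod M) (x : M) : subquot Z B :=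
  quot_pi _ (insubd (0 : submod_type Z) x).

Definition cls_repr M (Z B : submod M) (q : subquot Z B) : M :=
  val (quot_repr q).

(* The map of subquotients induced by f, when f Z is in Z' and f B in B'. *)
Definition subquot_map M N (Z B : submod M) (Z' B' : submod N)
  (f : M -> N) (q : subquot Z B) : subquot Z' B' := cls Z' B' (f (cls_repr q)).

End Subquotients.

Section DirectSums.
Context {k : comUnitRingType} {S : Type}.
Implicit Type A : S -> lmodType k.

(* The direct sum of a family of modules, which is used for finite S only. *)
Definition dsum A : Type := forall I, A I.
HB.instance Definition _ A := gen_eqMixin (dsum A).
HB.instance Definition _ A := gen_choiceMixin (dsum A).
Definition dsum_add A (c c' : dsum A) : dsum A := fun I => c I + c' I.
Definition dsum_opp A (c : dsum A) : dsum A := fun I => - c I.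
Definition dsum_scale A a (c : dsum A) : dsum A := fun I => a *: c I.

Lemma dsum_addA A : associative (@dsum_add A).
Proof. by move=> x y z; apply: functional_extensionality_dep => I; exact: addrA. Qed.
Lemma dsum_addC A : commutative (@dsum_add A).
Proof. by move=> x y; apply: functional_extensionality_dep => I; exact: addrC. Qed.
Lemma dsum_add0 A : left_id ((fun=> 0) : dsum A) (@dsum_add A).
Proof. by move=> x; apply: functional_extensionality_dep => I; exact: add0r. Qed.
Lemma dsum_addN A : left_inverse ((fun=> 0) : dsum A) (@dsum_opp A) (@dsum_add A).
Proof. by move=> x; apply: functional_extensionality_dep => I; exact: addNr. Qed.
HB.instance Definition _ A := GRing.isZmodule.Build (dsum A)
  (@dsum_addA A) (@dsum_addC A) (@dsum_add0 A) (@dsum_addN A).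

Lemma dsum_scaleA A a b (c : dsum A) :
  dsum_scale a (dsum_scale b c) = dsum_scale (a * b) c.
Proof. by apply: functional_extensionality_dep => I; exact: scalerA. Qed.
Lemma dsum_scale1 A : left_id 1 (@dsum_scale A).
Proof. by move=> c; apply: functional_extensionality_dep => I; exact: scale1r. Qed.
Lemma dsum_scaleDr A : right_distributive (@dsum_scale A) +%R.
Proof. by move=> a c c'; apply: functional_extensionality_dep => I; exact: scalerDr. Qed.
Lemma dsum_scaleDl A (c : dsum A) : {morph (@dsum_scale A)^~ c : a b / a + b}.
Proof. by move=> a b; apply: functional_extensionality_dep => I; exact: scalerDl. Qed.
HB.instance Definition _ A := GRing.Zmodule_isLmodule.Build k (dsum A)
  (@dsum_scaleA A) (@dsum_scale1 A) (@dsum_scaleDr A) (@dsum_scaleDl A).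

Lemma dsumDE A (c c' : dsum A) I : (c + c') I = c I + c' I. Proof. by []. Qed.
Lemma dsumZE A a (c : dsum A) I : (a *: c) I = a *: c I. Proof. by []. Qed.

End DirectSums.

Section TensorProduct.
Context {k : comUnitRingType}.
Implicit Types M N P : lmodType k.

Definition free_mod (K : choiceType) : lmodType k := {freeg K / k}.
Definition gen (K : choiceType) (x : K) : free_mod K := << x >>.

Definition lin_ext (K : choiceType) M (f : K -> M) : free_mod K -> M := fglift f.

Lemma lin_ext_is_additive (K : choiceType) M (f : K -> M) :
  {morph lin_ext f : u v / u - v}.
Proof. exact: lift_is_additive. Qed.
HB.instance Definition _ (K : choiceType) M (f : K -> M) :=
  GRing.isZmodMorphism.Build (free_mod K) M (lin_ext f) (lin_ext_is_additive f).

Lemma free_modE (K : choiceType) (u : free_mod K) :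
  u = \sum_(x <- dom u) coeff x u *: gen x.
Proof.
rewrite -[LHS]freeg_sumE; apply: eq_bigr => x _.
apply/eqP/freeg_eqP => y; rewrite coeffZ !coeffU.
by rewrite mul1r.
Qed.

Lemma lin_extU (K : choiceType) M (f : K -> M) a x :
  lin_ext f << a *g x >> = a *: f x.
Proof. exact: liftU. Qed.

Lemma lin_ext_gen (K : choiceType) M (f : K -> M) x : lin_ext f (gen x) = f x.
Proof. by rewrite /gen lin_extU scale1r. Qed.

Lemma lin_ext_is_scalable (K : choiceType) M (f : K -> M) : scalable (lin_ext f).
Proof.
move=> a u; rewrite [a *: u]/(fgscale a u) /fgscale raddf_sum /=.
rewrite -[in RHS](freeg_sumE u) raddf_sum /= scaler_sumr.
by apply: eq_bigr => x _; rewrite !lin_extU scalerA.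
Qed.
HB.instance Definition _ (K : choiceType) M (f : K -> M) :=
  GRing.isScalable.Build k (free_mod K) M *:%R (lin_ext f)
    (lin_ext_is_scalable f).

Lemma free_mod_ext (K : choiceType) M (f g : {linear free_mod K -> M}) :
  (forall x, f (gen x) = g (gen x)) -> f =1 g.
Proof.
move=> fg u; rewrite (free_modE u) !linear_sum.
by apply: eq_bigr => x _; rewrite !linearZ /= fg.
Qed.

Definition bilinear_rels M N : set (free_mod (M * N)%type) :=
  [set u | exists a x x' y,
     u = gen (a *: x + x', y) - a *: gen (x, y) - gen (x', y)] `|`
  [set u | exists a x y y',
     u = gen (x, a *: y + y') - a *: gen (x, y) - gen (x, y')].

Definition tensor M N : lmodType k := quot_mod (submod_span (@bilinear_rels M N)).

Definition tensor_free M N M' N' (f : M -> M') (g : N -> N') :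
  free_mod (M * N)%type -> free_mod (M' * N')%type :=
  lin_ext (fun p : M * N => gen (f p.1, g p.2)).
HB.instance Definition _ M N M' N' (f : M -> M') (g : N -> N') :=
  GRing.Linear.on (tensor_free f g).

Definition tensor_map M N M' N' (f : M -> M') (g : N -> N')
  (q : tensor M N) : tensor M' N' :=
  quot_pi _ (tensor_free f g (quot_repr q)).

Lemma tensor_free_rels M N M' N' (f : {linear M -> M'}) (g : {linear N -> N'}) u :
  submod_span (@bilinear_rels M N) u ->
  submod_span (@bilinear_rels M' N') (tensor_free f g u).
Proof.
move=> su; suff: submod_preim (tensor_free f g : {linear _ -> _})
  (submod_span (@bilinear_rels M' N')) u by [].
apply: su.
move=> _ [[a [x [x' [y ->]]]]|[a [x [y [y' ->]]]]] U; apply => /=;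
  rewrite !linearB /= linearZ /= /tensor_free !lin_ext_gen /= linearP.
- by left; exists a, (f x), (f x'), (g y).
- by right; exists a, (f x), (g y), (g y').
Qed.

Lemma tensor_map_pi M N M' N' (f : {linear M -> M'}) (g : {linear N -> N'}) u :
  tensor_map f g (quot_pi _ u) = quot_pi _ (tensor_free f g u).
Proof.
apply/quot_eqP; rewrite -linearB; apply: tensor_free_rels.
by apply/quot_eqP; rewrite quot_reprK.
Qed.

Lemma tensor_map_is_linear M N M' N' (f : {linear M -> M'})
  (g : {linear N -> N'}) : linear (tensor_map f g).
Proof.
move=> a p q; rewrite -(quot_reprK p) -(quot_reprK q).
rewrite -[a *: _]quot_piZ -quot_piD !tensor_map_pi linearP quot_piD.
by congr (_ + _); exact: quot_piZ.
Qed.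
HB.instance Definition _ M N M' N' (f : {linear M -> M'}) (g : {linear N -> N'}) :=
  GRing.isLinear.Build k (tensor M N) (tensor M' N') *:%R (tensor_map f g)
    (tensor_map_is_linear f g).

Lemma tensor_map_id M N (f : {linear M -> M}) (g : {linear N -> N}) :
  f =1 id -> g =1 id -> tensor_map f g =1 id.
Proof.
move=> f1 g1 q; rewrite -[RHS](quot_reprK q) -[in LHS](quot_reprK q) tensor_map_pi.
congr quot_pi; apply: (@free_mod_ext _ _ (tensor_free f g) idfun) => -[x y].
by rewrite /= /tensor_free lin_ext_gen /= f1 g1.
Qed.

Lemma tensor_map_comp M N M' N' M'' N''
  (f : {linear M -> M'}) (g : {linear N -> N'})
  (f' : {linear M' -> M''}) (g' : {linear N' -> N''})
  (f'' : {linear M -> M''}) (g'' : {linear N -> N''}) :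
  f' \o f =1 f'' -> g' \o g =1 g'' ->
  tensor_map f' g' \o tensor_map f g =1 tensor_map f'' g''.
Proof.
move=> ff gg q; rewrite /= -(quot_reprK q) !tensor_map_pi; congr quot_pi.
apply: (@free_mod_ext _ _ (tensor_free f' g' \o tensor_free f g)
  (tensor_free f'' g'')) => -[x y].
by rewrite /= /tensor_free !lin_ext_gen /= -ff -gg.
Qed.

End TensorProduct.

(* The second case says that k is the ring of integers. *)
Definition field_or_int (k : comUnitRingType) : Prop :=
  (forall x : k, x != 0 -> x \is a GRing.unit) \/
  (exists f : {rmorphism int -> k}, bijective f).

Section SimplicialPosets.
Context {disp : Order.disp_t} {S : finBPOrderType disp} (rk : S -> nat).

(* rk I is |I|: the interval below I is the Boolean lattice of rank rk I. *)
Definition simplicial_poset : Prop :=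
  forall I : S, exists f : {set 'I_(rk I)} -> S,
    (forall A B, (f A <= f B)%O = (A \subset B)) /\
    (forall J, (J <= I)%O <-> exists A, f A = J).

Definition sdim (I : S) : int := (rk I)%:Z - 1.
Definition covers (I J : S) : bool := (I < J)%O && (rk J == (rk I).+1).
Definition vertex (i : S) : bool := rk i == 1%N.
Definition verts (I : S) : {pred S} := fun i => vertex i && (i <= I)%O.

(* sgn J I is [J:I]. *)
Definition sign_convention (sgn : S -> S -> int) : Prop :=
  (forall I J, covers I J -> sgn J I = 1 \/ sgn J I = -1) /\
  (forall I J' J'' J, J' != J'' ->
    covers I J' -> covers J' J -> covers I J'' -> covers J'' J ->
    sgn J J' * sgn J' I + sgn J J'' * sgn J'' I = 0).

End SimplicialPosets.

Section Sheaves.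
Context {k : comUnitRingType} {disp : Order.disp_t} {S : finBPOrderType disp}.
Implicit Type A : S -> lmodType k.

(* A sheaf with values A; res I J is meaningful for I <= J only. *)
Record sheaf A := Sheaf {
  res : forall I J, {linear A I -> A J};
  res_id : forall I, res I I =1 id;
  res_comp : forall I J K, (I <= J)%O -> (J <= K)%O ->
    res J K \o res I J =1 res I K }.

(* A cosheaf with values A; cores I J, for I <= J, is the map A(J) -> A(I). *)
Record cosheaf A := Cosheaf {
  cores : forall I J, {linear A J -> A I};
  cores_id : forall I, cores I I =1 id;
  cores_comp : forall I J K, (I <= J)%O -> (J <= K)%O ->
    cores I J \o cores J K =1 cores I K }.

Program Definition tensor_sheaf A B (F : sheaf A) (G : sheaf B) :
    sheaf (fun I => tensor (A I) (B I)) :=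
  @Sheaf _ (fun I J => tensor_map (res F I J) (res G I J)) _ _.
Next Obligation.
by move=> A B F G I; apply: tensor_map_id; exact: res_id.
Qed.
Next Obligation.
by move=> A B F G I J K IJ JK; apply: tensor_map_comp; exact: res_comp.
Qed.

Definition subsheaf A (F : sheaf A) (U : forall I, submod (A I))
    (G : sheaf (fun I => submod_type (U I))) : Prop :=
  forall I J x, (I <= J)%O -> val (res G I J x) = res F I J (val x).

Definition subcosheaf A (F : cosheaf A) (U : forall I, submod (A I))
    (G : cosheaf (fun I => submod_type (U I))) : Prop :=
  forall I J x, (I <= J)%O -> val (cores G I J x) = cores F I J (val x).

Variables (rk : S -> nat) (sgn : S -> S -> int).

Definition coboundary A (F : sheaf A) (c : dsum A) : dsum A := fun J =>
  \sum_(I | covers rk I J) (sgn J I)%:~R *: res F I J (c I).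

Definition boundary A (F : cosheaf A) (c : dsum A) : dsum A := fun I =>
  \sum_(J | covers rk I J) (sgn J I)%:~R *: cores F I J (c J).

Lemma coboundary_is_linear A (F : sheaf A) : linear (coboundary F).
Proof.
move=> a c c'; apply: functional_extensionality_dep => J.
rewrite dsumDE dsumZE /coboundary scaler_sumr -big_split.
apply: eq_bigr => I _; rewrite dsumDE dsumZE linearP scalerDr !scalerA.
by rewrite mulrC.
Qed.
HB.instance Definition _ A (F : sheaf A) :=
  GRing.isLinear.Build k (dsum A) (dsum A) *:%R (coboundary F)
    (coboundary_is_linear F).

Lemma boundary_is_linear A (F : cosheaf A) : linear (boundary F).
Proof.
move=> a c c'; apply: functional_extensionality_dep => I.
rewrite dsumDE dsumZE /boundary scaler_sumr -big_split.
apply: eq_bigr => J _; rewrite dsumDE dsumZE linearP scalerDr !scalerA.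
by rewrite mulrC.
Qed.
HB.instance Definition _ A (F : cosheaf A) :=
  GRing.isLinear.Build k (dsum A) (dsum A) *:%R (boundary F)
    (boundary_is_linear F).

(* The summand of the elements of dimension m: both C^m and C_m. *)
Program Definition dim_part A (m : int) : submod (dsum A) :=
  @Submod k (dsum A) (fun c => forall I, sdim rk I <> m -> c I = 0) _ _.
Next Obligation. by []. Qed.
Next Obligation.
by move=> A m a c c' c0 c'0 I Im; rewrite dsumDE dsumZE c0 ?c'0 // scaler0 addr0.
Qed.

Definition cohomology_sheaf A (F : sheaf A) (m : int) : lmodType k :=
  subquot (submod_cap (dim_part A m)
             (submod_preim (coboundary F : {linear _ -> _}) (submod0 _)))
          (submod_im (coboundary F : {linear _ -> _}) (dim_part A (m - 1))).

Definition homology_cosheaf A (F : cosheaf A) (m : int) : lmodType k :=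
  subquot (submod_cap (dim_part A m)
             (submod_preim (boundary F : {linear _ -> _}) (submod0 _)))
          (submod_im (boundary F : {linear _ -> _}) (dim_part A (m + 1))).

End Sheaves.

Section SingularHomology.
Variables (R : realType) (k : comUnitRingType).

Definition simplex (d : nat) : set 'rV[R]_d.+1 :=
  [set t | (forall i, 0 <= t 0 i) /\ \sum_i t 0 i = 1].
Arguments simplex d : clear implicits.

(* The affine map of simplices given on the vertices by f. *)
Definition simplex_op_fun m d (f : 'I_m.+1 -> 'I_d.+1) (t : 'rV[R]_m.+1) :
  'rV[R]_d.+1 := \row_j \sum_(i | f i == j) t 0 i.

Lemma simplex_op_subproof m d (f : 'I_m.+1 -> 'I_d.+1) (t : simplex m) :
  simplex_op_fun f (set_val t) \in simplex d.
Proof.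
case: t => t tm; have [t0 t1] := set_mem tm; apply/mem_set; split => /=.
  by move=> j; rewrite mxE; apply: sumr_ge0 => i _; exact: t0.
under eq_bigr do rewrite mxE.
by rewrite -[RHS]t1 [RHS](partition_big f xpredT).
Qed.

Definition simplex_op m d (f : 'I_m.+1 -> 'I_d.+1) (t : simplex m) : simplex d :=
  SigSub (simplex_op_subproof f t).

(* All maps, continuous or not, are generators; continuity is imposed in
   chains_in. *)
Definition sing (X : Type) : choiceType :=
  {classic {d : nat & simplex d -> X}}.
Definition mk_sing (X : Type) d (s : simplex d -> X) : sing X :=
  Tagged (fun d => simplex d -> X) s.
Definition chain (X : Type) : lmodType k := @free_mod k (sing X).

Definition face_sum X d : (simplex d -> X) -> chain X :=
  match d with
  | 0%N => fun=> 0
  | m.+1 => fun s =>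
      \sum_(i < m.+2) (-1) ^+ i *: @gen k _ (mk_sing (s \o simplex_op (fintype.lift i)))
  end.

Definition chain_bd (X : Type) : chain X -> chain X :=
  lin_ext (fun s : sing X => face_sum (tagged s)).
HB.instance Definition _ X := GRing.Linear.on (@chain_bd X).

Definition chain_push X X' (f : X -> X') : chain X -> chain X' :=
  lin_ext (fun s : sing X => @gen k _ (mk_sing (f \o tagged s))).
HB.instance Definition _ X X' (f : X -> X') := GRing.Linear.on (chain_push f).

Section Spaces.
Context {X : topologicalType}.
Implicit Types A B : set X.

(* The singular d-chains of the subspace A *)
Program Definition chains_in (d : nat) A : submod (chain X) :=
  @Submod k (chain X) (fun c => forall s : sing X, coeff s c != 0 ->
    [/\ tag s = d, continuous (tagged s) & range (tagged s) `<=` A]) _ _.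
Next Obligation. by move=> d A s; rewrite coeff0 eqxx. Qed.
Next Obligation.
move=> d A a x y hx hy s; rewrite coeffD coeffZ => h.
have [x0|] := eqVneq (coeff s x) 0; last exact: hx.
by apply: hy; move: h; rewrite x0 mulr0 add0r.
Qed.

(* In degree 0 the condition on the boundary is void, as chain_bd vanishes on 0-chains. *)
Definition rel_cycles d A B : submod (chain X) :=
  submod_cap (chains_in d A)
    (submod_preim (@chain_bd X : {linear _ -> _}) (chains_in d.-1 B)).
Definition rel_boundaries d A B : submod (chain X) :=
  submod_add (submod_im (@chain_bd X : {linear _ -> _}) (chains_in d.+1 A))
    (chains_in d B).

(* H_d(A, B), for B included in A *)
Definition homology d A B : lmodType k :=
  subquot (rel_cycles d A B) (rel_boundaries d A B).

Definition homology_incl d A B A' B' : homology d A B -> homology d A' B' :=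
  subquot_map (rel_cycles d A' B') (rel_boundaries d A' B') id.

(* The connecting map, for d = e + 1 *)
Definition homology_connect d e A B : homology d A B -> homology e B set0 :=
  subquot_map (rel_cycles e B set0) (rel_boundaries e B set0)
    (@chain_bd X).

End Spaces.

Definition homology_map (X X' : topologicalType) (f : X -> X') d
    (A B : set X) (A' B' : set X') : homology d A B -> homology d A' B' :=
  subquot_map (rel_cycles d A' B') (rel_boundaries d A' B')
    (chain_push f).

(* The shuffle (Eilenberg-Zilber) product of singular chains, followed by
   mul : X -> X -> X. A subset a of 'I_(p + q) with p elements is the set of
   the steps at which the first coordinate of the corresponding lattice path
   increases; steps_before a is this path, and shuffle_inv a counts the
   inversions of the shuffle. *)
Definition steps_before p q r (a : {set 'I_(p + q)}) (v : 'I_(p + q).+1) :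
  'I_r.+1 := inord #|finset (fun x : 'I_(p + q) => (x \in a) && (x < v)%N)|.
Definition shuffle_inv p q (a : {set 'I_(p + q)}) : nat :=
  #|finset (fun xy : 'I_(p + q) * 'I_(p + q) =>
      [&& xy.1 \in a, xy.2 \notin a & (xy.2 < xy.1)%N])|.

Definition sing_product X (mul : X -> X -> X) p q
    (s : simplex p -> X) (s' : simplex q -> X) : chain X :=
  \sum_(a : {set 'I_(p + q)} | #|a| == p) (-1) ^+ shuffle_inv a *:
    @gen k _ (mk_sing (fun t : simplex (p + q) =>
      mul (s (simplex_op (@steps_before p q p a) t))
          (s' (simplex_op (@steps_before p q q (finset.setC a)) t)))).

Definition chain_product X (mul : X -> X -> X) (c c' : chain X) : chain X :=
  lin_ext (fun s : sing X =>
    lin_ext (fun s' : sing X => sing_product mul (tagged s) (tagged s')) c') c.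

Definition pontryagin (X : topologicalType) (mul : X -> X -> X) (A : set X) p q
    (x : homology p A set0) (y : homology q A set0) : homology (p + q) A set0 :=
  cls _ _ (chain_product mul (cls_repr x) (cls_repr y)).

End SingularHomology.

Arguments simplex R d : clear implicits.
Arguments homology_incl {R k X d A B} A' B' _.
Arguments homology_connect {R k X d} e {A} B _.
Arguments homology_map {R k X X'} f {d A B} A' B' _.

Definition acyclic_int (R : realType) (X : topologicalType) (A : set X) : Prop :=
  (forall d (x : homology R int d A set0), (0 < d)%N -> x = 0) /\
  (exists f : {linear homology R int 0 A set0 -> int^o}, bijective f).

Definition homeo_between (X Y : topologicalType) (A : set X) (B : set Y)
    (f : X -> Y) : Prop :=
  exists g : Y -> X,
    [/\ {within A, continuous f}, {within B, continuous g},
        forall x, A x -> B (f x) /\ g (f x) = x &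
        forall y, B y -> A (g y) /\ f (g y) = y].

Section PseudoCells.
Variable R : realType.

Definition disc d : set 'rV[R]_d := [set x | \sum_i x 0 i ^+ 2 <= 1].
Definition open_disc d : set 'rV[R]_d := [set x | \sum_i x 0 i ^+ 2 < 1].
Definition sphere d : set 'rV[R]_d := [set x | \sum_i x 0 i ^+ 2 = 1].

Variable X : topologicalType.
Implicit Types A F dF : set X.

(* CW structures on the subspace A of X with characteristic maps phi *)
Record CW_structure A (E : Type) (cdim : E -> nat)
    (phi : forall e, 'rV[R]_(cdim e) -> X) : Prop := {
  CW_hausdorff : hausdorff_space (subspace A);
  CW_continuous : forall e, {within @disc (cdim e), continuous (phi e)};
  CW_sub : forall e, phi e @` @disc (cdim e) `<=` A;
  CW_cell : forall e, homeo_between (@open_disc (cdim e))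
    (phi e @` @open_disc (cdim e)) (phi e);
  CW_partition : forall x, A x ->
    exists! e, (phi e @` @open_disc (cdim e)) x;
  CW_attach : forall e, exists D : set E,
    [/\ finite_set D, forall e', D e' -> (cdim e' < cdim e)%N &
        phi e @` @sphere (cdim e) `<=`
          \bigcup_(e' in D) (phi e' @` @open_disc (cdim e'))];
  CW_weak : forall C, C `<=` A ->
    (forall e, closed (phi e @^-1` C `&` @disc (cdim e))) ->
    closed (C : set (subspace A)) }.

(* (F, dF) is a pseudo-cell of dimension m. For m = 0 the last condition
   makes dF empty, i.e. of dimension at most -1. *)
Definition pseudo_cell (m : nat) F dF : Prop :=
  [/\ compact F, connected F &
   exists (E : Type) (cdim : E -> nat) (phi : forall e, 'rV[R]_(cdim e) -> X),
     let cell e := phi e @` @open_disc (cdim e) in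
     [/\ CW_structure F phi,
         dF `<=` F /\ closed (dF : set (subspace F)),
         forall e, cell e `<=` dF \/ cell e `&` dF = set0,
         (forall e, (cdim e <= m)%N) /\ (exists e, cdim e = m) &
         forall e, cell e `<=` dF -> (cdim e < m)%N]].

Section Complexes.
Context {disp : Order.disp_t} {S : finPOrderType disp}.
Variables (F dF : S -> set X) (fdim : S -> nat).

(* The union of the pseudo-cells of dimension less than m, i.e. X_(m - 1) *)
Definition skeleton (m : nat) : set X :=
  \bigcup_(I in [set I | (fdim I < m)%N]) F I.

(* X is a pseudo-cell complex with face poset S. As the attaching maps are
   injective, the pseudo-cells are identified with subspaces of X: X_m is
   obtained from X_(m - 1) by attaching the F I with fdim I = m when these
   meet X_(m - 1) exactly along dF I, their interiors are disjoint, and X has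
   the topology coinduced by the F I. *)
Record pseudo_cell_complex : Prop := {
  pcc_cell : forall I, pseudo_cell (fdim I) (F I) (dF I);
  pcc_attach : forall I, F I `&` skeleton (fdim I) = dF I;
  pcc_disjoint : forall I J, I != J -> fdim I = fdim J ->
    (F I `\` dF I) `&` (F J `\` dF J) = set0;
  pcc_cover : \bigcup_I F I = setT;
  pcc_topology : forall C : set X,
    (forall I, closed (C `&` F I : set (subspace (F I)))) -> closed C;
  pcc_bd : forall I, dF I =
    \bigcup_(J in [set J | (fdim J < fdim I)%N /\ F J `<=` dF I]) F J;
  pcc_order : forall I J : S, (I <= J)%O <-> F J `<=` F I }.

End Complexes.

Section Buchsbaum.
Context {disp : Order.disp_t} {S : finBPOrderType disp}.
Variables (k : comUnitRingType) (F dF : S -> set X) (fdim rk : S -> nat).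

Record simple_complex (n : nat) : Prop := {
  simple_pcc : pseudo_cell_complex F dF fdim;
  simple_poset : simplicial_poset rk;
  simple_poset_dim : (exists I, sdim rk I = n%:Z - 1) /\
    (forall I, sdim rk I <= n%:Z - 1);
  simple_fdim : forall I, (fdim I)%:Z = n%:Z - (rk I)%:Z }.

Record buchsbaum_complex (n : nat) : Prop := {
  buchsbaum_simple : simple_complex n;
  buchsbaum_acyclic : forall I, I != \bot%O -> acyclic_int R (F I);
  buchsbaum_rel : forall I i (x : homology R k i (F I) (dF I)),
    I != \bot%O -> i <> fdim I -> x = 0 }.

Definition structure_val (I : S) : lmodType k :=
  homology R k (fdim I) (F I) (dF I).

(* For I <_1 J, the map of the structure sheaf is [J:I] m, where m is the
   composite of
     H_a(F_I, dF_I) -> H_b(dF_I) -> H_b(dF_I, dF_I \ F_J^o)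
   (a = fdim I, b = fdim J = a - 1) with the inverse of the isomorphism
     H_b(F_J, dF_J) -> H_b(dF_I, dF_I \ F_J^o)
   induced by the inclusion. Functoriality determines the other maps. *)
Definition structure_sheaf (sgn : S -> S -> int) (H : sheaf structure_val) : Prop :=
  forall I J (x : structure_val I), covers rk I J ->
    let b := fdim J in
    let A := dF I in
    let B := dF I `\` (F J `\` dF J) in
    homology_incl A B (res H I J x) =
    (sgn J I)%:~R *: homology_incl A B (homology_connect b A x).

End Buchsbaum.
End PseudoCells.

Section TorusData.
Variables (R : realType) (N : nat).
(* R[i]^o carries the topology of the norm *)
Local Notation C := (R[i]^o).
Local Notation V := 'rV[C]_N.

Definition circle : set C := [set z | `|z| = 1].
Definition torus : set V := [set t | forall a, `|t 0 a| = 1].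
Definition torus_mul (s t : V) : V := \row_a (s 0 a * t 0 a).
Definition torus_one : V := const_mx 1.

(* theta is an isomorphism from the circle to the one-dimensional subtorus T1
   of the torus. *)
Definition subtorus_iso (T1 : set V) (theta : C -> V) : Prop :=
  [/\ {within circle, continuous theta}, T1 `<=` torus,
      forall z w, circle z -> circle w ->
        theta (z * w) = torus_mul (theta z) (theta w),
      forall z w, circle z -> circle w -> theta z = theta w -> z = w &
      theta @` circle = T1].

Section Bundles.
Context {Y Q : topologicalType}.
Variables (act : Y -> V -> Y) (rho : Y -> Q).

Definition trivialization (U : set Q) (xi : Y -> V) : Prop :=
  homeo_between (rho @^-1` U) (U `*` torus) (fun y => (rho y, xi y)) /\
  (forall y t, U (rho y) -> torus t -> xi (act y t) = torus_mul (xi y) t).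

Record principal_torus_bundle : Prop := {
  ptb_act1 : forall y, act y torus_one = y;
  ptb_actM : forall y s t, torus s -> torus t ->
    act (act y s) t = act y (torus_mul s t);
  ptb_act_continuous :
    {within (setT `*` torus), continuous (fun p : Y * V => act p.1 p.2)};
  ptb_continuous : continuous rho;
  ptb_act_fiber : forall y t, torus t -> rho (act y t) = rho y;
  ptb_locally_trivial : forall q, exists U xi,
    [/\ open U, U q & trivialization U xi] }.

Context {disp : Order.disp_t} {S : finBPOrderType disp}.
Variables (F : S -> set Q).

(* tr I J compares xi I, restricted over F J, with xi J. The trivializations
   are defined over the faces and not at a point; the comparison map
   T^N -> T^N is taken in the fiber over some point of F J. Since F J is
   connected, the choice of this point is irrelevant up to homotopy. *)
Definition transition_maps (xi : S -> Y -> V) (tr : S -> S -> V -> V) : Prop :=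
  forall I J, I != \bot%O -> (I <= J)%O ->
    exists2 q, F J q & forall y, rho y = q -> tr I J (xi I y) = xi J y.

End Bundles.

Variable k : comUnitRingType.

Definition loop (t : simplex R 1) : C :=
  (cos (2 * pi * set_val t 0 ord_max) +i* sin (2 * pi * set_val t 0 ord_max))%C.
Definition circle_class : homology R k 1 circle set0 :=
  cls _ _ (@gen k _ (mk_sing loop)).

Context {disp : Order.disp_t} {S : finBPOrderType disp}.
Variables (rk : S -> nat) (tr : S -> S -> V -> V).
Variables (lam : S -> set V) (theta : S -> C -> V).

(* T^N(I), with the convention that it is empty for I = \bot; L_val j I is then
   H_j(T^N(I)), which is 0 for I = \bot as it should be. *)
Definition torus_at (I : S) : set V := [set t | I != \bot%O /\ torus t].
Definition L_val (j : nat) (I : S) : lmodType k :=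
  homology R k j (torus_at I) set0.

Definition locally_constant_sheaf (L : forall j, sheaf (L_val j)) : Prop :=
  forall j I J (x : L_val j I), I != \bot%O -> (I <= J)%O ->
    res (L j) I J x = homology_map (tr I J) (torus_at J) set0 x.

Definition inverse_cosheaf (L : forall j, sheaf (L_val j))
    (Lhat : forall j, cosheaf (L_val j)) : Prop :=
  forall j I J, I != \bot%O -> (I <= J)%O ->
    cancel (res (L j) I J) (cores (Lhat j) I J) /\
    cancel (cores (Lhat j) I J) (res (L j) I J).

(* The product of the subtori tr i I (lam i), i in Vert(I), as a subspace of
   the space of families indexed by S, and its map to T^N(I) *)
Definition subtori_product (I : S) : set {ptws S -> V} :=
  [set f | forall i, if verts rk I i then (tr i I @` lam i) (f i)
                     else f i = torus_one].
Definition subtori_mul (I : S) (f : {ptws S -> V}) : V :=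
  \big[torus_mul/torus_one]_(i | verts rk I i) f i.

Record characteristic_map : Prop := {
  char_subtorus : forall i, vertex rk i -> subtorus_iso (lam i) (theta i);
  char_split : forall I, I != \bot%O ->
    let phi := homology_map (subtori_mul I) (torus_at I) set0
      : homology R k 1 (subtori_product I) set0 -> L_val 1 I in
    injective phi /\ exists r : {linear L_val 1 I -> _}, cancel phi r }.

Definition omega (i I : S) : L_val 1 I :=
  homology_map (tr i I) (torus_at I) set0
    (homology_map (theta i) (lam i) set0 circle_class).

Definition L_mul I p q : L_val p I -> L_val q I -> L_val (p + q) I :=
  pontryagin torus_mul (p := p) (q := q).

(* The degree j part of the ideal of L(I) generated by the omega i I. As the
   product is graded commutative, left and two-sided ideals coincide. *)
Definition ideal (j : nat) (I : S) : submod (L_val j I) :=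
  match j with
  | 0%N => submod0 _
  | q.+1 => submod_span [set y : L_val q.+1 I |
      exists2 i, verts rk I i & exists x : L_val q I, y = L_mul (omega i I) x]
  end.

(* The degree j part of w_1 ^ ... ^ w_l ^ L(I), for s = [:: w_1; ...; w_l] *)
Fixpoint principal_set (I : S) (s : seq (L_val 1 I)) (j : nat) :
    set (L_val j I) :=
  match s, j with
  | [::], _ => setT
  | _ :: _, 0%N => [set 0]
  | w :: s', q.+1 => [set y | exists2 x, principal_set s' x & y = L_mul w x]
  end.

Definition principal_ideal (j : nat) (I : S) : submod (L_val j I) :=
  submod_span (principal_set (j := j) [seq omega i I | i <- enum (verts rk I)]).

End TorusData.

(* Main.v *)
(* Let T be the sum of the modules H_0(J) (x) Pi(I) over I <= J, graded by |J| - |I|,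
   whose differential is the coboundary in J plus the boundary in I; it computes both sides.
   For fixed nonempty I, the complex of the H_0(J), J >= I, is the cellular chain complex of
   the acyclic face F_I. Its terms are projective, so it contracts onto k in fdim J = 0, and T
   projects onto the chains of Pi.
   For fixed J, the complex of the Pi(I), I <= J, resolves the ideal I(J): the transition maps
   are translations, so everything takes place in the homology of one torus T^N, where the
   products with the omega_i and the cap products with dual 1-cochains satisfy the Koszul
   relations on the level of chains. So T also projects onto the cochains of H_0 (x) I.
   Both projections have contractions up to an error of lower filtration, so their kernels
   are acyclic. *)
From HB Require Import structures.
From mathcomp Require Import all_boot all_order all_algebra.
From mathcomp Require Import generic_quotient ring_quotient.
From mathcomp Require Import all_classical all_reals all_analysis.
From mathcomp Require Import complex.
From mathcomp Require Import zify ring lra.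
From mathcomp.multinomials Require Import freeg.
Require Import Defs.
Set Implicit Arguments.
Unset Strict Implicit.
Unset Printing Implicit Defensive.
Import Order.TTheory GRing.Theory Num.Theory.
Import numFieldNormedType.Exports.
Local Open Scope classical_set_scope.
Local Open Scope ring_scope.

(** The values of [H0] are relative homology modules about which only acyclicity statements are
    given, so their projectivity has to be extracted from exactness itself: by induction on the
    dimension, a contraction of the column above I in low degrees exhibits the module at I as a
    retract of a sum of modules of smaller faces. Contractions, unlike vanishing statements, can
    then be tensored with Pi(I). Acyclicity is given over the integers; contractions of free
    complexes are formulas on generators and pass to k. Pseudo-cells come without collars, so
    excision for faces is obtained from their CW structures, one cell at a time, by pushing the
    punctured cell radially to its boundary. What is used of the homology of T^N are functionals
    dual to the omega_i: the splitting of the characteristic map followed by the winding number in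
    one circle factor. They yield operators Q_a that map Pi(I) to the ideal at I with the vertex a
    added and that sum up to the identity on the ideals. With them, adding vertices becomes a
    homotopy on the Boolean lattice below J, augmented by the ideal I(J) at the bottom. *)

Arguments submod_set : simpl never.

(** * Submodules and free modules *)

Section SubmodTheory.
Context {k : comUnitRingType}.
Implicit Types M N : lmodType k.

Lemma sm0 M (U : submod M) : U 0. Proof. exact: submod_set0. Qed.
Lemma smZ M (U : submod M) a x : U x -> U (a *: x).
Proof.
by move=> Ux; rewrite -[_ *: _]addr0; apply: submod_setP => //; exact: sm0.
Qed.
Lemma smD M (U : submod M) x y : U x -> U y -> U (x + y).
Proof. by move=> Ux Uy; rewrite -[x]scale1r; exact: submod_setP. Qed.
Lemma smN M (U : submod M) x : U x -> U (- x).
Proof. by rewrite -scaleN1r; exact: smZ. Qed.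
Lemma smB M (U : submod M) x y : U x -> U y -> U (x - y).
Proof. by move=> Ux Uy; apply: smD => //; exact: smN. Qed.
Lemma sm_sum M (U : submod M) (I : Type) (r : seq I) (P : pred I) (f : I -> M) :
  (forall i, P i -> U (f i)) -> U (\sum_(i <- r | P i) f i).
Proof. by move=> h; elim/big_ind : _ => //; [exact: sm0|exact: smD]. Qed.

Lemma sm_preimE M N (f : {linear M -> N}) (U : submod N) x :
  submod_preim f U x = U (f x).
Proof. by []. Qed.

(** Chains in a subspace, sequences of points of a convex set and simplices of small mesh are all of
    this form; the predicate of [chains_in] is convertible to an instance. *)
Program Definition supp_in (K : choiceType) (P : K -> Prop) :
  submod (@free_mod k K) :=
  @Submod k _ (fun c => forall x, coeff x c != 0 -> P x) _ _.
Next Obligation. by move=> K P x; rewrite coeff0 eqxx. Qed.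
Next Obligation.
move=> K P a u v hu hv x; rewrite coeffD coeffZ => h.
have [x0|] := eqVneq (coeff x u) 0; last exact: hu.
by apply: hv; move: h; rewrite x0 mulr0 add0r.
Qed.

Arguments supp_in {K} P : simpl never.

Lemma supp_gen (K : choiceType) (P : K -> Prop) x :
  P x -> supp_in P (@gen k K x).
Proof.
move=> Px y; rewrite /gen coeffU mul1r.
by case: (eqVneq x y) => [<-//|_]; rewrite eqxx.
Qed.

Lemma lin_ext_in (K : choiceType) M (P : K -> Prop) (U : submod M)
    (f : K -> M) c :
  (forall x, P x -> U (f x)) -> supp_in P c -> U (lin_ext f c).
Proof.
move=> fU Pc; rewrite (free_modE c) linear_sum.
rewrite big_seq_cond; apply: sm_sum => x /andP[xc _].
rewrite linearZ /= lin_ext_gen; apply: smZ; apply: fU; apply: Pc.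
by move: xc; rewrite mem_dom.
Qed.

Lemma supp_in_ind (K : choiceType) (P : K -> Prop) (U : submod (@free_mod k K)) c :
  (forall x, P x -> U (gen x)) -> supp_in P c -> U c.
Proof.
move=> h /(lin_ext_in (U := U) (f := @gen k K)) -/(_ h).
suff -> : lin_ext (@gen k K) c = c by [].
by apply: (@free_mod_ext _ _ _ (lin_ext (@gen k K)) idfun) => x /=; rewrite lin_ext_gen.
Qed.

Lemma free_ind (K : choiceType) (U : submod (@free_mod k K)) :
  (forall x, U (gen x)) -> forall c, U c.
Proof. by move=> h c; apply: (@supp_in_ind _ (fun=> True)). Qed.

Program Definition eq_sub M N (f g : {linear M -> N}) : submod M :=
  @Submod k M (fun x => f x = g x) _ _.
Next Obligation. by move=> M N f g /=; rewrite !linear0. Qed.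
Next Obligation. by move=> M N f g a x y /= fx fy; rewrite !linearP fx fy. Qed.

Lemma lin_eq_on (K : choiceType) M (P : K -> Prop)
    (f g : {linear @free_mod k K -> M}) c :
  (forall x, P x -> f (gen x) = g (gen x)) -> supp_in P c -> f c = g c.
Proof. by move=> h /(supp_in_ind (U := eq_sub f g)); apply. Qed.

Lemma supp_inS (K : choiceType) (P Q : K -> Prop) c :
  (forall x, P x -> Q x) -> supp_in P c -> supp_in Q c.
Proof. by move=> PQ h x /h /PQ. Qed.

Lemma supp_in_split (K : choiceType) (P Q : K -> Prop) c :
  supp_in (fun x => P x \/ Q x) c ->
  exists u v, [/\ supp_in P u, supp_in Q v & c = u + v].
Proof.
move/(supp_in_ind (U := submod_add (supp_in P) (supp_in Q))); apply => x [Px|Qx].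
  by exists (gen x), 0; rewrite addr0; split => //; [exact: supp_gen|exact: sm0].
by exists 0, (gen x); rewrite add0r; split => //; [exact: sm0|exact: supp_gen].
Qed.

Lemma supp_in_add (K : choiceType) (P Q : K -> Prop) u v :
  supp_in P u -> supp_in Q v -> supp_in (fun x => P x \/ Q x) (u + v).
Proof.
by move=> Pu Qv; apply: smD; [apply: supp_inS Pu|apply: supp_inS Qv]; auto.
Qed.

Lemma supp_in_and (K : choiceType) (P Q : K -> Prop) c :
  supp_in P c -> supp_in Q c -> supp_in (fun x => P x /\ Q x) c.
Proof. by move=> h1 h2 x xc; split; [exact: h1|exact: h2]. Qed.

End SubmodTheory.

Arguments free_mod : simpl never.

Section ModuleTactic.
Context {k : comUnitRingType} {M : lmodType k}.

Inductive mexpr := MZero | MVar of nat | MAdd of mexpr & mexpr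
  | MOpp of mexpr | MScale of k & mexpr.

Fixpoint meval (env : seq M) e : M :=
  match e with
  | MZero => 0
  | MVar n => nth 0 env n
  | MAdd a b => meval env a + meval env b
  | MOpp a => - meval env a
  | MScale c a => c *: meval env a
  end.

Fixpoint mcoef (i : nat) e : k :=
  match e with
  | MZero => 0
  | MVar n => if Nat.eqb n i then 1 else 0
  | MAdd a b => mcoef i a + mcoef i b
  | MOpp a => - mcoef i a
  | MScale c a => c * mcoef i a
  end.

Lemma mevalE env e : meval env e = \sum_(i < size env) mcoef i e *: nth 0 env i.
Proof.
elim: e => [|n|a IHa b IHb|a IHa|c a IHa] /=.
- by rewrite big1 // => i _; rewrite scale0r.
- have [ln|ln] := ltnP n (size env).
    rewrite (bigD1 (Ordinal ln)) //= PeanoNat.Nat.eqb_refl scale1r big1 ?addr0 // => i.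
    rewrite -val_eqE /= => ni; case: PeanoNat.Nat.eqb_spec => [e|_]; rewrite ?scale0r //.
    by rewrite e eqxx in ni.
  rewrite nth_default // big1 // => i _.
  case: PeanoNat.Nat.eqb_spec => [ni|_]; last by rewrite scale0r.
  by exfalso; move: ln; rewrite ni leqNgt ltn_ord.
- rewrite IHa IHb -big_split; apply: eq_bigr => i _ /=; by rewrite scalerDl.
- rewrite IHa -sumrN; apply: eq_bigr => i _; by rewrite scaleNr.
- rewrite IHa scaler_sumr; apply: eq_bigr => i _; by rewrite scalerA.
Qed.

(** Computes to a conjunction with one scalar identity per atom, the form in which [ring] can
    finish. *)
Fixpoint mcoefs_eq n e1 e2 : Prop :=
  if n is m.+1 then mcoef m e1 = mcoef m e2 /\ mcoefs_eq m e1 e2 else True.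

Lemma meval_eq env e1 e2 :
  mcoefs_eq (size env) e1 e2 -> meval env e1 = meval env e2.
Proof.
rewrite !mevalE => h; apply: eq_bigr => i _; congr (_ *: _).
move: (nat_of_ord i) (ltn_ord i) => j; elim: (size env) h => // n IH /= [h hn].
by rewrite ltnS leq_eqVlt => /orP[/eqP->//|]; exact: IH.
Qed.

End ModuleTactic.

(** Atoms that are equal by conversion share an index, whence the second clause. *)
Ltac mod_index x env :=
  match env with
  | x :: _ => constr:(O)
  | ?y :: _ => let _ := constr:(erefl x : x = y) in constr:(O)
  | _ :: ?e => let n := mod_index x e in constr:(S n)
  end.
Ltac mod_mem x env :=
  match env with
  | context [x :: _] => constr:(true)
  | _ => let _ := mod_index x env in constr:(true)
  | _ => constr:(false)
  end.
Ltac mod_atoms env t :=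
  lazymatch t with
  | @Algebra.add _ ?a ?b => let e := mod_atoms env a in mod_atoms e b
  | @Algebra.opp _ ?a => mod_atoms env a
  | @GRing.scale _ _ _ ?a => mod_atoms env a
  | @Algebra.zero _ => env
  | _ => lazymatch mod_mem t env with true => env | false => constr:(t :: env) end
  end.
Ltac mod_reify k env t :=
  lazymatch t with
  | @Algebra.add _ ?a ?b =>
      let x := mod_reify k env a in let y := mod_reify k env b in
      constr:(@MAdd k x y)
  | @Algebra.opp _ ?a => let x := mod_reify k env a in constr:(@MOpp k x)
  | @GRing.scale _ _ ?c ?a => let x := mod_reify k env a in constr:(@MScale k c x)
  | @Algebra.zero _ => constr:(@MZero k)
  | _ => let n := mod_index t env in constr:(@MVar k n)
  end.
(* Decides equalities of linear combinations in an lmodType over k. *)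
Ltac module k M :=
  lazymatch goal with |- _ = ?b :> ?T =>
  lazymatch goal with |- ?a = _ =>
    let env := mod_atoms (@nil (GRing.Lmodule.sort M)) a in
    let env := mod_atoms env b in
    let x := mod_reify k env a in let y := mod_reify k env b in
    change (@meval k M env x = @meval k M env y);
    apply: meval_eq; cbn [mcoefs_eq size mcoef Nat.eqb]; repeat (split; first by ring); exact I
  end end.

(** * Chains on ordered simplices *)

(* A simplex is given by the list of its vertices, which realc maps to a singular chain; [::]
   is a generator, so that the complex of these chains is augmented. *)
Section SeqChains.
Context {k : comUnitRingType}.
Local Notation FS V := (@free_mod k (seq V)).
Implicit Types V W : choiceType.

Definition cone V (v : V) : FS V -> FS V := lin_ext (fun s => gen (v :: s)).
HB.instance Definition _ V (v : V) := GRing.Linear.on (cone v).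

(** The alternating sum of the faces in recursive form: the face omitting [v], minus the cone from
    [v] over the boundary of the rest. [sbdE] gives the closed formula. *)
Fixpoint sbd V (s : seq V) : FS V :=
  if s is v :: s' then gen s' - cone v (sbd s') else 0.
Definition bd V : FS V -> FS V := lin_ext (@sbd V).
HB.instance Definition _ V := GRing.Linear.on (@bd V).

Definition cmap V W (h : V -> W) : FS V -> FS W :=
  lin_ext (fun s => gen (map h s)).
HB.instance Definition _ V W (h : V -> W) := GRing.Linear.on (cmap h).

Lemma cone_gen V (v : V) s : cone v (gen s) = gen (v :: s).
Proof. exact: lin_ext_gen. Qed.
Lemma cmap_gen V W (h : V -> W) s : cmap h (gen s) = gen (map h s).
Proof. exact: lin_ext_gen. Qed.
Lemma bd_gen V (s : seq V) : bd (gen s) = sbd s.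
Proof. exact: lin_ext_gen. Qed.

Lemma bd_cone V (v : V) c : bd (cone v c) = c - cone v (bd c).
Proof.
apply: (@free_mod_ext _ _ _ (@bd V \o cone v) (idfun \- (cone v \o @bd V))) => s.
by rewrite /= cone_gen !bd_gen.
Qed.

Lemma bdK V (c : FS V) : bd (bd c) = 0.
Proof.
apply: (@free_mod_ext _ _ _ (@bd V \o @bd V) \0) => /= s.
rewrite bd_gen; elim: s => [|v s IH]; first by rewrite linear0.
by rewrite linearB /= bd_gen bd_cone IH linear0 subr0 subrr.
Qed.

Lemma cmap_cone V W (h : V -> W) v c : cmap h (cone v c) = cone (h v) (cmap h c).
Proof.
apply: (@free_mod_ext _ _ _ (cmap h \o cone v) (cone (h v) \o cmap h)) => s /=.
by rewrite cone_gen !cmap_gen cone_gen.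
Qed.

Lemma bd_cmap V W (h : V -> W) c : bd (cmap h c) = cmap h (bd c).
Proof.
apply: (@free_mod_ext _ _ _ (@bd W \o cmap h) (cmap h \o @bd V)) => s /=.
rewrite cmap_gen !bd_gen; elim: s => [|v s IH] /=; first by rewrite linear0.
by rewrite linearB /= cmap_gen cmap_cone IH.
Qed.

Definition seq_in V n (C : set V) (s : seq V) : Prop :=
  size s = n /\ forall v, v \in s -> C v.

Lemma cone_in V n (C : set V) v c : C v ->
  supp_in (seq_in n C) c -> supp_in (seq_in n.+1 C) (cone v c).
Proof.
move=> Cv; apply: lin_ext_in => s [sn sC]; apply: supp_gen; split => /=.
  by rewrite sn.
by move=> w; rewrite inE => /orP[/eqP->//|]; exact: sC.
Qed.

Lemma sbd_in V n (C : set V) s : seq_in n.+1 C s -> supp_in (seq_in n C) (sbd s).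
Proof.
elim: s n => [|v s IH] n; first by case.
move=> [/= [sn] sC]; apply: smB.
  apply: supp_gen; split => // w ws; apply: sC.
  by rewrite inE ws orbT.
case: s sn sC IH => [|w s] sn sC IH; first by rewrite linear0; exact: sm0.
case: n sn => // n sn; apply: cone_in; first by apply: sC; rewrite mem_head.
by apply: IH; split => // u us; apply: sC; rewrite inE us orbT.
Qed.

Lemma bd_in V n (C : set V) c :
  supp_in (seq_in n.+1 C) c -> supp_in (seq_in n C) (bd c).
Proof. by apply: lin_ext_in => s; exact: sbd_in. Qed.

(** The standard triangulation of a prism, with [f] on the bottom vertices and [g] on the top ones;
    [sprismE] is the familiar alternating sum. *)
Fixpoint sprism V W (f g : V -> W) (s : seq V) : FS W :=
  if s is v :: s' then gen (f v :: g v :: map g s') - cone (f v) (sprism f g s')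
  else 0.
Definition prism V W (f g : V -> W) : FS V -> FS W := lin_ext (sprism f g).
HB.instance Definition _ V W (f g : V -> W) := GRing.Linear.on (prism f g).

Lemma prism_gen V W (f g : V -> W) s : prism f g (gen s) = sprism f g s.
Proof. exact: lin_ext_gen. Qed.

Lemma prism_cone V W (f g : V -> W) v c : prism f g (cone v c) =
  cone (f v) (cone (g v) (cmap g c)) - cone (f v) (prism f g c).
Proof.
apply: (@free_mod_ext _ _ _ (prism f g \o cone v)
  ((cone (f v) \o (cone (g v) \o cmap g)) \- (cone (f v) \o prism f g))) => s /=.
by rewrite cone_gen !prism_gen cmap_gen !cone_gen.
Qed.

Lemma bd_prism V W (f g : V -> W) c :
  bd (prism f g c) = cmap g c - cmap f c - prism f g (bd c).
Proof.
apply: (@free_mod_ext _ _ _ (@bd W \o prism f g)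
  (cmap g \- cmap f \- (prism f g \o @bd V))) => s /=.
rewrite prism_gen bd_gen !cmap_gen; elim: s => [|v s IH] /=.
  by rewrite !linear0 subrr addr0.
rewrite linearB /= bd_gen /= !linearB /= prism_gen prism_cone.
have -> : sbd (map g s) = cmap g (sbd s) by rewrite -!bd_gen -bd_cmap cmap_gen.
rewrite bd_cone IH !linearB /= !cone_gen.
module k (@free_mod k (seq W)).
Qed.

Lemma prism_cmap V W (X : choiceType) (f g : W -> X) (h : V -> W) c :
  prism f g (cmap h c) = prism (f \o h) (g \o h) c.
Proof.
apply: (@free_mod_ext _ _ _ (prism f g \o cmap h) (prism (f \o h) (g \o h))) => s /=.
rewrite cmap_gen !prism_gen; elim: s => //= v s ->.
by rewrite -map_comp.
Qed.

Lemma cmap_prism V W (X : choiceType) (f g : V -> W) (h : W -> X) c :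
  cmap h (prism f g c) = prism (h \o f) (h \o g) c.
Proof.
apply: (@free_mod_ext _ _ _ (cmap h \o prism f g) (prism (h \o f) (h \o g))) => s /=.
rewrite !prism_gen; elim: s => /= [|v s IH]; first by rewrite linear0.
by rewrite linearB /= cmap_gen cmap_cone IH /= -map_comp.
Qed.

Lemma prism_in V W n (f g : V -> W) (C : set V) (D : set W) c :
  (forall v, C v -> D (f v) /\ D (g v)) ->
  supp_in (seq_in n C) c -> supp_in (seq_in n.+1 D) (prism f g c).
Proof.
move=> CD; apply: lin_ext_in; elim: n => [|n IH] [|v s] [//= sn sC].
  exact: sm0.
have [Df Dg] := CD _ (sC _ (mem_head _ _)).
have sC' w : w \in s -> C w by move=> ws; apply: sC; rewrite inE ws orbT.
apply: smB.
  apply: supp_gen; split => /=; first by rewrite size_map; case: sn => ->.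
  move=> w; rewrite !inE => /or3P[/eqP->|/eqP->|/mapP[u /sC' Cu ->]] //.
  by have [] := CD _ Cu.
by apply: cone_in => //; apply: IH; split => //; case: sn.
Qed.

(* The two iterated prisms run through the same paths in a cube, with opposite signs. *)
Fixpoint sprism2 V W (f g h : V -> W) (s : seq V) : FS W :=
  if s is v :: s' then
    cone (f v) (sprism g h s + sprism2 f g h s')
  else 0.
Definition prism2 V W (f g h : V -> W) : FS V -> FS W := lin_ext (sprism2 f g h).
HB.instance Definition _ V W (f g h : V -> W) := GRing.Linear.on (prism2 f g h).

Lemma prism2_gen V W (f g h : V -> W) s : prism2 f g h (gen s) = sprism2 f g h s.
Proof. exact: lin_ext_gen. Qed.

Lemma prism2_cone V W (f g h : V -> W) v c : prism2 f g h (cone v c) =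
  cone (f v) (prism g h (cone v c) + prism2 f g h c).
Proof.
apply: (@free_mod_ext _ _ _ (prism2 f g h \o cone v)
  (cone (f v) \o ((prism g h \o cone v) \+ prism2 f g h))) => s /=.
by rewrite cone_gen !prism2_gen prism_gen.
Qed.

(** A monotone path in the square of the two directions raises the inner or the outer coordinate
    first, and these two triangles are the two terms. Exchanging the directions will show that
    products with paths anticommute. *)
Lemma prism_prism V (X : choiceType) W (a0 a1 : V -> X) (b0 b1 : X -> W) c :
  prism b0 b1 (prism a0 a1 c) = prism2 (b0 \o a0) (b1 \o a0) (b1 \o a1) c -
    prism2 (b0 \o a0) (b0 \o a1) (b1 \o a1) c.
Proof.
apply: (@free_mod_ext _ _ _ (prism b0 b1 \o prism a0 a1)
  (prism2 (b0 \o a0) (b1 \o a0) (b1 \o a1) \- prism2 (b0 \o a0) (b0 \o a1) (b1 \o a1))) => s /=.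
elim: s => [|v s IH]; first by rewrite prism_gen !prism2_gen /= linear0 subrr.
have cD w (x y : FS W) : cone w (x + y) = cone w x + cone w y by rewrite linearD.
have cN w (x : FS W) : cone w (- x) = - cone w x by rewrite linearN.
rewrite -cone_gen prism_cone linearB /= cmap_gen !prism_cone !prism2_cone IH.
rewrite !prism_cone -(cmap_gen a1) cmap_prism prism_cmap !cmap_gen -map_comp /=.
rewrite cmap_cone cmap_gen -map_comp !(cD, cN).
module k (@free_mod k (seq W)).
Qed.

(** The simplex is multiplied by a triangle with vertices [f], [g], [h]. The prisms are the products
    with its three sides, and the last term has a plus sign because the triangle has even
    dimension. *)
Lemma bd_prism2 V W (f g h : V -> W) c : bd (prism2 f g h c) =
  prism g h c - prism f h c + prism f g c + prism2 f g h (bd c).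
Proof.
apply: (@free_mod_ext _ _ _ (@bd W \o prism2 f g h)
  (prism g h \- prism f h \+ prism f g \+ (prism2 f g h \o @bd V))) => s /=.
rewrite prism2_gen bd_gen !prism_gen; elim: s => [|v s IH].
  by rewrite /= !linear0 !addr0.
rewrite [sprism2 _ _ _ _]/= bd_cone linearD /= IH.
have -> : gen [:: g v, h v & [seq h i | i <- s]] - cone (g v) (sprism g h s) =
  prism g h (cone v (gen s)).
  by rewrite prism_cone cmap_gen !cone_gen prism_gen.
rewrite bd_prism !bd_cone !cmap_cone !prism_cone !linearB /= prism2_cone !prism_cone.
rewrite !cmap_gen !cone_gen !bd_gen !prism_gen !prism2_gen.
do 6 rewrite ?[cone _ (_ + _)]linearD ?[cone _ (- _)]linearN /=.
rewrite ![cone (f v) (- _)]linearN /= ?cone_gen.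
module k (@free_mod k (seq W)).
Qed.

End SeqChains.

(** * Barycentric subdivision of affine chains *)

Section Subdivision.
Context {k : comUnitRingType} {R : realType}.
Local Notation FS V := (@free_mod k (seq V)).
Implicit Types V W : normedModType R.

Definition bary V (s : seq V) : V := (size s)%:R^-1 *: \sum_(v <- s) v.

Lemma bary_map V W (h : {linear V -> W}) (s : seq V) : bary (map h s) = h (bary s).
Proof. by rewrite /bary size_map big_map -(linear_sum h) linearZ. Qed.

(** [n] is fuel and equals the number of vertices in [sd]. The empty simplex is its own subdivision,
    so that a vertex is subdivided into itself. *)
Fixpoint ssd V n (s : seq V) : FS V :=
  if n is m.+1 then cone (bary s) (lin_ext (ssd m) (sbd s)) else gen s.
Definition sd V : FS V -> FS V := lin_ext (fun s => ssd (size s) s).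
HB.instance Definition _ V := GRing.Linear.on (@sd V).

(** The boundary of [s - sdh (bd s)] is [sd (bd s)], and the cone over the latter is [sd s]; hence
    the cone over [s - sdh (bd s)] defines a homotopy between the identity and the subdivision. *)
Fixpoint ssdh V n (s : seq V) : FS V :=
  if n is m.+1 then cone (bary s) (gen s - lin_ext (ssdh m) (sbd s)) else 0.
Definition sdh V : FS V -> FS V := lin_ext (fun s => ssdh (size s) s).
HB.instance Definition _ V := GRing.Linear.on (@sdh V).

Lemma sd_nil V : sd (gen [::]) = gen [::] :> FS V.
Proof. by rewrite /sd lin_ext_gen. Qed.

Lemma sdh_nil V : sdh (gen [::]) = 0 :> FS V.
Proof. by rewrite /sdh lin_ext_gen. Qed.

Lemma sd_gen V (s : seq V) : s != [::] ->
  sd (gen s) = cone (bary s) (sd (bd (gen s))).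
Proof.
case: s => // v s _; rewrite {1}/sd lin_ext_gen [size _]/= [ssd _ _]/=; congr cone.
rewrite bd_gen; apply: (@lin_eq_on _ _ _ (seq_in (size s) setT)).
  by move=> t [st _] /=; rewrite /sd !lin_ext_gen st.
exact: (@sbd_in _ _ _ setT (v :: s)).
Qed.

Lemma sdh_gen V (s : seq V) : s != [::] ->
  sdh (gen s) = cone (bary s) (gen s - sdh (bd (gen s))).
Proof.
case: s => // v s _; rewrite {1}/sdh lin_ext_gen [size _]/= [ssdh _ _]/=; congr cone.
congr (_ - _); rewrite bd_gen; apply: (@lin_eq_on _ _ _ (seq_in (size s) setT)).
  by move=> t [st _] /=; rewrite /sdh !lin_ext_gen st.
exact: (@sbd_in _ _ _ setT (v :: s)).
Qed.

(* The hypothesis for bd (gen (v :: s)) is available because bd lowers the size of the generators. *)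
Lemma seq_free_ind V (M : lmodType k) (f g : {linear FS V -> M}) :
  f (gen [::]) = g (gen [::]) ->
  (forall v s, f (bd (gen (v :: s))) = g (bd (gen (v :: s))) ->
     f (gen (v :: s)) = g (gen (v :: s))) ->
  f =1 g.
Proof.
move=> h0 hS; apply: free_mod_ext => s; move: {2}(size s) (erefl (size s)) => n.
elim: n s => [|n IH] [|v s] //= [sn]; apply: hS; rewrite bd_gen.
apply: (@lin_eq_on _ _ _ (seq_in n setT)); first by move=> t [] /IH.
by apply: sbd_in; split => //=; rewrite sn.
Qed.

Lemma bd_sd V (c : FS V) : bd (sd c) = sd (bd c).
Proof.
apply: (seq_free_ind (f := @bd k V \o @sd V) (g := @sd V \o @bd k V)) => [|v s] /=.
  by rewrite sd_nil bd_gen !linear0.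
by move=> IH; rewrite sd_gen // bd_cone IH bdK !linear0 addr0.
Qed.

Lemma bd_sdh V (c : FS V) : bd (sdh c) = c - sd c - sdh (bd c).
Proof.
apply: (seq_free_ind (f := @bd k V \o @sdh V)
  (g := idfun \- @sd V \- (@sdh V \o @bd k V))) => [|v s] /=.
  by rewrite sdh_nil sd_nil bd_gen !linear0 subrr addr0.
rewrite !bdK !linear0 addr0.
move=> IH; rewrite sdh_gen // bd_cone linearB /= IH !linearB /= sd_gen //.
module k (FS V).
Qed.

Lemma sd_cmap V W (h : {linear V -> W}) (c : FS V) : sd (cmap h c) = cmap h (sd c).
Proof.
apply: (seq_free_ind (f := @sd W \o cmap h) (g := cmap h \o @sd V)) => [|v s] /=.
  by rewrite sd_nil !cmap_gen sd_nil.
move=> IH; rewrite cmap_gen !sd_gen // cmap_cone -IH -bd_cmap cmap_gen.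
by rewrite (bary_map h (v :: s)).
Qed.

Lemma sdh_cmap V W (h : {linear V -> W}) (c : FS V) : sdh (cmap h c) = cmap h (sdh c).
Proof.
apply: (seq_free_ind (f := @sdh W \o cmap h) (g := cmap h \o @sdh V)) => [|v s] /=.
  by rewrite sdh_nil !cmap_gen sdh_nil linear0.
move=> IH; rewrite cmap_gen !sdh_gen // cmap_cone [cmap _ (_ - _)]linearB /= -IH -bd_cmap cmap_gen.
by rewrite (bary_map h (v :: s)).
Qed.

Definition bary_closed V (C : set V) : Prop :=
  forall s : seq V, s != [::] -> (forall v, v \in s -> C v) -> C (bary s).

Lemma sd_in V n (C : set V) (c : FS V) : bary_closed C ->
  supp_in (seq_in n C) c -> supp_in (seq_in n C) (sd c).
Proof.
move=> bC; apply: lin_ext_in; elim: n => [|n IH] s [sn sC]; rewrite sn.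
  by apply: supp_gen.
case: s sn sC => // v s [sn] sC; apply: cone_in; first exact: bC.
apply: (lin_ext_in (P := seq_in n C)) => [t tn|]; last by apply: sbd_in; split => //=; rewrite sn.
by have := IH t tn; case: tn => ->.
Qed.

Lemma sdh_in V n (C : set V) (c : FS V) : bary_closed C ->
  supp_in (seq_in n C) c -> supp_in (seq_in n.+1 C) (sdh c).
Proof.
move=> bC; apply: lin_ext_in; elim: n => [|n IH] s [sn sC]; rewrite sn.
  exact: sm0.
case: s sn sC => // v s [sn] sC; apply: cone_in; first exact: bC.
apply: smB; first by apply: supp_gen; split => //=; rewrite sn.
apply: (lin_ext_in (P := seq_in n C)) => [t tn|]; last by apply: sbd_in; split => //=; rewrite sn.
by have := IH t tn; case: tn => ->.
Qed.

Definition small V (e : R) (s : seq V) : Prop :=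
  forall v w, v \in s -> w \in s -> `|v - w| <= e.

Lemma ball_bary_closed V (b : V) r : bary_closed [set x : V | `|x - b| <= r].
Proof.
move=> s s0 sC /=; rewrite /bary.
have sz : (size s)%:R != 0 :> R by rewrite pnatr_eq0 size_eq0.
have -> : (size s)%:R^-1 *: \sum_(v <- s) v - b = (size s)%:R^-1 *: \sum_(v <- s) (v - b).
  rewrite sumrB scalerBr; congr (_ - _).
  by rewrite big_const_seq count_predT iter_addr_0 -(scaler_nat _ b) scalerA mulVf // scale1r.
rewrite normrZ ger0_norm ?invr_ge0 // ler_pdivrMl ?lt_neqAle 1?eq_sym ?sz //=.
apply: (le_trans (ler_norm_sum _ _ _)).
rewrite [leRHS](_ : _ = \sum_(v <- s) r); last first.
  by rewrite big_const_seq count_predT iter_addr_0 mulr_natl.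
by rewrite big_seq [leRHS]big_seq; apply: ler_sum => v vs; exact: sC.
Qed.

(** In the mean of the differences [w - v] the summand with [w = v] vanishes, which leaves n terms
    out of n + 1. *)
Lemma bary_near V (e : R) (s : seq V) v n : size s = n.+1 -> small e s -> v \in s ->
  `|v - bary s| <= n%:R / n.+1%:R * e.
Proof.
move=> sn se vs; rewrite distrC /bary sn.
have -> : n.+1%:R^-1 *: \sum_(w <- s) w - v = n.+1%:R^-1 *: \sum_(w <- s) (w - v).
  rewrite sumrB scalerBr; congr (_ - _).
  by rewrite big_const_seq count_predT iter_addr_0 -(scaler_nat _ v) scalerA sn mulVf ?scale1r // pnatr_eq0.
rewrite normrZ ger0_norm ?invr_ge0 // [leRHS](_ : _ = n.+1%:R^-1 * (e * n%:R)); last by ring.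
rewrite ler_wpM2l ?invr_ge0 //.
apply: (le_trans (ler_norm_sum _ _ _)).
rewrite (perm_big _ (perm_to_rem vs)) big_cons /= subrr normr0 add0r.
have -> : e * n%:R = \sum_(w <- rem v s) e.
  by rewrite big_const_seq count_predT iter_addr_0 size_rem // sn mulr_natr.
rewrite big_seq [leRHS]big_seq; apply: ler_sum => w /mem_rem ws; exact: se.
Qed.

(** Two vertices of a simplex of the subdivision lie in the subdivision of a face, where induction
    applies, or one of them is the barycentre. The latter is within the claimed distance of all
    vertices and hence, balls being closed under barycentres, of the whole subdivision. *)
Lemma sd_small V n (e : R) (c : FS V) : 0 <= e ->
  supp_in (fun s => size s = n.+1 /\ small e s) c ->
  supp_in (fun s => size s = n.+1 /\ small (n%:R / n.+1%:R * e) s) (sd c).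
Proof.
move=> e0; apply: lin_ext_in; elim: n => [|n IH] s [sn se]; rewrite sn.
  case: s sn se => // v [|//] _ se.
  rewrite /= linear0 subr0 lin_ext_gen /= cone_gen; apply: supp_gen; split => //.
  by move=> u w; rewrite !inE => /eqP-> /eqP->; rewrite subrr normr0 !mul0r.
rewrite [ssd _ _]/=; apply: (lin_ext_in (P := fun t => (size t = n.+1 /\
  small (n%:R / n.+1%:R * e) t) /\
  seq_in n.+1 [set x : V | `|x - bary s| <= n.+1%:R / n.+2%:R * e] t)) => [t|].
  move=> [[tn te] [_ tb]]; apply: supp_gen; split; first by rewrite /= tn.
  have le1 : n%:R / n.+1%:R * e <= n.+1%:R / n.+2%:R * e.
    rewrite ler_wpM2r // ler_pdivrMr // mulrAC ler_pdivlMr //.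
    by rewrite -!natrM ler_nat; lia.
  have nn : 0 <= n.+1%:R / n.+2%:R * e by rewrite mulr_ge0.
  move=> u w; rewrite !inE => /orP[/eqP->|ut] /orP[/eqP->|wt].
  - by rewrite subrr normr0.
  - by rewrite distrC; exact: tb.
  - exact: tb.
  - exact: le_trans (te _ _ ut wt) le1.
apply: supp_in_and.
  apply: (lin_ext_in (P := fun t => size t = n.+1 /\ small e t)) => [t tP|].
    by have := IH t tP; case: tP => ->.
  apply: (supp_inS (P := seq_in n.+1 [set v | v \in s])) => [t [tn ts]|].
    by split=> // u w /ts us /ts ws; exact: se.
  exact: sbd_in.
apply: (lin_ext_in (P := seq_in n.+1 [set x : V | `|x - bary s| <= n.+1%:R / n.+2%:R * e])) => [t tP|].
  have := @sd_in V n.+1 _ _ (@ball_bary_closed V (bary s) (n.+1%:R / n.+2%:R * e)) (supp_gen tP).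
  by rewrite /sd lin_ext_gen; case: tP => ->.
by apply: sbd_in; split => // v vs; exact: bary_near.
Qed.

Definition sdh_iter V j (c : FS V) : FS V := \sum_(i < j) sdh (iter i (@sd V) c).

Lemma bd_sdh_iter V j (c : FS V) :
  bd (sdh_iter j c) = c - iter j (@sd V) c - sdh_iter j (bd c).
Proof.
rewrite /sdh_iter; elim: j => [|j IH]; first by rewrite !big_ord0 linear0 subrr subr0.
rewrite !big_ord_recr linearD /= IH bd_sdh.
have -> : bd (iter j (@sd V) c) = iter j (@sd V) (bd c).
  by elim: (j) => //= i <-; rewrite bd_sd.
by module k (FS V).
Qed.

Lemma iter_sd_small V n (e : R) (c : FS V) j : 0 <= e ->
  supp_in (fun s => size s = n.+1 /\ small e s) c ->
  supp_in (fun s => size s = n.+1 /\ small ((n%:R / n.+1%:R) ^+ j * e) s)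
    (iter j (@sd V) c).
Proof.
move=> e0 h; elim: j => [|j IH] /=; first by rewrite expr0 mul1r.
rewrite exprS -mulrA; apply: sd_small => //.
by rewrite mulr_ge0 // exprn_ge0 // divr_ge0.
Qed.

Lemma iter_sd_in V n (C : set V) (c : FS V) j : bary_closed C ->
  supp_in (seq_in n C) c -> supp_in (seq_in n C) (iter j (@sd V) c).
Proof. by move=> bC h; elim: j => //= j; exact: sd_in. Qed.

Lemma sdh_iter_in V n (C : set V) (c : FS V) j : bary_closed C ->
  supp_in (seq_in n C) c -> supp_in (seq_in n.+1 C) (sdh_iter j c).
Proof.
by move=> bC h; apply: sm_sum => i _; apply: sdh_in => //; exact: iter_sd_in.
Qed.

Lemma mesh_cvg n (e d : R) : 0 < d -> exists j0, forall j, (j0 <= j)%N ->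
  (n%:R / n.+1%:R) ^+ j * e <= d.
Proof.
move=> d0.
have q1 : `|n%:R / n.+1%:R : R| < 1.
  by rewrite ger0_norm ?divr_ge0 // ltr_pdivrMr // mul1r ltr_nat.
have : (fun j => (n%:R / n.+1%:R) ^+ j * e) @ \oo --> 0 * e.
  by apply: cvgMl; exact: cvg_expr.
rewrite mul0r => /cvgr_le /(_ _ d0) [j0 _ h].
by exists j0 => j /h.
Qed.

End Subdivision.

Lemma continuous_comp_within (T U X : topologicalType) (C : set U)
    (f : T -> U) (K : U -> X) :
  continuous f -> (forall t, C (f t)) -> {within C, continuous K} ->
  continuous (K \o f).
Proof.
move=> cf Cf cK t W /= KW.
have := cK (f t) W KW; rewrite /nbhs /= -nbhs_subspace_in // => /cf.
by rewrite /nbhs /= => h; apply: filterS h => u /= h; exact: h.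
Qed.

Lemma continuous_sumr (K : numFieldType) (T : topologicalType) (V : normedModType K)
    (I : Type) (r : seq I) (f : I -> T -> V) :
  (forall i, continuous (f i)) -> continuous (fun x => \sum_(i <- r) f i x).
Proof.
move=> fc t; suff : (\sum_(i <- r) f i x) @[x --> t] --> \sum_(i <- r) f i t by [].
elim: r => [|i r IH].
  rewrite big_nil; under eq_cvg do rewrite big_nil.
  by move=> U /nbhs_singleton U0; apply: (@filterE _ (nbhs t)).
rewrite big_cons; under eq_fun do rewrite big_cons.
by apply: cvgD => //; exact: fc.
Qed.

(** * Realization as singular chains *)

Section Realization.
Context {R : realType} {k : comUnitRingType}.
Local Notation FS V := (@free_mod k (seq V)).
Local Notation simplex := (simplex R).
Implicit Types V W : normedModType R.

Definition affs V n (s : seq V) (t : simplex n) : V :=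
  \sum_(i < n.+1) (set_val t : 'rV_n.+1) 0 i *: nth 0 s i.

(** The empty sequence has degree -1 and goes to 0, so that realization drops the augmentation and
    is a chain map. *)
Definition real X V (K : V -> X) (s : seq V) : @chain R k X :=
  if s is _ :: s' then
    gen (mk_sing (fun t : simplex (size s') => K (affs s t)))
  else 0.
Definition realc X V (K : V -> X) : FS V -> @chain R k X := lin_ext (real K).
HB.instance Definition _ X V (K : V -> X) := GRing.Linear.on (realc K).

Lemma realc_gen X V (K : V -> X) s : realc K (gen s) = real K s.
Proof. exact: lin_ext_gen. Qed.

Lemma real_size X V (K : V -> X) s n : size s = n.+1 ->
  real K s = gen (mk_sing (fun t : simplex n => K (affs s t))).
Proof. by case: s => // v s [<-]. Qed.

Lemma sbdE V (s : seq V) :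
  sbd s = \sum_(i < size s) (-1) ^+ i *: gen (take i s ++ drop i.+1 s) :> FS V.
Proof.
elim: s => [|v s IH]; first by rewrite big_ord0.
rewrite [LHS]/= [size _]/= big_ord_recl /= expr0 scale1r drop0; congr (_ + _).
rewrite IH linear_sum -sumrN; apply: eq_bigr => i _.
by rewrite linearZ /= cone_gen -scaleNr exprS mulN1r.
Qed.

Lemma affs_face V n (s : seq V) (i : 'I_n.+2) (t : simplex n) :
  size s = n.+2 ->
  affs s (simplex_op (fintype.lift i) t) = affs (take i s ++ drop i.+1 s) t.
Proof.
move=> sn; rewrite /affs.
transitivity (\sum_(l < n.+1) (set_val t : 'rV_n.+1) 0 l *: nth 0 s (fintype.lift i l)).
  rewrite (partition_big (fintype.lift i) xpredT) //=; apply: eq_bigr => j _.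
  rewrite /simplex_op_fun mxE scaler_suml; apply: eq_bigr => l /eqP <- //.
apply: eq_bigr => l _; congr (_ *: _); rewrite nth_cat size_takel; last first.
  by rewrite sn ltnW.
rewrite /= /bump; case: leqP => li; last by rewrite add0n nth_take.
by rewrite nth_drop add1n addSn subnKC.
Qed.

Lemma chain_bd_gen X d (s : simplex d -> X) :
  chain_bd (gen (mk_sing s)) = @face_sum R k X d s.
Proof. by rewrite /chain_bd lin_ext_gen. Qed.

Lemma chain_bd_real X V (K : V -> X) s :
  chain_bd (real K s) = realc K (sbd s).
Proof.
case: s => [|v [|w s]]; first by rewrite !linear0.
  by rewrite /= chain_bd_gen /= linear0 subr0 realc_gen.
set u := _ :: _; have su : size u = (size s).+2 by [].
rewrite (real_size K su) chain_bd_gen sbdE su linear_sum; apply: eq_bigr => i _.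
rewrite linearZ /= realc_gen; congr (_ *: _).
rewrite (@real_size _ _ _ _ (size s)); last first.
  by have := ltn_ord i; move: (nat_of_ord i) => j jl; rewrite size_cat (size_drop j) /= size_takel ?su 1?ltnW // subnKC.
by congr (gen (mk_sing _)); apply/funext => t /=; rewrite affs_face.
Qed.

Lemma chain_bd_realc X V (K : V -> X) c : chain_bd (realc K c) = realc K (bd c).
Proof.
apply: (@free_mod_ext _ _ _ (@chain_bd R k X \o realc K) (realc K \o @bd k V)) => s /=.
by rewrite realc_gen bd_gen chain_bd_real.
Qed.

Lemma chain_push_realc X Y V (f : X -> Y) (K : V -> X) c :
  chain_push f (realc K c) = realc (f \o K) c.
Proof.
apply: (@free_mod_ext _ _ _ (chain_push f \o realc K) (realc (f \o K))) => s /=.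
rewrite !realc_gen; case: s => [|v s]; first by rewrite linear0.
by rewrite /chain_push lin_ext_gen.
Qed.

Definition convex_in V (C : set V) : Prop := forall n (t : simplex n) (s : seq V),
  size s = n.+1 -> (forall v, v \in s -> C v) -> C (affs s t).

Lemma simplex_ge0 n (t : simplex n) i : 0 <= (set_val t : 'rV_n.+1) 0 i.
Proof. by case: t => t ht /=; have [t0 _] := set_mem ht; exact: t0. Qed.

Lemma simplex_sum1 n (t : simplex n) : \sum_i (set_val t : 'rV_n.+1) 0 i = 1.
Proof. by case: t => t ht /=; have [_ t1] := set_mem ht. Qed.

Lemma unif_subproof n : (const_mx n.+1%:R^-1 : 'rV[R]_n.+1) \in simplex n.
Proof.
apply/mem_set; split => [i|]; first by rewrite mxE invr_ge0.
under eq_bigr do rewrite mxE.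
by rewrite sumr_const card_ord -[_^-1 *+ _]mulr_natl divff // pnatr_eq0.
Qed.
Definition unif n : simplex n := SigSub (unif_subproof n).

Lemma convex_bary_closed V (C : set V) : convex_in C -> bary_closed C.
Proof.
move=> cC [//|v s] _ sC; have := cC _ (unif (size s)) (v :: s) erefl sC.
rewrite /affs; under eq_bigr do rewrite /= mxE.
rewrite -scaler_sumr /bary; congr (C (_ *: _)).
by rewrite [RHS](big_nth 0) big_mkord.
Qed.

Lemma affs_map V W (h : {linear V -> W}) n (s : seq V) (t : simplex n) :
  affs (map h s) t = h (affs s t).
Proof.
rewrite /affs linear_sum; apply: eq_bigr => i _; rewrite linearZ; congr (_ *: _).
have [si|si] := ltnP i (size s); first by rewrite (nth_map 0).
by rewrite !nth_default ?size_map // linear0.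
Qed.

Lemma realc_cmap X V W (K : W -> X) (h : {linear V -> W}) c :
  realc K (cmap h c) = realc (K \o h) c.
Proof.
apply: (@free_mod_ext _ _ _ (realc K \o cmap h) (realc (K \o h))) => s /=.
rewrite cmap_gen !realc_gen; case: s => [//|v s].
have e : size (map h (v :: s)) = (size s).+1 by rewrite size_map.
rewrite (real_size K e); congr (gen (mk_sing _)); apply/funext => t.
by rewrite affs_map.
Qed.

Lemma realc_congr X V (K K' : V -> X) (C : set V) n c : convex_in C ->
  (forall v, C v -> K v = K' v) -> supp_in (seq_in n C) c ->
  realc K c = realc K' c.
Proof.
move=> cC KK; apply: lin_eq_on => s [_ sC] /=; rewrite !realc_gen.
case: s sC => //= v s sC; congr (gen (mk_sing _)); apply/funext => t.
by apply: KK; exact: cC.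
Qed.

Lemma affs_continuous V n (s : seq V) : continuous (@affs V n s).
Proof.
apply: (@continuous_sumr R (simplex n)) => i t.
apply: (cvgZr_tmp (F := nbhs t) (s := fun u : simplex n => (set_val u : 'rV_n.+1) 0 i)).
apply: (@continuous_comp _ _ _ set_val (fun M : 'rV[R]_n.+1 => M 0 i)).
  exact: initial_continuous.
exact: coord_continuous.
Qed.

Section InSpace.
Context {X : topologicalType}.

Lemma gen_in d (A : set X) (s : simplex d -> X) :
  continuous s -> (forall t, A (s t)) -> chains_in R k d A (gen (mk_sing s)).
Proof. by move=> cs sA; apply: (@supp_gen k); split => // _ [t _ <-]. Qed.

Lemma chains_in_ind d (A : set X) (U : submod (@chain R k X)) c :
  (forall s : simplex d -> X, continuous s -> (forall t, A (s t)) ->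
    U (gen (mk_sing s))) ->
  chains_in R k d A c -> U c.
Proof.
move=> h; apply: supp_in_ind => -[d' s] /= [dd cs sA]; move: s cs sA.
by rewrite dd => s cs sA; apply: h => // t; apply: sA; exists t.
Qed.

Lemma real_in V (K : V -> X) (C : set V) (A : set X) n s : convex_in C ->
  {within C, continuous K} -> (forall v, C v -> A (K v)) ->
  seq_in n.+1 C s -> chains_in R k n A (real K s).
Proof.
move=> cC cK KA [sn sC]; rewrite (real_size _ sn); apply: gen_in => [|t].
  apply: (continuous_comp_within (C := C)) cK; first exact: affs_continuous.
  by move=> t; exact: cC.
by apply: KA; exact: cC.
Qed.

Lemma realc_in V (K : V -> X) (C : set V) (A : set X) n c : convex_in C ->
  {within C, continuous K} -> (forall v, C v -> A (K v)) ->
  supp_in (seq_in n.+1 C) c -> chains_in R k n A (realc K c).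
Proof. by move=> cC cK KA; apply: lin_ext_in => s; exact: real_in. Qed.

End InSpace.

Definition vert d (i : 'I_d.+1) : 'rV[R]_d.+1 := delta_mx 0 i.
Definition std d : seq 'rV[R]_d.+1 := [seq vert i | i <- enum 'I_d.+1].

Lemma size_std d : size (std d) = d.+1.
Proof. by rewrite size_map size_enum_ord. Qed.

Lemma nth_std d (i : 'I_d.+1) : nth 0 (std d) i = vert i.
Proof. by rewrite (nth_map ord0) ?size_enum_ord // nth_ord_enum. Qed.

Lemma simplex_vert d (i : 'I_d.+1) : simplex d (vert i).
Proof.
split=> [j|]; first by rewrite mxE; case: (_ && _).
rewrite (bigD1 i) //= big1 ?addr0 ?mxE ?eqxx // => j ji.
by rewrite mxE (negbTE ji) andbF.
Qed.

Lemma std_in d : seq_in d.+1 (simplex d) (std d).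
Proof. by split; [exact: size_std|move=> v /mapP[i _ ->]; exact: simplex_vert]. Qed.

Lemma affs_std d (t : simplex d) : affs (std d) t = set_val t.
Proof.
rewrite /affs [RHS]row_sum_delta; apply: eq_bigr => i _.
by rewrite nth_std.
Qed.

Lemma simplex_convex d : convex_in (simplex d).
Proof.
move=> n t s sn sC; have nC i : (i < n.+1)%N -> simplex d (nth 0 s i).
  by move=> ni; apply: sC; rewrite mem_nth // sn.
split=> [j|].
  rewrite /affs summxE; apply: sumr_ge0 => i _; rewrite mxE mulr_ge0 //.
    exact: simplex_ge0.
  by have [] := nC i (ltn_ord i).
rewrite /affs; under eq_bigr do rewrite summxE.
rewrite exchange_big /= -[RHS](simplex_sum1 t); apply: eq_bigr => i _.
under eq_bigr do rewrite mxE.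
by rewrite -mulr_sumr; have [_ ->] := nC i (ltn_ord i); rewrite mulr1.
Qed.

Definition to_simplex d (v : 'rV[R]_d.+1) : simplex d := insubd (unif d) v.

Lemma to_simplexK d v : simplex d v -> set_val (to_simplex v) = v.
Proof. by move=> dv; rewrite /to_simplex [LHS]insubdK //; exact/mem_set. Qed.

Lemma set_valK d (t : simplex d) : to_simplex (set_val t) = t.
Proof. exact: valKd. Qed.

(** Lets a singular simplex serve as the map [K] of [realc]. Outside of the simplex the values are
    junk, and continuity is claimed within the simplex only. *)
Definition ext X d (s : simplex d -> X) (v : 'rV[R]_d.+1) : X := s (to_simplex v).

(** Every singular simplex is the realization of the standard one, so identities between natural
    operations can be checked on affine chains. *)
Lemma real_std X d (s : simplex d -> X) : real (ext s) (std d) = gen (mk_sing s).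
Proof.
rewrite (real_size _ (size_std d)); congr (gen (mk_sing _)); apply/funext => t.
by rewrite affs_std /ext set_valK.
Qed.

Lemma ext_continuous (X : topologicalType) d (s : simplex d -> X) :
  continuous s -> {within simplex d, continuous (ext s)}.
Proof.
move=> cs; apply/subspace_sigL_continuousP.
by have -> : sigL (simplex d) (ext s) = s by apply/funext => t; rewrite /sigL /= /ext set_valK.
Qed.

Definition lmap V (s : seq V) n (v : 'rV[R]_n.+1) : V :=
  \sum_(i < n.+1) v 0 i *: nth 0 s i.
Lemma lmap_is_linear V (s : seq V) n : linear (@lmap V s n).
Proof.
move=> a u v; rewrite /lmap scaler_sumr -big_split; apply: eq_bigr => i _ /=.
by rewrite !mxE scalerDl scalerA.
Qed.
HB.instance Definition _ V (s : seq V) n :=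
  GRing.isLinear.Build R _ _ _ (@lmap V s n) (@lmap_is_linear V s n).

Lemma map_lmap_std V (s : seq V) n : size s = n.+1 -> map (@lmap V s n) (std n) = s.
Proof.
move=> sn; apply: (@eq_from_nth _ 0); rewrite size_map size_std // => i ni.
rewrite (nth_map 0) ?size_std // (nth_std (Ordinal ni)) /lmap.
rewrite (bigD1 (Ordinal ni)) //= big1 ?addr0 => [|j ji].
  by rewrite mxE !eqxx scale1r.
by rewrite mxE (negbTE ji) andbF scale0r.
Qed.

Lemma realc_ext_affs X V (K : V -> X) (s : seq V) n m c :
  supp_in (seq_in m (simplex n)) c ->
  realc (ext (fun t : simplex n => K (affs s t))) c = realc K (cmap (@lmap V s n) c).
Proof.
move=> h; rewrite realc_cmap; apply: realc_congr h; first exact: simplex_convex.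
by move=> v dv; rewrite /ext /affs to_simplexK.
Qed.

(* The operation on singular chains given on d-simplices by the affine chain O d. *)
Definition nat_op X (O : forall d, FS 'rV[R]_d.+1) : @chain R k X -> @chain R k X :=
  lin_ext (fun s : @sing R X => realc (ext (tagged s)) (O (tag s))).
HB.instance Definition _ X O := GRing.Linear.on (@nat_op X O).

Lemma nat_op_gen X O d (s : simplex d -> X) :
  nat_op O (gen (mk_sing s)) = realc (ext s) (O d).
Proof. by rewrite /nat_op lin_ext_gen. Qed.

Lemma nat_op_real X V (K : V -> X) O n m (s : seq V) : size s = n.+1 ->
  supp_in (seq_in m (simplex n)) (O n) ->
  nat_op O (real K s) = realc K (cmap (@lmap V s n) (O n)).
Proof. by move=> sn h; rewrite (real_size _ sn) nat_op_gen (realc_ext_affs _ _ h). Qed.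

Lemma chain_bdK X (c : @chain R k X) : chain_bd (chain_bd c) = 0.
Proof.
apply: (@free_mod_ext _ _ _ (@chain_bd R k X \o @chain_bd R k X) \0) => -[d s] /=.
rewrite -[existT _ _ _]/(mk_sing s) -real_std chain_bd_real chain_bd_realc.
by rewrite -bd_gen bdK linear0.
Qed.

End Realization.

(** * Subdivision of singular chains *)

Section ChainOperators.
Context {R : realType} {k : comUnitRingType}.
Local Notation FS V := (@free_mod k (seq V)).
Local Notation simplex := (simplex R).
Local Notation chain X := (@chain R k X).
Implicit Types V W : normedModType R.

(** An operation [P] compatible with affine maps is determined by its values on the standard
    simplices. The condition on [[::]] is there because realization kills the empty sequence. *)
Lemma nat_op_realc X V (K : V -> X) (O : forall d, FS 'rV[R]_d.+1)
    (P : {linear FS V -> FS V}) (m : nat -> nat) c :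
  (forall n, supp_in (seq_in (m n) (simplex n)) (O n)) ->
  realc K (P (gen [::])) = 0 ->
  (forall n s, size s = n.+1 -> P (gen s) = cmap (@lmap R V s n) (O n)) ->
  nat_op O (realc K c) = realc K (P c).
Proof.
move=> Om P0 PS.
apply: (@free_mod_ext _ _ _ (nat_op O \o realc K) (realc K \o P)) => s /=.
rewrite realc_gen; case: s => [|v s]; first by rewrite linear0 P0.
by rewrite (PS (size s)) // (nat_op_real K (n := size s) _ (Om _)).
Qed.

Definition sdj V j (c : FS V) : FS V := iter j (@sd k R V) c.
Lemma sdj_linear V j : linear (@sdj V j).
Proof. by elim: j => //= j IH a u v; rewrite /sdj !iterS; have := IH a u v; rewrite /sdj => ->; rewrite linearP. Qed.
HB.instance Definition _ V j := GRing.isLinear.Build k _ _ _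
  (@sdj V j) (@sdj_linear V j).

Definition csd X j : chain X -> chain X :=
  nat_op (fun d => sdj j (gen (std d))).
HB.instance Definition _ X j := GRing.Linear.on (@csd X j).
Definition csdh X j : chain X -> chain X :=
  nat_op (fun d => sdh_iter j (gen (std d))).
HB.instance Definition _ X j := GRing.Linear.on (@csdh X j).

Lemma sdh_iter_linear V j : linear (@sdh_iter k R V j).
Proof.
move=> a u v; rewrite /sdh_iter scaler_sumr -big_split; apply: eq_bigr => i _.
by rewrite -!/(sdj i _) !linearP.
Qed.
HB.instance Definition _ V j := GRing.isLinear.Build k _ _ _
  (@sdh_iter k R V j) (@sdh_iter_linear V j).

Lemma sdj_cmap V W (h : {linear V -> W}) j (c : FS V) :
  sdj j (cmap h c) = cmap h (sdj j c).
Proof. by rewrite /sdj; elim: j => //= j ->; rewrite sd_cmap. Qed.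

Lemma sdj_nil V j : sdj j (gen [::]) = gen [::] :> FS V.
Proof. by rewrite /sdj; elim: j => //= j ->; rewrite sd_nil. Qed.

Lemma std_supp d : supp_in (seq_in d.+1 (simplex d)) (gen (std d) : FS _).
Proof. by apply: supp_gen; exact: std_in. Qed.

Lemma simplex_bary_closed d : bary_closed (simplex d).
Proof. by apply: convex_bary_closed; exact: simplex_convex. Qed.

Lemma csd_realc X V (K : V -> X) j c : csd j (realc K c) = realc K (sdj j c).
Proof.
apply: (@nat_op_realc _ _ _ _ _ succn) => [n||n s sn].
- by rewrite /= /sdj; apply: iter_sd_in; [exact: simplex_bary_closed|exact: std_supp].
- by rewrite /= sdj_nil realc_gen.
- by rewrite /= -sdj_cmap cmap_gen map_lmap_std.
Qed.

Lemma csdh_realc X V (K : V -> X) j c : csdh j (realc K c) = realc K (sdh_iter j c).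
Proof.
apply: (@nat_op_realc _ _ _ _ _ (fun n => n.+2)) => [n||n s sn].
- by apply: sdh_iter_in; [exact: simplex_bary_closed|exact: std_supp].
- rewrite /= /sdh_iter big1 ?linear0 // => i _.
  by rewrite -/(sdj i _) sdj_nil sdh_nil.
- rewrite /= /sdh_iter linear_sum; apply: eq_bigr => i _.
  by rewrite /= -sdh_cmap -!/(sdj i _) -sdj_cmap cmap_gen map_lmap_std.
Qed.

Lemma bd_csdh X j (c : chain X) :
  chain_bd (csdh j c) = c - csd j c - csdh j (chain_bd c).
Proof.
apply: (@free_mod_ext _ _ _ (@chain_bd R k X \o csdh j)
  (idfun \- csd j \- (csdh j \o @chain_bd R k X))) => -[d s] /=.
rewrite -[existT _ _ _]/(mk_sing s) -(real_std s) -realc_gen chain_bd_realc.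
by rewrite csdh_realc csd_realc csdh_realc chain_bd_realc bd_sdh_iter !linearB.
Qed.

Lemma bd_csd X j (c : chain X) : chain_bd (csd j c) = csd j (chain_bd c).
Proof.
apply: (@free_mod_ext _ _ _ (@chain_bd R k X \o csd j)
  (csd j \o @chain_bd R k X)) => -[d s] /=.
rewrite -[existT _ _ _]/(mk_sing s) -(real_std s) -realc_gen chain_bd_realc.
rewrite !csd_realc chain_bd_realc; congr realc.
by rewrite /sdj; elim: (j) => //= i <-; rewrite bd_sd.
Qed.

Section InSpace.
Context {X : topologicalType}.
Implicit Types A : set X.

Lemma ext_maps d (s : simplex d -> X) A v : (forall t, A (s t)) -> A (ext s v).
Proof. by move=> sA; exact: sA. Qed.

Lemma csd_in d A j (c : chain X) : chains_in R k d A c -> chains_in R k d A (csd j c).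
Proof.
apply: (chains_in_ind (U := submod_preim (csd j : {linear chain X -> chain X}) (chains_in R k d A))) => s cs sA.
rewrite sm_preimE /= -(real_std s) -realc_gen csd_realc.
apply: (realc_in (C := simplex d)); first exact: simplex_convex.
- exact: ext_continuous.
- by move=> v _; exact: ext_maps.
- by rewrite /= /sdj; apply: iter_sd_in; [exact: simplex_bary_closed|exact: std_supp].
Qed.

Lemma csdh_in d A j (c : chain X) :
  chains_in R k d A c -> chains_in R k d.+1 A (csdh j c).
Proof.
apply: (chains_in_ind (U := submod_preim (csdh j : {linear chain X -> chain X}) (chains_in R k d.+1 A))) => s cs sA.
rewrite sm_preimE /= -(real_std s) -realc_gen csdh_realc.
apply: (realc_in (C := simplex d)); first exact: simplex_convex.
- exact: ext_continuous.
- by move=> v _; exact: ext_maps.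
- by apply: sdh_iter_in; [exact: simplex_bary_closed|exact: std_supp].
Qed.

Lemma simplex_compact d : compact (simplex d : set 'rV[R]_d.+1).
Proof.
apply: (@subclosed_compact _ _ [set v : 'rV[R]_d.+1 | forall i, `[0, 1]%classic (v ord0 i)]).
- have -> : (simplex d : set 'rV[R]_d.+1) =
      (\bigcap_i ((fun v : 'rV[R]_d.+1 => v 0 i) @^-1` [set x | 0 <= x])) `&`
      ((fun v : 'rV[R]_d.+1 => \sum_i v 0 i) @^-1` [set 1]).
    by apply/seteqP; split=> v [h1 h2]; split => // i; [move=> _; exact: h1|exact: (h1 i)].
  apply: closedI.
    apply: closed_bigI => i _; apply: preimage_closed.
      by move=> x _; exact: coord_continuous.
    exact: closed_ge.
  apply: preimage_closed; last exact: closed_eq.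
  by move=> x _; exact: (@continuous_sumr R _ R^o _ _ (fun i (v : 'rV[R]_d.+1) => v 0 i) (fun i => @coord_continuous _ _ _ _ _) x).
- by apply: (@rV_compact R^o d.+1 (fun=> `[0, 1]%classic)) => i; exact: segment_compact.
- move=> v [v0 v1] i; rewrite /= in_itv /= v0 -v1 (bigD1 i) //= lerDl.
  by apply: sumr_ge0 => j _.
Qed.

(** Each point of the simplex has a neighbourhood on which one bound works, and compactness makes
    the bound uniform. The near-covering form of compactness keeps track of the point and of the
    bound at once. *)
Lemma lebesgue_number d (s : simplex d -> X) (U1 U2 : set X) : continuous s ->
  open U1 -> open U2 -> (forall t, U1 (s t) \/ U2 (s t)) ->
  exists2 e : R, 0 < e & forall v, simplex d v ->
    (forall w, simplex d w -> `|w - v| <= e -> U1 (ext s w)) \/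
    (forall w, simplex d w -> `|w - v| <= e -> U2 (ext s w)).
Proof.
move=> cs oU1 oU2 sU.
have loc (W : set X) (v : 'rV[R]_d.+1) : open W -> simplex d v -> W (ext s v) ->
    \forall v' \near v & e \near (0 : R)^'+,
      forall w, simplex d w -> `|w - v'| <= e -> W (ext s w).
  move=> oW dv Wv; have := ext_continuous cs; rewrite continuous_subspace_in => /(_ v).
  rewrite inE => /(_ dv W) /=; have nW : nbhs (ext s v) W by exact: open_nbhs_nbhs.
  move=> /(_ nW); rewrite /nbhs /= -nbhs_subspace_in // => /nbhs_ballP[e /= e0 be].
  exists (ball v (e / 2), [set x | x < e / 2]).
    split; first by apply: nbhsx_ballx; rewrite divr_gt0.
    by apply: nbhs_right_lt; rewrite divr_gt0.
  move=> [v' r] /= [vv' re] w dw wv'; apply: be => //.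
  rewrite -ball_normE /=; have -> : v - w = (v - v') + (v' - w) by rewrite addrA subrK.
  apply: (le_lt_trans (ler_normD _ _)); rewrite [e]splitr ltrD //.
    by move: vv'; rewrite -ball_normE.
  by rewrite distrC; exact: le_lt_trans wv' re.
have := @simplex_compact d; rewrite compact_near_coveringP => /(_ _ (0 : R)^'+
  (fun e v => (forall w, simplex d w -> `|w - v| <= e -> U1 (ext s w)) \/
    (forall w, simplex d w -> `|w - v| <= e -> U2 (ext s w))) _) [].
  move=> v dv; case: (sU (to_simplex v)) => h; [have := loc _ _ oU1 dv h|have := loc _ _ oU2 dv h].
    by apply: filterS => -[? ?] /= ?; left.
  by apply: filterS => -[? ?] /= ?; right.
(* The property holds for radii strictly between 0 and [e]. *)
move=> e /= e0 he; exists (e / 2); first by rewrite divr_gt0.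
move=> v dv; apply: (he (e / 2)) => //=; last by rewrite divr_gt0.
by rewrite sub0r normrN ger0_norm ?divr_ge0 ?ltW // ltr_pdivrMr // ltr_pMr // ltr1n.
Qed.

Lemma affs_near V n (s : seq V) (e : R) (t : simplex n) : size s = n.+1 ->
  small e s -> `|affs s t - nth 0 s 0| <= e.
Proof.
move=> sn se; have n0 i : (i < n.+1)%N -> nth 0 s i \in s by move=> ni; rewrite mem_nth ?sn.
have -> : affs s t - nth 0 s 0 =
    \sum_(i < n.+1) (set_val t : 'rV_n.+1) 0 i *: (nth 0 s i - nth 0 s 0).
  under eq_bigr do rewrite scalerBr.
  by rewrite sumrB -scaler_suml simplex_sum1 scale1r.
rewrite -[leRHS]mul1r -(simplex_sum1 t) mulr_suml.
apply: (le_trans (ler_norm_sum _ _ _)); apply: ler_sum => i _.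
rewrite normrZ ger0_norm ?simplex_ge0 // ler_wpM2l ?simplex_ge0 //.
by apply: se; apply: n0.
Qed.

Definition two_small d A (U1 U2 : set X) (s : @sing R X) :=
  [/\ tag s = d, continuous (tagged s), range (tagged s) `<=` A &
      range (tagged s) `<=` U1 \/ range (tagged s) `<=` U2].

(** The number of subdivisions depends on the chain. Demanding smallness for all large [j] makes the
    property stable under linear combinations, so that single simplices suffice. *)
Lemma csd_small d A (U1 U2 : set X) (c : chain X) : open U1 -> open U2 -> A `<=` U1 `|` U2 ->
  chains_in R k d A c -> exists j0, forall j, (j0 <= j)%N ->
    supp_in (two_small d A U1 U2) (csd j c).
Proof.
move=> oU1 oU2 AU.
pose P (c : chain X) := exists j0, forall j, (j0 <= j)%N ->
    supp_in (two_small d A U1 U2) (csd j c).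
have P0 : P 0 by exists 0%N => j _; rewrite linear0; exact: sm0.
have PP a x y : P x -> P y -> P (a *: x + y).
  move=> [i hi] [j hj]; exists (maxn i j) => l; rewrite geq_max => /andP[il jl].
  by rewrite linearP; apply: submod_setP; [exact: hi|exact: hj].
apply: (chains_in_ind (U := Submod P0 PP)) => s cs sA.
have [|e e0 he] := @lebesgue_number d s U1 U2 cs oU1 oU2.
  by move=> t; exact/AU.
(* Twice this number bounds the diameter of the standard simplex. *)
pose B : R := \sum_(v <- std d) `|v|.
have sD : small (B + B) (std d : seq 'rV[R]_d.+1).
  move=> u v us vs; apply: (le_trans (ler_normB _ _)).
  have n1 (w : 'rV[R]_d.+1) : w \in std d -> `|w| <= B.
    by move=> ws; rewrite /B (big_rem w) //= lerDl; apply: sumr_ge0.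
  by rewrite lerD // n1.
have B0 : 0 <= B + B by rewrite addr_ge0 ?sumr_ge0.
have [j0 hj0] := mesh_cvg d (B + B) e0.
exists j0 => j /hj0 jj; rewrite -(real_std s) -realc_gen csd_realc.
apply: (lin_ext_in (P := fun t => (size t = d.+1 /\
   small ((d%:R / d.+1%:R) ^+ j * (B + B)) t) /\ seq_in d.+1 (simplex d) t)) => [u [[ud ue] [_ uD]]|].
  rewrite (real_size _ ud); apply: supp_gen; split => //=.
  - by apply: (continuous_comp_within (C := simplex d));
      [exact: affs_continuous|move=> t; exact: simplex_convex|exact: ext_continuous].
  - by move=> _ [t _ <-]; exact: ext_maps.
  have us : small e u by move=> v w vu wu; exact: le_trans (ue _ _ vu wu) jj.
  have uD0 : simplex d (nth 0 u 0) by apply: uD; rewrite mem_nth ?ud.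
  case: (he _ uD0) => hU; [left|right] => _ [t _ <-]; apply: hU.
  - exact: simplex_convex.
  - exact: affs_near.
  - exact: simplex_convex.
  - exact: affs_near.
apply: supp_in_and.
  by apply: iter_sd_small => //; apply: supp_gen; split => //; exact: size_std.
by apply: iter_sd_in; [exact: simplex_bary_closed|exact: std_supp].
Qed.

Lemma csd_split d A (U1 U2 : set X) (c : chain X) : open U1 -> open U2 -> A `<=` U1 `|` U2 ->
  chains_in R k d A c -> exists j u v,
  [/\ chains_in R k d (A `&` U1) u, chains_in R k d (A `&` U2) v & csd j c = u + v].
Proof.
move=> oU1 oU2 AU cA; have [j hj] := csd_small oU1 oU2 AU cA; exists j.
have := supp_inS (Q := fun s : @sing R X =>
  [/\ tag s = d, continuous (tagged s) & range (tagged s) `<=` A `&` U1] \/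
  [/\ tag s = d, continuous (tagged s) & range (tagged s) `<=` A `&` U2]) _ (hj j (leqnn j)).
case/(_ _)/supp_in_split => [s [sd cs sA [sU|sU]]|u [v [hu hv e]]]; last by exists u, v.
  by left; split => // x xs; split; [exact: sA|exact: sU].
by right; split => // x xs; split; [exact: sA|exact: sU].
Qed.

End InSpace.

End ChainOperators.

(** * Homotopy invariance *)

Section NaturalHomotopies.
Context {R : realType} {k : comUnitRingType}.
Local Notation FS V := (@free_mod k (seq V)).
Local Notation simplex := (simplex R).
Local Notation chain X := (@chain R k X).
Implicit Types V W U : normedModType R.

(** Serves maps such as [top], and later [pr], which are affine without being linear. *)
Lemma realc_cmap_affine X V W (K : W -> X) (h : V -> W) c :
  (forall n s (t : simplex n), size s = n.+1 -> affs (map h s) t = h (affs s t)) ->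
  realc K (cmap h c) = realc (k := k) (K \o h) c.
Proof.
move=> hh; apply: (@free_mod_ext _ _ _ (realc K \o cmap h) (realc (K \o h))) => s /=.
rewrite cmap_gen !realc_gen; case: s => [//|v s].
have e : size (map h (v :: s)) = (size s).+1 by rewrite size_map.
rewrite (real_size K e); congr (gen (mk_sing _)); apply/funext => t.
by rewrite hh.
Qed.

Definition bot d (v : 'rV[R]_d.+1) : 'rV[R]_d.+1 * R^o := (v, 0).
Definition top d (v : 'rV[R]_d.+1) : 'rV[R]_d.+1 * R^o := (v, 1).
Definition cyl d : set ('rV[R]_d.+1 * R^o) := [set p | simplex d p.1 /\ 0 <= p.2 <= 1].

Lemma affs_pair V W U (f : V -> W) (c : U) n (s : seq V) (t : simplex n) :
  size s = n.+1 -> affs (map (fun v => (f v, c)) s) t = (affs (map f s) t, c).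
Proof.
move=> sn; rewrite /affs.
have fs (r : seq 'I_n.+1) (F : 'I_n.+1 -> W * U) :
    \sum_(i <- r) F i = (\sum_(i <- r) (F i).1, \sum_(i <- r) (F i).2).
  by elim: r => [|i r IH]; rewrite ?big_nil // !big_cons IH.
rewrite fs; congr (_, _).
  apply: eq_bigr => i _; rewrite !(nth_map 0) ?sn //.
rewrite -[RHS]scale1r -(simplex_sum1 t) scaler_suml; apply: eq_bigr => i _.
by rewrite (nth_map 0) ?sn.
Qed.

Lemma affs_bot d n s (t : simplex n) : size s = n.+1 ->
  affs (map (@bot d) s) t = bot (affs s t).
Proof. by move=> sn; rewrite (@affs_pair _ _ _ id) // map_id. Qed.
Lemma affs_top d n s (t : simplex n) : size s = n.+1 ->
  affs (map (@top d) s) t = top (affs s t).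
Proof. by move=> sn; rewrite (@affs_pair _ _ _ id) // map_id. Qed.

Lemma cyl_convex d : convex_in (@cyl d).
Proof.
move=> n t s sn sC.
have fs (r : seq 'I_n.+1) (F : 'I_n.+1 -> 'rV[R]_d.+1 * R^o) :
    \sum_(i <- r) F i = (\sum_(i <- r) (F i).1, \sum_(i <- r) (F i).2).
  by elim: r => [|i r IH]; rewrite ?big_nil // !big_cons IH.
rewrite /affs fs; split => /=.
  have := @simplex_convex R d n t (map fst s); rewrite size_map => /(_ sn) h.
  rewrite (eq_bigr (fun i : 'I_n.+1 => (set_val t : 'rV_n.+1) 0 i *: nth 0 (map fst s) i)) => [|i _].
    by apply: h => _ /mapP[p /sC[h _] ->].
  by rewrite (nth_map 0) ?sn.
have h i : 0 <= (nth 0 s i).2 <= 1.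
  have [si|si] := ltnP i (size s); first by have [] := sC _ (mem_nth 0 si).
  by rewrite nth_default //= lexx ler01.
apply/andP; split.
  by apply: sumr_ge0 => i _; rewrite mulr_ge0 ?simplex_ge0 //; case/andP: (h i).
rewrite -(simplex_sum1 t); apply: ler_sum => i _.
by rewrite -[leRHS]mulr1 ler_wpM2l ?simplex_ge0 //; case/andP: (h i).
Qed.

Lemma simplex_op_fun_is_linear m d (f : 'I_m.+1 -> 'I_d.+1) :
  linear (@simplex_op_fun R m d f).
Proof.
move=> a u v; apply/rowP => j; rewrite !mxE mulr_sumr -big_split /=.
by apply: eq_bigr => i _; rewrite !mxE.
Qed.
HB.instance Definition _ m d f := GRing.isLinear.Build R _ _ _
  (@simplex_op_fun R m d f) (@simplex_op_fun_is_linear m d f).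

Definition fpair U m d (f : 'I_m.+1 -> 'I_d.+1) (p : 'rV[R]_m.+1 * U) :
  'rV[R]_d.+1 * U := (simplex_op_fun f p.1, p.2).
Lemma fpair_is_linear U m d f : linear (@fpair U m d f).
Proof. by move=> a u v; rewrite /fpair linearP. Qed.
HB.instance Definition _ U m d f := GRing.isLinear.Build R _ _ _
  (@fpair U m d f) (@fpair_is_linear U m d f).

Lemma simplex_op_fun_vert m d (f : 'I_m.+1 -> 'I_d.+1) i :
  simplex_op_fun f (@vert R _ i) = @vert R _ (f i).
Proof.
apply/rowP => j; rewrite !mxE eqxx /= eq_sym.
case: eqVneq => [fij|fij].
  rewrite (bigD1 i) ?fij //= big1 ?addr0 => [|l /andP[_ li]].
    by rewrite mxE !eqxx.
  by rewrite mxE (negbTE li) andbF.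
rewrite big1 // => l /eqP fl; rewrite mxE eqxx /=; case: eqVneq => [li|//].
by rewrite -fl li eqxx in fij.
Qed.

Lemma simplex_op_fun_in m d (f : 'I_m.+1 -> 'I_d.+1) v :
  simplex m v -> simplex d (simplex_op_fun f v).
Proof. by move=> mv; have := simplex_op_subproof f (to_simplex v); rewrite to_simplexK // inE. Qed.

Lemma ext_op X m d (f : 'I_m.+1 -> 'I_d.+1) (s : simplex d -> X) v :
  simplex m v -> ext (s \o simplex_op f) v = ext s (simplex_op_fun f v).
Proof.
move=> mv; rewrite /ext /=; congr s; apply: val_inj.
by rewrite [RHS]to_simplexK ?[LHS]/= ?to_simplexK //; exact: simplex_op_fun_in.
Qed.

Lemma bd_std d : bd (gen (@std R d.+1)) =
  \sum_(i < d.+2) (-1) ^+ i *: cmap (simplex_op_fun (fintype.lift i)) (gen (@std R d)) :> FS _.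
Proof.
rewrite bd_gen sbdE size_std; apply: eq_bigr => i _; rewrite cmap_gen; congr (_ *: gen _).
have il : (i < d.+2)%N := ltn_ord i.
have sz : size (take i (@std R d.+1) ++ drop i.+1 (@std R d.+1)) = d.+1.
  move: il; move: (nat_of_ord i) => j jl.
  by rewrite size_cat size_drop size_takel !size_std 1?ltnW //; lia.
apply: (@eq_from_nth _ 0); first by rewrite sz [RHS]size_map size_std.
move=> l; rewrite sz => ld.
rewrite (nth_map 0) ?size_std // (nth_std (Ordinal ld)) simplex_op_fun_vert -nth_std.
rewrite nth_cat size_takel; last by rewrite size_std ltnW.
rewrite /= /bump; case: leqP => li; last by rewrite add0n nth_take.
by rewrite nth_drop add1n addSn subnKC.
Qed.

Section Hop.
Context {X Y : Type}.
Variable K : forall d, (simplex d -> X) -> 'rV[R]_d.+1 * R^o -> Y.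

(** A homotopy is given simplex by simplex, on the cylinder over the domain of each singular
    simplex. It then has to be continuous only along the simplices of a given subspace;
    [natural_family] is the compatibility with faces that makes the prisms a chain homotopy. *)
Definition hop : chain X -> chain Y := lin_ext (fun s : @sing R X =>
  realc (K (tagged s)) (prism (@bot _) (@top _) (gen (@std R (tag s))))).
HB.instance Definition _ := GRing.Linear.on hop.

Definition push_at (r : R^o) : chain X -> chain Y := lin_ext (fun s : @sing R X =>
  gen (mk_sing (fun t : simplex (tag s) => K (tagged s) (set_val t : 'rV[R]_(_.+1), r)))).
HB.instance Definition _ r := GRing.Linear.on (push_at r).

Definition natural_family := forall m d (f : 'I_m.+1 -> 'I_d.+1) (s : simplex d -> X) p,
  cyl p -> K (s \o simplex_op f) p = K s (fpair f p).

Lemma hop_gen d (s : simplex d -> X) :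
  hop (gen (mk_sing s)) = realc (K s) (prism (@bot _) (@top _) (gen (@std R d))).
Proof. by rewrite /hop lin_ext_gen. Qed.

Lemma push_at_gen r d (s : simplex d -> X) : push_at r (gen (mk_sing s)) =
  gen (mk_sing (fun t : simplex d => K s (set_val t : 'rV[R]_(_.+1), r))).
Proof. by rewrite /push_at lin_ext_gen. Qed.

Lemma prism_cyl d n (c : FS 'rV[R]_d.+1) : supp_in (seq_in n (simplex d)) c ->
  supp_in (seq_in n.+1 (@cyl d)) (prism (@bot d) (@top d) c).
Proof. by apply: prism_in => v dv; split; split => //=; rewrite lexx ler01. Qed.

Lemma bd_hop c : natural_family ->
  chain_bd (hop c) = push_at 1 c - push_at 0 c - hop (chain_bd c).
Proof.
move=> nK.
apply: (@free_mod_ext _ _ _ (@chain_bd R k Y \o hop)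
  (push_at 1 \- push_at 0 \- (hop \o @chain_bd R k X))) => -[d s] /=.
rewrite -[existT _ _ _]/(mk_sing s) hop_gen chain_bd_realc bd_prism !linearB /=.
rewrite !realc_cmap_affine; [|by move=> *; exact: affs_bot|by move=> *; exact: affs_top].
rewrite !realc_gen !(real_size _ (size_std _)) !push_at_gen.
congr (_ - _ - _).
- congr (gen (mk_sing _)); apply/funext => t; by rewrite /= affs_std.
- congr (gen (mk_sing _)); apply/funext => t; by rewrite /= affs_std.
(* For d = 0 the boundary of the standard simplex is the empty sequence, whose prism is 0. *)
rewrite chain_bd_gen; case: d s => [|d] s.
  rewrite bd_gen [std 0]/std enum_ordSl enum_ord0 /= !linear0 addr0 prism_gen /= !linear0.
  by [].
rewrite bd_std /= !linear_sum; apply: eq_bigr => i _; rewrite !linearZ /=; congr (_ *: _).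
rewrite hop_gen prism_cmap.
rewrite (realc_congr (K' := K s \o fpair (fintype.lift i)) (@cyl_convex d) (n := d.+2)).
- by rewrite -realc_cmap cmap_prism.
- by move=> p dp /=; exact: nK.
- by apply: prism_cyl; exact: std_supp.
Qed.

Lemma push_at_push r (g : X -> Y) c :
  (forall d (s : simplex d -> X) v, simplex d v -> K s (v, r) = g (ext s v)) ->
  push_at r c = chain_push g c.
Proof.
move=> Kg; apply: (@free_mod_ext _ _ _ (push_at r) (chain_push g)) => -[d s] /=.
rewrite -[existT _ _ _]/(mk_sing s) push_at_gen /chain_push lin_ext_gen /=.
congr (gen (mk_sing _)); apply/funext => t; rewrite Kg /ext ?set_valK //.
by case: t => t ht /=; exact: set_mem.
Qed.

End Hop.

Lemma chain_push_id X (f : X -> X) (c : chain X) : f =1 id -> chain_push f c = c.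
Proof.
move=> fid; apply: (@free_mod_ext _ _ _ (chain_push f) idfun) => -[d s] /=.
rewrite /chain_push lin_ext_gen; congr (gen (mk_sing _)).
by apply/funext => t /=; rewrite fid.
Qed.

Lemma hop_in (X Y : topologicalType) (K : forall d, (simplex d -> X) -> 'rV[R]_d.+1 * R^o -> Y)
  d A B c :
  (forall s : simplex d -> X, continuous s -> (forall t, A (s t)) ->
    {within @cyl d, continuous (K d s)} /\ (forall p, cyl p -> B (K d s p))) ->
  chains_in R k d A c -> chains_in R k d.+1 B (hop K c).
Proof.
move=> h; apply: (chains_in_ind (U := submod_preim (hop K : {linear chain X -> chain Y})
  (chains_in R k d.+1 B))) => s cs sA.
rewrite sm_preimE /= hop_gen; have [cK KB] := h s cs sA.
apply: (realc_in (C := @cyl d)) => //; first exact: cyl_convex.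
by apply: prism_cyl; exact: std_supp.
Qed.

End NaturalHomotopies.

Lemma withinP (T U : topologicalType) (A : set T) (f : T -> U) :
  {within A, continuous f} <-> forall x, A x -> forall W, nbhs (f x) W ->
    nbhs x [set y | A y -> W (f y)].
Proof. by split => [/subspace_continuousP|h]; [|apply/subspace_continuousP]. Qed.

Lemma within_comp (T U W : topologicalType) (C : set T) (D : set U) (f : T -> U) (h : U -> W) :
  {within C, continuous f} -> (forall x, C x -> D (f x)) ->
  {within D, continuous h} -> {within C, continuous (h \o f)}.
Proof.
move=> /withinP fc CD /withinP hc; apply/withinP => x Cx O hO.
have := fc x Cx _ (hc _ (CD _ Cx) _ hO); apply: filterS => y yy Cy.
by apply: yy => //; exact: CD.
Qed.

Lemma within_pair (T U W : topologicalType) (C : set T) (f : T -> U) (h : T -> W) :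
  {within C, continuous f} -> {within C, continuous h} ->
  {within C, continuous (fun x => (f x, h x))}.
Proof.
move=> /withinP fc /withinP hc; apply/withinP => x Cx O [[A B] /= [fA hB] AB].
have h1 := fc x Cx _ fA; have h2 := hc x Cx _ hB.
by apply: filterS2 h1 h2 => y h1 h2 Cy; apply: (AB (f y, h y)); split; [exact: h1|exact: h2].
Qed.

Lemma within_cont (T U : topologicalType) (C : set T) (f : T -> U) :
  continuous f -> {within C, continuous f}.
Proof.
move=> fc; apply/withinP => x _ W fW; have h : nbhs x (f @^-1` W) by exact: fc.
by apply: filterS h => y Wy _.
Qed.

Lemma cont_cst (T U : topologicalType) (c : U) : continuous (fun _ : T => c).
Proof. by move=> x W /nbhs_singleton Wc; apply: (@filterE _ (nbhs x)). Qed.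

Lemma cont_pair (T U W : topologicalType) (f : T -> U) (h : T -> W) :
  continuous f -> continuous h -> continuous (fun x => (f x, h x)).
Proof.
move=> fc hc x O [[A B] /= [fA hB] AB].
have h1 : nbhs x (f @^-1` A) by exact: fc.
have h2 : nbhs x (h @^-1` B) by exact: hc.
by apply: filterS2 h1 h2 => y h1 h2; apply: (AB (f y, h y)).
Qed.

(** * Excision *)

Section Excision.
Context {R : realType} {k : comUnitRingType} {X : topologicalType}.
Local Notation chain := (@chain R k X).
Local Notation chains_in := (@chains_in R k X).
Local Notation simplex := (simplex R).
Implicit Types (A B P Y Z W : set X).

Lemma chains_inS d A B c : A `<=` B -> chains_in d A c -> chains_in d B c.
Proof.
move=> AB; apply: (@supp_inS k) => s [sd cs sA]; split => //.
exact: subset_trans AB.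
Qed.

Lemma chains_in_setI d A B c : chains_in d A c -> chains_in d B c ->
  chains_in d (A `&` B) c.
Proof.
move=> hA hB s sc; have [sd cs sA] := hA s sc; have [_ _ sB] := hB s sc.
by split => // x xs; split; [exact: sA|exact: sB].
Qed.

Lemma chains_in_bd d A c : chains_in d.+1 A c -> chains_in d A (chain_bd c).
Proof.
apply: (chains_in_ind (U := submod_preim (@chain_bd R k X : {linear _ -> _})
  (chains_in d A))) => s cs sA.
rewrite sm_preimE /= -real_std -realc_gen chain_bd_realc.
apply: (realc_in (C := simplex d.+1)); first exact: simplex_convex.
- exact: ext_continuous.
- by move=> v _; exact: ext_maps.
- by apply: bd_in; exact: std_supp.
Qed.

Lemma chains_in_bd0 A c : chains_in 0 A c -> chain_bd c = 0.
Proof.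
apply: (chains_in_ind (U := eq_sub (@chain_bd R k X : {linear chain -> chain}) \0)).
by move=> s _ _; rewrite /eq_sub /submod_set /= chain_bd_gen.
Qed.

Lemma chains_in_bdp d A c : chains_in d A c -> chains_in d.-1 A (chain_bd c).
Proof.
case: d => [/chains_in_bd0->|d]; first exact: sm0.
exact: chains_in_bd.
Qed.

Definition C2 d P Y : submod chain := submod_add (chains_in d P) (chains_in d Y).

Lemma C2l d P Y c : chains_in d P c -> C2 d P Y c.
Proof. by move=> Pc; exists c, 0; rewrite addr0; split => //; exact: sm0. Qed.
Lemma C2r d P Y c : chains_in d Y c -> C2 d P Y c.
Proof. by move=> Yc; exists 0, c; rewrite add0r; split => //; exact: sm0. Qed.

Lemma C2S d P Y P' Y' c : P `<=` P' -> Y `<=` Y' -> C2 d P Y c -> C2 d P' Y' c.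
Proof.
by move=> PP YY [u [v [Pu Yv ->]]]; exists u, v; split => //;
  [exact: chains_inS Pu|exact: chains_inS Yv].
Qed.

Lemma C2_setI d P Y W c : C2 d P Y c -> chains_in d W c ->
  C2 d (P `&` W) (Y `&` W) c.
Proof.
move=> [u [v [Pu Yv ->]]] Wc.
have := supp_in_and (supp_in_add Pu Yv) Wc.
move/(supp_inS (Q := fun s : @sing R X =>
  [/\ tag s = d, continuous (tagged s) & range (tagged s) `<=` P `&` W] \/
  [/\ tag s = d, continuous (tagged s) & range (tagged s) `<=` Y `&` W])).
case/(_ _)/supp_in_split => [s [[[sd cs sP]|[sd cs sY]] [_ _ sW]]|u' [v' [h1 h2 ->]]].
- by left; split => // x xs; split; [exact: sP|exact: sW].
- by right; split => // x xs; split; [exact: sY|exact: sW].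
- by exists u', v'.
Qed.

Definition excisive P Y := forall d c, chains_in d (P `|` Y) c ->
  C2 d.-1 P Y (chain_bd c) ->
  exists2 b, chains_in d.+1 (P `|` Y) b & C2 d P Y (c - chain_bd b).

Lemma excisive_sub P Y : P `<=` Y -> excisive P Y.
Proof.
move=> PY d c cin _; exists 0; first exact: sm0.
rewrite linear0 subr0; apply: C2r; apply: chains_inS cin.
by move=> x [/PY|].
Qed.

(** The chain is split over B and the union of B' and A. The part in this union has a boundary which
    is small for B and A and lies in the union; as B and A meet inside B', it is small for B' and A,
    so that this part can be split further. *)
Lemma excisive_trans B B' A : B' `<=` B -> B `&` A `<=` B' ->
  excisive B' A -> excisive B (B' `|` A) -> excisive B A.
Proof.
move=> B'B BA eB' eB d c cin hc.
have eqU : B `|` (B' `|` A) = B `|` A.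
  apply/seteqP; split => x; first by move=> [|[/B'B|]]; [left|left|right].
  by move=> [|]; [left|right; right].
have cin' : chains_in d (B `|` (B' `|` A)) c by rewrite eqU.
have [b bin [u [v [Bu Yv e]]]] := eB d c cin' (C2S (fun=> id) (@subsetUr _ _ _) hc).
have hv : C2 d.-1 B' A (chain_bd v).
    have -> : chain_bd v = chain_bd c - chain_bd u.
      have := congr1 (@chain_bd R k X) e; rewrite linearB /= chain_bdK subr0 linearD /= => ->.
      by rewrite addrAC subrr add0r.
    have h2 : C2 d.-1 B A (chain_bd c - chain_bd u).
      by apply: smB => //; apply: C2l; exact: chains_in_bdp.
    have h3 : chains_in d.-1 (B' `|` A) (chain_bd c - chain_bd u).
      have -> : chain_bd c - chain_bd u = chain_bd v.
        have := congr1 (@chain_bd R k X) e; rewrite linearB /= chain_bdK subr0 linearD /= => ->.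
        by rewrite addrAC subrr add0r.
      exact: chains_in_bdp.
    apply: C2S (C2_setI h2 h3); last by move=> x [].
    by move=> x [Bx [//|Ax]]; apply: BA.
  have [b' b'in hb'] := eB' d v Yv hv.
  exists (b + b').
    apply: smD; first by rewrite -eqU.
    by apply: chains_inS b'in => x [/B'B|]; [left|right].
  rewrite linearD /= opprD addrA e -addrA; apply: smD; first exact: C2l.
  exact: C2S hb'.
Qed.

End Excision.

(** * Excision for a single cell *)

Section CellExcision.
Context {R : realType} {k : comUnitRingType} {X : topologicalType}.
Local Notation simplex := (simplex R).

(** Discs and spheres are Euclidean, while the norm on row vectors is the maximum norm. *)
Definition sqn d (v : 'rV[R]_d) : R := \sum_i v 0 i ^+ 2.

Lemma sqn_continuous d : continuous (@sqn d : 'rV[R]_d -> R^o).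
Proof.
apply: (@continuous_sumr R _ R^o _ _ (fun i (v : 'rV[R]_d) => v 0 i ^+ 2)) => i v.
rewrite /continuous_at expr2; under eq_fun do rewrite expr2.
by apply: (@cvgM R _ (nbhs v)); exact: coord_continuous.
Qed.

Lemma sqn_ge0 d (v : 'rV[R]_d) : 0 <= sqn v.
Proof. by apply: sumr_ge0 => i _; exact: sqr_ge0. Qed.

Lemma sqn_eq0 d (v : 'rV[R]_d) : (sqn v == 0) = (v == 0).
Proof.
apply/eqP/eqP => [|->]; last by rewrite /sqn big1 // => i _; rewrite mxE expr0n.
move/psumr_eq0P => h; apply/rowP => i; rewrite mxE.
by apply/eqP; rewrite -sqrf_eq0; apply/eqP/h => // j _; exact: sqr_ge0.
Qed.

Lemma sqnZ d a (v : 'rV[R]_d) : sqn (a *: v) = a ^+ 2 * sqn v.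
Proof. by rewrite /sqn mulr_sumr; apply: eq_bigr => i _; rewrite mxE exprMn. Qed.

Lemma disc_closed d : closed (@disc R d).
Proof. by apply: (@preimage_closed _ _ (@sqn d : 'rV[R]_d -> R^o) [set x | x <= 1]);
  [move=> v _; exact: sqn_continuous|exact: closed_le]. Qed.

(** The point at time [p.2] on the segment from [p.1] to its radial projection onto the sphere. *)
Definition radial d (p : 'rV[R]_d * R^o) : 'rV[R]_d :=
  (1 - p.2 + p.2 / Num.sqrt (sqn p.1)) *: p.1.

Lemma radial_disc d v (r : R) : v != 0 -> @disc R d v -> 0 <= r <= 1 -> disc (radial (v, r)).
Proof.
move=> v0 dv /andP[r0 r1]; rewrite /disc /= -/(sqn _) sqnZ /=.
have q0 : 0 < sqn v by rewrite lt0r sqn_eq0 v0 sqn_ge0.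
rewrite -{2}(sqr_sqrtr (ltW q0)) -exprMn mulrDl mulfVK ?gt_eqF ?sqrtr_gt0 //.
rewrite expr_le1 //; last by rewrite addr_ge0 // mulr_ge0 ?sqrtr_ge0 // subr_ge0.
rewrite -[leRHS](subrK r) lerD2r ler_piMr ?subr_ge0 //.
by rewrite -[leRHS]sqrtr1 ler_wsqrtr.
Qed.

Lemma radial_sphere d v : v != 0 -> @sphere R d (radial (v, 1)).
Proof.
move=> v0; rewrite /sphere /= -/(sqn _) sqnZ /= subrr add0r mul1r.
have q0 : 0 < sqn v by rewrite lt0r sqn_eq0 v0 sqn_ge0.
by rewrite exprVn sqr_sqrtr ?ltW // mulVf // gt_eqF.
Qed.

Lemma radial0 d v : radial (v, 0) = v :> 'rV[R]_d.
Proof. by rewrite /radial /= mul0r addr0 subr0 scale1r. Qed.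

Lemma radial_id d v r : @sphere R d v -> radial (v, r) = v.
Proof.
move=> sv; rewrite /radial /=; have -> : sqn v = 1 by exact: sv.
by rewrite sqrtr1 divr1 subrK scale1r.
Qed.

Lemma radial_continuous d (p : 'rV[R]_d * R^o) : p.1 != 0 -> {for p, continuous (@radial d)}.
Proof.
move=> p0; rewrite /prop_for /continuous_at /radial; apply: cvgZ; last exact: cvg_fst.
apply: cvgD; first by apply: cvgB; [exact: cvg_cst|exact: cvg_snd].
apply: cvgM; first exact: cvg_snd.
apply: cvgV; first by rewrite gt_eqF // sqrtr_gt0 lt0r sqn_eq0 p0 sqn_ge0.
apply: (@continuous_comp _ _ _ (fun p : 'rV[R]_d * R^o => sqn p.1) Num.sqrt).
  by apply: (@continuous_comp _ _ _ fst (@sqn d)); [exact: cvg_fst|exact: sqn_continuous].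
exact: sqrt_continuous.
Qed.

Section Cell.
Variables (d : nat) (phi : 'rV[R]_d -> X) (P Y : set X).
Local Notation e := (phi @` @open_disc R d).
Hypothesis phic : {within @disc R d, continuous phi}.
Hypothesis phih : homeo_between (@open_disc R d) e phi.
Hypothesis phiK : forall K, closed K -> K `<=` @disc R d -> closed (phi @` K).
Hypothesis Yc : closed Y.
Hypothesis eY : e `&` Y = set0.
Hypothesis eP : phi @` @disc R d `<=` P.
Hypothesis PYe : P `|` Y `<=` Y `|` e.
Hypothesis sY : phi @` @sphere R d `<=` Y.

Lemma open_disc0 : @open_disc R d 0.
Proof. by rewrite /open_disc /= big1 // => i _; rewrite mxE expr0n. Qed.

Lemma open_disc_sub : @open_disc R d `<=` @disc R d.
Proof. by move=> v; exact: ltW. Qed.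

Lemma disc_cases v : @disc R d v -> open_disc v \/ sphere v.
Proof. by rewrite /disc /= le_eqVlt => /orP[/eqP|]; [right|left]. Qed.

(* The punctured open cell flows radially to the boundary of the cell. *)
Lemma cell_push : exists G : X * R^o -> X,
  [/\ {within ((P `|` Y) `&` ~` [set phi 0]) `*` `[0, 1]%classic, continuous G},
      (forall x r, Y x -> G (x, r) = x) /\ (forall x, G (x, 0) = x),
      forall x r, 0 <= r <= 1 -> ((P `|` Y) `&` ~` [set phi 0]) x -> P x -> P (G (x, r)) &
      forall x, ((P `|` Y) `&` ~` [set phi 0]) x -> Y (G (x, 1))].
Proof.
have [g [_ gc gK Kg]] := phih.
pose G (p : X * R^o) : X := if `[< e p.1 >] then phi (radial (g p.1, p.2)) else p.1.
have Ge x r : e x -> G (x, r) = phi (radial (g x, r)) by move=> ex; rewrite /G /= asboolT.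
have GY x r : Y x -> G (x, r) = x.
  move=> Yx; rewrite /G /= asboolF // => ex.
  by have : (e `&` Y) x by []; rewrite eY.
have g0 x : e x -> x <> phi 0 -> g x != 0.
  by move=> /Kg[_ gx] x0; apply/eqP => gx0; apply: x0; rewrite -gx gx0.
have rad x r : e x -> x <> phi 0 -> 0 <= r <= 1 -> disc (radial (g x, r)).
  move=> ex x0 r01; apply: radial_disc => //; first exact: g0.
  by apply: open_disc_sub; have [] := Kg _ ex.
have phin (W : set X) v : disc v -> nbhs (phi v) W -> nbhs v [set u | disc u -> W (phi u)].
  by move=> dv Wv; have /withinP/(_ v dv W Wv) := phic.
exists G; split => //.
- apply/withinP => -[x r] [[/= /PYe[Yx|ex] /= x0] /=]; rewrite in_itv /= => r01 W.
    rewrite GY // => /nbhs_interior Wx.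
    (* Continuity at a point of [Y] cannot be read off in the disc. The points of the cell whose
       track leaves [W] are gathered in a closed subset of the disc, at distance at least 1/2 from
       the centre where the flow breaks down; its image is closed and misses [x]. *)
    pose good v := forall r : R^o, 0 <= r <= 1 -> W° (phi (radial (v, r))).
    pose Bad := [set v | [/\ disc v, 4^-1 <= sqn v & ~ good v]].
    have Badc : closed Bad.
      rewrite -openC openE => v nbad.
      have [dv|ndv] := pselect (disc v); last first.
        have odc : open (~` @disc R d) by rewrite openC; exact: disc_closed.
        apply: filterS (open_nbhs_nbhs (conj odc ndv)).
        by move=> u ndu [du _ _]; apply: ndu.
      have [qv|qv] := ltP (sqn v) 4^-1.
        have oq : open (@sqn d @^-1` [set x | x < 4^-1]).
          by apply: (open_comp (f := @sqn d : 'rV[R]_d -> R^o));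
            [move=> w _; exact: sqn_continuous|exact: open_lt].
        apply: filterS (open_nbhs_nbhs (conj oq qv)).
        by move=> u /= qu [_ qu' _]; move: qu; rewrite ltNge qu'.
      have gv : good v by apply: contrapT => ng; apply: nbad.
      have v0 : v != 0.
        by rewrite -sqn_eq0 gt_eqF // (lt_le_trans _ qv) // invr_gt0.
      (* The tube lemma: all times in [0, 1] are handled at once near [v]. *)
      have := @segment_compact R 0 1; rewrite compact_near_coveringP.
      move/(_ _ (nbhs v) (fun u (r : R) => u != 0 -> disc u -> 0 <= r <= 1 ->
        W° (phi (radial (u, r : R^o)))) _) => hnear.
      suff loc : forall t : R, `[0, 1]%classic t -> \forall t' \near t & u \near nbhs v,
          u != 0 -> disc u -> 0 <= t' <= 1 -> W° (phi (radial (u, t' : R^o))).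
        apply: filterS (hnear loc) => u Wu [du qu]; apply => t t01.
        apply: (Wu t) => //.
        by rewrite -sqn_eq0 gt_eqF // (lt_le_trans _ qu) // invr_gt0.
      move=> t; rewrite /= in_itv /= => t01.
      have dr : disc (radial (v, t : R^o)) by exact: radial_disc.
      have Wn : nbhs (phi (radial (v, t : R^o))) W° by apply: open_nbhs_nbhs; split; [exact: open_interior|exact: gv].
      have [[A B] /= [Av Bt] AB] := @radial_continuous d (v, t) v0 _ (phin _ _ dr Wn).
      exists (B, A) => //= -[t' u] /= [Bt' Au] u0 du t01'.
      by apply: (AB (u, t')) => //=; exact: radial_disc.
    (* With the inner disc of radius 1/2 added, every point of the cell outside [B0] is good. *)
    pose B0 := phi @` (Bad `|` [set v | disc v /\ sqn v <= 4^-1]).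
    have B0c : closed B0.
      apply: phiK; last by move=> v [[]|[]].
      apply: closedU => //; apply: closedI; first exact: disc_closed.
      by apply: (@preimage_closed _ _ (@sqn d : 'rV[R]_d -> R^o) [set x | x <= 4^-1]);
        [move=> w _; exact: sqn_continuous|exact: closed_le].
    have xB0 : ~ B0 x.
      have sph v : disc v -> phi v = x -> sphere v.
        move=> /disc_cases[ov|//] vx; have : (e `&` Y) x by split => //; exists v.
        by rewrite eY.
      move=> [v [[dv qv ng]|[dv qv]] vx]; have sv := sph v dv vx.
        by apply: ng => t t01; rewrite radial_id // vx; exact: nbhs_singleton.
      have : sqn v = 1 by exact: sv.
      by move=> q1; move: qv; rewrite q1 leNgt invf_lt1 ?ltr1n.
    exists (W° `&` ~` B0, setT) => /=.
      split; last exact: filterT; apply: filterI => //.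
      by apply: open_nbhs_nbhs; split => //; rewrite openC.
    move=> [x' r'] /= [[Wx' nB] _] [[/PYe[Yx'|ex'] x0'] /=]; rewrite in_itv /= => r01'.
      by rewrite GY //; exact: interior_subset.
    have [og gx'] := Kg _ ex'; rewrite Ge //; apply: interior_subset.
    have : good (g x').
      apply: contrapT => ng; apply: nB; exists (g x') => //.
      have [q4|q4] := leP 4^-1 (sqn (g x')); first by left; split => //; exact: open_disc_sub.
      by right; split; [exact: open_disc_sub|exact: ltW].
    exact.
  rewrite Ge // => Wx.
  have dx := rad x r ex x0 r01.
  have [[A B] /= [Ax Br] AB] := @radial_continuous d (g x, r) (g0 _ ex x0) _ (phin _ _ dx Wx).
  have /withinP/(_ x ex A Ax) gx := gc.
  exists ([set x' | ~ Y x' /\ (e x' -> A (g x'))], B) => /=.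
    split => //; apply: filterI; last exact: gx.
    apply: open_nbhs_nbhs; split; first by rewrite openC.
    by move=> Yx; have : (e `&` Y) x by []; rewrite eY.
  move=> [x' r'] /= [[nY ge] Br'] [[/PYe[//|ex'] x0'] /=]; rewrite in_itv /= => r01'.
  by rewrite Ge //; apply: (AB (g x', r')) => //=; [split => //; exact: ge|exact: rad].
- split => // x; case: (pselect (e x)) => ex; last by rewrite /G /= asboolF.
  by rewrite (Ge x 0) // radial0; have [] := Kg _ ex.
- move=> x r r01 [/PYe[Yx|ex] x0] Px; first by rewrite GY.
  by rewrite Ge //; apply: eP; exists (radial (g x, r)) => //; exact: rad.
- move=> x [/PYe[Yx|ex] x0]; first by rewrite GY.
  rewrite Ge //; apply: sY; exists (radial (g x, 1)) => //.
  by apply: radial_sphere; exact: g0.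
Qed.

(** After subdivision the chain is a sum of a part that avoids the centre and a part that avoids
    [Y], hence lies in [P]. The flow of [cell_push] moves the first part into [Y]. The terms that
    the homotopies contribute on the boundary are small because the boundary is. *)
Lemma cell_excision : excisive (R := R) (k := k) P Y.
Proof.
move=> m c cin hc.
have [G [Gc [GY G0] GP G1]] := cell_push.
have oU : open (~` [set phi 0]).
  rewrite openC; have -> : [set phi 0] = phi @` [set 0] by rewrite image_set1.
  apply: phiK; last by move=> _ ->; apply: open_disc_sub; exact: open_disc0.
  exact/accessible_closed_set1/hausdorff_accessible/norm_hausdorff.
have oV : open (~` Y) by rewrite openC.
have nY0 : ~ Y (phi 0).
  move=> Y0; have : (e `&` Y) (phi 0) by split => //; exists 0 => //; exact: open_disc0.
  by rewrite eY.
have cov : P `|` Y `<=` ~` [set phi 0] `|` ~` Y.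
  move=> x _; have [->|x0] := pselect (x = phi 0); first by right.
  by left.
have [j [u [v [hu hv e1]]]] := csd_split oU oV cov cin.
pose K l (s : simplex l -> X) (p : 'rV[R]_l.+1 * R^o) := G (ext s p.1, p.2).
have nK : natural_family K.
  by move=> l l' f s [w r] [/= dw _]; rewrite /K /= ext_op.
have Kc l (s : simplex l -> X) : continuous s ->
    (forall t, ((P `|` Y) `&` ~` [set phi 0]) (s t)) -> {within @cyl R l, continuous (K l s)}.
  move=> cs sA; apply: (within_comp (f := fun p : 'rV[R]_l.+1 * R^o => (ext s p.1, p.2)) _ _ Gc).
    apply: within_pair; last by apply: within_cont => ?; exact: cvg_snd.
    apply: (within_comp (D := simplex l) (f := fst)); last exact: ext_continuous.
      by apply: within_cont => ?; exact: cvg_fst.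
    by move=> p [].
  by move=> [w r] [/= dw r01]; split => /=; [exact: sA|rewrite in_itv].
have GZ x r : 0 <= r <= 1 -> ((P `|` Y) `&` ~` [set phi 0]) x -> (P `|` Y) (G (x, r)).
  by move=> r01 [[Px|Yx] x0]; [left; apply: GP => //; split => //; left|right; rewrite GY].
have hopP l A B w : (forall x, A x -> ((P `|` Y) `&` ~` [set phi 0]) x) ->
    (forall x r, A x -> 0 <= r <= 1 -> B (G (x, r))) ->
    chains_in R k l A w -> chains_in R k l.+1 B (hop K w).
  move=> AZ AB; apply: hop_in => s cs sA; split; first by apply: Kc => // t; exact: AZ.
  by move=> [p r] [/= dp r01]; apply: AB => //; exact: sA.
have hopu : chains_in R k m.+1 (P `|` Y) (hop K u).
  by apply: hopP hu => // x r Ax r01; apply: GZ.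
have push0 w : push_at K 0 w = w.
  rewrite (push_at_push (g := id)) ?chain_push_id //.
  by move=> l s p dp; rewrite /K /= G0.
have push1 : chains_in R k m Y (push_at K 1 u).
  apply: (lin_ext_in (P := fun s : @sing R X => [/\ tag s = m, continuous (tagged s) &
    range (tagged s) `<=` (P `|` Y) `&` ~` [set phi 0]])) hu => -[l s] /= [<- cs sA].
  have sA' t : ((P `|` Y) `&` ~` [set phi 0]) (s t) by apply: sA; exists t.
  have dt (t : simplex l) : simplex l (set_val t) by case: t => t ht /=; exact: set_mem.
  apply: gen_in => [|t]; last by rewrite /K /=; apply: G1; exact: sA'.
  apply: (continuous_comp_within (C := @cyl R l) (f := fun t : simplex l =>
    (set_val t : 'rV[R]_l.+1, 1 : R^o))); last exact: Kc.
    by apply: cont_pair => t; [exact: initial_continuous|exact: cont_cst].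
  by move=> t; split => //=; rewrite ler01 lexx.
have low w : C2 m.-1 P Y w -> m = 0%N -> w = chain_bd c -> w = 0.
  by move=> _ m0 ->; apply: (chains_in_bd0 (A := P `|` Y)); rewrite -m0.
have hdc : C2 m P Y (csdh j (chain_bd c)).
  case: m {hu hv hopu push1 low} cin hc => [cin _|m cin hc].
    by rewrite (chains_in_bd0 cin) linear0; exact: sm0.
  have [u' [v' [Pu Yv ->]]] := hc; rewrite linearD; apply: smD.
    by apply: C2l; apply: csdh_in.
  by apply: C2r; apply: csdh_in.
have hdu : C2 m P Y (hop K (chain_bd u)).
  case: m {low hdc hopu push1} cin hc hu hv e1 => [cin _ hu _ _|m cin hc hu hv e1].
    by rewrite (chains_in_bd0 hu) linear0; exact: sm0.
  have h1 : C2 m P Y (chain_bd u).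
    have -> : chain_bd u = csd j (chain_bd c) - chain_bd v.
      by rewrite -bd_csd e1 linearD /= addrK.
    apply: smB.
      have [u' [v' [Pu Yv ->]]] := hc; rewrite linearD; apply: smD.
        by apply: C2l; apply: csd_in.
      by apply: C2r; apply: csd_in.
    apply: C2l; apply: (chains_inS (A := (P `|` Y) `&` ~` Y)); last exact: chains_in_bd.
    by move=> x [[//|Yx] //].
  have [u' [v' [Pu Yv ->]]] := C2_setI h1 (chains_in_bd hu); rewrite linearD; apply: smD.
    by apply: C2l; apply: hopP Pu => [x []//|x r [Px Ux] r01]; exact: GP.
  by apply: C2r; apply: hopP Yv => [x []//|x r [Yx Ux] r01]; rewrite GY.
exists (csdh j c - hop K u).
  by apply: smB => //; apply: csdh_in.
have -> : c - chain_bd (csdh j c - hop K u) =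
    push_at K 1 u - hop K (chain_bd u) + v + csdh j (chain_bd c).
  rewrite linearB /= bd_csdh bd_hop // push0 e1.
  module k (@Defs.chain R k X).
apply: smD => //; apply: smD; first by apply: smB => //; exact: C2r.
by apply: C2l; apply: chains_inS hv => x [[//|Yx] //].
Qed.

End Cell.

End CellExcision.

Lemma within_closed (T U : topologicalType) (D : set T) (C : set U) (f : T -> U) :
  closed D -> {within D, continuous f} -> closed C -> closed (f @^-1` C `&` D).
Proof.
move=> cD /continuous_closedP fc /fc cC.
by rewrite (closed_setIS _ cD).
Qed.

(** * CW complexes *)

Section CWExcision.
Context {R : realType} {k : comUnitRingType} {X : topologicalType}.

(** Hausdorffness is available in the subspace [F]: compact sets are closed there, and then in the
    space because [F] is closed. *)
Lemma compact_closed_in (F K : set X) : hausdorff_space (subspace F) -> closed F ->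
  compact K -> K `<=` F -> closed K.
Proof.
move=> hF cF cK KF; have KFE : K `&` F = K by apply/seteqP; split => [x []|x Kx] //; split => //; exact: KF.
have : compact (K `&` F : set (subspace F)) by apply/compact_subspaceIP; rewrite KFE.
rewrite KFE => /(compact_closed hF) /closed_subspaceP[V cV VK].
by rewrite -KFE -VK; exact: closedI.
Qed.

Lemma disc_compact d : compact (@disc R d).
Proof.
apply: bounded_closed_compact; last exact: disc_closed.
exists 1; split; first exact: num_real.
move=> M M1 v dv; apply: (le_trans _ (ltW M1)).
rewrite /Num.norm /= mx_normrE; apply/bigmax_leP; split => // -[i j] _ /=.
rewrite (ord1 i) -(@ler_pXn2r _ 2) ?nnegrE // expr1n.
rewrite real_normK ?num_real //; apply: le_trans dv.
by rewrite (bigD1 j) //= lerDl; apply: sumr_ge0 => l _; exact: sqr_ge0.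
Qed.

Section CW.
Variables (F dF : set X) (E : Type) (cdim : E -> nat) (phi : forall e, 'rV[R]_(cdim e) -> X).
Arguments phi : clear implicits.
Hypothesis Fcw : CW_structure F phi.
Hypothesis Fc : closed F.
Hypothesis Fk : compact F.
Local Notation cell e := (phi e @` @open_disc R (cdim e)).

Lemma phi_closed e K : closed K -> K `<=` @disc R (cdim e) -> closed (phi e @` K).
Proof.
move=> cK KD; apply: (compact_closed_in (CW_hausdorff Fcw) Fc); last first.
  by move=> _ [v /KD dv <-]; apply: (CW_sub Fcw (e := e)); exists v.
apply: continuous_compact; last by apply: subclosed_compact KD => //; exact: disc_compact.
apply: continuous_subspaceW KD _; exact: (CW_continuous Fcw).
Qed.

Lemma cell_sub e : cell e `<=` F.
Proof. by move=> _ [v ov <-]; apply: (CW_sub Fcw (e := e)); exists v => //; exact: open_disc_sub. Qed.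

Lemma cell_uniq e e' x : cell e x -> cell e' x -> e = e'.
Proof.
move=> ex ex'; have [e0 [_ u]] := CW_partition Fcw (cell_sub ex).
by rewrite -(u _ ex) -(u _ ex').
Qed.

(** All sets of centres of cells are closed: by the attaching condition a closed cell contains only
    finitely many centres, and the topology is weak. In a compact space such a family of points is
    finite. *)
Lemma cells_finite : exists l : seq {classic E}, forall e, e \in l.
Proof.
pose c (e : E) := phi e 0.
have cc e : cell e (c e) by exists 0 => //; exact: open_disc0.
have closedC (C : set X) : (forall x, C x -> exists e, x = c e) -> closed (C : set (subspace F)).
  move=> Ce; apply: (CW_weak Fcw); first by move=> x /Ce[e ->]; apply: cell_sub (cc e).
  move=> e; have [D [Df Dlt Dsub]] := CW_attach Fcw e.
  pose C' := C `&` c @` (D `|` [set e]).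
  have C'c : closed C'.
    apply: (compact_closed_in (CW_hausdorff Fcw) Fc); last first.
      by move=> _ [_ [e' _ <-]]; apply: cell_sub (cc e').
    apply: finite_compact; apply: (sub_finite_set (B := c @` (D `|` [set e]))); first by move=> x [].
    apply: finite_image; by rewrite finite_setU; split => //; exact: finite_set1.
  have -> : phi e @^-1` C `&` @disc R (cdim e) = phi e @^-1` C' `&` @disc R (cdim e).
    apply/seteqP; split => v [Cv dv]; last by split => //; case: Cv.
    split => //; split => //; have [e' pv] := Ce _ Cv; exists e' => //.
    have [ov|sv] := disc_cases dv.
      by right; apply: (@cell_uniq e' e (phi e v)); [rewrite pv; exact: cc|exists v].
    have [e'' De'' ce''] : (\bigcup_(e' in D) cell e') (phi e v) by apply: Dsub; exists v.
    by left; rewrite (@cell_uniq e' e'' (phi e v)) // pv; exact: cc.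
  by apply: within_closed => //; [exact: disc_closed|exact: (CW_continuous Fcw)].
have FS : compact (F : set (subspace F)).
  have : compact (F `&` F : set (subspace F)) by apply/compact_subspaceIP; rewrite setIid.
  by rewrite setIid.
(* The filter of the lists that contain a given finite list; the near-covering form of compactness
   then yields one list for all points. *)
pose Fl : set_system (seq {classic E}) :=
  [set P : set (seq {classic E}) | exists l0 : seq {classic E},
    forall l : seq {classic E}, {subset l0 <= l} -> P l].
have FlF : Filter Fl.
  split; first by exists [::].
    move=> P Q [l1 h1] [l2 h2]; exists (l1 ++ l2) => l hl; split; [apply: h1|apply: h2] => e el;
      by apply: hl; rewrite mem_cat el ?orbT.
  by move=> P Q PQ [l0 h]; exists l0 => l /h /PQ.
have := FS; rewrite compact_near_coveringP.
move/(_ _ Fl (fun (l : seq {classic E}) x => forall e : {classic E}, c e = x -> e \in l) FlF) => hcov.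
have [|l0 hl0] := hcov; last by exists l0 => e; exact: (hl0 l0 (fun=> id) (c e) (cell_sub (cc e)) e).
move=> x Fx.
have [[e xe]|nx] := pselect (exists e, x = c e).
  exists (~` [set c e' | e' in [set e' | e' <> e]], [set l : seq {classic E} | (e : {classic E}) \in l]) => /=.
    split; last by exists [:: e : {classic E}] => l /(_ e); rewrite mem_head; exact.
    apply: open_nbhs_nbhs; split.
      by rewrite openC; apply: closedC => _ [e' _ <-]; exists e'.
    move=> [e' /= ne ce']; apply: ne.
    by apply: (@cell_uniq e' e x); rewrite ?xe // -?xe -ce'; exact: cc.
  move=> [x' l] /= [nx' el] e' ce'; have [->//|ne] := pselect (e' = e).
  by exfalso; apply: nx'; exists e'.
exists (~` [set c e' | e' in setT], setT) => /=.
  split; last by exists [::].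
  apply: open_nbhs_nbhs; split.
    by rewrite openC; apply: closedC => _ [e' _ <-]; exists e'.
  by move=> [e' _ ce']; apply: nx; exists e'.
by move=> [x' l] /= [nx' _] e' ce'; exfalso; apply: nx'; exists e'.
Qed.

Hypothesis dFF : dF `<=` F.
Hypothesis dFc : closed dF.
Hypothesis dFcell : forall e, cell e `<=` dF \/ cell e `&` dF = set0.
Variable A : set X.
Hypothesis Ac : closed A.
Hypothesis dFA : dF `<=` A.
Hypothesis FA : F `&` A `<=` dF.

Let B (l : seq {classic E}) : set X := dF `|` [set x | exists2 e, e \in l & cell e x].
(** The cells of [l] are attached to [dF] and to cells of [l] of smaller dimension, so that [B l] is
    a subcomplex containing [dF]. *)
Let good (l : seq {classic E}) := forall e : {classic E}, e \in l -> ~ (cell e `<=` dF) /\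
  phi e @` @sphere R (cdim e) `<=` dF `|`
    [set x | exists e' : {classic E}, [/\ e' \in l, (cdim e' < cdim e)%N & cell e' x]].

Lemma B_closed l : good l -> closed (B l).
Proof.
move=> gl; have -> : B l = dF `|` \big[setU/set0]_(e <- l) (phi e @` @disc R (cdim e)).
  apply/seteqP; split => x [|]; try by left.
    move=> [e el [v ov <-]]; right; rewrite -bigcup_seq; exists e => //.
    by exists v => //; exact: open_disc_sub.
  rewrite -bigcup_seq => -[e /= el [v /disc_cases[ov|sv] <-]].
    by right; exists e => //; exists v.
  have [_ /(_ (phi e v))] := gl _ el; case; first by exists v.
    by left.
  by move=> [e' [e'l _ ce']]; right; exists e'.
apply: closedU => //; apply: closed_bigsetU => e _.
by apply: phi_closed => //; exact: disc_closed.
Qed.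

(** Induction on the number of cells outside [dF]. A cell of maximal dimension can be removed
    without destroying the attaching condition, and [excisive_trans] adds it back by excision for
    this one cell. *)
Lemma cells_excisive n l : (size l <= n)%N -> good l -> excisive (R := R) (k := k) (B l) A.
Proof.
elim: n l => [|n IH] l.
  case: l => // _ _; apply: excisive_sub => x [/dFA//|[]//].
move=> ln gl; have [->|l0] := eqVneq l [::].
  by apply: excisive_sub => x [/dFA//|[]//].
have [e0 e0l emax] : exists2 e0 : {classic E}, e0 \in l & forall e, e \in l -> (cdim e <= cdim e0)%N.
  elim: l l0 {ln gl} => // e l IHl _; have [->|l0] := eqVneq l [::].
    by exists e; rewrite ?mem_head // => e'; rewrite inE => /eqP->.
  have [e0 e0l emax] := IHl l0; have [le|le] := leqP (cdim e) (cdim e0).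
    by exists e0; rewrite ?inE ?e0l ?orbT // => e'; rewrite inE => /orP[/eqP->|/emax].
  exists e; rewrite ?mem_head // => e'; rewrite inE => /orP[/eqP->//|/emax h].
  exact: leq_trans h (ltnW le).
pose l' := [seq e <- l | e != e0].
have l'l e : (e \in l') = (e != e0) && (e \in l) by rewrite mem_filter.
have gl' : good l'.
  move=> e; rewrite l'l => /andP[ee0 el]; have [h1 h2] := gl e el; split => //.
  move=> x /h2[|[e' [e'l ce h]]]; [by left|right; exists e'; split => //].
  rewrite l'l e'l andbT; apply/eqP => e'e0; move: ce.
  by rewrite e'e0 ltnNge emax.
have sl' : (size l' <= n)%N.
  rewrite -ltnS (leq_trans _ ln) // /l' size_filter -(count_predC (pred1 e0) l).
  rewrite -{1}[count _ _]add0n ltn_add2r -has_count.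
  by apply/hasP; exists e0 => /=.
have [ne0 se0] := gl _ e0l.
have ce0F x : cell e0 x -> dF x -> False.
  by case: (dFcell e0) => [//|h] h1 h2; have : (cell e0 `&` dF) x by []; rewrite h.
have ce0 x : cell e0 x -> B l' x -> False.
  move=> h1 [|[e]]; first exact: ce0F.
  rewrite l'l => /andP[/eqP ee0 _] h2; apply: ee0; exact: cell_uniq h2 h1.
have BE x : B l x -> B l' x \/ cell e0 x.
  move=> [|[e el ce]]; first by left; left.
  have [<-|ee0] := eqVneq e e0; first by right.
  by left; right; exists e => //; rewrite l'l ee0.
have B'B : B l' `<=` B l.
  by move=> x [|[e]]; [left|rewrite l'l => /andP[_ el] h; right; exists e].
have BF : B l `<=` F by move=> x [/dFF//|[e _ /cell_sub]].
apply: (@excisive_trans _ _ _ (B l) (B l')) => //.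
- by move=> x [Bx Ax]; left; apply: FA; split => //; exact: BF.
- exact: IH.
apply: (@cell_excision R k X (cdim e0) (phi e0)).
- exact: (CW_continuous Fcw).
- exact: (CW_cell Fcw).
- exact: phi_closed.
- by apply: closedU => //; exact: B_closed.
- apply/seteqP; split => // x [h [|Ax]]; first exact: ce0.
  by apply: (ce0F x) => //; apply: FA; split => //; exact: cell_sub h.
- move=> _ [v /disc_cases[ov|sv] <-]; first by right; exists e0 => //; exists v.
  have [|h|[e' [e'l _ h]]] := se0 (phi e0 v); [by exists v|by left|by right; exists e'].
- by move=> x [/BE[h|h]|[h|h]]; [left; left|right|left; left|left; right].
- move=> _ [v sv <-]; have [|h|[e' [e'l ce' h]]] := se0 (phi e0 v).
  + by exists v.
  + by left; left.
  + left; right; exists e' => //; rewrite l'l e'l andbT; apply/eqP => e'e0.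
    by move: ce'; rewrite e'e0 ltnn.
Qed.

Lemma cw_excisive : excisive (R := R) (k := k) F A.
Proof.
have [lE lEP] := cells_finite.
pose l : seq {classic E} := [seq e <- lE | ~~ `[< cell e `<=` dF >]].
have lP (e : {classic E}) : (e \in l) = ~~ `[< cell e `<=` dF >] by rewrite mem_filter lEP andbT.
have BF : B l = F.
  apply/seteqP; split => x; first by move=> [/dFF//|[e _ /cell_sub]].
  move=> Fx; have [e [ex _]] := CW_partition Fcw Fx.
  have [h|h] := pselect (cell e `<=` dF); first by left; exact: h.
  by right; exists e => //; rewrite lP; apply/asboolPn.
rewrite -BF; apply: (@cells_excisive (size l)) => // e; rewrite lP => /asboolPn h; split => //.
have [D [_ Dlt Dsub]] := CW_attach Fcw e.
move=> x /Dsub[e' De' ce']; have [h'|h'] := pselect (cell e' `<=` dF); first by left; exact: h'.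
by right; exists e'; split => //; [rewrite lP; exact/asboolPn|exact: Dlt].
Qed.

End CW.

End CWExcision.

(** * Subquotients *)

Section SubquotTheory.
Context {k : comUnitRingType}.
Implicit Types M N : lmodType k.

Lemma cls_reprK M (Z B : submod M) (q : subquot Z B) : cls Z B (cls_repr q) = q.
Proof. by rewrite /cls /cls_repr valKd quot_reprK. Qed.

Lemma cls_repr_in M (Z B : submod M) (q : subquot Z B) : Z (cls_repr q).
Proof. by rewrite /cls_repr; have /asboolP := valP (quot_repr q). Qed.

Lemma val_insubd_in M (Z : submod M) x : Z x -> val (insubd (0 : submod_type Z) x) = x.
Proof. by move=> Zx; rewrite insubdK //; exact/asboolP. Qed.

Lemma cls_eqP M (Z B : submod M) x y : Z x -> Z y ->
  cls Z B x = cls Z B y <-> B (x - y).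
Proof.
move=> Zx Zy; rewrite /cls quot_eqP sm_preimE linearB /=.
by rewrite !val_insubd_in.
Qed.

Lemma cls_linear M (Z B : submod M) a x y : Z x -> Z y ->
  cls Z B (a *: x + y) = a *: cls Z B x + cls Z B y.
Proof.
move=> Zx Zy; rewrite /cls -[a *: quot_pi _ _]quot_piZ -quot_piD; congr quot_pi.
apply: val_inj; rewrite linearP /= !val_insubd_in //.
exact: submod_setP.
Qed.

Lemma cls0 M (Z B : submod M) : cls Z B 0 = 0.
Proof.
have := cls_linear B 1 (sm0 Z) (sm0 Z); rewrite scaler0 addr0 scale1r.
by move/eqP; rewrite eq_sym -subr_eq0 addrK => /eqP.
Qed.

Lemma clsD M (Z B : submod M) x y : Z x -> Z y -> cls Z B (x + y) = cls Z B x + cls Z B y.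
Proof. by move=> Zx Zy; rewrite -[x]scale1r cls_linear // !scale1r. Qed.

Lemma clsZ M (Z B : submod M) a x : Z x -> cls Z B (a *: x) = a *: cls Z B x.
Proof. by move=> Zx; rewrite -[a *: x]addr0 cls_linear ?cls0 ?addr0 //; exact: sm0. Qed.

Lemma cls_sum M (Z B : submod M) (I : Type) (r : seq I) (P : pred I) (f : I -> M) :
  (forall i, P i -> Z (f i)) ->
  cls Z B (\sum_(i <- r | P i) f i) = \sum_(i <- r | P i) cls Z B (f i).
Proof.
move=> Zf; elim: r => [|i r IH]; first by rewrite !big_nil cls0.
rewrite !big_cons; case: ifP => // Pi; rewrite clsD ?IH //; first exact: Zf.
exact: sm_sum.
Qed.

Lemma cls_eq0P M (Z B : submod M) x : Z x -> cls Z B x = 0 <-> B x.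
Proof.
move=> Zx; rewrite -(cls0 Z B); rewrite cls_eqP ?subr0 //; exact: sm0.
Qed.

Lemma subquot_map_cls M N (Z B : submod M) (Z' B' : submod N) (f : {linear M -> N}) x :
  (forall y, Z y -> Z' (f y)) -> (forall y, B y -> B' (f y)) -> Z x ->
  subquot_map Z' B' f (cls Z B x) = cls Z' B' (f x).
Proof.
move=> ZZ BB Zx; apply/cls_eqP; [exact/ZZ/cls_repr_in|exact: ZZ|].
rewrite -linearB; apply: BB; apply/(cls_eqP _ (cls_repr_in _) Zx).
exact: cls_reprK.
Qed.

Lemma subquot_map_linear M N (Z B : submod M) (Z' B' : submod N) (f : {linear M -> N}) :
  (forall y, Z y -> Z' (f y)) -> (forall y, B y -> B' (f y)) ->
  linear (@subquot_map k M N Z B Z' B' f).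
Proof.
move=> ZZ BB a p q; rewrite -(cls_reprK p) -(cls_reprK q) -cls_linear; try exact: cls_repr_in.
rewrite !subquot_map_cls //; try exact: cls_repr_in; last first.
  by apply: submod_setP; exact: cls_repr_in.
by rewrite linearP cls_linear //; apply/ZZ/cls_repr_in.
Qed.

Definition pack_linear M N (f : M -> N) (hf : linear f) : {linear M -> N} :=
  HB.pack f (GRing.isLinear.Build k M N *:%R f hf).

(* Two maps out of a common complex that identify the same classes induce an isomorphism. *)
Lemma subquot_zigzag T M N (Z B : submod M) (Z' B' : submod N) (ZT : submod T)
    (e : {linear T -> M}) (h : {linear T -> N}) :
  (forall t, ZT t -> Z (e t)) -> (forall t, ZT t -> Z' (h t)) ->
  (forall x, Z x -> exists2 t, ZT t & e t = x) ->
  (forall x, Z' x -> exists2 t, ZT t & h t = x) ->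
  (forall t, ZT t -> B (e t) <-> B' (h t)) ->
  exists f : {linear subquot Z B -> subquot Z' B'}, bijective f.
Proof.
move=> Ze Zh se sh eh.
pose lft (x : subquot Z B) := xget 0 [set t | ZT t /\ e t = cls_repr x].
have lftP x : ZT (lft x) /\ e (lft x) = cls_repr x.
  have [t Zt et] := se _ (cls_repr_in x).
  by have := @xgetI _ 0 [set t | ZT t /\ e t = cls_repr x] t; apply.
pose rgt (x : subquot Z' B') := xget 0 [set t | ZT t /\ h t = cls_repr x].
have rgtP x : ZT (rgt x) /\ h (rgt x) = cls_repr x.
  have [t Zt et] := sh _ (cls_repr_in x).
  by have := @xgetI _ 0 [set t | ZT t /\ h t = cls_repr x] t; apply.
pose f x := cls Z' B' (h (lft x)).
have fP t : ZT t -> f (cls Z B (e t)) = cls Z' B' (h t).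
  move=> Zt; rewrite /f; have [Zl el] := lftP (cls Z B (e t)).
  apply/cls_eqP; [exact: Zh|exact: Zh|]; rewrite -linearB; apply/eh; first exact: smB.
  rewrite linearB /= el; apply/cls_eqP; [exact: cls_repr_in|exact: Ze|exact: cls_reprK].
have fl : linear f.
  move=> a p q; have [Zp ep] := lftP p; have [Zq eq] := lftP q.
  have -> : a *: p + q = cls Z B (e (a *: lft p + lft q)).
    rewrite linearP ep eq cls_linear ?cls_reprK //; exact: cls_repr_in.
  rewrite fP; last exact: submod_setP.
  by rewrite linearP cls_linear //; exact: Zh.
exists (pack_linear fl); exists (fun y => cls Z B (e (rgt y))) => x.
  have [Zl el] := lftP x; have [Zr hr] := rgtP (f x).
  rewrite -[RHS]cls_reprK -el /=; apply/cls_eqP; [exact: Ze|exact: Ze|].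
  rewrite -linearB; apply/eh; first exact: smB.
  rewrite linearB /= hr; apply/cls_eqP; [exact: cls_repr_in|exact: Zh|exact: cls_reprK].
have [Zr hr] := rgtP x; rewrite /= fP // hr; exact: cls_reprK.
Qed.

End SubquotTheory.

(** * Simplicial posets *)

Section SimplicialPoset.
Context {disp : Order.disp_t} {S : finBPOrderType disp} (rk : S -> nat).
Hypothesis hS : simplicial_poset rk.

Lemma card_below I : #|finset (fun K : S => (K <= I)%O)| = (2 ^ rk I)%N.
Proof.
have [f [fle fI]] := hS I.
have finj : injective f.
  move=> A B e; apply/eqP; rewrite finset.eqEsubset -!fle e lexx //.
have -> : finset (fun K : S => (K <= I)%O) = (f @: [set: {set 'I_(rk I)}])%SET.
  apply/setP => K; rewrite inE; apply/idP/imsetP => [/fI[A <-]|[A _ ->]]; first by exists A.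
  by apply/fI; exists A.
by rewrite card_imset // -powersetT card_powerset cardsT card_ord.
Qed.

(** [simplicial_poset] provides a separate chart for each element. Counting the elements below [f A]
    recovers its rank, so that the one chart below [J] describes the ranks as well. *)
Lemma below_coord J : exists f : {set 'I_(rk J)} -> S,
  [/\ forall A B, (f A <= f B)%O = (A \subset B), forall A, (f A <= J)%O,
      forall K, (K <= J)%O -> exists A, f A = K & forall A, rk (f A) = #|A|].
Proof.
have [f [fle fI]] := hS J; exists f; split => // [A|K|A]; [by apply/fI; exists A|by move/fI|].
have finj : injective f by move=> B C e; apply/eqP; rewrite finset.eqEsubset -!fle e lexx.
have := card_below (f A); have -> : finset (fun K : S => (K <= f A)%O) = (f @: powerset A)%SET.
  apply/setP => K; rewrite inE; apply/idP/imsetP => [KA|[B]]; last by rewrite inE => BA ->; rewrite fle.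
  have /fI[B fB] : (K <= J)%O by apply: (le_trans KA); apply/fI; exists A.
  by exists B => //; rewrite inE -fle fB.
by rewrite card_imset // card_powerset => /eqP; rewrite eqn_exp2l // => /eqP.
Qed.

Lemma rk_lt I J : (I < J)%O -> (rk I < rk J)%N.
Proof.
move=> IJ; have [f [fle fJ fs frk]] := below_coord J.
have [A fA] := fs _ (ltW IJ); rewrite -fA frk -[X in (_ < X)%N]card_ord -cardsT.
apply: proper_card; rewrite finset.properEneq finset.subsetT andbT; apply/eqP => AT.
have [B fB] := fs _ (lexx J); move: IJ; rewrite -fA AT lt_neqAle => /andP[/eqP ne _].
by apply: ne; apply/eqP; rewrite eq_le fJ -{1}fB fle finset.subsetT.
Qed.

Lemma rk_bot : rk \bot%O = 0%N.
Proof.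
have [f [fle fJ fs frk]] := below_coord \bot%O.
have [A fA] := fs _ (lexx _); have f0 : (f finset.set0 <= \bot)%O by exact: fJ.
move: (frk finset.set0); rewrite cards0; have -> : f finset.set0 = \bot%O by apply/eqP; rewrite -lex0.
by [].
Qed.

Lemma rk_eq0 I : (rk I == 0%N) = (I == \bot%O).
Proof.
apply/eqP/eqP => [r0|->]; last exact: rk_bot.
apply/eqP; case: (eqVneq I \bot%O) => // n0; have : (\bot < I)%O by rewrite lt0x.
by move/rk_lt; rewrite r0.
Qed.

Lemma covers_lt I J : covers rk I J -> (I < J)%O. Proof. by case/andP. Qed.
Lemma covers_le I J : covers rk I J -> (I <= J)%O. Proof. by move/covers_lt/ltW. Qed.
Lemma covers_rk I J : covers rk I J -> rk J = (rk I).+1. Proof. by case/andP => _ /eqP. Qed.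
Lemma coversE I J : (I <= J)%O -> rk J = (rk I).+1 -> covers rk I J.
Proof.
move=> IJ rJ; rewrite /covers rJ eqxx andbT lt_neqAle IJ andbT.
by apply/eqP => e; move: rJ; rewrite e => /eqP; rewrite eqn_leq ltnn andbF.
Qed.

End SimplicialPoset.

(** * Faces of a simple pseudo-cell complex *)

Section Faces.
Context {R : realType} {k : comUnitRingType} {Q : topologicalType}
  {disp : Order.disp_t} {S : finBPOrderType disp}.
Variables (F dF : S -> set Q) (fdim rk : S -> nat) (n : nat).
Hypothesis hQ : simple_complex R F dF fdim rk n.
Let P := simple_pcc hQ.

Lemma dface_sub I : dF I `<=` F I.
Proof. by rewrite -(pcc_attach P I) => x []. Qed.

Lemma fdimE I : (fdim I + rk I = n)%N.
Proof. by have := simple_fdim hQ I; lia. Qed.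

Lemma fdim_lt I J : (I < J)%O -> (fdim J < fdim I)%N.
Proof. by move/(rk_lt (simple_poset hQ)); have := fdimE I; have := fdimE J; lia. Qed.

Lemma fdim_le I J : (I <= J)%O -> (fdim J <= fdim I)%N.
Proof. by rewrite le_eqVlt => /orP[/eqP->//|/fdim_lt /ltnW]. Qed.

Lemma covers_fdim I J : covers rk I J -> fdim I = (fdim J).+1.
Proof. by move/covers_rk; have := fdimE I; have := fdimE J; lia. Qed.

Lemma face_le I J : (I <= J)%O -> F J `<=` F I.
Proof. by move/(pcc_order P). Qed.

Lemma face_lt_sub I J : (I < J)%O -> F J `<=` dF I.
Proof.
move=> IJ; rewrite -(pcc_attach P I) => x Jx; split; first exact: face_le (ltW IJ) _ Jx.
by exists J => //=; exact: fdim_lt.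
Qed.

Lemma dfaceE I x : dF I x <-> exists2 J, (I < J)%O & F J x.
Proof.
split=> [|[J IJ Jx]]; last exact: face_lt_sub IJ _ Jx.
rewrite (pcc_bd P) => -[J /= [lJ sJ] Jx]; exists J => //.
rewrite lt_neqAle; apply/andP; split; first by apply: contraTneq lJ => ->; rewrite ltnn.
by apply/(pcc_order P); exact: subset_trans sJ (@dface_sub I).
Qed.

Lemma open_face I x : F I x -> exists J, [/\ (I <= J)%O, F J x & ~ dF J x].
Proof.
move: {2}(fdim I) (leqnn (fdim I)) => m; elim: m I => [|m IH] I Im Ix.
  exists I; split => // /dfaceE[J IJ _]; have := fdim_lt IJ; lia.
have [dx|ndx] := pselect (dF I x); last by exists I.
have [J IJ Jx] := (dfaceE _ _).1 dx.
have [|K [JK Kx nK]] := IH J _ Jx; first by have := fdim_lt IJ; lia.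
by exists K; split => //; exact: le_trans (ltW IJ) JK.
Qed.

Lemma open_face_uniq I J x : F I x -> ~ dF I x -> F J x -> ~ dF J x -> I = J.
Proof.
wlog ij : I J / (fdim I <= fdim J)%N.
  move=> wl hI dI hJ dJ; have [h|h] := leqP (fdim I) (fdim J); first exact: wl.
  by apply/esym; apply: wl => //; exact: ltnW.
move=> hI dI hJ dJ; apply: contrapT => /eqP IJ.
move: ij; rewrite leq_eqVlt => /orP[/eqP e|l].
  by have : ((F I `\` dF I) `&` (F J `\` dF J)) x by []; rewrite (pcc_disjoint P IJ e).
by apply: dJ; rewrite -(pcc_attach P J); split => //; exists I.
Qed.

(** Every point lies in the interior of exactly one face, and this face is contained in all faces
    through the point. *)
Lemma faceI I J x : F I x -> F J x -> exists L, [/\ (I <= L)%O, (J <= L)%O, F L x & ~ dF L x].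
Proof.
move=> /open_face[K [IK Kx nK]] /open_face[L [JL Lx nL]].
by exists K; split => //; rewrite (open_face_uniq Kx nK Lx nL).
Qed.

Lemma face_compact I : compact (F I).
Proof. by have [] := pcc_cell P I. Qed.

Lemma face_hausdorff I : hausdorff_space (subspace (F I)).
Proof. by have [_ _ [E [cdim [phi [cw _ _ _ _]]]]] := pcc_cell P I; exact: CW_hausdorff cw. Qed.

Definition XA (D : {set S}) : set Q := [set x | exists2 J, J \in D & F J x].

Lemma XA_compact D : compact (XA D).
Proof.
have -> : XA D = \big[setU/set0]_(J <- enum D) F J.
  rewrite -bigcup_seq; apply/seteqP; split => x [J JD Jx]; exists J => //=.
    by rewrite mem_enum.
  by move: JD; rewrite /= mem_enum.
by apply: bigsetU_compact => J _; exact: face_compact.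
Qed.

(** The order is reverse inclusion, so these are the sets of faces of subcomplexes; [XA] is the
    underlying space. *)
Definition upc (D : {set S}) := forall J L, J \in D -> (J <= L)%O -> L \in D.

(** The part inside one face is a finite union of faces, hence compact, hence closed in that
    Hausdorff face; and the topology of the complex is coinduced by the faces. *)
Lemma XA_closed D : upc D -> closed (XA D).
Proof.
move=> uD; apply: (pcc_topology P) => I.
have e : XA D `&` F I = XA (D :&: [set L | (I <= L)%O])%SET.
  apply/seteqP; split => x.
    move=> [[J JD Jx] Ix]; have [L [JL IL Lx _]] := faceI Jx Ix.
    by exists L => //; rewrite !inE IL andbT; exact: uD JD JL.
  move=> [J]; rewrite !inE => /andP[JD IJ] Jx; split; first by exists J.
  exact: face_le IJ _ Jx.
have KF : XA D `&` F I `<=` F I by move=> x [].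
have : compact (XA D `&` F I) by rewrite e; exact: XA_compact.
by move/compact_subspaceIP; apply: compact_closed; exact: face_hausdorff.
Qed.

Lemma upc_ge I : upc [set L | (I <= L)%O].
Proof. by move=> J L; rewrite !inE; exact: le_trans. Qed.
Lemma upc_gt I : upc [set L | (I < L)%O].
Proof. by move=> J L; rewrite !inE; exact: lt_le_trans. Qed.
Lemma XA_ge I : XA [set L | (I <= L)%O] = F I.
Proof.
apply/seteqP; split => x; last by move=> Ix; exists I; rewrite ?inE.
by move=> [J]; rewrite inE => /face_le; apply.
Qed.
Lemma XA_gt I : XA [set L | (I < L)%O] = dF I.
Proof.
apply/seteqP; split => x; first by move=> [J]; rewrite inE => IJ Jx; apply/dfaceE; exists J.
by move/dfaceE => [J IJ Jx]; exists J; rewrite ?inE.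
Qed.
Lemma face_closed I : closed (F I).
Proof. by rewrite -XA_ge; apply: XA_closed; exact: upc_ge. Qed.
Lemma dface_closed I : closed (dF I).
Proof. by rewrite -XA_gt; apply: XA_closed; exact: upc_gt. Qed.

Lemma XA_sub (D D' : {set S}) : D \subset D' -> XA D `<=` XA D'.
Proof. by move/fintype.subsetP => DD x [J JD Jx]; exists J => //; exact: DD. Qed.

(** Then [F J] meets the subcomplex exactly in its boundary, and adding [J] gives a subcomplex
    again. *)
Definition addable J D := [/\ upc D, J \notin D & forall L, (J < L)%O -> L \in D].

Lemma addable_bd J D : addable J D -> dF J `<=` XA D.
Proof. by move=> [_ _ h] x /dfaceE[L JL Lx]; exists L => //; exact: h. Qed.

Lemma addable_cap J D : addable J D -> F J `&` XA D `<=` dF J.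
Proof.
move=> [uD JD h] x [Jx [K KD Kx]]; have [L [JL KL Lx _]] := faceI Jx Kx.
apply/dfaceE; exists L => //; rewrite lt_neqAle JL andbT.
by apply: contraNneq JD => ->; exact: uD KD KL.
Qed.

Lemma face_excisive J D : addable J D -> excisive (R := R) (k := k) (F J) (XA D).
Proof.
move=> aJ; have [uD _ _] := aJ.
have [_ _ [E [cdim [phi [cw [dFF _] dFcell _ _]]]]] := pcc_cell P J.
exact: (@cw_excisive R k Q _ _ _ _ _ cw (@face_closed J) (@face_compact J) dFF
  (@dface_closed J) dFcell _ (XA_closed uD) (addable_bd aJ) (addable_cap aJ)).
Qed.

End Faces.

(** * The cellular complex of a union of faces *)

Section Cellular.
Context {R : realType} {k : comUnitRingType} {Q : topologicalType}
  {disp : Order.disp_t} {S : finBPOrderType disp}.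
Variables (F dF : S -> set Q) (fdim rk : S -> nat) (n : nat).
Hypothesis hQ : buchsbaum_complex R k F dF fdim rk n.
Let hS := buchsbaum_simple hQ.
Local Notation chain := (chain R k Q).
Local Notation C := (@chains_in R k Q).
Local Notation cyc := (@rel_cycles R k Q).
Local Notation bnd := (@rel_boundaries R k Q).
Local Notation H := (structure_val R k F dF fdim).
Local Notation XA := (XA F).
Implicit Types (D : {set S}) (J I K L : S) (c : chain).

Lemma bndS i A B A' B' c : A `<=` A' -> B `<=` B' -> bnd i A B c -> bnd i A' B' c.
Proof.
move=> AA BB [_ [v [[b Cb <-] Bv ->]]]; exists (chain_bd b), v; split => //.
  by exists b => //; exact: chains_inS Cb.
exact: chains_inS Bv.
Qed.

Lemma bnd_bd i A B b : C i.+1 A b -> bnd i A B (chain_bd b).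
Proof. by move=> Ab; exists (chain_bd b), 0; rewrite addr0; split => //; [exists b|exact: sm0]. Qed.

Lemma bnd_sub i A B c : C i B c -> bnd i A B c.
Proof. by move=> Bc; exists 0, c; rewrite add0r; split => //; exact: sm0. Qed.

Lemma face_bnd J i u : J != \bot%O -> i <> fdim J -> cyc i (F J) (dF J) u -> bnd i (F J) (dF J) u.
Proof. by move=> J0 ni cu; apply/(cls_eq0P _ cu); exact: buchsbaum_rel hQ _ _ _ _ _. Qed.

Lemma repr_cls J u : cyc (fdim J) (F J) (dF J) u ->
  bnd (fdim J) (F J) (dF J) (u - cls_repr (cls _ _ u : H J)).
Proof. by move=> cu; apply: (cls_eqP _ cu (cls_repr_in _)).1; rewrite cls_reprK. Qed.

(** Excision: the bounding chain may be replaced by a sum of chains in [F J] and in [XA D]. What the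
    first of them leaves of [u] lies in both sets, thus in the boundary of the face. *)
Lemma face_injective J D u i : addable J D -> cyc i (F J) (dF J) u ->
  bnd i (F J `|` XA D) (XA D) u -> bnd i (F J) (dF J) u.
Proof.
move=> aJ cu [_ [v [[b Cb <-] Dv /= uE]]].
have [|e Ce [b1 [b2 [Fb1 Db2 be]]]] := face_excisive hS (k := k) aJ Cb.
  rewrite (_ : chain_bd b = u - v); last by rewrite uE addrK.
  by apply: smB; [apply: C2l; case: cu|apply: C2r].
have {}be : chain_bd b = chain_bd b1 + chain_bd b2.
  by rewrite -linearD -be linearB /= chain_bdK subr0.
exists (chain_bd b1), (chain_bd b2 + v); split; [by exists b1| |by rewrite uE be addrA].
apply: (chains_inS (addable_cap hS aJ)); apply: chains_in_setI.
  rewrite (_ : _ + v = u - chain_bd b1); last by rewrite uE be; module k (Defs.chain R k Q).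
  by apply: smB; [case: cu|exact: chains_in_bd].
by apply: smD => //; exact: chains_in_bd.
Qed.

Lemma setD1_addable D J : upc D -> J \in D -> (forall L, (L < J)%O -> L \notin D) ->
  addable J (D :\ J)%SET.
Proof.
move=> uD JD Jm; split.
- move=> K L; rewrite !finset.in_setD1 => /andP[KJ KD] KL; rewrite (uD K L KD KL) andbT.
  by apply/eqP => LJ; have := Jm K; rewrite lt_neqAle KJ -LJ KL KD => /(_ isT).
- by rewrite finset.in_setD1 eqxx.
- move=> L JL; rewrite finset.in_setD1 (uD J L JD (ltW JL)) andbT.
  by apply: contraTneq JL => ->; rewrite ltxx.
Qed.

Lemma XA_setD1 D J : J \in D -> XA D = F J `|` XA (D :\ J)%SET.
Proof.
move=> JD; apply/seteqP; split => x.
  move=> [L LD Lx]; have [<-|LJ] := eqVneq L J; first by left.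
  by right; exists L => //; rewrite finset.in_setD1 LJ.
by move=> [Jx|[L]]; [exists J|rewrite finset.in_setD1 => /andP[_ LD] Lx; exists L].
Qed.

(** The faces outside [D] are split off one at a time, largest dimension first. A face of dimension
    [i] contributes a cycle of its own; any other face has no relative homology in degree [i], and
    its part is pushed into its boundary. Excluding the least element keeps to the faces with the
    Buchsbaum property. If no face outside [D] has dimension [i], the sum is empty and the lemma is
    a vanishing statement. *)
Lemma face_decomposition D D' i c : upc D -> upc D' -> D \subset D' -> \bot%O \notin D' ->
  (forall J, J \in D' -> J \notin D -> fdim J = i -> forall L, (J < L)%O -> L \in D) ->
  cyc i (XA D') (XA D) c ->
  exists2 u : S -> chain, forall J, cyc i (F J) (dF J) (u J) &
    bnd i (XA D') (XA D) (c - \sum_(J | [&& J \in D', J \notin D & fdim J == i]) u J).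
Proof.
move=> uD; move: {2}#|D'| (leqnn #|D'|) => m; elim: m D' c => [|m IH] D' c.
  rewrite leqn0 cards_eq0 => /eqP-> _ _ _ _ [Cc _]; exists (fun=> 0); first by move=> J; exact: sm0.
  rewrite big_pred0 ?subr0; last by move=> J; rewrite finset.in_set0.
  apply: bnd_sub; apply: chains_inS Cc => x [J]; by rewrite finset.in_set0.
move=> cD' uD' DD' bD' hD' [Cc Bc].
have [D'D|] := boolP (D' \subset D).
  exists (fun=> 0); first by move=> J; exact: sm0.
  rewrite big1 // subr0; apply: bnd_sub; apply: chains_inS Cc; exact: XA_sub.
move=> /fintype.subsetPn[J0 J0D' J0D].
pose P := [pred J | (J \in D') && (J \notin D)].
have P0 : P J0 by rewrite /= J0D'.
(* By maximality this face is contained in no other face of [D'], so that removing it leaves a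
   subcomplex. *)
have [J /andP[JD' JD] Jmax] := arg_maxnP fdim P0.
have Jm L : (L < J)%O -> L \notin D'.
  move=> LJ; apply/negP => LD'; have LD : L \notin D by apply: contra JD => LD; exact: uD LD (ltW LJ).
  have : (fdim L <= fdim J)%N by apply: Jmax; rewrite /= LD' LD.
  by rewrite leqNgt (fdim_lt hS LJ).
have aJ := setD1_addable uD' JD' Jm; set D1 := (D' :\ J)%SET in aJ *.
have XE := XA_setD1 JD'; rewrite -/D1 in XE.
have D1D' : D1 \subset D' by apply: subD1set.
have DD1 : D \subset D1.
  apply/fintype.subsetP => L LD; rewrite finset.in_setD1 (fintype.subsetP DD' _ LD) andbT.
  by apply: contraNneq JD => <-.
have XD1 := XA_sub (F := F) DD1; have XD1' := XA_sub (F := F) D1D'.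
have FD' : F J `<=` XA D' by rewrite XE => x; left.
have [||b Cb [u [v [Fu Dv uv]]]] := @face_excisive R k _ _ _ _ _ _ _ _ hS _ _ aJ i c.
- by rewrite -XE.
- by apply: C2r; apply: chains_inS Bc.
rewrite -XE in Cb.
have cE : chain_bd c = chain_bd u + chain_bd v by rewrite -linearD -uv linearB /= chain_bdK subr0.
have cu : cyc i (F J) (dF J) u.
  split => //; apply: (chains_inS (addable_cap hS aJ)); apply: chains_in_setI.
    exact: chains_in_bdp.
  rewrite /= (_ : chain_bd u = chain_bd c - chain_bd v); last by rewrite cE addrK.
  by apply: smB; [apply: chains_inS Bc|exact: chains_in_bdp].
have IH1 v' : C i (XA D1) v' -> C i.-1 (XA D) (chain_bd v') ->
    exists2 w : S -> chain, forall J, cyc i (F J) (dF J) (w J) &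
    bnd i (XA D') (XA D) (v' - \sum_(J | [&& J \in D1, J \notin D & fdim J == i]) w J).
  move=> Cv' Bv'; have [||||||w cw hw] := IH D1 v'.
  - by move: cD'; rewrite [#|D'|](cardsD1 J) JD'.
  - by case: aJ.
  - by [].
  - by apply: contra bD' => /(fintype.subsetP D1D').
  - by move=> L /(fintype.subsetP D1D'); exact: hD'.
  - by [].
  by exists w => //; exact: bndS hw.
(* In dimension [i] the boundary of the face lies in [XA D] by hypothesis, so [u] and [v] are
   relative cycles separately. *)
have [Ji|Ji] := eqVneq (fdim J) i.
  have dFD : dF J `<=` XA D.
    by move=> x /(dfaceE hS)[L JL Lx]; exists L => //; exact: hD' JL.
  have Bv : C i.-1 (XA D) (chain_bd v).
    rewrite /= (_ : chain_bd v = chain_bd c - chain_bd u); last by rewrite cE addrAC subrr add0r.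
    by apply: smB => //; case: cu => _ cu; apply: chains_inS cu.
  have [w cw hw] := IH1 v Dv Bv; exists (fun L => if L == J then u else w L).
    by move=> L; case: eqP => [->|].
  rewrite (bigD1 J) /=; last by rewrite JD' JD Ji eqxx.
  rewrite eqxx (eq_big (fun L => [&& L \in D1, L \notin D & fdim L == i]) w).
  - rewrite (_ : c - _ = chain_bd b + (v - \sum_(L | [&& L \in D1, L \notin D & fdim L == i]) w L)).
      by apply: smD => //; exact: bnd_bd.
    by rewrite -(subrK (chain_bd b) c) uv; module k (Defs.chain R k Q).
  - by move=> L; rewrite finset.in_setD1; case: (L \in D') (L == J) => [] [] //=; rewrite ?andbF ?andbT.
  - by move=> L /andP[_ /negPf->].
have J0b : J != \bot%O by apply: contraNneq bD' => <-.
have [|_ [w [[b' Fb' <-] dw /= uE]]] := face_bnd J0b _ cu; first by move=> e; rewrite e eqxx in Ji.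
have [||w' cw' hw'] := IH1 (v + w).
- by apply: smD => //; exact: chains_inS (addable_bd hS aJ) dw.
- rewrite linearD /= (_ : _ + _ = chain_bd c) // cE uE linearD /= chain_bdK add0r addrC.
  by [].
exists w' => //; rewrite (eq_bigl (fun L => [&& L \in D1, L \notin D & fdim L == i])).
  rewrite (_ : c - _ = chain_bd (b + b') + (v + w -
      \sum_(L | [&& L \in D1, L \notin D & fdim L == i]) w' L)).
    apply: smD => //; apply: bnd_bd; apply: smD => //; exact: chains_inS Fb'.
  by rewrite -(subrK (chain_bd b) c) uv uE linearD /=; module k (Defs.chain R k Q).
move=> L; rewrite finset.in_setD1; have [->|] := eqVneq L J => //=.
by rewrite (negPf Ji) !andbF.
Qed.

Variables (sgn : S -> S -> int) (hsgn : sign_convention rk sgn).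
Variables (H0 : sheaf H) (hH0 : structure_sheaf rk sgn H0).

Definition low D q : {set S} := finset (fun J => (J \in D) && (fdim J < q)%N).

Lemma low_upc D q : upc D -> upc (low D q).
Proof.
move=> uD J L; rewrite !inE => /andP[JD Jq] JL; rewrite (uD _ _ JD JL) /=.
exact: leq_ltn_trans (fdim_le hS JL) Jq.
Qed.

Lemma low_sub D q q' : (q <= q')%N -> low D q \subset low D q'.
Proof.
by move=> qq; apply/fintype.subsetP => J; rewrite !inE => /andP[-> /leq_trans]; apply.
Qed.

Lemma low_D D q : low D q \subset D.
Proof. by apply/fintype.subsetP => J; rewrite !inE => /andP[]. Qed.

(** The representatives are arbitrary choices, so [rep] is linear and compatible with boundaries
    only up to relative boundaries, which [represents] allows for. *)
Definition rep D q (y : dsum H) : chain :=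
  \sum_(J | (J \in D) && (fdim J == q)) cls_repr (y J).

Definition supp D q (y : dsum H) := forall J, ~~ ((J \in D) && (fdim J == q)) -> y J = 0.

Definition represents D q (y : dsum H) c :=
  bnd q (XA (low D q.+1)) (XA (low D q)) (c - rep D q y).

Lemma sub_int a : a = 1 \/ a = -1 -> (a%:~R * a%:~R = 1 :> k).
Proof. by move=> [->|->]; rewrite ?mulrNz ?mulrNN mulr1. Qed.

Lemma cls_reprD (M : lmodType k) (Z B : submod M) a (x y : subquot Z B) :
  B (cls_repr (a *: x + y) - (a *: cls_repr x + cls_repr y)).
Proof.
apply: (cls_eqP B (cls_repr_in _) _).1.
  by apply: submod_setP; exact: cls_repr_in.
by rewrite cls_linear ?cls_reprK //; exact: cls_repr_in.
Qed.

Lemma gt_nbot K : \bot%O \notin finset (fun J => (K < J)%O).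
Proof. by rewrite inE ltx0. Qed.

(** The cellular boundary formula. By [face_decomposition] the boundary is a sum of cycles of the
    facets. To identify the one at [J], all other faces in the boundary of [K] are collapsed, and
    there [face_injective] reduces the claim to the definition of the structure sheaf. *)
Lemma chain_bd_repr K (x : H K) : K != \bot%O ->
  bnd (fdim K).-1 (dF K) (XA (low (finset (fun J => (K < J)%O)) (fdim K).-1))
    (chain_bd (cls_repr x) -
     \sum_(J | covers rk K J) cls_repr ((sgn J K)%:~R *: res H0 K J x)).
Proof.
move=> K0; set D' := finset _; set q := (fdim K).-1.
have uD' : upc D' := @upc_gt _ _ K.
have XD' : XA D' = dF K := XA_gt hS K.
have [||||||u cu hu] := @face_decomposition (low D' q) D' q (chain_bd (cls_repr x)).
- exact: low_upc.
- by [].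
- exact: low_D.
- exact: gt_nbot.
- move=> J; rewrite inE => KJ _ Jq L JL; by rewrite !inE (lt_trans KJ JL) -Jq (fdim_lt hS JL).
- rewrite XD'; split; first by have [] := cls_repr_in x.
  by rewrite sm_preimE /= chain_bdK; exact: sm0.
rewrite XD' in hu.
have covE J : [&& J \in D', J \notin low D' q & fdim J == q] = covers rk K J.
  rewrite !inE; apply/and3P/idP => [[KJ _ /eqP Jq]|cJ].
    apply: coversE (ltW KJ) _; have := fdimE hS J; have := fdimE hS K; have := fdim_lt hS KJ.
    by move: Jq; rewrite /q; lia.
  have KJ := covers_lt cJ; have e := covers_fdim hS cJ.
  by rewrite KJ /q e /= ltnn eqxx.
rewrite (eq_bigl _ _ covE) in hu.
rewrite (_ : _ - _ = (chain_bd (cls_repr x) - \sum_(J | covers rk K J) u J) +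
  \sum_(J | covers rk K J) (u J - cls_repr ((sgn J K)%:~R *: res H0 K J x))); last first.
  by rewrite sumrB; module k (Defs.chain R k Q).
apply: smD => //; apply: sm_sum => J cJ.
have KJ := covers_lt cJ; have e := covers_fdim hS cJ.
have Jq : fdim J = q by rewrite /q e.
have FJ : F J `<=` dF K by move=> y; exact: (face_lt_sub hS KJ).
have sdF : dF J `<=` XA (low D' q).
  move=> y /(dfaceE hS)[L JL Ly]; exists L => //; by rewrite !inE (lt_trans KJ JL) -Jq (fdim_lt hS JL).
apply: (bndS FJ sdF).
have aJ : addable J (D' :\ J)%SET.
  apply: setD1_addable => //; first by rewrite inE.
  move=> L LJ; rewrite inE; apply/negP => KL; have := fdim_lt hS KL; have := fdim_lt hS LJ; lia.
have JD' : J \in D' by rewrite inE.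
have XE := XA_setD1 JD'; rewrite XD' in XE.
set B := dF K `\` (F J `\` dF J).
have BE : XA (D' :\ J)%SET = B.
  apply/seteqP; split => y.
    move=> hy; split; first by rewrite XE; right.
    by move=> [Jy nJy]; apply: nJy; apply: (addable_cap hS aJ).
  move=> []; rewrite XE => -[Jy|//] nJy; apply: (addable_bd hS aJ).
  by apply: contrapT => ndy; apply: nJy.
have cr : cyc (fdim J) (F J) (dF J) (cls_repr ((sgn J K)%:~R *: res H0 K J x)) by exact: cls_repr_in.
rewrite -Jq; apply: (face_injective aJ); first by apply: smB => //; rewrite Jq; exact: cu.
rewrite -XE BE.
have dB : dF J `<=` B by rewrite -BE => y; exact: (addable_bd hS aJ).
have := hH0 x cJ.
rewrite -/B /homology_incl /homology_connect /subquot_map.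
set r := cls_repr (res H0 K J x); set z := chain_bd (cls_repr x).
have cz : cyc (fdim J) (dF K) set0 z.
  rewrite Jq; split; first by have [] := cls_repr_in x.
  by rewrite sm_preimE /= chain_bdK; exact: sm0.
set r' := cls_repr (cls _ _ z).
have r'z : bnd (fdim J) (dF K) set0 (r' - z).
  by apply: (cls_eqP _ (cls_repr_in _) cz).1; rewrite cls_reprK.
have cycB y : cyc (fdim J) (F J) (dF J) y -> cyc (fdim J) (dF K) B y.
  by move=> [h1 h2]; split; [exact: chains_inS h1|exact: chains_inS h2].
have cyc0 y : cyc (fdim J) (dF K) set0 y -> cyc (fdim J) (dF K) B y.
  by move=> [h1 h2]; split => //; apply: chains_inS h2.
have r'c : cyc (fdim J) (dF K) B r' by apply: cyc0; exact: cls_repr_in.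
rewrite -clsZ // => /(cls_eqP _ (cycB _ (cls_repr_in _)) (smZ _ r'c)) h.
set a := (sgn J K)%:~R in h *.
(* The map of the structure sheaf is [[J:K]] times the geometric one; multiplying by the same sign
   again leaves the geometric one. *)
have aa : a * a = 1 by apply: sub_int; exact: hsgn.1.
have hr := cls_reprD a (res H0 K J x) 0; rewrite addr0 in hr.
have hr0 : bnd (fdim J) (F J) (dF J) (cls_repr (0 : H J)).
  by rewrite -[cls_repr _]subr0; apply: (cls_eqP _ (cls_repr_in _) (sm0 _)).1; rewrite cls_reprK cls0.
have hu' : bnd (fdim J) (dF K) B (z - u J).
  rewrite Jq (_ : z - u J = (z - \sum_(i | covers rk K i) u i) +
      \sum_(i | covers rk K i && (i != J)) u i); last first.
    by rewrite (bigD1 J cJ) /=; module k (Defs.chain R k Q).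
  apply: smD.
    apply: (bndS _ _ hu) => // y hy; rewrite -BE.
    apply: (XA_sub (D := low D' q)) hy; apply/fintype.subsetP => L.
    rewrite !inE => /andP[-> Lq]; rewrite andbT.
    by apply: contraTneq Lq => ->; rewrite Jq ltnn.
  apply: sm_sum => L /andP[cL LJ]; apply: bnd_sub; have [h1 _] := cu L.
  apply: (chains_inS _ h1) => y Ly; rewrite -BE; exists L => //.
  by rewrite !inE LJ (covers_lt cL).
have FB y : bnd (fdim J) (F J) (dF J) y -> bnd (fdim J) (dF K) B y by exact: bndS.
have r'B : bnd (fdim J) (dF K) B (r' - z) by apply: (bndS _ _ r'z).
rewrite (_ : _ - _ = - (z - u J) - (cls_repr (a *: res H0 K J x) - (a *: r + cls_repr (0 : H J)))
  - a *: (r - a *: r') - cls_repr (0 : H J) - (r' - z)).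
  apply: smB r'B; apply: smB (FB _ hr0); apply: smB (smZ _ h); apply: smB (FB _ hr).
  exact: smN.
rewrite scalerBr scalerA aa; module k (Defs.chain R k Q).
Qed.

Lemma rep_cyc D q y : upc D -> cyc q (XA (low D q.+1)) (XA (low D q)) (rep D q y).
Proof.
move=> uD; apply: sm_sum => J /andP[JD /eqP <-]; have [h1 h2] := cls_repr_in (y J).
split.
  by apply: chains_inS h1 => x Jx; exists J => //; rewrite inE JD /=.
rewrite sm_preimE; apply: chains_inS h2 => x /(dfaceE hS)[L JL Lx]; exists L => //.
by rewrite inE (uD _ _ JD (ltW JL)) (fdim_lt hS JL).
Qed.

Lemma face_bndD D q J c : upc D -> J \in D -> fdim J = q ->
  bnd q (F J) (dF J) c -> bnd q (XA (low D q.+1)) (XA (low D q)) c.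
Proof.
move=> uD JD Jq; apply: bndS => x.
  by move=> Jx; exists J => //; rewrite inE JD Jq /=.
move=> /(dfaceE hS)[L JL Lx]; exists L => //.
by rewrite inE (uD _ _ JD (ltW JL)) -Jq (fdim_lt hS JL).
Qed.

Lemma represents_ex D q c : upc D -> \bot%O \notin D ->
  cyc q (XA (low D q.+1)) (XA (low D q)) c -> exists2 y, supp D q y & represents D q y c.
Proof.
move=> uD bD cc; have [||||||u cu hu] := @face_decomposition (low D q) (low D q.+1) q c.
- exact: low_upc.
- exact: low_upc.
- exact: low_sub.
- by apply: contra bD => /(fintype.subsetP (low_D _ _)).
- move=> J; rewrite !inE => /andP[JD _] _ Jq L JL.
  by rewrite inE (uD _ _ JD (ltW JL)) -Jq (fdim_lt hS JL).
- by [].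
exists (fun J => if (J \in D) && (fdim J == q) then cls _ _ (u J) else 0).
  by move=> J /negPf->.
rewrite /represents; rewrite (_ : c - _ = (c - \sum_(J | (J \in D) && (fdim J == q)) u J) +
  \sum_(J | (J \in D) && (fdim J == q)) (u J - cls_repr (cls _ _ (u J) : H J))); last first.
  rewrite sumrB /rep; under [X in c - X]eq_bigr => J -> do [].
  by module k (Defs.chain R k Q).
apply: smD.
  move: hu; rewrite (eq_bigl (fun J => (J \in D) && (fdim J == q))) // => J.
  rewrite !inE; case: (J \in D) => //=; case: eqVneq => [->|]; first by rewrite ltnn ltnS leqnn.
  by rewrite !andbF.
apply: sm_sum => J /andP[JD /eqP Jq]; apply: (face_bndD uD JD Jq).
by rewrite -Jq; apply: repr_cls; rewrite Jq.
Qed.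

(** Compared at one face [J] of dimension [q] at a time: all other faces of dimension at most [q]
    are collapsed. *)
Lemma represents_inj D q y z c : upc D -> \bot%O \notin D -> supp D q y -> supp D q z ->
  represents D q y c -> represents D q z c -> y = z.
Proof.
move=> uD bD sy sz hy hz; apply: functional_extensionality_dep => J.
have [/andP[JD /eqP Jq]|nJ] := boolP ((J \in D) && (fdim J == q)); last by rewrite sy ?sz.
rewrite -[y J]cls_reprK -[z J]cls_reprK; apply: (cls_eqP _ (cls_repr_in _) (cls_repr_in _)).2.
have JD' : J \in low D q.+1 by rewrite inE JD Jq /=.
have aJ : addable J (low D q.+1 :\ J)%SET.
  apply: setD1_addable => //; first exact: low_upc.
  move=> L LJ; rewrite inE; apply/negP => /andP[_]; have := fdim_lt hS LJ; rewrite Jq; lia.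
apply: (face_injective aJ); first by apply: smB; exact: cls_repr_in.
have key w : bnd q (XA (low D q.+1)) (XA (low D q.+1 :\ J)%SET) w ->
    bnd (fdim J) (XA (low D q.+1)) (XA (low D q.+1 :\ J)%SET) w by rewrite Jq.
rewrite -XA_setD1 //; apply: key.
have lD : low D q \subset (low D q.+1 :\ J)%SET.
  apply/fintype.subsetP => L; rewrite !inE => /andP[LD Lq]; rewrite LD ltnS (ltnW Lq) /= !andbT.
  by apply: contraTneq Lq => ->; rewrite Jq ltnn.
have h : bnd q (XA (low D q.+1)) (XA (low D q.+1 :\ J)%SET) (rep D q y - rep D q z).
  rewrite (_ : _ - _ = (c - rep D q z) - (c - rep D q y)); last by module k (Defs.chain R k Q).
  by apply: smB; [apply: bndS hz|apply: bndS hy] => //; exact: XA_sub.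
have hJ w : bnd q (XA (low D q.+1)) (XA (low D q.+1 :\ J)%SET) (rep D q w - cls_repr (w J)).
  rewrite /rep (bigD1 J) /=; last by rewrite JD Jq eqxx.
  rewrite addrAC subrr add0r; apply: bnd_sub; apply: sm_sum => L /andP[/andP[LD /eqP Lq] LJ].
  have [h1 _] := cls_repr_in (w L); rewrite -Lq; apply: chains_inS h1 => x Lx; exists L => //.
  by rewrite !inE LJ LD Lq /=.
rewrite (_ : _ - _ = (rep D q y - rep D q z) - (rep D q y - cls_repr (y J)) +
  (rep D q z - cls_repr (z J))); last by module k (Defs.chain R k Q).
by apply: smD (hJ _); apply: smB.
Qed.

(** In passing to cells the singular boundary becomes the coboundary of the structure sheaf, by
    [chain_bd_repr] on each face and an exchange of the sums over pairs of faces. *)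
Lemma represents_bd D q y c : upc D -> \bot%O \notin D -> supp D q.+1 y ->
  represents D q.+1 y c -> represents D q (coboundary rk sgn H0 y) (chain_bd c).
Proof.
move=> uD bD sy [_ [v [[b Cb <-] Cv /= cE]]].
have {cE} : c = rep D q.+1 y + (chain_bd b + v) by rewrite -cE addrC subrK.
move=> ->; rewrite !linearD /= chain_bdK add0r /represents.
rewrite addrAC; apply: smD; last exact: bnd_bd.
rewrite /rep linear_sum /=.
have cE J : (J \in D) && (fdim J == q) -> coboundary rk sgn H0 y J =
    \sum_(K | covers rk K J && ((K \in D) && (fdim K == q.+1))) (sgn J K)%:~R *: res H0 K J (y K).
  move=> _; rewrite /coboundary [RHS]big_mkcondr; apply: eq_bigr => K _; case: ifPn => // nK.
  by rewrite sy // linear0 scaler0.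
have hsum (I : finType) (P : pred I) (M : lmodType k) (Z B : submod M) (f : I -> subquot Z B) :
    B (cls_repr (\sum_(i | P i) f i) - \sum_(i | P i) cls_repr (f i)).
  apply: (cls_eqP _ (cls_repr_in _) _).1; first by apply: sm_sum => i _; exact: cls_repr_in.
  rewrite cls_reprK cls_sum; last by move=> i _; exact: cls_repr_in.
  by apply: eq_bigr => i _; rewrite cls_reprK.
pose t K J := cls_repr ((sgn J K)%:~R *: res H0 K J (y K)).
rewrite (_ : _ - _ = \sum_(K | (K \in D) && (fdim K == q.+1))
    (chain_bd (cls_repr (y K)) - \sum_(J | covers rk K J) t K J)
  - \sum_(J | (J \in D) && (fdim J == q)) (cls_repr (coboundary rk sgn H0 y J) -
      \sum_(K | covers rk K J && ((K \in D) && (fdim K == q.+1))) t K J)); last first.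
  rewrite !sumrB (exchange_big_dep (fun J => (J \in D) && (fdim J == q))) /=; last first.
    move=> K J /andP[KD /eqP Kq] cJ; rewrite (uD _ _ KD (covers_le cJ)) /=.
    by have := covers_fdim hS cJ; rewrite Kq => -[->].
  rewrite [X in _ = _ - X - _](eq_bigr (fun J => \sum_(K | covers rk K J && ((K \in D) && (fdim K == q.+1))) t K J)); last first.
    by move=> J _; apply: eq_bigl => K; rewrite andbC.
  by module k (Defs.chain R k Q).
apply: smB; apply: sm_sum.
  move=> K /andP[KD /eqP Kq].
  have K0 : K != \bot%O by apply: contraNneq bD => <-.
  have e1 : (fdim K).-1 = q by rewrite Kq.
  have := chain_bd_repr (y K) K0; rewrite e1; apply: bndS => x.
    move=> /(dfaceE hS)[L KL Lx]; exists L => //; rewrite inE (uD _ _ KD (ltW KL)) /=.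
    by rewrite -Kq (fdim_lt hS KL).
  move=> [L]; rewrite !inE => /andP[KL Lq] Lx; exists L => //.
  by rewrite inE (uD _ _ KD (ltW KL)).
move=> J PJ; rewrite cE //; move: (PJ) => /andP[JD /eqP Jq].
apply: (face_bndD uD JD Jq); rewrite -Jq; exact: hsum.
Qed.

End Cellular.

(** * Augmentation and change of coefficients *)

Section Augmentation.
Context {R : realType} {k : comUnitRingType} {X : topologicalType}.

Definition aug : chain R k X -> k^o := lin_ext (fun s : sing R X => (tag s == 0%N)%:R : k^o).
HB.instance Definition _ := GRing.Linear.on aug.

Lemma aug_gen d (s : simplex R d -> X) : aug (gen (mk_sing s)) = (d == 0%N)%:R.
Proof. exact: lin_ext_gen. Qed.

Lemma aug_tag s : aug (gen s) = (tag s == 0%N)%:R.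
Proof. exact: lin_ext_gen. Qed.

Lemma aug_bd c : aug (chain_bd c) = 0.
Proof.
apply: (free_mod_ext (f := aug \o @chain_bd R k X) (g := \0)) => -[d s] /=.
rewrite chain_bd_gen; case: d s => [|[|d]] s /=; first by rewrite linear0.
  by rewrite !big_ord_recl big_ord0 !linearD /= !linearZ /= !aug_gen /= linear0 scale1r scaleN1r addr0 subrr.
by rewrite linear_sum big1 // => i _; rewrite linearZ /= aug_gen scaler0.
Qed.

Lemma chains_in_set0 d c : @chains_in R k X d set0 c -> c = 0.
Proof.
move=> h; rewrite (free_modE c) big_seq big1 // => s; rewrite mem_dom => sc.
have [_ _ /(_ (tagged s (to_simplex (vert 0))))] := h s sc.
by case; exists (to_simplex (vert 0)).
Qed.

Lemma augZ_linear (P : chain R k X) : linear (fun c => aug c *: P).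
Proof. by move=> a x y; rewrite linearP scalerDl scalerA. Qed.

End Augmentation.

Section BaseChange.
Context {k : comUnitRingType}.

Lemma add_ext (K : choiceType) (W : zmodType) (f g : {additive @free_mod int K -> W}) :
  (forall x, f (gen x) = g (gen x)) -> f =1 g.
Proof.
move=> fg u; rewrite (free_modE u) !raddf_sum; apply: eq_bigr => x _.
by rewrite -[coeff x u]intz scaler_int !raddfMz fg.
Qed.

(** The target is regarded as a module over the integers through [zmodule], so that [lin_ext]
    applies. *)
Definition bc (K : choiceType) : @free_mod int K -> @free_mod k K :=
  fun c => (lin_ext (fun x => gen x : zmodule (@free_mod k K)) c : zmodule (@free_mod k K)).

Lemma bc_is_additive (K : choiceType) : zmod_morphism (@bc K).
Proof. by move=> x y; rewrite /bc linearB. Qed.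
HB.instance Definition _ (K : choiceType) :=
  GRing.isZmodMorphism.Build _ _ (@bc K) (@bc_is_additive K).

Lemma bc_gen (K : choiceType) (x : K) : bc (gen x) = gen x.
Proof. by rewrite /bc lin_ext_gen. Qed.

Lemma bcZ (K : choiceType) a (u : @free_mod int K) : bc (a *: u) = a%:~R *: bc u.
Proof. have -> : a *: u = u *~ a by rewrite -scaler_int intz.
by rewrite raddfMz scaler_int. Qed.

End BaseChange.

(** * Acyclicity over k *)

Section Acyclic.
Context {R : realType} {k : comUnitRingType} {X : topologicalType}.
Variable A : set X.
Hypothesis hA : acyclic_int R A.

Lemma acyclic_point : exists p, A p.
Proof.
have [_ [f [g fg gf]]] := hA; apply: contrapT => nA.
have A0 : A = set0 by apply/seteqP; split => // x Ax; apply: nA; exists x.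
have := gf 1; rewrite -(cls_reprK (g 1)).
have [h _] := cls_repr_in (g 1); rewrite {1}A0 in h; rewrite (chains_in_set0 h) cls0 linear0.
by move/eqP; rewrite eq_sym oner_eq0.
Qed.

(** [f] identifies H_0 with the integers, where the augmentation becomes multiplication by the
    augmentation [e] of a generator. A point has augmentation 1, so [e] is not 0, and the integers
    have no zero divisors. *)
Lemma acyclic_int0 c : @chains_in R int X 0 A c -> aug c = 0 ->
  exists2 b, chains_in R int 1 A b & chain_bd b = c.
Proof.
move=> Ac ac; have [_ [f [g fg gf]]] := hA.
have cyc0 u : @chains_in R int X 0 A u -> rel_cycles R int 0 A set0 u.
  by move=> Au; split => //; rewrite sm_preimE /= (chains_in_bd0 Au); exact: sm0.
have bnd0 u : rel_boundaries R int 0 A set0 u ->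
    exists2 b, chains_in R int 1 A b & chain_bd b = u.
  by move=> [_ [v [[b Ab <-] /chains_in_set0-> ->]]]; rewrite addr0; exists b.
pose e := aug (cls_repr (g 1)).
have augE u : @chains_in R int X 0 A u -> aug u = f (cls _ _ u) * e.
  move=> Au; pose m := f (cls (rel_cycles R int 0 A set0) (rel_boundaries R int 0 A set0) u).
  have cE : cls (rel_cycles R int 0 A set0) (rel_boundaries R int 0 A set0) u =
      cls _ _ (m *: cls_repr (g 1)).
    rewrite clsZ; last exact: cls_repr_in.
    rewrite cls_reprK; apply: (can_inj fg); rewrite linearZ /= gf.
    by rewrite -[RHS]/(m * 1) mulr1.
  have [|b _ be] := bnd0 (u - m *: cls_repr (g 1)).
    apply: (cls_eqP _ (cyc0 _ Au) _).1 => //; apply: smZ; exact: cls_repr_in.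
  transitivity (aug (chain_bd b + m *: cls_repr (g 1))); first by rewrite be subrK.
  by rewrite linearD /= aug_bd add0r linearZ.
have [p Ap] := acyclic_point.
have e0 : e != 0.
  apply/eqP => e0; have := augE (gen (mk_sing (fun _ : simplex R 0 => p))).
  rewrite e0 mulr0 aug_gen eqxx => /(_ _)/eqP; rewrite oner_eq0 => /(_ _)/negP; apply => //.
  by apply: gen_in => //; exact: cont_cst.
apply: bnd0; apply/(cls_eq0P _ (cyc0 _ Ac)); apply: (can_inj fg).
have := augE _ Ac; rewrite ac => /esym/eqP; rewrite mulf_eq0 (negPf e0) orbF => /eqP->.
by rewrite linear0.
Qed.

Lemma acyclic_int_pos d c : (0 < d)%N -> @chains_in R int X d A c -> chain_bd c = 0 ->
  exists2 b, chains_in R int d.+1 A b & chain_bd b = c.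
Proof.
move=> d0 Ac c0; have [h _] := hA.
have cc : rel_cycles R int d A set0 c by split => //; rewrite sm_preimE /= c0; exact: sm0.
have [_ [v [[b Ab <-] /chains_in_set0-> ->]]] := (cls_eq0P _ cc).1 (h d _ d0).
by rewrite addr0; exists b.
Qed.

Let good d (s : sing R X) := [/\ tag s = d, continuous (tagged s) & range (tagged s) `<=` A].

(** A contraction is determined by its values on generators and can be base changed to [k]. Degree
    by degree, the chain to be bounded is a cycle by the equation one degree below, and [xget]
    chooses a bounding chain; the base point is [p]. *)
Lemma int_contraction p d : A p -> exists h : sing R X -> chain R int X,
  forall i s, (i <= d)%N -> good i s -> chains_in R int i.+1 A (h s) /\
    chain_bd (h s) = gen s - aug (gen s) *: gen (mk_sing (fun _ : simplex R 0 => p)) -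
      lin_ext h (chain_bd (gen s)).
Proof.
move=> Ap; set P := gen (mk_sing _).
have AP : @chains_in R int X 0 A P by apply: gen_in => //; exact: cont_cst.
have genA i s : good i s -> @chains_in R int X i A (gen s).
  by move=> gs; exact: supp_gen.
pose spec (h : sing R X -> chain R int X) i s :=
  [set b | chains_in R int i.+1 A b /\
     chain_bd b = gen s - aug (gen s) *: P - lin_ext h (chain_bd (gen s))].
elim: d => [|d [h IH]].
  exists (fun s => xget 0 (spec (fun=> 0) 0%N s)) => i s; rewrite leqn0 => /eqP-> gs.
  have As := genA _ _ gs.
  suff : spec (fun=> 0) 0%N s (xget 0 (spec (fun=> 0) 0%N s)).
    by move=> [h1 h2]; split => //; rewrite h2 (chains_in_bd0 As) !linear0.
  have [||b Ab be] := @acyclic_int0 (gen s - P).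
  - exact: smB.
  - rewrite linearB /=; have [e _ _] := gs.
    by rewrite !aug_tag e subrr.
  apply: (@xgetI _ _ _ b); split => //; rewrite be (chains_in_bd0 As) linear0 subr0.
  by have [e _ _] := gs; rewrite aug_tag e scale1r.
(* [h'] agrees with [h] up to degree [d], so the equations already solved persist. *)
pose h' (s : sing R X) : chain R int X := if (tag s <= d)%N then h s else xget 0 (spec h d.+1 s).
have hh' i c : (i <= d)%N -> @chains_in R int X i A c -> lin_ext h' c = lin_ext h c.
  move=> id; apply: (lin_eq_on (f := lin_ext h') (g := lin_ext h)) => s [ts _ _].
  by rewrite /= !lin_ext_gen /h' ts id.
have bdh i c : (i <= d)%N -> @chains_in R int X i A c ->
    chains_in R int i.+1 A (lin_ext h c) /\
    chain_bd (lin_ext h c) = c - aug c *: P - lin_ext h (chain_bd c).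
  move=> id Ac; split; first by apply: (lin_ext_in _ Ac) => s gs; exact: (IH _ _ id gs).1.
  apply: (lin_eq_on (f := @chain_bd R int X \o lin_ext h)
    (g := (idfun \- pack_linear (augZ_linear P)) \- (lin_ext h \o @chain_bd R int X)) _ Ac) => s gs.
  by rewrite /= lin_ext_gen; exact: (IH _ _ id gs).2.
exists h' => i s id gs; have [id'|id'] := leqP i d.
  have -> : h' s = h s by have [ts _ _] := gs; rewrite /h' ts id'.
  have [h1 h2] := IH _ _ id' gs; split => //; rewrite h2; congr (_ - _).
  by rewrite (hh' i.-1) //; [exact: leq_trans (leq_pred _) id'|apply/chains_in_bdp/genA].
have {id id'} id : i = d.+1 by apply/eqP; rewrite eqn_leq id id'.
rewrite {i}id in gs *; have As := genA _ _ gs.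
have -> : h' s = xget 0 (spec h d.+1 s) by have [ts _ _] := gs; rewrite /h' ts ltnn.
rewrite (hh' d) //; last exact: chains_in_bd.
have as0 : @aug R int X (gen s) = 0.
  by have [e _ _] := gs; rewrite aug_tag e.
have [h1 h2] := bdh d _ (leqnn d) (chains_in_bd As).
have [|||b Ab be] := @acyclic_int_pos d.+1 (gen s - lin_ext h (chain_bd (gen s))).
- by [].
- exact: smB.
- rewrite linearB /= h2 aug_bd scale0r subr0 chain_bdK linear0 subr0 subrr.
  by [].
apply: (@xgetI _ 0 (spec h d.+1 s) b); split => //; rewrite be as0 scale0r subr0.
by [].
Qed.

Lemma acyclic_contraction p d : A p -> exists h : {linear chain R k X -> chain R k X},
  forall c, @chains_in R k X d A c -> chains_in R k d.+1 A (h c) /\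
    chain_bd (h c) = c - aug c *: gen (mk_sing (fun _ : simplex R 0 => p)) - h (chain_bd c).
Proof.
move=> Ap; have [h hP] := int_contraction d Ap.
pose hk : {linear chain R k X -> chain R k X} := lin_ext (fun s => bc (h s)).
have bc_in i c : @chains_in R int X i A c -> chains_in R k i A (bc c).
  move=> Ac; rewrite (free_modE c) raddf_sum big_seq; apply: sm_sum => s sc.
  rewrite /= bcZ bc_gen; apply: smZ; apply: supp_gen; apply: Ac.
  by rewrite mem_dom in sc.
have bc_bd (c : chain R int X) : bc (chain_bd c) = chain_bd (bc c : chain R k X).
  apply: (add_ext (f := @bc k _ \o @chain_bd R int X) (g := @chain_bd R k X \o @bc k _)) => -[j s] /=.
  rewrite bc_gen /chain_bd !lin_ext_gen /=.
  case: j s => [|j] s /=; first by rewrite raddf0.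
  by rewrite raddf_sum; apply: eq_bigr => i _; rewrite /= bcZ bc_gen rmorphXn rmorphN1.
have bc_h (c : chain R int X) : bc (lin_ext h c) = hk (bc c).
  apply: (add_ext (f := @bc k _ \o lin_ext h) (g := hk \o @bc k _)) => s /=.
  by rewrite bc_gen !lin_ext_gen.
exists hk => c Ac; set P := gen (mk_sing _); split.
  by apply: (lin_ext_in _ Ac) => s gs; apply: bc_in; exact: (hP _ _ (leqnn d) gs).1.
apply: (lin_eq_on (f := @chain_bd R k X \o hk)
    (g := (idfun \- pack_linear (augZ_linear P)) \- (hk \o @chain_bd R k X)) _ Ac) => s gs /=.
rewrite lin_ext_gen -bc_bd (hP _ _ (leqnn d) gs).2 !raddfB /= bc_h bc_bd bc_gen bcZ bc_gen.
by rewrite !aug_tag; case: eqP.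
Qed.

Lemma acyclic_boundary d c : (0 < d)%N -> @chains_in R k X d A c -> chain_bd c = 0 ->
  exists2 b, chains_in R k d.+1 A b & chain_bd b = c.
Proof.
case: d => // d _ Ac c0; have [p Ap] := acyclic_point.
have [h hP] := acyclic_contraction d.+1 Ap; have [h1 h2] := hP c Ac; exists (h c) => //.
rewrite h2 c0 linear0 subr0; suff -> : aug c = 0 by rewrite scale0r subr0.
apply: (lin_eq_on (f := aug) (g := \0) _ Ac) => s [/= e _ _].
by rewrite aug_tag e.
Qed.

Lemma acyclic_boundary0 c : @chains_in R k X 0 A c -> aug c = 0 ->
  exists2 b, chains_in R k 1 A b & chain_bd b = c.
Proof.
move=> Ac c0; have [p Ap] := acyclic_point.
have [h hP] := acyclic_contraction 0 Ap; have [h1 h2] := hP c Ac; exists (h c) => //.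
by rewrite h2 c0 scale0r subr0 (chains_in_bd0 Ac) linear0 subr0.
Qed.

End Acyclic.

(** * Exactness of the columns *)

Section Exactness.
Context {R : realType} {k : comUnitRingType} {Q : topologicalType}
  {disp : Order.disp_t} {S : finBPOrderType disp}.
Variables (F dF : S -> set Q) (fdim rk : S -> nat) (n : nat).
Hypothesis hQ : buchsbaum_complex R k F dF fdim rk n.
Let hS := buchsbaum_simple hQ.
Variables (sgn : S -> S -> int) (hsgn : sign_convention rk sgn).
Local Notation H := (structure_val R k F dF fdim).
Variables (H0 : sheaf H) (hH0 : structure_sheaf rk sgn H0).
Local Notation C := (@chains_in R k Q).
Local Notation bnd := (@rel_boundaries R k Q).
Local Notation cyc := (@rel_cycles R k Q).
Local Notation delta := (coboundary rk sgn H0).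
Implicit Types (I J : S).

(** A face of dimension 0 has empty boundary, so the augmentation is defined on its classes. The
    other faces get 0, so that a sum over all faces augments a column. *)
Definition face_aug J (h : H J) : k^o := if fdim J == 0%N then aug (cls_repr h) else 0.

Lemma face_aug_linear J : linear (@face_aug J).
Proof.
move=> a x y; rewrite /face_aug; case: eqP => [J0|_]; last by rewrite scaler0 addr0.
have [_ [v [[b _ <-] dv e]]] := cls_reprD a x y.
have dF0 : dF J = set0.
  by rewrite -(pcc_attach (simple_pcc hS) J) J0; apply/seteqP; split => // z [_ [L /=]].
rewrite dF0 in dv; move/chains_in_set0: dv e => ->; rewrite addr0 => e.
have := aug_bd b; rewrite [chain_bd b]/= -[X in aug X]e linearB /= => /eqP.
by rewrite subr_eq0 => /eqP->; rewrite linearP.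
Qed.
HB.instance Definition _ J :=
  GRing.isLinear.Build k (H J) k^o *:%R (@face_aug J) (@face_aug_linear J).

Definition up I : {set S} := finset (fun J => (I <= J)%O).

Definition aug_up (I : S) (y : dsum H) : k := \sum_(J | (I <= J)%O) face_aug (y J).

Section Fixed.
Variable I : S.
Hypothesis I0 : I != \bot%O.
Let D := up I.
Let uD : upc D. Proof. by move=> J L; rewrite !inE; exact: le_trans. Qed.
Let bD : \bot%O \notin D.
Proof. by rewrite inE; apply: contra I0 => h; rewrite -lex0. Qed.
Let XD : XA F D = F I. Proof. exact: XA_ge hS I. Qed.
Let accF := buchsbaum_acyclic hQ I0.

Lemma aug_rep y : supp D 0 y -> aug (rep D 0 y) = aug_up I y.
Proof.
move=> sy; rewrite /rep linear_sum /= /aug_up [RHS](bigID (fun J => fdim J == 0%N)) /=.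
rewrite [X in _ = _ + X]big1 ?addr0; last first.
  by move=> J /andP[_ /negPf J0]; rewrite /face_aug J0.
apply: eq_big => [J|J /andP[_ J0]]; first by rewrite inE.
by rewrite /face_aug J0.
Qed.

Lemma represents_aug y c : supp D 0 y -> represents D 0 y c -> aug c = aug_up I y.
Proof.
move=> sy [_ [v [[b _ <-] Cv /= e]]]; rewrite -(aug_rep sy).
have l0 : XA F (low fdim D 0) = set0.
  by apply/seteqP; split => // x [J]; rewrite inE ltn0 andbF.
rewrite l0 in Cv; move: e; rewrite (chains_in_set0 Cv) addr0 => e.
by have := aug_bd b; rewrite -e linearB /= => /eqP; rewrite subr_eq0 => /eqP.
Qed.

Let uL q : upc (low fdim D q) := @low_upc _ _ _ _ _ _ _ _ _ _ hQ D q uD.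

Lemma rep_in q (y : dsum H) : C q (XA F (low fdim D q.+1)) (rep D q y).
Proof. by have [] := rep_cyc hQ q y uD. Qed.

Lemma represents_rep q (y : dsum H) : represents D q y (rep D q y).
Proof. by rewrite /represents subrr; exact: sm0. Qed.

Lemma supp_delta q y : supp D q.+1 y -> supp D q (delta y).
Proof.
move=> sy J nJ; rewrite /coboundary big1 // => K cK; rewrite sy ?linear0 ?scaler0 //.
apply: contra nJ => /andP[KD /eqP Kq]; rewrite (uD KD (covers_le cK)) /=.
by have := covers_fdim hS cK; rewrite Kq => -[->].
Qed.

Lemma aug_delta y : supp D 1 y -> aug_up I (delta y) = 0.
Proof.
move=> sy; have h := represents_bd hQ hsgn hH0 uD bD sy (represents_rep 1 y).
by rewrite -(represents_aug (supp_delta sy) h) aug_bd.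
Qed.

(** A point of the acyclic face is homologous to a chain in its 0-dimensional faces, by
    [face_decomposition] with no face left to contribute. *)
Lemma aug_up_onto : exists2 y, supp D 0 y & aug_up I y = 1.
Proof.
have [p Fp] := acyclic_point accF.
pose g : chain R k Q := gen (mk_sing (fun _ : simplex R 0 => p)).
have Cg : C 0 (F I) g by apply: gen_in => //; exact: cont_cst.
have [||||||u _] := @face_decomposition R k _ _ _ _ _ _ _ _ hQ (low fdim D 1) D 0 g.
- exact: uL.
- exact: uD.
- exact: low_D.
- exact: bD.
- by move=> J JD; rewrite inE JD /= => h e; rewrite e in h.
- by rewrite XD; split => //; rewrite sm_preimE /= (chains_in_bd0 Cg); exact: sm0.
rewrite big_pred0; last first.
  by move=> J; rewrite !inE; case: (I <= J)%O => //=; case: (fdim J).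
rewrite subr0 => -[_ [v [[b _ <-] Cv /= gE]]].
have av : aug v = 1.
  have : aug g = 1 by rewrite aug_gen.
  by rewrite gE linearD /= aug_bd add0r.
have [y sy hy] : exists2 y : dsum H, supp D 0 y & represents D 0 y v.
  apply: (represents_ex hQ uD bD); split => //.
  by rewrite sm_preimE /= (chains_in_bd0 Cv); exact: sm0.
by exists y => //; rewrite -(represents_aug sy hy).
Qed.

Lemma cycle_boundary q c : C q (F I) c -> chain_bd c = 0 -> (q = 0%N -> aug c = 0) ->
  exists2 b, C q.+1 (F I) b & chain_bd b = c.
Proof.
case: q => [|q] Ic c0 ac; first by apply: (acyclic_boundary0 accF) => //; exact: ac.
exact: (acyclic_boundary accF).
Qed.

(** This subcomplex has no [q]-dimensional faces, so the decomposition relative to the empty set has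
    no summands. *)
Lemma low_cycle q c : C q (XA F (low fdim D q)) c -> chain_bd c = 0 ->
  exists2 b, C q.+1 (XA F (low fdim D q)) b & chain_bd b = c.
Proof.
move=> Cc c0.
have [||||||u _] := @face_decomposition R k _ _ _ _ _ _ _ _ hQ finset.set0 (low fdim D q) q c.
- by move=> J L; rewrite finset.in_set0.
- exact: uL.
- exact: finset.sub0set.
- by rewrite inE negb_and bD.
- by move=> J; rewrite inE => /andP[_ h] _ e; rewrite e ltnn in h.
- by split => //; rewrite sm_preimE /= c0; exact: sm0.
rewrite big_pred0; last first.
  move=> J; rewrite !inE; case: eqVneq => [->|]; last by rewrite !andbF.
  by rewrite ltnn !andbF.
rewrite subr0 => -[_ [v [[b Cb <-] Cv /= cE]]].
have v0 : v = 0.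
  apply: (@chains_in_set0 R k Q q); apply: chains_inS Cv => x [J]; by rewrite finset.in_set0.
by exists b => //; rewrite cE v0 addr0.
Qed.

(** The cellular complex computes singular homology: a cellular cycle is represented by a singular
    one, which bounds in the acyclic face [F I], and the bounding chain can be moved into a
    skeleton, where it represents a cellular chain. *)
Lemma delta_exact (q : nat) y : supp D q y ->
  (forall q', q = q'.+1 -> delta y = 0) -> (q = 0%N -> aug_up I y = 0) ->
  exists2 w, supp D q.+1 w & delta w = y.
Proof.
move=> sy dy ay; pose c := rep D q y; have Cc : C q (XA F (low fdim D q.+1)) c := @rep_in q y.
have lI q' : XA F (low fdim D q') `<=` F I by rewrite -XD; apply: XA_sub; exact: low_D.
have ll q' : XA F (low fdim D q') `<=` XA F (low fdim D q'.+1) by apply: XA_sub; exact: low_sub.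
(* [c] is only a relative cycle. Its boundary bounds in the skeleton of one dimension less, and the
   correction gives an absolute cycle [c'] that represents the same cellular chain. *)
have [c' [Cc' c'0 cc']] : exists c', [/\ C q (XA F (low fdim D q.+1)) c', chain_bd c' = 0 &
    C q (XA F (low fdim D q.+1)) (c - c') /\ bnd q (XA F (low fdim D q.+1)) (XA F (low fdim D q)) (c - c')].
  case: q sy dy ay @c Cc => [|q] sy dy ay c Cc.
    by exists c; rewrite (chains_in_bd0 Cc) subrr; split => //; split; exact: sm0.
  have := represents_bd hQ hsgn hH0 uD bD sy (represents_rep q.+1 y).
  rewrite (dy q erefl) => hr.
  have {hr} : bnd q (XA F (low fdim D q.+1)) (XA F (low fdim D q)) (chain_bd c).
    move: hr; rewrite -/c /represents.
    have : bnd q (XA F (low fdim D q.+1)) (XA F (low fdim D q)) (rep D q (0 : dsum H)).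
      apply: sm_sum => J /andP[JD /eqP Jq]; apply: (face_bndD hQ uD JD Jq).
      rewrite -Jq -[cls_repr _]subr0; apply: (cls_eqP _ (cls_repr_in _) (sm0 _)).1.
      by rewrite cls_reprK cls0.
    by move=> h1 /(smD h1); rewrite addrC subrK.
  move=> [_ [v [[b Cb <-] Cv /= cE]]].
  have v0 : chain_bd v = 0 by have := chain_bdK c; rewrite cE linearD /= chain_bdK add0r.
  have [b' Cb' be] := low_cycle Cv v0.
  have hbb : C q.+1 (XA F (low fdim D q.+1)) (b + b').
    by apply: smD => //; apply: chains_inS Cb'; exact: ll.
  exists (c - (b + b')); split.
  - by apply: smB => //; apply: chains_inS hbb; exact: ll.
  - by rewrite linearB /= linearD /= be cE subrr.
  - rewrite opprB addrCA subrr addr0; split; last exact: bnd_sub.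
    by apply: chains_inS hbb; exact: ll.
have [b Cb be] : exists2 b, C q.+1 (F I) b & chain_bd b = c'.
  apply: cycle_boundary => //; first exact: chains_inS Cc'.
  move=> q0; have hy : represents D q y c'.
    rewrite /represents -[c'](subrK c) -addrA; apply: smD; last by rewrite subrr; exact: sm0.
    by rewrite -opprB; apply: smN; case: cc'.
  rewrite q0 in sy hy; by rewrite (represents_aug sy hy) ay.
(* All faces of dimension q + 1 belong to the skeleton already, so [b] can be moved into it. *)
have [||||||u _] := @face_decomposition R k _ _ _ _ _ _ _ _ hQ (low fdim D q.+2) D q.+1 b.
- exact: uL.
- exact: uD.
- exact: low_D.
- exact: bD.
- by move=> J JD; rewrite inE JD => h e; move: h; rewrite e ltnSn.
- rewrite XD; split => //; rewrite sm_preimE /= be; apply: chains_inS Cc'; exact: ll.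
rewrite big_pred0; last first.
  move=> J; rewrite !inE; case: eqVneq => [->|]; last by rewrite !andbF.
  by rewrite ltnSn; case: (_ <= _)%O.
rewrite subr0 => -[_ [b1 [[e Ce <-] Cb1 /= bE]]].
have b1c' : chain_bd b1 = c' by rewrite -be bE linearD /= chain_bdK add0r.
have [w sw hw] : exists2 w : dsum H, supp D q.+1 w & represents D q.+1 w b1.
  by apply: (represents_ex hQ uD bD); split => //; rewrite sm_preimE /= b1c'.
exists w => //; apply: (represents_inj hQ uD bD (supp_delta sw) sy (c := c')).
  by have := represents_bd hQ hsgn hH0 uD bD sw hw; rewrite b1c'.
rewrite /represents -[c'](subrK c) -addrA; apply: smD; last by rewrite subrr; exact: sm0.
by rewrite -opprB; apply: smN; case: cc'.
Qed.

End Fixed.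
End Exactness.

(** * Direct sums over the poset *)

Section DirectSumMaps.
Context {k : comUnitRingType} {S : finType}.
Variable A : S -> lmodType k.
Implicit Types (I J : S) (P : pred S) (y : dsum A).

Definition dproj J (y : dsum A) : A J := y J.
Lemma dproj_linear J : linear (@dproj J). Proof. by []. Qed.
HB.instance Definition _ J := GRing.isLinear.Build k (dsum A) (A J) *:%R (@dproj J) (@dproj_linear J).

Definition dinj J (x : A J) : dsum A := fun L =>
  match @eqP _ J L with
  | ReflectT e => eq_rect J (fun K => A K : Type) x L e
  | ReflectF _ => 0
  end.

Lemma dinj_linear J : linear (@dinj J).
Proof.
move=> a x z; apply: functional_extensionality_dep => L; rewrite dsumDE dsumZE /dinj.
by case: eqP => [e|_]; [case: L / e|rewrite scaler0 addr0].
Qed.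
HB.instance Definition _ J := GRing.isLinear.Build k (A J) (dsum A) *:%R (@dinj J) (@dinj_linear J).

Lemma dinjE J x : dinj x J = x.
Proof. by rewrite /dinj; case: eqP => // e; rewrite (eq_irrelevance e erefl). Qed.

Lemma dinj_ne J L (x : A J) : L != J -> dinj x L = 0.
Proof. by move=> LJ; rewrite /dinj; case: eqP => // e; rewrite e eqxx in LJ. Qed.

Lemma dsum_sumE (I : Type) (r : seq I) (P : pred I) (f : I -> dsum A) L :
  (\sum_(i <- r | P i) f i) L = \sum_(i <- r | P i) f i L.
Proof. exact: (raddf_sum (@dproj L)). Qed.

Lemma dinj_sum y : y = \sum_J dinj (y J).
Proof.
apply: functional_extensionality_dep => L; rewrite dsum_sumE (bigD1 L) //= dinjE big1 ?addr0 //.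
by move=> J JL; rewrite dinj_ne // eq_sym.
Qed.

Definition dmask P (y : dsum A) : dsum A := fun J => if P J then y J else 0.
Lemma dmask_linear P : linear (@dmask P).
Proof.
move=> a x z; apply: functional_extensionality_dep => J; rewrite dsumDE dsumZE /dmask.
by case: (P J) => //; rewrite scaler0 addr0.
Qed.
HB.instance Definition _ P := GRing.isLinear.Build k (dsum A) (dsum A) *:%R (dmask P) (@dmask_linear P).

Lemma dmask_id P y : (forall J, ~~ P J -> y J = 0) -> dmask P y = y.
Proof.
by move=> h; apply: functional_extensionality_dep => J; rewrite /dmask; case: ifPn => // /h.
Qed.

Lemma dmask0 P y : (forall J, P J -> y J = 0) -> dmask P y = 0.
Proof.
by move=> h; apply: functional_extensionality_dep => J; rewrite /dmask; case: ifP => // /h.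
Qed.

End DirectSumMaps.

(** * Signs and squares of the differentials *)

Section Signs.
Context {k : comUnitRingType} {disp : Order.disp_t} {S : finBPOrderType disp} (rk : S -> nat).
Hypothesis hS : simplicial_poset rk.
Variables (sgn : S -> S -> int) (hsgn : sign_convention rk sgn).

(** An interval of length two in a Boolean lattice has exactly two intermediate elements, and the
    sign convention cancels their terms. *)
Lemma sgn_sum0 I J : \sum_(K | covers rk I K && covers rk K J) sgn J K * sgn K I = 0.
Proof.
have [|nK] := pselect (exists K, covers rk I K && covers rk K J); last first.
  by rewrite big_pred0 // => K; apply/negP => h; apply: nK; exists K.
move=> [K0 /andP[cI cJ]].
have [f [fle fJ fs frk]] := below_coord hS J.
have finj : injective f by move=> B C e; apply/eqP; rewrite finset.eqEsubset -!fle e lexx.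
have IJ : (I <= J)%O := le_trans (covers_le cI) (covers_le cJ).
have [A fA] := fs _ IJ; have [B fB] := fs _ (covers_le cJ); have [T fT] := fs _ (lexx J).
have cB : (A \subset B) && (#|B| == #|A|.+1).
  rewrite -fle -!frk fA fB (covers_le cI) /=; apply/eqP; exact: covers_rk cI.
have cT : #|T| = #|A|.+2 by rewrite -!frk fA fT (covers_rk cJ) (covers_rk cI).
have rJ : rk J = #|A|.+2 by rewrite -cT -frk fT.
have Tfull (C : {set 'I_(rk J)}) : C \subset T by rewrite -fle fT.
have cTA : #|T :\: A|%SET = 2%N by rewrite cardsD (finset.setIidPr (Tfull A)) cT -addn2 addKn.
have [a [b [ab TAE]]] : exists a b, a != b /\ (T :\: A)%SET = [set a; b]%SET.
  by move/eqP: cTA => /cards2P[a [b [ab ->]]]; exists a, b.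
have inTA c : (c \in T) && (c \notin A) = (c == a) || (c == b).
  have : (c \in (T :\: A)%SET) = (c \in [set a; b]%SET) by rewrite TAE.
  by rewrite !inE andbC.
have aA : a \notin A by have := inTA a; rewrite eqxx /= => /andP[].
have bA : b \notin A by have := inTA b; rewrite eqxx orbT /= => /andP[].
have cov c : c \notin A -> covers rk I (f (c |: A)%SET) && covers rk (f (c |: A)%SET) J.
  move=> cA; apply/andP; split; apply: coversE.
  - by rewrite -fA fle finset.subsetUr.
  - by rewrite -fA !frk cardsU1 cA.
  - exact: fJ.
  - by rewrite frk cardsU1 cA; exact: rJ.
have covP K : covers rk I K && covers rk K J = (K == f (a |: A)%SET) || (K == f (b |: A)%SET).
  apply/idP/orP => [/andP[h1 h2]|]; last by case=> /eqP->; exact: cov.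
  have [C fC] := fs _ (covers_le h2).
  have AC : A \subset C by rewrite -fle fA fC (covers_le h1).
  have : #|C| = #|A|.+1 by rewrite -!frk fA fC (covers_rk h1).
  move=> cC; have : #|(C :\: A)%SET| = 1%N by rewrite cardsD (finset.setIidPr AC) cC subSnn.
  move/eqP/cards1P => [c CAE].
  have CE : C = (c |: A)%SET.
    rewrite -CAE; apply/setP => x; rewrite !inE.
    by have := fintype.subsetP AC x; case: (x \in A) => [/(_ isT)->|_]; rewrite ?orbF.
  have : (c == a) || (c == b).
    have cCA : c \in (C :\: A)%SET by rewrite CAE inE.
    by rewrite -inTA; move: cCA; rewrite inE => /andP[-> /(fintype.subsetP (Tfull C))->].
  by rewrite -fC CE => /orP[/eqP->|/eqP->]; [left|right].
have ne : f (a |: A)%SET != f (b |: A)%SET.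
  apply/eqP => /finj e; have : a \in (b |: A)%SET by rewrite -e !inE eqxx.
  by rewrite !inE (negPf ab) (negPf aA).
rewrite (eq_bigl _ _ covP) (bigD1 (f (a |: A)%SET)) ?eqxx //= (bigD1 (f (b |: A)%SET)) /=; last first.
  by rewrite eqxx orbT eq_sym.
rewrite big1 ?addr0; last by move=> K; case: (K == f (a |: A)%SET); case: (K == f (b |: A)%SET).
have /andP[h1 h2] := cov _ aA; have /andP[h3 h4] := cov _ bA.
exact: hsgn.2 ne h1 h2 h3 h4.
Qed.

Lemma sgn_sum0k I J :
  \sum_(K | covers rk I K && covers rk K J) (sgn J K)%:~R * (sgn K I)%:~R = 0 :> k.
Proof.
under eq_bigr do rewrite -intrM.
by rewrite -(rmorph_sum (intr : {rmorphism int -> k})) sgn_sum0.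
Qed.

Variable A : S -> lmodType k.

Lemma coboundaryK (F : sheaf A) c : coboundary rk sgn F (coboundary rk sgn F c) = 0.
Proof.
apply: functional_extensionality_dep => J; rewrite /coboundary.
under eq_bigr => K _ do rewrite linear_sum scaler_sumr /=.
rewrite (exchange_big_dep xpredT) //= big1 // => I _.
have -> : \sum_(K | covers rk K J && covers rk I K)
    (sgn J K)%:~R *: res F K J ((sgn K I)%:~R *: res F I K (c I)) =
  \sum_(K | covers rk I K && covers rk K J) ((sgn J K)%:~R * (sgn K I)%:~R) *: res F I J (c I).
  rewrite (eq_bigl (fun K => covers rk I K && covers rk K J)); last by move=> K; rewrite andbC.
  apply: eq_bigr => K /andP[h1 h2]; rewrite linearZ /= scalerA; congr (_ *: _).
  exact: (res_comp F (covers_le h1) (covers_le h2)).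
by rewrite -scaler_suml sgn_sum0k scale0r.
Qed.

Lemma boundaryK (F : cosheaf A) c : boundary rk sgn F (boundary rk sgn F c) = 0.
Proof.
apply: functional_extensionality_dep => I; rewrite /boundary.
under eq_bigr => K _ do rewrite linear_sum scaler_sumr /=.
rewrite (exchange_big_dep xpredT) //= big1 // => J _.
have -> : \sum_(K | covers rk I K && covers rk K J)
    (sgn K I)%:~R *: cores F I K ((sgn J K)%:~R *: cores F K J (c J)) =
  \sum_(K | covers rk I K && covers rk K J) ((sgn J K)%:~R * (sgn K I)%:~R) *: cores F I J (c J).
  apply: eq_bigr => K /andP[h1 h2]; rewrite linearZ /= scalerA mulrC; congr (_ *: _).
  exact: (cores_comp F (covers_le h1) (covers_le h2)).
by rewrite -scaler_suml sgn_sum0k scale0r.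
Qed.

End Signs.

(** * Contraction of the columns *)

Section Lifting.
Context {k : comUnitRingType}.

(** Projectivity, phrased for maps [g] with values in the image of [f]. *)
Definition lifts (M : lmodType k) := forall (A B : lmodType k) (f : {linear A -> B})
  (g : {linear M -> B}), (forall x, exists a, f a = g x) ->
  exists h : {linear M -> A}, forall x, f (h x) = g x.

Lemma lifts_dsum (S : finType) (H : S -> lmodType k) (P : pred S) (A B : lmodType k)
    (f : {linear A -> B}) (g : {linear dsum H -> B}) :
  (forall J, P J -> lifts (H J)) -> (forall x, exists a, f a = g (dmask P x)) ->
  exists h : {linear dsum H -> A}, forall x, f (h x) = g (dmask P x).
Proof.
move=> lH fg.
have hJ J : exists h : {linear H J -> A}, forall x, f (h x) = g (dmask P (dinj x)).
  have [PJ|nP] := boolP (P J); last first.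
    exists \0 => x /=; rewrite linear0 dmask0 ?linear0 // => L PL.
    by rewrite dinj_ne //; apply: contraNneq nP => <-.
  exact: (lH J PJ A B f (g \o dmask P \o @dinj k S H J) (fun x => fg (dinj x))).
pose h J := projT1 (cid (hJ J)).
have hP J x : f (h J x) = g (dmask P (dinj x)) := projT2 (cid (hJ J)) x.
have hl : linear (fun x : dsum H => \sum_J h J (x J)).
  move=> a x y; rewrite scaler_sumr -big_split; apply: eq_bigr => J _.
  by rewrite dsumDE dsumZE linearP.
exists (pack_linear hl) => x /=; rewrite linear_sum /= [in RHS](dinj_sum x) !linear_sum.
by apply: eq_bigr => J _; rewrite hP.
Qed.

End Lifting.

Section Contraction.
Context {R : realType} {k : comUnitRingType} {Q : topologicalType}
  {disp : Order.disp_t} {S : finBPOrderType disp}.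
Variables (F dF : S -> set Q) (fdim rk : S -> nat) (n : nat).
Hypothesis hQ : buchsbaum_complex R k F dF fdim rk n.
Let hS := buchsbaum_simple hQ.
Variables (sgn : S -> S -> int) (hsgn : sign_convention rk sgn).
Local Notation H := (structure_val R k F dF fdim).
Variables (H0 : sheaf H) (hH0 : structure_sheaf rk sgn H0).
Local Notation delta := (coboundary rk sgn H0).
Local Notation supp D q y := (@supp R k Q disp S F dF fdim D q (y : dsum H)).
Implicit Types (I J : S) (y : dsum H).

Definition level I q : pred S := fun J => (J \in up I) && (fdim J == q).

Lemma supp_mask I q y : supp (up I) q (dmask (level I q) y).
Proof. by move=> J /negPf nJ; rewrite /dmask /level nJ. Qed.

Lemma mask_supp I q y : supp (up I) q y -> dmask (level I q) y = y.
Proof. exact: dmask_id. Qed.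

Lemma aug_upP I a y z : aug_up I (a *: y + z) = a * aug_up I y + aug_up I z.
Proof.
rewrite /aug_up mulr_sumr -big_split; apply: eq_bigr => J _; exact: (face_aug_linear hQ).
Qed.
Lemma aug_upD I y z : aug_up I (y + z) = aug_up I y + aug_up I z.
Proof. by rewrite -[y]scale1r aug_upP mul1r scale1r. Qed.
Lemma aug_upZ I a y : aug_up I (a *: y) = a * aug_up I y.
Proof.
have a0 : aug_up I (0 : dsum H) = 0.
  by have /eqP := aug_upD I 0 0; rewrite addr0 -subr_eq subrr => /eqP.
by rewrite -[a *: y]addr0 aug_upP a0 addr0.
Qed.
Lemma aug_upN I y : aug_up I (- y) = - aug_up I y.
Proof. by rewrite -scaleN1r aug_upZ mulN1r. Qed.

Lemma suppB I q y z : supp (up I) q y -> supp (up I) q z -> supp (up I) q (y - z).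
Proof. by move=> sy sz J nJ; rewrite -scaleN1r dsumDE dsumZE sy // sz // scaler0 addr0. Qed.
Lemma suppZ I q a y : supp (up I) q y -> supp (up I) q (a *: y).
Proof. by move=> sy J nJ; rewrite dsumZE sy // scaler0. Qed.

(** The contraction of the column above [I] onto the multiples of [u], as far as it has been
    constructed, namely in degrees below [m]. In degree 0 the augmentation takes the place of the
    differential. *)
Definition partial_contraction I u m (s : dsum H -> dsum H) := forall q y, (q < m)%N ->
  supp (up I) q y -> [/\ supp (up I) q.+1 (s y),
    q = 0%N -> delta (s y) + aug_up I y *: u = y &
    forall q', q = q'.+1 -> delta (s y) + s (delta y) = y].

Section Step.
Variable I : S.
Hypothesis I0 : I != \bot%O.
Variable u : dsum H.
Hypothesis su : supp (up I) 0 u.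
Hypothesis au : aug_up I u = 1.

(** By the contraction in lower degrees the right-hand side is a cycle, of augmentation 0 if m = 0,
    so exactness applies. It yields a preimage for each single [y]; [contraction_step] makes the
    choice linear by projectivity. *)
Lemma contraction_residue m (s : {linear dsum H -> dsum H}) y :
  partial_contraction I u m s -> supp (up I) m y ->
  exists2 w, supp (up I) m.+1 w &
    delta w = y - (if m == 0%N then aug_up I y *: u else s (delta y)).
Proof.
move=> hs sy; case: eqP => m0.
  subst m; apply: (delta_exact hQ hsgn hH0 I0) => //; first by apply: suppB => //; exact: suppZ.
  by move=> _; rewrite aug_upD aug_upN aug_upZ au mulr1 subrr.
case: m hs sy m0 => // m hs sy _; have sd := supp_delta hQ sgn H0 sy.
have [ss h0 h1] := hs m _ (ltnSn m) sd.
apply: (delta_exact hQ hsgn hH0 I0) => //; first exact: suppB.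
move=> q [qm]; subst q; rewrite linearB /=; apply/eqP; rewrite subr_eq0; apply/eqP/esym.
case: m hs sy sd ss h0 h1 => [|m] hs sy sd ss h0 h1.
  by rewrite -[RHS]h0 // (aug_delta hQ hsgn hH0 I0 sy) scale0r addr0.
rewrite -[RHS](h1 m erefl) coboundaryK ?linear0 ?addr0 //.
exact: simple_poset hS.
Qed.

Lemma contraction_step m (s : {linear dsum H -> dsum H}) :
  partial_contraction I u m s -> (forall J, level I m J -> lifts (H J)) ->
  exists s' : {linear dsum H -> dsum H}, partial_contraction I u m.+1 s'.
Proof.
move=> hs lH.
have gl : linear (fun y => y - (if m == 0%N then aug_up I y *: u else s (delta y))).
  move=> a x y; case: eqP => _.
    rewrite aug_upD aug_upZ; module k (dsum H).
  by rewrite !linearD !linearZ /=; module k (dsum H).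
pose f : {linear dsum H -> dsum H} := delta \o dmask (level I m.+1).
have [|h hh] := @lifts_dsum k S H (level I m) _ _ f (pack_linear gl) lH.
  move=> x; have [w sw dw] := contraction_residue hs (@supp_mask I m x); exists w.
  by rewrite /= mask_supp.
(* The masks keep the old values below degree [m] and use the lift [h] in degree [m] only. *)
pose s' : {linear dsum H -> dsum H} :=
  (s \o dmask (fun J => (fdim J < m)%N)) \+ ((dmask (level I m.+1) \o h) \o dmask (level I m)).
exists s' => q y; rewrite ltnS leq_eqVlt => /orP[/eqP->|qm] sy.
  have e1 z : supp (up I) m z -> s' z = dmask (level I m.+1) (h z).
    move=> sz; rewrite /= (mask_supp sz) [X in s X]dmask0 ?linear0 ?add0r // => J Jm; apply: sz.
    by rewrite negb_and; apply/orP; right; rewrite neq_ltn Jm.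
  have e2 : delta (s' y) = y - (if m == 0%N then aug_up I y *: u else s (delta y)).
    by rewrite e1 //; have := hh y; rewrite (mask_supp sy).
  have e3 z q' : (q' < m)%N -> supp (up I) q' z -> s' z = s z.
    move=> q'm sz; rewrite /= [dmask (level I m) z]dmask0 ?linear0 ?addr0.
      by rewrite dmask_id // => J Jm; apply: sz; apply: contra Jm => /andP[_ /eqP->].
    by move=> J /andP[_ /eqP Jm]; apply: sz; rewrite Jm negb_and; apply/orP; right; rewrite neq_ltn q'm orbT.
  split; first by rewrite e1 //; exact: supp_mask.
    by move=> m0; rewrite e2 m0 eqxx subrK.
  move=> q' mq'; rewrite e2 (e3 _ q'); last 2 first.
  - by rewrite mq'.
  - by apply: (supp_delta hQ); rewrite -mq'.
  by rewrite mq' subrK.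
have e3 z q' : (q' < m)%N -> supp (up I) q' z -> s' z = s z.
  move=> q'm sz; rewrite /= [dmask (level I m) z]dmask0 ?linear0 ?addr0.
    by rewrite dmask_id // => J Jm; apply: sz; apply: contra Jm => /andP[_ /eqP->].
  by move=> J /andP[_ /eqP Jm]; apply: sz; rewrite Jm negb_and; apply/orP; right; rewrite neq_ltn q'm orbT.
have [h1 h2 h3] := hs q y qm sy.
split; rewrite (e3 y q) // => q' qq'; rewrite (e3 (delta y) q'); first exact: h3 q' qq'.
  by apply: leq_trans qm; rewrite qq'.
by apply: (supp_delta hQ); rewrite -qq'.
Qed.

Lemma contraction_upto m : (forall J, (fdim J < m)%N -> J != \bot%O -> lifts (H J)) ->
  exists s : {linear dsum H -> dsum H}, partial_contraction I u m s.
Proof.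
elim: m => [|m IH] lH; first by exists \0.
have [|s hs] := IH; first by move=> J Jm; apply: lH; exact: leq_trans Jm _.
apply: (contraction_step hs) => J /andP[IJ /eqP Jm]; apply: lH; first by rewrite Jm.
by apply: contraNneq I0 => J0; move: IJ; rewrite inE J0 lex0.
Qed.

(** The column vanishes above degree [fdim I], hence so does the residue, and [x] is recovered from
    lower degrees. *)
Lemma contraction_top (s : {linear dsum H -> dsum H}) (x : H I) :
  partial_contraction I u (fdim I) s ->
  dinj x = if fdim I == 0%N then aug_up I (dinj x) *: u else s (delta (dinj x)).
Proof.
move=> hs; have sx : supp (up I) (fdim I) (dinj x).
  move=> J; rewrite inE negb_and => nJ; apply: dinj_ne; apply: contraTneq nJ => ->.
  by rewrite lexx eqxx.
have [w sw dw] := contraction_residue hs sx.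
apply/eqP; rewrite -subr_eq0 -dw; apply/eqP.
have -> : w = 0; last exact: linear0.
apply: functional_extensionality_dep => J; apply: sw; rewrite inE.
apply/negP => /andP[IJ /eqP e]; have := fdim_le hS IJ; by rewrite e ltnn.
Qed.

End Step.

(** By [contraction_top] the identity of [H I] factors through the differential, with values in
    faces of dimension one less, and [s]. So [H I] is a retract of a module that is projective by
    induction; for a face of dimension 0 it is a retract of [k]. *)
Lemma structure_lifts I : I != \bot%O -> lifts (H I).
Proof.
move: {2}(fdim I) (leqnn (fdim I)) => m; elim: m I => [|m IH] I Im I0.
  have [u su au] := aug_up_onto hQ I0.
  have I00 : fdim I = 0%N by apply/eqP; rewrite -leqn0.
  have [s hs] : exists s : {linear dsum H -> dsum H}, partial_contraction I u (fdim I) s.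
    by rewrite I00; exists \0.
  move=> A B f g fg.
  have gl : linear (fun c : k^o => (c : k) *: g (u I)) by move=> c x y; rewrite scalerDl -scalerA.
  have [a fa] := fg (u I).
  have hl : linear (fun x : H I => aug_up I (dinj x) *: a).
    by move=> c x y; rewrite linearP aug_upD aug_upZ scalerDl -scalerA.
  exists (pack_linear hl) => x /=; rewrite linearZ /= fa -linearZ.
  have := contraction_top I0 su au x hs; rewrite I00 /= => /(congr1 (@dproj k S H I)).
  by rewrite {1}/dproj dinjE /dproj dsumZE => {2}->.
have [le|gt] := leqP (fdim I) m; first exact: IH.
have Ime : fdim I = m.+1 by apply/eqP; rewrite eqn_leq Im gt.
have [u su au] := aug_up_onto hQ I0.
have [|s hs] := @contraction_upto I I0 u su au m.+1; first by move=> J Jm; exact: IH.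
move=> A B f g fg.
pose g' : {linear dsum H -> B} := g \o (@dproj k S H I \o s).
have [||h hh] := @lifts_dsum k S H (level I m) A B f g'.
- move=> J /andP[IJ /eqP Jm]; apply: IH; first by rewrite Jm.
  by apply: contraNneq I0 => J0; move: IJ; rewrite inE J0 lex0.
- by move=> x; exact: fg.
exists ((h \o delta) \o @dinj k S H I) => x; rewrite /= hh /= mask_supp; last first.
  apply: (supp_delta hQ) => J; rewrite inE negb_and => nJ; apply: dinj_ne.
  by apply: contraTneq nJ => ->; rewrite lexx Ime eqxx.
rewrite -Ime in hs; have := contraction_top I0 su au x hs; rewrite Ime /= => e.
by rewrite -e /dproj dinjE.
Qed.

Lemma column_contraction I : I != \bot%O -> exists (u : dsum H) (s : {linear dsum H -> dsum H}),
  [/\ supp (up I) 0 u, aug_up I u = 1,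
    forall q y, supp (up I) q y -> supp (up I) q.+1 (s y),
    forall y, supp (up I) 0 y -> delta (s y) + aug_up I y *: u = y &
    forall q y, supp (up I) q.+1 y -> delta (s y) + s (delta y) = y].
Proof.
move=> I0; have [u su au] := aug_up_onto hQ I0.
have [|s hs] := @contraction_upto I I0 u su au n.+1; first by move=> J _; exact: structure_lifts.
(* Faces have dimension at most [n], so the contraction constructed up to degree [n] works in all
   degrees. *)
have big0 q y : (n < q)%N -> supp (up I) q y -> y = 0.
  move=> nq sy; apply: functional_extensionality_dep => J; apply: sy.
  apply/negP => /andP[_ /eqP e]; have := fdimE hS J; rewrite e; lia.
exists u, s; split => //.
- move=> q y sy; have [le|gt] := leqP q n; first by have [] := hs q y le sy.
  by rewrite (big0 q y) // linear0 => J _.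
- by move=> y sy; have [_ h _] := hs 0%N y (ltn0Sn _) sy; exact: h.
- move=> q y sy; have [le|gt] := leqP q.+1 n; first by have [_ _ h] := hs q.+1 y le sy; exact: h q erefl.
  by rewrite (big0 q.+1 y) // !linear0 addr0.
Qed.

End Contraction.

(** * Products of chains *)

Section PrismMaps.
Context {k : comUnitRingType}.
Local Notation FS V := (@free_mod k (seq V)).
Implicit Types V W : choiceType.

Lemma prism2_cmap V W (X : choiceType) (f g h : W -> X) (r : V -> W) (c : FS V) :
  prism2 f g h (cmap r c) = prism2 (f \o r) (g \o r) (h \o r) c.
Proof.
apply: (@free_mod_ext _ _ _ (prism2 f g h \o cmap r) (prism2 (f \o r) (g \o r) (h \o r))) => s /=.
elim: s => [|v s IH]; first by rewrite cmap_gen !prism2_gen.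
by rewrite -cone_gen cmap_cone !prism2_cone IH -cmap_cone prism_cmap.
Qed.

Lemma cmap_prism2 V W (X : choiceType) (f g h : V -> W) (r : W -> X) (c : FS V) :
  cmap r (prism2 f g h c) = prism2 (r \o f) (r \o g) (r \o h) c.
Proof.
apply: (@free_mod_ext _ _ _ (cmap r \o prism2 f g h) (prism2 (r \o f) (r \o g) (r \o h))) => s /=.
elim: s => [|v s IH]; first by rewrite !prism2_gen linear0.
by rewrite -cone_gen !prism2_cone cmap_cone linearD /= IH cmap_prism.
Qed.

Lemma prism2_in V W n (f g h : V -> W) (C : set V) (D : set W) (c : FS V) :
  (forall v, C v -> [/\ D (f v), D (g v) & D (h v)]) ->
  supp_in (seq_in n C) c -> supp_in (seq_in n.+2 D) (prism2 f g h c).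
Proof.
move=> CD; apply: lin_ext_in => s; elim: s n => [|v s IH] [|n] [//= sn sC]; try exact: sm0.
have [Df Dg Dh] := CD _ (sC _ (mem_head _ _)).
have sC' w : w \in s -> C w by move=> ws; apply: sC; rewrite inE ws orbT.
apply: cone_in => //; apply: smD; last by apply: IH; split => //; case: sn.
rewrite -[gen _ - _]/(sprism g h (v :: s)) -prism_gen.
apply: (prism_in (C := C)); last exact: supp_gen.
by move=> w /CD[].
Qed.

End PrismMaps.

Section CrossProduct.
Context {R : realType} {k : comUnitRingType} {X : Type} (mul : X -> X -> X).
Local Notation FS V := (@free_mod k (seq V)).
Local Notation simplex := (simplex R).
Local Notation chain := (@chain R k X).
Local Notation sing := (@sing R X).

Lemma affs_op (V : normedModType R) m n (s : seq V) (f : 'I_m.+1 -> 'I_n.+1) (t : simplex m) :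
  affs s (simplex_op f t) = affs [seq nth 0 s (f i) | i <- enum 'I_m.+1] t.
Proof.
rewrite /affs; transitivity (\sum_(i < m.+1) (set_val t : 'rV_m.+1) 0 i *: nth 0 s (f i)).
  rewrite [RHS](partition_big f xpredT) //=; apply: eq_bigr => j _.
  by rewrite /simplex_op_fun mxE scaler_suml; apply: eq_bigr => l /eqP <-.
by apply: eq_bigr => i _; rewrite (nth_map ord0) ?size_enum_ord // nth_ord_enum.
Qed.

(** Places a simplex over the [i]-th vertex of a [p]-simplex; prisms between these copies
    triangulate products. *)
Definition pr (V : normedModType R) p (i : 'I_p.+1) (v : V) : V * 'rV[R]_p.+1 := (v, @vert R _ i).
Definition sprod p d : set ('rV[R]_d.+1 * 'rV[R]_p.+1) := [set q | simplex d q.1 /\ simplex p q.2].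
Definition Kx p d (a : simplex p -> X) (s : simplex d -> X) (q : 'rV[R]_d.+1 * 'rV[R]_p.+1) : X :=
  mul (ext a q.2) (ext s q.1).

Lemma sprod_convex p d : convex_in (@sprod p d).
Proof.
move=> n t s sn sC.
have fs (r : seq 'I_n.+1) (F : 'I_n.+1 -> 'rV[R]_d.+1 * 'rV[R]_p.+1) :
    \sum_(i <- r) F i = (\sum_(i <- r) (F i).1, \sum_(i <- r) (F i).2).
  by elim: r => [|i r IH]; rewrite ?big_nil // !big_cons IH.
have ss : size (map fst s) = n.+1 /\ size (map snd s) = n.+1 by rewrite !size_map.
rewrite /affs fs; split => /=.
  have h := @simplex_convex R d n t (map fst s) ss.1; move: h; rewrite /affs => h.
  rewrite (eq_bigr (fun i : 'I_n.+1 => (set_val t : 'rV_n.+1) 0 i *: nth 0 (map fst s) i)) => [|i _].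
    by apply: h => _ /mapP[q /sC[h _] ->].
  by rewrite (nth_map 0) ?sn.
have h := @simplex_convex R p n t (map snd s) ss.2; move: h; rewrite /affs => h.
rewrite (eq_bigr (fun i : 'I_n.+1 => (set_val t : 'rV_n.+1) 0 i *: nth 0 (map snd s) i)) => [|i _].
  by apply: h => _ /mapP[q /sC[_ h] ->].
by rewrite (nth_map 0) ?sn.
Qed.

Definition oppair p d p' d' (g : 'I_p.+1 -> 'I_p'.+1) (f : 'I_d.+1 -> 'I_d'.+1)
    (q : 'rV[R]_d.+1 * 'rV[R]_p.+1) : 'rV[R]_d'.+1 * 'rV[R]_p'.+1 :=
  (simplex_op_fun f q.1, simplex_op_fun g q.2).
Lemma oppair_linear p d p' d' g f : linear (@oppair p d p' d' g f).
Proof. by move=> a u v; rewrite /oppair !linearP. Qed.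
HB.instance Definition _ p d p' d' g f := GRing.isLinear.Build R _ _ _
  (@oppair p d p' d' g f) (@oppair_linear p d p' d' g f).

Lemma Kx_op p d p' d' (g : 'I_p.+1 -> 'I_p'.+1) (f : 'I_d.+1 -> 'I_d'.+1)
    (a : simplex p' -> X) (s : simplex d' -> X) n c : supp_in (seq_in n (@sprod p d)) c ->
  realc (Kx a s) (cmap (oppair g f) c) = realc (k := k) (Kx (a \o simplex_op g) (s \o simplex_op f)) c.
Proof.
move=> hc; rewrite realc_cmap; apply: realc_congr hc; first exact: sprod_convex.
by move=> q [q1 q2]; rewrite /Kx !ext_op.
Qed.

Lemma prism_sprod p d i j n (c : FS 'rV[R]_d.+1) : supp_in (seq_in n (simplex d)) c ->
  supp_in (seq_in n.+1 (@sprod p d)) (prism (pr i) (pr j) c).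
Proof. by apply: prism_in => v dv; split; split => //=; exact: simplex_vert. Qed.

Lemma oppair_pr p d p' d' (g : 'I_p.+1 -> 'I_p'.+1) (f : 'I_d.+1 -> 'I_d'.+1) i v :
  oppair g f (pr i v) = pr (g i) (simplex_op_fun f v).
Proof. by rewrite /oppair /pr /= simplex_op_fun_vert. Qed.

(* The product with the path a, where the prism over the d-simplex s triangulates [d] x [1]. *)
Definition cr1 (a : simplex 1 -> X) : chain -> chain := lin_ext (fun s : sing =>
  realc (Kx a (tagged s)) (prism (pr ord0) (pr ord_max) (gen (@std R (tag s))))).
HB.instance Definition _ a := GRing.Linear.on (cr1 a).

Lemma cr1_gen a d (s : simplex d -> X) :
  cr1 a (gen (mk_sing s)) = realc (Kx a s) (prism (pr ord0) (pr ord_max) (gen (@std R d))).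
Proof. exact: lin_ext_gen. Qed.

(** The product with a singular triangle. Its boundary formula shows that products with a cycle
    depend on the other factor up to homology only. *)
Definition cr2 (a : simplex 2 -> X) : chain -> chain := lin_ext (fun s : sing =>
  realc (Kx a (tagged s)) (prism2 (pr ord0) (pr (fintype.lift ord0 ord0)) (pr ord_max) (gen (@std R (tag s))))).
HB.instance Definition _ a := GRing.Linear.on (cr2 a).

Lemma cr2_gen a d (s : simplex d -> X) :
  cr2 a (gen (mk_sing s)) = realc (Kx a s)
    (prism2 (pr ord0) (pr (fintype.lift ord0 ord0)) (pr ord_max) (gen (@std R d))).
Proof. exact: lin_ext_gen. Qed.

Lemma realc_pr p d (a : simplex p -> X) (s : simplex d -> X) i :
  realc (Kx a s) (cmap (pr i) (gen (@std R d))) =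
  gen (mk_sing (fun t : simplex d => mul (ext a (@vert R _ i)) (s t))) :> chain.
Proof.
rewrite realc_cmap_affine; last by move=> n r t sn; rewrite (@affs_pair _ _ _ _ id) // map_id.
rewrite realc_gen (real_size _ (size_std _)); congr (gen (mk_sing _)); apply/funext => t.
by rewrite /Kx /= affs_std /ext set_valK.
Qed.

Definition trl (x : X) : chain -> chain := chain_push (mul x).
HB.instance Definition _ x := GRing.Linear.on (trl x).

Lemma trl_gen x d (s : simplex d -> X) : trl x (gen (mk_sing s)) = gen (mk_sing (fun t => mul x (s t))).
Proof. by rewrite /trl /chain_push lin_ext_gen. Qed.

Lemma prism_face p p' d (g : 'I_p.+1 -> 'I_p'.+1) i j (l : 'I_d.+2) (a : simplex p' -> X) (s : simplex d.+1 -> X) :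
  realc (Kx a s) (prism (pr (g i)) (pr (g j)) (cmap (simplex_op_fun (fintype.lift l)) (gen (@std R d)))) =
  realc (Kx (a \o simplex_op g) (s \o simplex_op (fintype.lift l)))
    (prism (pr i) (pr j) (gen (@std R d))) :> chain.
Proof.
rewrite -(@Kx_op _ _ _ _ _ _ _ _ d.+2); last by apply: prism_sprod; exact: std_supp.
rewrite prism_cmap cmap_prism; congr (realc _ (prism _ _ _)); apply/funext => v /=;
  by rewrite oppair_pr.
Qed.

Lemma simplex_op_id d (t : simplex d) : simplex_op id t = t.
Proof.
apply: val_inj; apply/rowP => j; rewrite [LHS]mxE (bigD1 j) //= big1 ?addr0 //.
by move=> i /andP[/eqP->]; rewrite eqxx.
Qed.

Lemma bd_cr1 a c : chain_bd (cr1 a c) =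
  trl (ext a (@vert R _ ord_max)) c - trl (ext a (@vert R _ ord0)) c - cr1 a (chain_bd c).
Proof.
apply: (@free_mod_ext _ _ _ (@chain_bd R k X \o cr1 a)
  (trl (ext a (@vert R _ ord_max)) \- trl (ext a (@vert R _ ord0)) \- (cr1 a \o @chain_bd R k X))) => -[d s] /=.
rewrite -[existT _ _ _]/(mk_sing s) cr1_gen chain_bd_realc bd_prism !linearB /= !realc_pr !trl_gen.
congr (_ - _); rewrite chain_bd_gen; case: d s => [|d] s.
  rewrite bd_gen [std 0]/std enum_ordSl enum_ord0 /= !linear0 addr0 prism_gen /= !linear0.
  by [].
rewrite bd_std /= !linear_sum; apply: eq_bigr => i _; rewrite !linearZ /=; congr (_ *: _).
rewrite cr1_gen -[pr ord0 in LHS]/(pr (id ord0)) -[pr ord_max in LHS]/(pr (id ord_max)).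
rewrite prism_face; congr realc; apply/funext => q; rewrite /Kx /ext /=.
by rewrite simplex_op_id.
Qed.

Lemma bd_cr2 (a : simplex 2 -> X) c : chain_bd (cr2 a c) =
  cr1 (a \o simplex_op (fintype.lift ord0)) c - cr1 (a \o simplex_op (fintype.lift (fintype.lift ord0 ord0))) c
  + cr1 (a \o simplex_op (fintype.lift ord_max)) c + cr2 a (chain_bd c).
Proof.
apply: (@free_mod_ext _ _ _ (@chain_bd R k X \o cr2 a)
  (cr1 (a \o simplex_op (fintype.lift ord0)) \- cr1 (a \o simplex_op (fintype.lift (fintype.lift ord0 ord0)))
  \+ cr1 (a \o simplex_op (fintype.lift ord_max)) \+ (cr2 a \o @chain_bd R k X))) => -[d s] /=.
rewrite -[existT _ _ _]/(mk_sing s) cr2_gen chain_bd_realc bd_prism2 !linearD /= linearN /= !cr1_gen.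
have face (l : 'I_3) (i j : 'I_3) : i = fintype.lift l ord0 -> j = fintype.lift l ord_max ->
    realc (Kx a s) (prism (pr i) (pr j) (gen (@std R d))) =
    realc (Kx (a \o simplex_op (fintype.lift l)) s) (prism (pr ord0) (pr ord_max) (gen (@std R d))) :> chain.
  move=> -> ->.
  have -> : Kx (a \o simplex_op (fintype.lift l)) s = Kx (a \o simplex_op (fintype.lift l)) (s \o simplex_op id).
    by apply/funext => q; rewrite /Kx /ext /= simplex_op_id.
  rewrite -(@Kx_op _ _ _ _ _ _ _ _ d.+2); last by apply: prism_sprod; exact: std_supp.
  rewrite cmap_prism; congr (realc _ (prism _ _ _)); apply/funext => v /=; rewrite oppair_pr.
    congr pr; apply/rowP => j'; rewrite mxE (bigD1 j') //= big1 ?addr0 // => i' /andP[/eqP->]; by rewrite eqxx.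
  congr pr; apply/rowP => j'; rewrite mxE (bigD1 j') //= big1 ?addr0 // => i' /andP[/eqP->]; by rewrite eqxx.
rewrite (face ord0) ?(face (fintype.lift ord0 ord0) ord0 ord_max) ?(face ord_max ord0 (fintype.lift ord0 ord0)); try by apply/val_inj.
congr (_ + _); rewrite chain_bd_gen; case: d s face => [|d] s face.
  rewrite bd_gen [std 0]/std enum_ordSl enum_ord0 /= !linear0 addr0 prism2_gen /= !linear0.
  by [].
rewrite bd_std /= !linear_sum; apply: eq_bigr => i _; rewrite !linearZ /=; congr (_ *: _).
rewrite cr2_gen prism2_cmap.
have -> : Kx a (s \o simplex_op (fintype.lift i)) = Kx (a \o simplex_op id) (s \o simplex_op (fintype.lift i)).
  by apply/funext => q; rewrite /Kx /ext /= simplex_op_id.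
rewrite -(@Kx_op _ _ _ _ _ _ _ _ d.+3); last first.
  by apply: (prism2_in (C := simplex d)); [move=> v dv; split; split => //=; exact: simplex_vert|exact: std_supp].
rewrite cmap_prism2.
congr (realc _ (prism2 _ _ _ _)); apply/funext => v /=; rewrite oppair_pr //.
Qed.

Definition lmap2 (V : normedModType R) (s : seq V) n p (q : 'rV[R]_n.+1 * 'rV[R]_p.+1) : V * 'rV[R]_p.+1 :=
  (lmap s q.1, q.2).
Lemma lmap2_linear V s n p : linear (@lmap2 V s n p).
Proof. by move=> a u v; rewrite /lmap2 linearP. Qed.
HB.instance Definition _ V s n p := GRing.isLinear.Build R _ _ _ (@lmap2 V s n p) (@lmap2_linear V s n p).

Lemma cr1_realc (V : normedModType R) (K : V -> X) a c : cr1 a (realc K c) =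
  realc (fun q : V * 'rV[R]_2 => mul (ext a q.2) (K q.1)) (prism (pr ord0) (pr ord_max) c).
Proof.
apply: (@free_mod_ext _ _ _ (cr1 a \o realc K) (realc (fun q : V * 'rV[R]_2 => mul (ext a q.2) (K q.1)) \o
  prism (pr ord0) (pr ord_max))) => s /=.
rewrite realc_gen; case: s => [|v s]; first by rewrite prism_gen !linear0.
rewrite cr1_gen.
rewrite (realc_congr (K' := (fun q : V * 'rV[R]_2 => mul (ext a q.2) (K q.1)) \o @lmap2 V (v :: s) (size s) 1)
  (@sprod_convex 1 (size s)) (n := (size s).+2)); last 2 first.
- by move=> q [dq _]; rewrite /Kx /ext /affs /= to_simplexK.
- by apply: prism_sprod; exact: std_supp.
rewrite -realc_cmap cmap_prism.
have -> : gen (v :: s) = cmap (@lmap R V (v :: s) (size s)) (gen (@std R (size s))) :> FS V.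
  by rewrite cmap_gen map_lmap_std.
by rewrite [in RHS]prism_cmap.
Qed.

Section Anticommute.
Variables a b : simplex 1 -> X.
Hypothesis mulC : forall x y z, mul x (mul y z) = mul y (mul x z).

(** The triangle of the square in which the coordinate of [c1] increases before that of [c2];
    swapping the coordinates exchanges the two triangles. *)
Definition sq2 (c1 c2 : simplex 1 -> X) : chain -> chain := lin_ext (fun s : sing =>
  realc (fun q : 'rV[R]_(tag s).+1 * 'rV[R]_2 * 'rV[R]_2 => mul (ext c1 q.2) (Kx c2 (tagged s) q.1))
    (prism2 (pr ord0 \o pr ord0) (pr ord_max \o pr ord0) (pr ord_max \o pr ord_max)
       (gen (@std R (tag s))))).
HB.instance Definition _ c1 c2 := GRing.Linear.on (sq2 c1 c2).

Definition swap (V : normedModType R) p (q : V * 'rV[R]_p * 'rV[R]_p) : V * 'rV[R]_p * 'rV[R]_p :=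
  (q.1.1, q.2, q.1.2).
Lemma swap_linear V p : linear (@swap V p). Proof. by []. Qed.
HB.instance Definition _ V p := GRing.isLinear.Build R _ _ _ (@swap V p) (@swap_linear V p).

(** The right-hand side is antisymmetric in [a] and [b]. Hence products with paths anticommute and
    have square zero on the level of chains, without any division by 2. *)
Lemma cr1_cr1 c : cr1 a (cr1 b c) = sq2 a b c - sq2 b a c.
Proof.
apply: (@free_mod_ext _ _ _ (cr1 a \o cr1 b) (sq2 a b \- sq2 b a)) => -[d s] /=.
rewrite -[existT _ _ _]/(mk_sing s) cr1_gen cr1_realc prism_prism linearB /= /sq2 !lin_ext_gen /=.
congr (_ - _).
have -> : (fun q : 'rV[R]_d.+1 * 'rV[R]_2 * 'rV[R]_2 => mul (ext b q.2) (Kx a s q.1)) =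
  (fun q : 'rV[R]_d.+1 * 'rV[R]_2 * 'rV[R]_2 => mul (ext a q.2) (Kx b s q.1)) \o @swap _ _.
  by apply/funext => q /=; rewrite /Kx /= mulC.
by rewrite -realc_cmap cmap_prism2.
Qed.

End Anticommute.

Definition front n : 'I_2 -> 'I_n.+2 := fun i => inord i.

(* c is evaluated on the front edge. For a cocycle c, this is a contraction dual to the
   product with a loop, by cap_cr1. *)
Definition cap (c : chain -> k) : chain -> chain := lin_ext (fun s : sing =>
  match s with
  | existT d.+1 s => c (gen (mk_sing (s \o simplex_op (@front d)))) *:
      gen (mk_sing (s \o simplex_op (fintype.lift ord0)))
  | _ => 0
  end).
HB.instance Definition _ c := GRing.Linear.on (cap c).

Definition lcap (V : normedModType R) (K : V -> X) (c : chain -> k) : FS V -> chain :=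
  lin_ext (fun s : seq V => match s with
    | [:: v, w & r] => c (real K [:: v; w]) *: real K (w :: r)
    | _ => 0 end).
HB.instance Definition _ V K c := GRing.Linear.on (@lcap V K c).

Lemma cap_realc (V : normedModType R) (K : V -> X) c x : cap c (realc K x) = lcap K c x.
Proof.
apply: (@free_mod_ext _ _ _ (cap c \o realc K) (lcap K c)) => s /=.
rewrite realc_gen /lcap lin_ext_gen; case: s => [|v [|w r]]; first by rewrite linear0.
  by rewrite /cap lin_ext_gen.
rewrite /cap [LHS]lin_ext_gen /=; congr (_ *: _).
  congr (c (gen (mk_sing _))); apply/funext => t /=; rewrite affs_op.
  by rewrite enum_ordSl enum_ordSl enum_ord0 /= /front !inordK.
congr (gen (mk_sing _)); apply/funext => t /=.
by rewrite (affs_face ord0).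
Qed.

Lemma lcap_cone2 (V : normedModType R) (K : V -> X) c v w y :
  lcap K c (cone v (cone w y)) = c (real K [:: v; w]) *: realc K (cone w y).
Proof.
have hl : linear (fun x : chain => c (real K [:: v; w]) *: x).
  by move=> a x z; rewrite scalerDr !scalerA mulrC.
apply: (@free_mod_ext _ _ _ (lcap K c \o (cone v \o cone w)) (pack_linear hl \o (realc K \o cone w))) => s /=.
by rewrite !cone_gen /lcap lin_ext_gen realc_gen.
Qed.

End CrossProduct.

(** * Comparison with the shuffle product *)

Section ShuffleProduct.
Context {R : realType} {k : comUnitRingType} {X : Type} (mul : X -> X -> X).
Local Notation FS V := (@free_mod k (seq V)).
Local Notation simplex := (simplex R).
Local Notation chain := (@chain R k X).
Local Notation sing := (@sing R X).

Lemma sprismE (V W : choiceType) (f g : V -> W) (s : seq V) : sprism f g s =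
  \sum_(i < size s) (-1) ^+ i *: gen (map f (take i.+1 s) ++ map g (drop i s)) :> FS W.
Proof.
elim: s => [|v s IH]; first by rewrite big_ord0.
rewrite [LHS]/= [size _]/= big_ord_recl /= expr0 scale1r take0; congr (_ + _).
rewrite IH linear_sum -sumrN; apply: eq_bigr => i _.
by rewrite linearZ /= cone_gen -scaleNr exprS mulN1r.
Qed.

Lemma steps_single d (i : 'I_(1 + d)) (v : 'I_(1 + d).+1) :
  steps_before (p := 1) (q := d) 1 (finset.set1 i) v = (if (i < v)%N then ord_max else ord0).
Proof.
apply: val_inj; rewrite /steps_before; case: ifPn => iv.
  have -> : finset (fun x : 'I_(1 + d) => (x \in finset.set1 i) && (x < v)%N) = finset.set1 i.
    by apply/setP => x; rewrite !inE; case: eqP => // ->.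
  by rewrite cards1 /= inordK.
have -> : finset (fun x : 'I_(1 + d) => (x \in finset.set1 i) && (x < v)%N) = finset.set0.
  by apply/setP => x; rewrite !inE; case: eqP => // ->; rewrite (negPf iv).
by rewrite cards0 /= inordK.
Qed.

Lemma steps_rest d (i : 'I_(1 + d)) (v : 'I_(1 + d).+1) :
  steps_before (p := 1) (q := d) d (finset.setC (finset.set1 i)) v = inord (v - (i < v)) :> 'I_d.+1.
Proof.
rewrite /steps_before; congr inord.
have -> : finset (fun x : 'I_(1 + d) => (x \in finset.setC (finset.set1 i)) && (x < v)%N) =
    (finset (fun x : 'I_(1 + d) => (x < v)%N) :\ i)%SET.
  by apply/setP => x; rewrite !inE.
have cv : #|finset (fun x : 'I_(1 + d) => (x < v)%N)| = v.
  have vd : (v <= 1 + d)%N by rewrite -ltnS.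
  have -> : finset (fun x : 'I_(1 + d) => (x < v)%N) = ([set widen_ord vd j | j : 'I_v])%SET.
    apply/setP => x; rewrite inE; apply/idP/imsetP => [xv|[j _ ->]]; last by rewrite /=.
    by exists (Ordinal xv) => //; exact: val_inj.
  by rewrite card_imset ?card_ord // => j j' /(congr1 val) /= h; exact: val_inj.
apply/eqP; rewrite -(eqn_add2l (i < v)) subnKC; last by case: (ltnP i v) => // /(leq_trans _); apply.
by rewrite -[X in _ == X]cv (cardsD1 i (finset (fun x : 'I_(1 + d) => (x < v)%N))) inE.
Qed.

Lemma shuffle_inv_single d (i : 'I_(1 + d)) : shuffle_inv (p := 1) (q := d) (finset.set1 i) = i.
Proof.
rewrite /shuffle_inv.
have -> : finset (fun xy : 'I_(1 + d) * 'I_(1 + d) =>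
    [&& xy.1 \in finset.set1 i, xy.2 \notin finset.set1 i & (xy.2 < xy.1)%N]) =
    ([set (i, widen_ord (ltnW (ltn_ord i)) j) | j : 'I_i])%SET.
  apply/setP => -[x y]; rewrite !inE /=; apply/and3P/imsetP => [[/eqP-> yi lt]|[j _ [-> ->]]].
    by exists (Ordinal lt) => //; congr pair; exact: val_inj.
  split; [by []|by rewrite -val_eqE /= neq_ltn (ltn_ord j)|exact: (ltn_ord j)].
by rewrite card_imset ?card_ord // => j j' [/= h]; exact: val_inj.
Qed.

Lemma simplex_op_fun_sum m d (f : 'I_m.+1 -> 'I_d.+1) (w : 'rV[R]_m.+1) :
  simplex_op_fun f w = \sum_i w 0 i *: @vert R _ (f i).
Proof.
rewrite [w in LHS]row_sum_delta linear_sum; apply: eq_bigr => i _.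
by rewrite linearZ /= -/(@vert R _ i) simplex_op_fun_vert.
Qed.

Lemma simplex_opE m d (f : 'I_m.+1 -> 'I_d.+1) (t : simplex m) :
  simplex_op f t = to_simplex (simplex_op_fun f (set_val t)).
Proof.
apply: val_inj; rewrite [RHS]to_simplexK //; apply: simplex_op_fun_in.
by case: t => t ht /=; exact: set_mem.
Qed.

(** A shuffle of one step with [d] steps is the position [i] of the single step. It has [i]
    inversions, and its term is the [i]-th simplex of the prism as in [sprismE]. *)
Lemma sing_product_cr1 d (a : simplex 1 -> X) (s : simplex d -> X) :
  sing_product k mul a s = cr1 mul a (gen (mk_sing s)) :> chain.
Proof.
rewrite cr1_gen prism_gen sprismE linear_sum size_std /sing_product /=.
rewrite (reindex_onto (fun i : 'I_d.+1 => finset.set1 (i : 'I_(1 + d)))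
  (fun A : {set 'I_(1 + d)} => odflt ord0 [pick x in A])) /=; last first.
  move=> A /cards1P[x ->]; case: pickP => [y|/(_ x)]; rewrite !inE; first by move/eqP->.
  by rewrite eqxx.
apply: eq_big => [i|i _].
  rewrite cards1 eqxx /=; case: pickP => [y|/(_ i)]; rewrite !inE; first by move/eqP->; rewrite eqxx.
  by rewrite eqxx.
rewrite shuffle_inv_single linearZ /= realc_gen; congr (_ *: _).
have sz : size ([seq pr (ord0 : 'I_2) j | j <- take i.+1 (@std R d)] ++ [seq pr (ord_max : 'I_2) j | j <- drop i (@std R d)]) = d.+2.
  by rewrite size_cat !size_map size_takel ?size_drop size_std //; have := ltn_ord i; lia.
rewrite (real_size _ sz); congr (gen (mk_sing _)); apply/funext => t; rewrite /Kx.
have fs (r : seq 'I_d.+2) (F : 'I_d.+2 -> 'rV[R]_d.+1 * 'rV[R]_2) :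
    \sum_(i <- r) F i = (\sum_(i <- r) (F i).1, \sum_(i <- r) (F i).2).
  by elim: r => [|j r IH]; rewrite ?big_nil // !big_cons IH.
rewrite /affs fs /=.
have nE (v : 'I_d.+2) : nth 0 ([seq pr (ord0 : 'I_2) j | j <- take i.+1 (@std R d)] ++
    [seq pr (ord_max : 'I_2) j | j <- drop i (@std R d)]) v =
    (vert (inord (v - (i < v)) : 'I_d.+1), vert (if (i < v)%N then ord_max else ord0)).
  have id := ltn_ord i; have vd := ltn_ord v.
  rewrite nth_cat size_map size_takel ?size_std // ltnS; case: (leqP v i) => vi.
    rewrite (nth_map 0) ?size_takel ?size_std // nth_take // subn0.
    by rewrite /pr -(@nth_std R d (inord v)) inordK // ltnS (leq_trans vi).
  rewrite (nth_map 0) ?size_drop ?size_std; last by lia.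
  rewrite nth_drop (_ : (i + (v - i.+1) = v - 1)%N); last by lia.
  by rewrite /pr -(@nth_std R d (inord (v - 1))) inordK //; lia.
rewrite /ext !simplex_opE !simplex_op_fun_sum; congr (mul (a (to_simplex _)) (s (to_simplex _)));
  apply: eq_bigr => v _; rewrite nE /=; congr (_ *: vert _).
  exact: steps_single.
exact: steps_rest.
Qed.

End ShuffleProduct.

(** * Cap products with 1-cochains *)

Section CapProduct.
Context {R : realType} {k : comUnitRingType}.
Local Notation FS V := (@free_mod k (seq V)).
Local Notation simplex := (simplex R).

(** By the cocycle identity on the first three vertices, the faces that omit the first or the second
    vertex together give, up to sign, the first face of the cap product; all other faces keep the
    front edge. *)
Lemma lcap_bd (X : Type) (V : normedModType R) (K : V -> X) (c : {linear @chain R k X -> k^o})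
    (D : set V) n y :
  (forall v w x, D v -> D w -> D x -> c (chain_bd (real K [:: v; w; x])) = 0) ->
  supp_in (seq_in n D) y -> lcap K c (bd y) = - chain_bd (lcap K c y).
Proof.
move=> hc; apply: (lin_eq_on (f := lcap K c \o @bd k V) (g := \- (@chain_bd R k X \o lcap K c))) => s [_ sD] /=.
rewrite bd_gen; case: s sD => [|v [|w [|x r]]] sD.
- by rewrite [sbd _]/= linear0 /lcap lin_ext_gen linear0 oppr0.
- by rewrite /= linear0 subr0 /lcap !lin_ext_gen !linear0 ?oppr0.
- rewrite [sbd _]/= linear0 subr0 cone_gen linearB /= /lcap !lin_ext_gen subrr linearZ /=.
  by rewrite chain_bd_gen /= scaler0 oppr0.
have vwx := hc v w x (sD v _) (sD w _) (sD x _); rewrite !inE !eqxx !orbT in vwx.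
pose a : k := c (real K [:: w; x]); pose b : k := c (real K [:: v; x]); pose e : k := c (real K [:: v; w]).
have {}vwx : a - (b - e) = 0.
  move/(_ isT isT isT): vwx; rewrite chain_bd_real /= linear0 subr0.
  rewrite [cone v _]linearB /= !cone_gen 2!linearB /= realc_gen linearB /= !realc_gen linearB /=.
  exact.
have [z yE] : exists z : FS V, z = @sbd k V (x :: r) by exists (@sbd k V (x :: r)).
have -> : sbd [:: v, w, x & r] = gen [:: w, x & r] - cone v (gen (x :: r) - cone w z) by rewrite yE.
have -> : lcap K c (gen [:: v, w, x & r]) = e *: real K [:: w, x & r] by exact: lin_ext_gen.
have bE : chain_bd (real K [:: w, x & r]) = real K (x :: r) - realc K (cone w z).
  by rewrite -[real K (x :: r)]realc_gen -linearB yE; exact: chain_bd_real.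
have cB p q : cone v (p - q) = cone v p - cone v q :> FS V by rewrite linearB.
have lB p q : lcap K c (p - q) = lcap K c p - lcap K c q by rewrite linearB.
have bZ p : chain_bd (e *: p) = e *: chain_bd p :> @chain R k X by rewrite linearZ.
rewrite cB !lB cone_gen lcap_cone2 -/e bZ bE.
have -> : lcap K c (gen [:: w, x & r]) = a *: real K (x :: r) by exact: lin_ext_gen.
have -> : lcap K c (gen [:: v, x & r]) = b *: real K (x :: r) by exact: lin_ext_gen.
have -> : a = b - e by apply/eqP; rewrite -subr_eq0 vwx.
by module k (@chain R k X).
Qed.

Section Space.
Context {X : topologicalType} (mul : X -> X -> X) (A : set X) (one : X).
Hypothesis mulc : continuous (fun p : X * X => mul p.1 p.2).
Hypothesis mulA : forall x y, A x -> A y -> A (mul x y).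
Hypothesis mulCA : forall x y z, mul x (mul y z) = mul y (mul x z).
Hypothesis mulC : forall x y, mul x y = mul y x.
Hypothesis mul1 : forall x, mul one x = x.
Local Notation C := (@chains_in R k X).

Lemma Kx_continuous p d (a : simplex p -> X) (s : simplex d -> X) :
  continuous a -> continuous s -> {within @sprod R p d, continuous (Kx mul a s)}.
Proof.
move=> ca cs; apply: (within_comp (D := setT) (h := fun x : X * X => mul x.1 x.2)
  (f := fun q : 'rV[R]_d.+1 * 'rV[R]_p.+1 => (ext a q.2, ext s q.1))).
- apply: within_pair.
    apply: (within_comp (D := simplex p) (f := snd)); last exact: ext_continuous.
      by apply: within_cont => ?; exact: cvg_snd.
    by move=> q [].
  apply: (within_comp (D := simplex d) (f := fst)); last exact: ext_continuous.
    by apply: within_cont => ?; exact: cvg_fst.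
  by move=> q [].
- by [].
- exact: within_cont.
Qed.

Lemma cr1_in d (a : simplex 1 -> X) c : continuous a -> (forall t, A (a t)) ->
  C d A c -> C d.+1 A (cr1 mul a c).
Proof.
move=> ca aA; apply: (chains_in_ind (U := submod_preim (cr1 mul a : {linear _ -> _}) (C d.+1 A))) => s cs sA.
rewrite sm_preimE /= cr1_gen; apply: (realc_in (C := @sprod R 1 d)).
- exact: sprod_convex.
- exact: Kx_continuous.
- by move=> q _; apply: mulA; exact: ext_maps.
- by apply: prism_sprod; exact: std_supp.
Qed.

Lemma cr2_in d (a : simplex 2 -> X) c : continuous a -> (forall t, A (a t)) ->
  C d A c -> C d.+2 A (cr2 mul a c).
Proof.
move=> ca aA; apply: (chains_in_ind (U := submod_preim (cr2 mul a : {linear _ -> _}) (C d.+2 A))) => s cs sA.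
rewrite sm_preimE /= cr2_gen; apply: (realc_in (C := @sprod R 2 d)).
- exact: sprod_convex.
- exact: Kx_continuous.
- by move=> q _; apply: mulA; exact: ext_maps.
apply: (prism2_in (C := simplex d)); last exact: std_supp.
by move=> v dv; split; split => //=; exact: simplex_vert.
Qed.

Definition cr1z (x : @chain R k X) : @chain R k X -> @chain R k X := lin_ext (fun s : @sing R X =>
  match s with existT 1 a => cr1 mul a x | _ => 0 end).
HB.instance Definition _ x := GRing.Linear.on (cr1z x).
Definition cr2z (x : @chain R k X) : @chain R k X -> @chain R k X := lin_ext (fun s : @sing R X =>
  match s with existT 2 a => cr2 mul a x | _ => 0 end).
HB.instance Definition _ x := GRing.Linear.on (cr2z x).
Definition trlz (x : @chain R k X) : @chain R k X -> @chain R k X := lin_ext (fun s : @sing R X =>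
  match s with existT 0 a => trl mul (ext a (@vert R 0 ord0)) x | _ => 0 end).
HB.instance Definition _ x := GRing.Linear.on (trlz x).

Lemma cr1z_gen a x : cr1z x (gen (mk_sing a)) = cr1 mul a x.
Proof. exact: lin_ext_gen. Qed.
Lemma cr2z_gen a x : cr2z x (gen (mk_sing a)) = cr2 mul a x.
Proof. exact: lin_ext_gen. Qed.

Lemma ext_vert_op m d (f : 'I_m.+1 -> 'I_d.+1) (a : simplex d -> X) i :
  ext (a \o simplex_op f) (@vert R m i) = ext a (@vert R d (f i)).
Proof. by rewrite ext_op ?simplex_op_fun_vert //; exact: simplex_vert. Qed.

Lemma cr2z_bd b x : C 2 A b -> chain_bd (cr2z x b) = cr1z x (chain_bd b) + cr2z (chain_bd x) b.
Proof.
apply: (chains_in_ind (U := eq_sub (@chain_bd R k X \o cr2z x)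
  ((cr1z x \o @chain_bd R k X) \+ cr2z (chain_bd x)))) => a ca aA; rewrite /eq_sub /submod_set /=.
rewrite !cr2z_gen bd_cr2 chain_bd_gen /= !big_ord_recl big_ord0 addr0 expr0 expr1 scale1r scaleN1r.
rewrite -signr_odd expr0 scale1r linearD /= linearD linearN /= !cr1z_gen; congr (_ + _).
have -> : (ord_max : 'I_3) = fintype.lift ord0 (fintype.lift ord0 ord0) by exact: val_inj.
by rewrite addrA.
Qed.

Lemma cr2z_in d z x : C 2 A z -> C d A x -> C d.+2 A (cr2z x z).
Proof.
move=> Az Ax; apply: (chains_in_ind (U := submod_preim (cr2z x : {linear _ -> _}) (C d.+2 A))) Az => a ca aA.
by rewrite sm_preimE /= cr2z_gen; exact: cr2_in.
Qed.

Lemma chain_product_cr1z z x : C 1 A z -> chain_product mul z x = cr1z x z.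
Proof.
apply: (chains_in_ind (U := eq_sub (lin_ext (fun s : @sing R X =>
    lin_ext (fun s' : @sing R X => sing_product k mul (tagged s) (tagged s')) x)) (cr1z x))) => a ca aA.
rewrite /eq_sub /submod_set /= cr1z_gen lin_ext_gen /=.
apply: (@free_mod_ext _ _ _ (lin_ext (fun s' : @sing R X => sing_product k mul a (tagged s'))) (cr1 mul a)) => -[d s].
by rewrite /= lin_ext_gen /= sing_product_cr1.
Qed.

(** Lets the representative of [omega] picked by [cls_repr] be replaced with the explicit loop. *)
Lemma product_homologous d z z' b x : C 1 A z -> C 1 A z' -> C 2 A b -> C d A x ->
  chain_bd x = 0 -> z - z' = chain_bd b ->
  exists2 e, C d.+2 A e & chain_product mul z x - chain_product mul z' x = chain_bd e.
Proof.
move=> Az Az' Ab Ax x0 zb; exists (cr2z x b); first exact: cr2z_in.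
rewrite !chain_product_cr1z // -linearB zb cr2z_bd // x0 [cr2z 0 _](_ : _ = 0) ?addr0 //.
apply: (lin_eq_on (f := cr2z 0) (g := \0) _ Ab) => -[j s] [/= e _ _]; move: s; rewrite e => s.
by rewrite cr2z_gen linear0.
Qed.

Lemma trl_one (c : @chain R k X) : trl mul one c = c.
Proof. exact: chain_push_id. Qed.

Lemma trl_in d x c : A x -> C d A c -> C d A (trl mul x c).
Proof.
move=> Ax; apply: (chains_in_ind (U := submod_preim (trl mul x : {linear _ -> _}) (C d A))) => s cs sA.
rewrite sm_preimE /= trl_gen; apply: gen_in; last by move=> t; exact: mulA.
move=> t; apply: (@continuous_comp _ _ _ (fun t => (x, s t)) (fun p : X * X => mul p.1 p.2)); last exact: mulc.
by apply: cont_pair => //; exact: cont_cst.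
Qed.

Definition path_to x (a : simplex 1 -> X) := [/\ continuous a, forall t, A (a t),
  ext a (@vert R 1 ord0) = one & ext a (@vert R 1 ord_max) = x].

Lemma bd_cr1_loop a (c : @chain R k X) : path_to one a -> chain_bd (cr1 mul a c) = - cr1 mul a (chain_bd c).
Proof. by move=> [_ _ a0 a1]; rewrite bd_cr1 a0 a1 subrr sub0r. Qed.

Lemma trl_homologous d a x c : path_to x a -> C d A c -> chain_bd c = 0 ->
  exists2 b, C d.+1 A b & trl mul x c - c = chain_bd b.
Proof.
move=> [ca aA a0 a1] Ac c0; exists (cr1 mul a c); first exact: cr1_in.
by rewrite bd_cr1 a0 a1 trl_one c0 linear0 subr0.
Qed.

Section Cocycle.
Variable c : {linear @chain R k X -> k^o}.
Hypothesis hc : forall b, C 2 A b -> c (chain_bd b) = 0.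

Lemma cap_bd d x : C d A x -> cap c (chain_bd x) = - chain_bd (cap c x).
Proof.
apply: (chains_in_ind (U := eq_sub (cap c \o @chain_bd R k X) (\- (@chain_bd R k X \o cap c)))) => s cs sA.
rewrite /eq_sub /submod_set /= -(real_std s) -realc_gen chain_bd_realc !cap_realc.
apply: (lcap_bd (D := simplex d) (n := d.+1)); last exact: std_supp.
move=> u v w du dv dw; apply: hc; apply: (real_in (C := simplex d)).
- exact: simplex_convex.
- exact: ext_continuous.
- by move=> ? _; exact: ext_maps.
by split => // y; rewrite !inE => /or3P[] /eqP->.
Qed.

Lemma cap_in d x : C d.+1 A x -> C d A (cap c x).
Proof.
apply: (chains_in_ind (U := submod_preim (cap c : {linear _ -> _}) (C d A))) => s cs sA.
rewrite sm_preimE /= -(real_std s) -realc_gen cap_realc /lcap lin_ext_gen.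
have [] := @std_in R d.+1; case: (std d.+1) => [|v [|w r]] //= [sz] sin; apply: smZ.
apply: (real_in (C := simplex d.+1) (s := w :: r)).
- exact: simplex_convex.
- exact: ext_continuous.
- by move=> ? _; exact: ext_maps.
by split; [rewrite /= sz|move=> y yr; apply: sin; rewrite inE yr orbT].
Qed.

Lemma cap_in0 x : C 0 A x -> cap c x = 0.
Proof.
apply: (chains_in_ind (U := eq_sub (cap c) \0)) => s cs sA.
by rewrite /eq_sub /submod_set /= /cap lin_ext_gen.
Qed.

Lemma lcap_prism (V W : normedModType R) (K : W -> X) (f g : V -> W) v s :
  lcap K c (sprism f g (v :: s)) = c (real K [:: f v; g v]) *: real K (map g (v :: s)) -
    (if s is w :: _ then c (real K [:: f v; f w]) *: realc K (sprism f g s) else 0).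
Proof.
rewrite [sprism _ _ _]/= linearB /= {1}/lcap lin_ext_gen; congr (_ - _).
case: s => [|w s]; first by rewrite /= !linear0.
rewrite [sprism _ _ _]/=.
have -> : gen [:: f w, g w & [seq g i | i <- s]] - cone (f w) (sprism f g s) =
    cone (f w) (gen (g w :: map g s) - sprism f g s) :> FS W by rewrite linearB /= cone_gen.
by rewrite lcap_cone2 [cone (f w) _]linearB /= cone_gen.
Qed.

(** In the first simplex of the prism the front edge is a translate of the loop [a], where [c] takes
    the value [p], and the rest is [x] because [a] ends at [one]. In the other simplices the front
    edge is that of [x], as [a] starts at [one], and they add up to the product with [cap c x]. *)
Lemma cap_cr1 d a (p : k) x : path_to one a ->
  (forall y, A y -> c (trl mul y (gen (mk_sing a))) = p) -> C d A x ->
  cap c (cr1 mul a x) = p *: x - cr1 mul a (cap c x).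
Proof.
move=> [ca aA a0 a1] hp.
apply: (chains_in_ind (U := eq_sub (cap c \o cr1 mul a) ( *:%R p \- (cr1 mul a \o cap c)))) => s cs sA.
rewrite /eq_sub /submod_set /= cr1_gen cap_realc prism_gen.
rewrite -[in RHS](real_std s) -[real _ _ in X in _ - X]realc_gen cap_realc.
have [sz _] := @std_in R d; rewrite /lcap lin_ext_gen -/(lcap _ _).
have := @realc_pr R k X mul 1 d a s ord_max; rewrite cmap_gen realc_gen a1.
have -> : (fun t : simplex d => mul one (s t)) = s by apply/funext => t; rewrite mul1.
rewrite -(real_std s); case: (std d) sz => [//|v r] sz e.
rewrite lcap_prism; congr (_ *: _ - _); [|exact: e|].
  rewrite -(hp (ext s v)); last exact: ext_maps.
  rewrite trl_gen; congr (c (gen (mk_sing _))); apply/funext => t; rewrite mulC /Kx.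
  have -> : affs [:: pr (ord0 : 'I_2) v; pr ord_max v] t = (v, set_val t).
    have ts := simplex_sum1 t; rewrite !big_ord_recl big_ord0 addr0 in ts.
    have te := affs_std t; rewrite /std enum_ordSl enum_ordSl enum_ord0 /= in te.
    move: te; rewrite /affs !big_ord_recl !big_ord0 !addr0 /= => te.
    have -> : ord_max = fintype.lift ord0 (ord0 : 'I_1) by exact: val_inj.
    transitivity ((set_val t : 'rV_2) 0 ord0 *: v + (set_val t : 'rV_2) 0 (fintype.lift ord0 ord0) *: v,
      (set_val t : 'rV_2) 0 ord0 *: @vert R 1 ord0 +
      (set_val t : 'rV_2) 0 (fintype.lift ord0 ord0) *: @vert R 1 (fintype.lift ord0 ord0)); first by [].
    by congr pair; [rewrite -scalerDl ts scale1r|exact: te].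
  by rewrite /= /ext set_valK.
case: r {sz e} => [|w r]; first by rewrite linear0.
rewrite linearZ; congr (_ *: _); last first.
  transitivity (@cr1 R k X mul a (realc (ext s) (gen (w :: r)))); last by rewrite realc_gen.
  by rewrite cr1_realc prism_gen.
congr (c (gen (mk_sing _))); apply/funext => t.
by rewrite (@affs_pair R _ _ _ id _ 1 [:: v; w]) //= /Kx /= a0 mul1.
Qed.

End Cocycle.
End Space.
End CapProduct.

(** * Winding numbers *)

Section Winding.
Context {R : realType} {k : comUnitRingType} {X : topologicalType}.
Hypothesis hX : hausdorff_space X.
Variable th : R^o -> X.
Hypothesis thc : continuous th.
Hypothesis thE : forall r s, th r = th s <-> cos r = cos s /\ sin r = sin s.
Local Notation C := (@chains_in R k X).

Definition turn : set X := th @` `[0, 2 * pi].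
Definition half (P : R -> bool) : set X := th @` [set r | r \in `[0, 2 * pi] /\ P (cos r)].

Lemma half_closed (P : R -> bool) : closed [set x : R | P x] -> closed (half P).
Proof.
move=> Pc; apply: compact_closed => //; apply: continuous_compact.
  by apply: continuous_subspaceT.
have -> : [set r : R | r \in `[0, 2 * pi] /\ P (cos r)] = `[0, 2 * pi] `&` (cos @^-1` [set x : R | P x]).
  by [].
apply: compact_closedI; first exact: segment_compact.
by apply: closed_comp => // x _; exact: continuous_cos.
Qed.

Definition lhalf := half (fun x => x <= 0).
Definition rhalf := half (fun x => 0 <= x).
Definition U1 : set X := ~` [set th (pi / 2)].
Definition U2 : set X := ~` [set th (- (pi / 2))].

Lemma lhalf_closed : closed lhalf. Proof. apply: half_closed; exact: closed_le. Qed.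
Lemma rhalf_closed : closed rhalf. Proof. apply: half_closed; exact: closed_ge. Qed.

Lemma lrhalf x : turn x -> lhalf x \/ rhalf x.
Proof.
move=> [r r01 <-]; have [c|c] := leP (cos r) 0; [left|right].
  by exists r => //; split.
by exists r => //; split => //; exact: ltW.
Qed.

(** The two closed arcs meet only in the two points that [U1] and [U2] leave out, so within the
    intersection of [U1] and [U2] each arc is open and closed. *)
Lemma lrhalf_disj x : U1 x -> U2 x -> lhalf x -> rhalf x -> False.
Proof.
move=> u1 u2 [r [_ c1] e] [s [_ c2] e2].
have [ec _] := (thE r s).1 (etrans e (esym e2)).
have c0 : cos r = 0 by apply/eqP; rewrite eq_le c1 ec c2.
have : sin r ^+ 2 = 1 by rewrite -[RHS](cos2Dsin2 r) c0 expr0n add0r.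
move/eqP; rewrite sqrf_eq1 => /orP[] /eqP s1.
  by apply: u1; rewrite -e; apply/thE; rewrite cos_pihalf sin_pihalf.
by apply: u2; rewrite -e; apply/thE; rewrite cosN sinN cos_pihalf sin_pihalf.
Qed.

Lemma U_open x : open (~` [set x] : set X).
Proof.
by rewrite openC; apply: accessible_closed_set1; exact: hausdorff_accessible.
Qed.

Lemma U_cover : turn `<=` U1 `|` U2.
Proof.
move=> x _; have [->|n] := pselect (x = th (pi / 2)); [right|by left].
move=> /thE; rewrite cosN sinN cos_pihalf sin_pihalf => -[_ /eqP].
by rewrite -subr_eq0 opprK -mulr2n pnatr_eq0.
Qed.

(** On 0-chains of the circle in the intersection of [U1] and [U2] this counts the points on the
    right arc; [unif] is the only point of the 0-simplex. *)
Definition cnt : chain R k X -> k^o := lin_ext (fun s : sing R X =>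
  (`[< ~ lhalf (tagged s (@unif R (tag s))) >]%:R : k^o)).
HB.instance Definition _ := GRing.Linear.on cnt.

Lemma edge_connected (a : simplex R 1 -> X) : continuous a -> connected (range a).
Proof.
move=> ac; pose g (r : R^o) : 'rV[R]_2 := vert ord0 + r *: (vert ord_max - vert ord0).
have gS r : r \in `[0, 1] -> simplex R 1 (g r).
  rewrite in_itv /= => /andP[r0 r1]; split => [i|].
    by rewrite !mxE; case: i => -[|[|]] //= _; lra.
  by rewrite !big_ord_recl big_ord0 !mxE /=; ring.
have -> : range a = (ext a \o g) @` `[0, 1].
  apply/seteqP; split => x [t]; last by move=> _ <-; exists (to_simplex (g t)).
  move=> _ <-; exists (set_val t 0 ord_max).
    rewrite /= in_itv /= simplex_ge0 -(simplex_sum1 t) big_ord_recr /= lerDr.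
    by apply: sumr_ge0 => i _; exact: simplex_ge0.
  rewrite /= /ext -[in RHS](set_valK t); congr (a (to_simplex _)).
  apply/rowP => i; rewrite !mxE; have := simplex_sum1 t.
  rewrite big_ord_recr big_ord_recr big_ord0 [LHS]/= add0r => h.
  case: i => -[|[|//]] hi /=.
    rewrite (_ : widen_ord _ _ = Ordinal hi) in h; last exact: val_inj.
    have -> : set_val t 0 ord_max = 1 - set_val t 0 (Ordinal hi) :> R by rewrite -h [X in X - _]addrC addrK.
    by ring.
  by rewrite (_ : Ordinal hi = ord_max); [ring|exact: val_inj].
apply: connected_continuous_connected; first exact: segment_connected.
apply: (within_comp (D := simplex R 1)); [|by move=> r /gS|exact: ext_continuous].
apply: continuous_subspaceT => r; apply: cvgD; first exact: cvg_cst.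
by apply: cvgZr_tmp; exact: cvg_id.
Qed.

(** An edge is connected and cannot pass from one arc to the other without meeting an excluded
    point. *)
Lemma cnt_edge c : C 1 (turn `&` (U1 `&` U2)) c -> cnt (chain_bd c) = 0.
Proof.
apply: (chains_in_ind (U := submod_preim (cnt \o @chain_bd R k X : {linear _ -> _}) (submod0 _))) => a ac aU.
rewrite sm_preimE /= chain_bd_gen linear_sum /= !big_ord_recl big_ord0 !linearZ /= /cnt !lin_ext_gen /=.
have h t t' : lhalf (a t) -> lhalf (a t').
  move=> lt; have lt' : range a `&` lhalf = range a; last first.
    by have [] : (range a `&` lhalf) (a t') by rewrite lt'; exists t'.
  apply: (edge_connected ac).
  - by exists (a t); split => //; exists t.
  - exists (~` rhalf); first by rewrite openC; exact: rhalf_closed.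
    apply/seteqP; split => x [[s _ <-] hx]; (split; first by exists s).
      by move=> rx; have [_ [u1 u2]] := aU s; exact: (lrhalf_disj u1 u2 hx).
    by have [ts _] := aU s; case: (lrhalf ts).
  - by exists lhalf; [exact: lhalf_closed|].
set x := a _; set y := a _; have -> : `[< ~ lhalf x >] = `[< ~ lhalf y >].
  by apply/asbool_equiv_eq; split => n l; apply: n; apply: h l.
by rewrite expr0 scale1r addr0 /bump /= expr1 scaleN1r subrr.
Qed.

(* The Mayer-Vietoris connecting map for the two arcs: p counts turns at the half-turn point. *)
Definition winds (z : chain R k X) (p : k) := exists u v b,
  [/\ C 1 (turn `&` U1) u, C 1 (turn `&` U2) v, C 2 turn b, z - chain_bd b = u + v & cnt (chain_bd u) = p].

Lemma winds_ex z : C 1 turn z -> chain_bd z = 0 -> exists p, winds z p.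
Proof.
move=> zA dz; have [j [u [v [uA vA e]]]] := csd_split (U_open _) (U_open _) U_cover zA.
exists (cnt (chain_bd u)), u, v, (csdh j z); split => //; first exact: csdh_in.
by rewrite bd_csdh dz linear0 subr0 opprB addrC subrK.
Qed.

Lemma winds_linear a z p z' p' : winds z p -> winds z' p' -> winds (a *: z + z') (a * p + p').
Proof.
move=> [u [v [b [h1 h2 h3 h4 <-]]]] [u' [v' [b' [h1' h2' h3' h4' <-]]]].
exists (a *: u + u'), (a *: v + v'), (a *: b + b'); split.
- exact: submod_setP.
- exact: submod_setP.
- exact: submod_setP.
- by rewrite linearP opprD addrACA -scalerBr h4 h4' scalerDr addrACA.
- by rewrite !linearP.
Qed.

(** A subdivision of [b] splits over [U1] and [U2]. The two splittings of its boundary then differ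
    by a chain in the intersection, and [cnt] vanishes on the boundary of that chain. *)
Lemma winds_bd b p : C 2 turn b -> winds (chain_bd b) p -> p = 0.
Proof.
move=> bA [u [v [b' [uA vA b'A + <-]]]]; rewrite -linearB.
have := smB bA b'A; move: (b - b') => {bA b'A} {}b bA e.
have [j [b1 [b2 [b1A b2A eb]]]] := csd_split (U_open _) (U_open _) U_cover bA.
have du0 : chain_bd u = - chain_bd v.
  by apply/eqP; rewrite -addr_eq0 -linearD -e; apply/eqP; exact: chain_bdK.
have chD d c : C d.+1 (turn `&` U1) c -> C d (turn `&` U1) (chain_bd c) by exact: chains_in_bd.
have chD2 d c : C d.+1 (turn `&` U2) c -> C d (turn `&` U2) (chain_bd c) by exact: chains_in_bd.
have both d c : C d (turn `&` U1) c -> C d (turn `&` U2) c -> C d (turn `&` (U1 `&` U2)) c.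
  by move=> h1 h2 s sc; have [? ? h] := h1 s sc; have [_ _ h'] := h2 s sc; split => // x hx; have [] := h x hx; have [] := h' x hx.
have duA : C 0 (turn `&` (U1 `&` U2)) (chain_bd u).
  by apply: both; [exact: chD|rewrite du0; apply: smN; exact: chD2].
have e2 : csd j u - chain_bd b1 = chain_bd b2 - csd j v.
  by apply/eqP; rewrite subr_eq addrAC eq_sym subr_eq -!linearD /= [b2 + b1]addrC -eb bd_csd e linearD.
have xA : C 1 (turn `&` (U1 `&` U2)) (csd j u - chain_bd b1).
  apply: both; first by apply: smB; [exact: csd_in|exact: chD].
  by rewrite e2; apply: smB; [exact: chD2|exact: csd_in].
have := cnt_edge xA; rewrite !linearB /= chain_bdK linear0 subr0 bd_csd => e3.
have /cnt_edge := @csdh_in R k X _ _ j _ duA; rewrite bd_csdh chain_bdK (linear0 (csdh j)) subr0 linearB /= e3 subr0.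
by [].
Qed.

Lemma sbd_edge (V : choiceType) (v w : V) : sbd [:: v; w] = gen [:: w] - gen [:: v] :> @free_mod k (seq V).
Proof. by rewrite /= linear0 subr0 cone_gen. Qed.

Lemma sbd_triangle (V : choiceType) (u v w : V) :
  sbd [:: u; v; w] = gen [:: v; w] - gen [:: u; w] + gen [:: u; v] :> @free_mod k (seq V).
Proof. by rewrite [LHS]/= linear0 subr0 cone_gen linearB /= !cone_gen opprB addrA addrAC. Qed.

Let K (r : R^o) : X := th (2 * pi * r).
Definition round : chain R k X := gen (mk_sing (fun t : simplex R 1 => th (2 * pi * set_val t 0 ord_max))).

Lemma round_real : round = real K [:: 0; 1].
Proof.
rewrite (@real_size _ _ _ _ K [:: 0; 1] 1) // /round; congr (gen (mk_sing _)); apply: funext => t.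
by rewrite /K /affs /= big_ord_recr big_ord_recr big_ord0 /= scaler0 !add0r; congr (th (_ * _)); rewrite /GRing.scale /= mulr1.
Qed.

Lemma round_cycle : chain_bd round = 0.
Proof.
rewrite round_real chain_bd_real sbd_edge linearB /= !realc_gen.
apply/eqP; rewrite subr_eq0; apply/eqP.
have K01 : K 1 = K 0.
  by apply/thE; rewrite mulr1 mulr0 cos0 sin0 mulr_natl cos2pi sin2pi.
rewrite !(@real_size _ _ _ _ K _ 0) //; congr (gen (mk_sing _)); apply: funext => t.
by have := simplex_sum1 t; rewrite /affs !big_ord_recl !big_ord0 /= !addr0 => ->; rewrite !scale1r.
Qed.

Lemma cnt_point r : cnt (real K [:: r]) = `[< ~ lhalf (K r) >]%:R.
Proof.
have -> : real K [:: r] = gen (mk_sing (fun _ : simplex R 0 => K r)) :> chain R k X.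
  rewrite (@real_size _ _ _ _ K _ 0) //; congr (gen (mk_sing _)); apply: funext => t.
  by have := simplex_sum1 t; rewrite /affs !big_ord_recl !big_ord0 /= !addr0 => ->; rewrite scale1r.
by rewrite /cnt lin_ext_gen.
Qed.

Lemma winds_loop : winds round 1.
Proof.
(* The half turn: on [m, 1] the angle runs from pi to 2 pi and misses the point left out by [U1], on
   [0, m] it misses that of [U2]. The degenerate triangle [[:: m; 0; 1]] rewrites the loop in terms
   of these two paths up to a boundary. *)
pose m : R^o := 1 / 2.
have Kc : continuous K by move=> r; apply: continuous_comp; [apply: cvgMr; exact: cvg_id|exact: thc].
have cv (a b : R) : convex_in (`[a, b] : set R^o).
  move=> n t s sn sC; rewrite /affs /= in_itv /=; apply/andP; split.
    rewrite -[a]mul1r -(simplex_sum1 t) mulr_suml; apply: ler_sum => i _; apply: ler_wpM2l; first exact: simplex_ge0.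
    have : nth 0 s i \in s by rewrite mem_nth // sn.
    by move/sC => /=; rewrite in_itv /= => /andP[].
  rewrite -[b]mul1r -(simplex_sum1 t) mulr_suml; apply: ler_sum => i _; apply: ler_wpM2l; first exact: simplex_ge0.
  have : nth 0 s i \in s by rewrite mem_nth // sn.
  by move/sC => /=; rewrite in_itv /= => /andP[].
have p0 := pi_gt0 R.
have Kr (a b : R) (P : set X) n s : (forall r, a <= r <= b -> P (K r)) -> seq_in n.+1 (`[a, b] : set R^o) s ->
    C n P (real K s).
  move=> h; apply: real_in; first exact: cv.
    by apply: continuous_subspaceT.
  by move=> r /=; rewrite in_itv /= => /h.
have Kt r : 0 <= r <= 1 -> turn (K r).
  by move=> /andP[r0 r1]; exists (2 * pi * r) => //=; rewrite in_itv /=; apply/andP; split; nra.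
exists (real K [:: m; 1]), (- real K [:: m; 0]), (real K [:: m; 0; 1]); split.
- apply: (Kr m 1) => [r /andP[r0 r1]|].
    split; first by apply: Kt; apply/andP; split => //; rewrite /m in r0; lra.
    move=> /thE[_]; rewrite sin_pihalf => s1.
    have : sin (2 * pi * r - pi) = -1 by rewrite sinB sinpi cospi s1; ring.
    have : 0 <= sin (2 * pi * r - pi).
      by apply: sin_ge0_pi; rewrite /m in r0; apply/andP; split; nra.
    by move=> h1 h2; rewrite h2 in h1; lra.
  by split => // r; rewrite !inE => /orP[] /eqP ->; rewrite /= in_itv /= /m; lra.
- apply: smN; apply: (Kr 0 m) => [r /andP[r0 r1]|].
    split; first by apply: Kt; apply/andP; split => //; rewrite /m in r1; lra.
    move=> /thE[_]; rewrite sinN sin_pihalf => s1.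
    have : 0 <= sin (2 * pi * r).
      by apply: sin_ge0_pi; rewrite /m in r1; apply/andP; split; nra.
    by move=> h1; rewrite s1 in h1; lra.
  by split => // r; rewrite !inE => /orP[] /eqP ->; rewrite /= in_itv /= /m; lra.
- apply: (Kr 0 1) => //.
  by split => // r; rewrite !inE => /or3P[] /eqP ->; rewrite /= in_itv /= /m; lra.
- rewrite round_real chain_bd_real sbd_triangle linearD linearB /= !realc_gen.
  by rewrite opprD opprB addrA; congr (_ - _); rewrite addrC subrK.
- have -> : chain_bd (real K [:: m; 1]) = real K [:: 1] - real K [:: m] :> chain R k X.
    by rewrite chain_bd_real sbd_edge linearB /= !realc_gen.
  have -> : cnt (real K [:: 1] - real K [:: m]) = cnt (real K [:: 1]) - cnt (real K [:: m]) by exact: linearB.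
  have k1 : `[< ~ lhalf (K 1) >] = true.
    apply/asboolP => -[r [_ r0]] /thE[]; rewrite mulr1 mulr_natl cos2pi => r1.
    by rewrite r1 in r0; lra.
  have k2 : `[< ~ lhalf (K m) >] = false.
    apply/asboolP; apply; exists pi; first by split; [rewrite in_itv /=; lra|rewrite cospi; lra].
    by congr th; rewrite /m; field.
  by rewrite (cnt_point 1) (cnt_point m) k1 k2 subr0.
Qed.

(** By [winds_bd] the winding number of a cycle depends on its class only. This is the source of the
    functionals dual to the characteristic map. *)
Lemma winding_functional : exists psi : {linear homology R k 1 turn set0 -> k^o},
  psi (cls _ _ round) = 1.
Proof.
have cyc z : rel_cycles R k 1 turn set0 z -> C 1 turn z /\ chain_bd z = 0.
  by move=> [h1 h2]; split => //; exact: chains_in_set0 h2.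
pose f (q : homology R k 1 turn set0) : k^o := xget 0 [set p | winds (cls_repr q) p].
have fP q : winds (cls_repr q) (f q).
  have [z1 z2] := cyc _ (cls_repr_in q); have [p wp] := winds_ex z1 z2.
  by apply: (@xgetI _ 0 [set p | winds (cls_repr q) p] p).
have fE z p : rel_cycles R k 1 turn set0 z -> winds z p -> f (cls _ _ z) = p.
  move=> zc wz; have := fP (cls _ _ z).
  have /cls_eqP : cls (rel_cycles R k 1 turn set0) (rel_boundaries R k 1 turn set0) (cls_repr (cls _ _ z : homology R k 1 turn set0)) = cls _ _ z.
    exact: cls_reprK.
  move=> /(_ (cls_repr_in _) zc) [_ [v [[b bA <-] v0 e]]] w.
  have v00 := chains_in_set0 v0; rewrite v00 addr0 in e.
  have := winds_linear (-1) wz w; rewrite scaleN1r addrC e mulN1r => /(winds_bd bA).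
  by move/eqP; rewrite addrC subr_eq0 => /eqP.
have fl : linear f.
  move=> a x y; rewrite -(cls_reprK x) -(cls_reprK y) -cls_linear; try exact: cls_repr_in.
  have h q : f (cls _ _ (cls_repr q)) = f q by rewrite cls_reprK.
  rewrite !h; apply: fE; first by apply: submod_setP; exact: cls_repr_in.
  exact: winds_linear.
exists (pack_linear fl) => /=; apply: fE winds_loop.
have [u [v [b [uA vA bA e _]]]] := winds_loop; split => /=.
  rewrite -[round](subrK (chain_bd b)) e; apply: smD; last exact: chains_in_bd.
  by apply: smD; [apply: supp_inS uA|apply: supp_inS vA] => s [h1 h2 h3]; split => // x /h3[].
by rewrite sm_preimE /= round_cycle; exact: sm0.
Qed.

End Winding.

(** * The circle, the torus and its subtori *)

Section UnitCircle.
Context {R : realType}.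
Local Notation C := (R[i]^o).

Definition expi (r : R^o) : C := (cos r +i* sin r)%C.

Lemma expi_eq (r s : R) : expi r = expi s <-> cos r = cos s /\ sin r = sin s.
Proof. by split => [[-> ->]|[e1 e2]] //; rewrite /expi e1 e2. Qed.

Lemma expi0 : expi 0 = 1.
Proof. by rewrite /expi cos0 sin0. Qed.

Lemma norm_expi (r : R) : `|expi r| = 1.
Proof. by rewrite normc_def /= cos2Dsin2 sqrtr1. Qed.

Lemma expi_surj (z : C) : `|z| = 1 -> exists2 r, 0 <= r <= 2 * pi & expi r = z.
Proof.
case: z => a b; rewrite normc_def /= => -[h].
have {h} h : a ^+ 2 + b ^+ 2 = 1.
  by rewrite -[LHS]sqr_sqrtr ?h ?expr1n // addr_ge0 // sqr_ge0.
have b2 := sqr_ge0 b; have a1 : -1 <= a <= 1 by apply/andP; split; nra.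
have [/andP[p0 p1] ca] := acos_def a1.
have sa : sin (acos a) = `|b|.
  by rewrite sin_acos // (_ : 1 - a ^+ 2 = b ^+ 2) ?sqrtr_sqr // -h addrC addKr.
have [bp|bn] := leP 0 b.
  exists (acos a); first by apply/andP; split => //; lra.
  by rewrite /expi ca sa ger0_norm.
exists (2 * pi - acos a); first by apply/andP; split; lra.
rewrite /expi mulr_natl addrC cosD2pi sinD2pi cosN sinN ca sa ltr0_norm //.
by rewrite opprK.
Qed.

Lemma normC_le (a b : R) : `|(a +i* b)%C| <= (`|a| + `|b|)%:C%C.
Proof.
rewrite normc_def /= lecE /= eqxx /=.
have ab : 0 <= `|a| + `|b| by rewrite addr_ge0.
rewrite -(ler_pXn2r (n := 2)) ?nnegrE ?sqrtr_ge0 // sqr_sqrtr ?addr_ge0 ?sqr_ge0 //.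
rewrite sqrrD !real_normK ?num_real // addrAC lerDl mulrn_wge0 // mulr_ge0 //.
Qed.

Lemma expi_continuous : continuous expi.
Proof.
move=> r; apply/cvgrPdist_lt => -[e e'] /=; rewrite ltcE /= => /andP[/eqP -> e0].
have e2 : 0 < e / 2 by rewrite divr_gt0.
have /cvgrPdist_lt/(_ _ e2) hc := @continuous_cos R r.
have /cvgrPdist_lt/(_ _ e2) hs := @continuous_sin R r.
near=> t; rewrite /expi; apply: le_lt_trans (normC_le _ _) _.
rewrite ltcE /= eqxx /= [ltRHS](splitr e); apply: ltrD; [near: t; exact: hc|near: t; exact: hs].
Unshelve. all: by end_near.
Qed.

End UnitCircle.

Section Torus.
Context {R : realType} {N : nat}.
Local Notation C := (R[i]^o).
Local Notation V := 'rV[C]_N.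

Lemma row_continuous (T : topologicalType) (f : T -> V) :
  (forall i, continuous (fun x => f x 0 i)) -> continuous f.
Proof.
move=> fc x A [P Pn PA].
have : \forall y \near x, forall i, P 0 i (f y 0 i).
  by apply: filter_forall => i; apply: fc; exact: Pn.
apply: filterS => y h; apply: PA => i j; rewrite (ord1 i); exact: h.
Qed.

Lemma torus_mul_continuous : continuous (fun p : V * V => torus_mul p.1 p.2).
Proof.
apply: row_continuous => i.
rewrite (_ : (fun p : V * V => _) = (fun p => (p.1 0 i : C) * p.2 0 i)); last by apply/funext => p; rewrite mxE.
have fc : continuous (fun p : V * V => p.1 0 i : C).
  move=> p; apply: (@continuous_comp _ _ _ (fst : V * V -> V) (fun M : V => M 0 i : C)); first exact: cvg_fst.
  exact: (@coord_continuous C).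
have sc : continuous (fun p : V * V => p.2 0 i : C).
  move=> p; apply: (@continuous_comp _ _ _ (snd : V * V -> V) (fun M : V => M 0 i : C)); first exact: cvg_snd.
  exact: (@coord_continuous C).
by move=> p; apply: (@cvgM C); [exact: fc|exact: sc].
Qed.

Lemma torus_mulC (x y : V) : torus_mul x y = torus_mul y x.
Proof. by apply/rowP => i; rewrite !mxE mulrC. Qed.

Lemma torus_mulA (x y z : V) : torus_mul x (torus_mul y z) = torus_mul (torus_mul x y) z.
Proof. by apply/rowP => i; rewrite !mxE mulrA. Qed.

Lemma torus_mul1 (x : V) : torus_mul (torus_one R N) x = x.
Proof. by apply/rowP => i; rewrite !mxE mul1r. Qed.

Lemma torus_mul_in (x y : V) : @torus R N x -> torus y -> torus (torus_mul x y).
Proof. by move=> tx ty i; rewrite mxE normrM tx ty mulr1. Qed.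

Lemma torus_mulKI (x y z : V) : @torus R N x -> torus_mul x y = torus_mul x z -> y = z.
Proof.
move=> tx h; apply/rowP => i; have := congr1 (fun M : V => M 0 i) h; rewrite !mxE.
by apply: mulfI; rewrite -normr_eq0 tx oner_neq0.
Qed.

Lemma torus_path (x : V) : @torus R N x -> exists a : simplex R 1 -> V, path_to (@torus R N) (torus_one R N) x a.
Proof.
move=> tx; have h i := expi_surj (tx i).
pose r i : R := xget 0 [set r | expi r = x 0 i].
have rP i : expi (r i) = x 0 i.
  by have [r0 _ e] := h i; apply: (@xgetI _ 0 [set r | expi r = x 0 i] r0).
pose b (v : 'rV[R]_2) : V := \row_i expi (v 0 ord_max * r i).
have bc : continuous b.
  apply: row_continuous => i; rewrite (_ : (fun v => _) = (fun v : 'rV[R]_2 => expi (v 0 ord_max * r i))); last first.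
    by apply/funext => v; rewrite mxE.
  move=> v; apply: (@continuous_comp _ _ _ (fun v : 'rV[R]_2 => (v 0 ord_max * r i : R^o)) expi); last exact: expi_continuous.
  apply: (@cvgMr_tmp R^o _ (nbhs v) _ (fun v : 'rV[R]_2 => v 0 ord_max)); exact: coord_continuous.
exists (fun t => b (set_val t)); split.
- by move=> t; apply: (@continuous_comp _ _ _ (set_val : simplex R 1 -> _) b); [exact: initial_continuous|exact: bc].
- by move=> t i; rewrite mxE norm_expi.
- rewrite /ext to_simplexK; last exact: simplex_vert.
  by apply/rowP => i; rewrite !mxE /= mul0r expi0.
- rewrite /ext to_simplexK; last exact: simplex_vert.
  by apply/rowP => i; rewrite !mxE /= mul1r rP.
Qed.

Section Subtorus.
Variables (T1 : set V) (theta : C -> V).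
Hypothesis hth : subtorus_iso T1 theta.

Lemma theta_torus z : circle z -> @torus R N (theta z).
Proof. by case: hth => _ T1t _ _ im cz; apply: T1t; rewrite -im; exists z. Qed.

Lemma theta1 : theta 1 = torus_one R N.
Proof.
have c1 : circle (1 : C) by rewrite /circle /= normr1.
case: hth => _ _ tM _ _; apply: (@torus_mulKI (theta 1)); first exact: theta_torus.
by rewrite -tM // mulr1 torus_mulC torus_mul1.
Qed.

Lemma theta_expi_continuous : continuous (theta \o expi).
Proof.
case: hth => tc _ _ _ _; apply: (@continuous_comp_within _ _ _ (@circle R) expi theta) tc.
  exact: expi_continuous.
exact: norm_expi.
Qed.

Lemma theta_expi_eq r s : theta (expi r) = theta (expi s) <-> cos r = cos s /\ sin r = sin s.
Proof.
case: hth => _ _ _ ti _; rewrite -expi_eq; split => [|->//].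
by apply: ti; exact: norm_expi.
Qed.

Lemma theta_expi_turn : T1 = (theta \o expi) @` `[0, 2 * pi].
Proof.
case: hth => _ _ _ _ <-; apply/seteqP; split => [_ [z cz <-]|_ [r _ <-]].
  by have [r r01 <-] := expi_surj cz; exists r => //; rewrite /= in_itv.
by exists (expi r) => //; exact: norm_expi.
Qed.

End Subtorus.

End Torus.

(** * Absolute cycles and their classes *)

Section AbsoluteHomology.
Context {R : realType} {k : comUnitRingType}.

Lemma chain_bd_push (X Y : Type) (f : X -> Y) (c : @chain R k X) :
  chain_bd (chain_push f c) = chain_push f (chain_bd c).
Proof.
apply: (@free_mod_ext _ _ _ (@chain_bd R k Y \o chain_push f) (chain_push f \o @chain_bd R k X)) => -[d s] /=.
rewrite -[existT _ _ _]/(mk_sing s) -(real_std s) -realc_gen.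
by rewrite chain_push_realc !chain_bd_realc chain_push_realc.
Qed.

Lemma chain_push_gen (X Y : Type) (f : X -> Y) d (s : simplex R d -> X) :
  chain_push f (gen (mk_sing s)) = gen (mk_sing (f \o s)) :> @chain R k Y.
Proof. exact: lin_ext_gen. Qed.

Section Space.
Context {X : topologicalType}.
Implicit Types A B : set X.
Local Notation C := (@chains_in R k X).

(** [rel_cycles] asks for a boundary in the empty set, that is, for boundary 0; the classes [hcl]
    are handled through this simpler form. *)
Program Definition cyc d A : submod (@chain R k X) :=
  @Submod k _ (fun z => C d A z /\ chain_bd z = 0) _ _.
Next Obligation. by move=> d A; split; [exact: sm0|exact: linear0]. Qed.
Next Obligation.
move=> d A a x y [hx x0] [hy y0]; split; first exact: submod_setP.
by rewrite linearP /= x0 y0 scaler0 addr0.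
Qed.

Definition hcl d A (z : @chain R k X) : homology R k d A set0 :=
  cls (rel_cycles R k d A set0) (rel_boundaries R k d A set0) z.

Lemma hcl0 d A : hcl d A 0 = 0.
Proof. exact: cls0. Qed.

Lemma cycP d A z : rel_cycles R k d A set0 z <-> cyc d A z.
Proof.
split=> -[h1 h2]; split => //; first exact: chains_in_set0 h2.
by rewrite sm_preimE /= h2; exact: sm0.
Qed.

Lemma relbP d A z : rel_boundaries R k d A set0 z <-> exists2 b, C d.+1 A b & chain_bd b = z.
Proof.
split=> [[_ [v [[b bA <-] v0 ->]]]|[b bA <-]].
  by exists b => //; rewrite (chains_in_set0 v0) addr0.
exists (chain_bd b), 0; split; [by exists b|exact: sm0|by rewrite addr0].
Qed.

Lemma hcl_linear d A a z z' : cyc d A z -> cyc d A z' -> hcl d A (a *: z + z') = a *: hcl d A z + hcl d A z'.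
Proof. by move=> /cycP h /cycP h'; exact: cls_linear. Qed.

Lemma hcl_ex d A (q : homology R k d A set0) : exists2 z, cyc d A z & q = hcl d A z.
Proof. exists (cls_repr q); [exact/cycP/cls_repr_in|by rewrite /hcl cls_reprK]. Qed.

Lemma hcl_eqP d A z z' : cyc d A z -> cyc d A z' ->
  hcl d A z = hcl d A z' <-> exists2 b, C d.+1 A b & chain_bd b = z - z'.
Proof. by move=> /cycP h /cycP h'; rewrite /hcl cls_eqP // relbP. Qed.

Lemma cyc_gen d A (s : simplex R d -> X) : continuous s -> (forall t, A (s t)) ->
  chain_bd (@gen k _ (mk_sing s)) = 0 -> cyc d A (gen (mk_sing s)).
Proof. by move=> cs sA; split => //; exact: gen_in. Qed.

End Space.

Lemma push_in (X Y : topologicalType) (f : X -> Y) (A : set X) (B : set Y) d c :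
  {within A, continuous f} -> (forall x, A x -> B (f x)) ->
  chains_in R k d A c -> chains_in R k d B (chain_push f c).
Proof.
move=> fc AB; apply: (chains_in_ind (U := submod_preim (chain_push f : {linear _ -> _}) (chains_in R k d B))) => s cs sA.
rewrite sm_preimE /= chain_push_gen; apply: gen_in; last by move=> t; exact: AB.
exact: (continuous_comp_within (C := A)).
Qed.

Section Push.
Context {X Y : topologicalType} (f : X -> Y) (A : set X) (B : set Y) (d : nat).
Hypothesis fc : {within A, continuous f}.
Hypothesis AB : forall x, A x -> B (f x).

Lemma push_cyc z : cyc d A z -> cyc d B (chain_push f z).
Proof. by move=> [h z0]; split; [exact: push_in h|rewrite chain_bd_push z0 linear0]. Qed.

Let ZZ z : rel_cycles R k d A set0 z -> rel_cycles R k d B set0 (chain_push f z).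
Proof. by move/cycP => h; apply/cycP; exact: push_cyc. Qed.

Let BB z : rel_boundaries R k d A set0 z -> rel_boundaries R k d B set0 (chain_push f z).
Proof.
move/relbP => -[b bA <-]; apply/relbP; exists (chain_push f b); first exact: push_in bA.
by rewrite chain_bd_push.
Qed.

Lemma homology_map_hcl z : cyc d A z -> homology_map f B set0 (hcl d A z) = hcl d B (chain_push f z).
Proof. by move/cycP => h; exact: subquot_map_cls. Qed.

Lemma homology_map_linear : linear (homology_map f B set0 : homology R k d A set0 -> homology R k d B set0).
Proof. exact: subquot_map_linear. Qed.

End Push.

Section Inclusion.
Context {X : topologicalType} (A B : set X) (d : nat).
Hypothesis AB : A `<=` B.

Lemma cycS z : cyc d A z -> cyc d B z.
Proof. by move=> [h z0]; split => // s /h[h1 h2 h3]; split => // x /h3 /AB. Qed.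

Let ZZ (z : @chain R k X) : rel_cycles R k d A set0 z -> rel_cycles R k d B set0 z.
Proof. by move/cycP => h; apply/cycP; exact: cycS. Qed.

Let BB (z : @chain R k X) : rel_boundaries R k d A set0 z -> rel_boundaries R k d B set0 z.
Proof.
move/relbP => -[b bA <-]; apply/relbP; exists b => //.
by move=> s /bA[h1 h2 h3]; split => // x /h3 /AB.
Qed.

Lemma homology_incl_hcl z : cyc d A z -> homology_incl B set0 (hcl d A z) = hcl d B z.
Proof. by move/cycP => h; exact: (subquot_map_cls (f := idfun)). Qed.

Lemma homology_incl_linear : linear (homology_incl B set0 : homology R k d A set0 -> homology R k d B set0).
Proof. exact: (subquot_map_linear (f := idfun)). Qed.

End Inclusion.

End AbsoluteHomology.

(** * Koszul relations *)

Section Koszul.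
Context {k : comUnitRingType} {W : lmodType k} {S : eqType}.
Variables (Z : nat -> submod W) (D : {linear W -> W}) (E I : S -> {linear W -> W}) (vs : seq S).
Hypothesis EZ : forall i d x, Z d x -> Z d.+1 (E i x).
Hypothesis IZ : forall i d x, i \in vs -> Z d.+1 x -> Z d (I i x).
Hypothesis I0 : forall i x, i \in vs -> Z 0 x -> I i x = 0.
Hypothesis EE : forall i l x, E i (E l x) = - E l (E i x).
Hypothesis EEii : forall i x, E i (E i x) = 0.
Hypothesis IE : forall i l d x, i \in vs -> l \in vs -> Z d x ->
  I i (E l x) = (i == l)%:R *: x - E l (I i x).
Hypothesis DE : forall i x, D (E i x) = - E i (D x).
Hypothesis DI : forall i d x, i \in vs -> Z d x -> D (I i x) = - I i (D x).
Hypothesis DZ : forall d x, Z d.+1 x -> Z d (D x).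
Hypothesis D0 : forall x, Z 0 x -> D x = 0.

Definition koP i : {linear W -> W} := E i \o I i.

(* With P_i = E_i I_i, the maps Q_i = P_i (1 - P_l) ... over the l after i have the telescoping
   sum 1 - (1 - P_1) ... (1 - P_n), whose last term kills the ideal of the E_i. *)
Fixpoint kill (s : seq S) : {linear W -> W} :=
  if s is i :: s' then (idfun \- koP i) \o kill s' else idfun.

Definition koQ i : {linear W -> W} := koP i \o kill (drop (index i vs).+1 vs).

Lemma koP_in i d x : i \in vs -> Z d x -> Z d (koP i x).
Proof.
move=> iv; case: d => [|d] h /=; first by rewrite I0 // linear0; exact: sm0.
by apply: EZ; exact: IZ.
Qed.

Lemma koP_D i d x : i \in vs -> Z d x -> D (koP i x) = koP i (D x).
Proof. by move=> iv h /=; rewrite DE (DI iv h) linearN opprK. Qed.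

Lemma kill_in s d x : {subset s <= vs} -> Z d x -> Z d (kill s x).
Proof.
elim: s => [|i s IH] //= sv h.
have h' : Z d (kill s x) by apply: IH => // j js; apply: sv; rewrite inE js orbT.
by apply: smB => //; apply: koP_in => //; apply: sv; exact: mem_head.
Qed.

Lemma kill_D s d x : {subset s <= vs} -> Z d x -> D (kill s x) = kill s (D x).
Proof.
elim: s => [|i s IH] //= sv h.
have sv' : {subset s <= vs} by move=> j js; apply: sv; rewrite inE js orbT.
have iv : i \in vs by apply: sv; exact: mem_head.
by rewrite linearB -[E i _]/(koP i _) (koP_D iv (kill_in sv' h)) IH.
Qed.

Lemma subset_drop n : {subset drop n vs <= vs}.
Proof. by move=> j /mem_drop. Qed.

Lemma koQ_in i d x : i \in vs -> Z d x -> Z d (koQ i x).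
Proof. by move=> iv h; apply: koP_in => //; apply: kill_in => //; exact: subset_drop. Qed.

Lemma koQ_D i d x : i \in vs -> Z d x -> D (koQ i x) = koQ i (D x).
Proof.
move=> iv h; rewrite /koQ [LHS](koP_D (d := d) iv); last by apply: kill_in => //; exact: subset_drop.
by rewrite (kill_D _ h) //; exact: subset_drop.
Qed.

(** By the Koszul relation and the vanishing of [E l] squared, [koP l] fixes the image of [E l], so
    the factor of [l] kills it; the factors of other indices commute with [E l]. *)
Lemma kill_E s l d x : {subset s <= vs} -> l \in vs -> Z d x ->
  kill s (E l x) = if l \in s then 0 else E l (kill s x).
Proof.
move=> + lv h; elim: s => [|i s IH] //= sv.
have sv' : {subset s <= vs} by move=> j js; apply: sv; rewrite inE js orbT.
have iv : i \in vs by apply: sv; exact: mem_head.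
rewrite IH // inE; case: ifP => [_|ls]; first by rewrite orbT (linear0 (I i)) (linear0 (E i)) subr0.
rewrite (IE iv lv (kill_in sv' h)) orbF eq_sym; case: eqVneq => [->|il].
  by rewrite scale1r linearB EEii subr0 subrr.
by rewrite scale0r sub0r linearN EE opprK linearB.
Qed.

Lemma sum_koQ x : uniq vs -> \sum_(i <- vs) koQ i x = x - kill vs x.
Proof.
rewrite /koQ; elim: vs => [|i s IH] /=; first by rewrite big_nil subrr.
move=> /andP[si us]; rewrite big_cons /= eqxx drop0 opprB addrCA; congr (_ + _).
rewrite -IH // big_seq [RHS]big_seq; apply: eq_bigr => j js.
by case: eqVneq => // e; rewrite e js in si.
Qed.

(** Cycles that model a principal ideal on the level of chains; the recursion is that of
    [principal_set], with [E] in place of the products. *)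
Fixpoint wedges (s : seq S) (j : nat) : set W :=
  match s, j with
  | [::], _ => [set z | Z j z /\ D z = 0]
  | _ :: _, 0 => [set 0]
  | i :: s', j'.+1 => [set z | exists2 x, wedges s' j' x & z = E i x]
  end.

Lemma wedges_lin s j a x y : wedges s j x -> wedges s j y -> wedges s j (a *: x + y).
Proof.
elim: s j x y => [|i s IH] [|j] x y /=.
- by move=> [xZ x0] [yZ y0]; split; [exact: submod_setP|rewrite linearP x0 y0 scaler0 addr0].
- by move=> [xZ x0] [yZ y0]; split; [exact: submod_setP|rewrite linearP x0 y0 scaler0 addr0].
- by move=> -> ->; rewrite scaler0 addr0.
by move=> [x' hx ->] [y' hy ->]; exists (a *: x' + y'); [exact: IH|rewrite linearP].
Qed.

Lemma wedges0 s j : wedges s j 0.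
Proof.
elim: s j => [|i s IH] [|j] //=; try by split; [exact: sm0|exact: linear0].
by exists 0 => //; rewrite linear0.
Qed.

Lemma wedgesN s j x : wedges s j x -> wedges s j (- x).
Proof. by move=> h; rewrite -[- x]addr0 -scaleN1r; apply: wedges_lin => //; exact: wedges0. Qed.

Lemma wedges_cycle s j x : wedges s j x -> Z j x /\ D x = 0.
Proof.
elim: s j x => [|i s IH] [|j] x //=; first by move=> ->; split; [exact: sm0|exact: linear0].
by move=> [y /IH[yZ y0] ->]; split; [exact: EZ|rewrite DE y0 linear0 oppr0].
Qed.

Lemma wedges_front s1 s2 i j x : wedges (s1 ++ i :: s2) j x -> wedges (i :: s1 ++ s2) j x.
Proof.
elim: s1 j x => [|l s1 IH] [|j] x //= [y /IH].
case: j => [|j] /=.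
  by move=> -> ->; exists 0; rewrite // !linear0.
move=> [z hz ->] ->; exists (- E l z); last by rewrite EE linearN.
by apply: (@wedgesN (l :: s1 ++ s2) j.+1); exists z.
Qed.

Lemma wedges_perm s t j x : perm_eq s t -> wedges s j x -> wedges t j x.
Proof.
elim: t s j x => [|i t IH] s j x st; first by move/perm_nilP: st => ->.
have si : i \in s by rewrite (perm_mem st) mem_head.
case/path.splitPr: si st => s1 s2 st /wedges_front.
have st' : perm_eq (s1 ++ s2) t by rewrite -(perm_cons i) (perm_catCA [:: i] s1 s2).
by case: j => [|j] //= [y hy ->]; exists y => //; exact: IH hy.
Qed.

Lemma wedges_kill s t j x : {subset s <= vs} -> {subset t <= vs} -> wedges s j x -> wedges s j (kill t x).
Proof.
move=> + tv; elim: s j x => [|i s IH] [|j] x sv /=.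
- by move=> [xZ x0]; split; [exact: kill_in|rewrite (kill_D tv xZ) x0 linear0].
- by move=> [xZ x0]; split; [exact: kill_in|rewrite (kill_D tv xZ) x0 linear0].
- by move=> ->; rewrite linear0.
have sv' : {subset s <= vs} by move=> l ls; apply: sv; rewrite inE ls orbT.
have iv : i \in vs by apply: sv; exact: mem_head.
move=> [y hy ->]; have [yZ _] := wedges_cycle hy; rewrite (kill_E tv iv yZ).
case: ifP => _; first by exists 0; [exact: wedges0|rewrite linear0].
by exists (kill t y) => //; exact: IH.
Qed.

Lemma wedges_I s a j x : {subset s <= vs} -> a \in vs -> a \notin s -> wedges s j.+1 x -> wedges s j (I a x).
Proof.
move=> + av; elim: s j x => [|i s IH] j x sv /=.
  by case: j => [|j] _ [xZ x0]; split; try exact: IZ; rewrite (DI av xZ) x0 linear0 oppr0.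
have sv' : {subset s <= vs} by move=> l ls; apply: sv; rewrite inE ls orbT.
have iv : i \in vs by apply: sv; exact: mem_head.
rewrite inE negb_or => /andP[ai as_] [y hy ->]; have [yZ _] := wedges_cycle hy.
rewrite (IE av iv yZ) (negbTE ai) scale0r sub0r.
case: j y hy yZ => [|j] y hy yZ /=; first by rewrite (I0 av yZ) linear0 oppr0.
by exists (- I a y); [apply: wedgesN; exact: IH|rewrite linearN].
Qed.

Lemma wedges_P s a j x : {subset s <= vs} -> a \in vs -> a \notin s -> wedges s j x -> wedges (a :: s) j (koP a x).
Proof.
move=> sv av as_; case: j => [|j] h /=.
  by have [hZ _] := wedges_cycle h; rewrite (I0 av hZ) linear0.
by exists (I a x) => //; exact: wedges_I.
Qed.

(** The kill factors in [koQ a] preserve these sets; then [I a] passes through the factors different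
    from [a], and [E a] adds the new factor. This is the passage from the ideal at I to the one at I
    with the vertex [a] added. *)
Lemma wedges_Q s a j x : {subset s <= vs} -> a \in vs -> a \notin s -> wedges s j x -> wedges (a :: s) j (koQ a x).
Proof.
move=> sv av as_ h; apply: wedges_P => //; apply: wedges_kill => //; exact: subset_drop.
Qed.

Definition linear_ideal (j : nat) : set W :=
  match j with
  | 0 => [set 0]
  | j'.+1 => [set z | exists2 x : S -> W, (forall i, Z j' (x i) /\ D (x i) = 0) & z = \sum_(i <- vs) E i (x i)]
  end.

Lemma linear_ideal_Q a j x : a \in vs -> linear_ideal j x -> wedges [:: a] j (koQ a x).
Proof.
move=> av; case: j => [|j] /=; first by move=> ->; rewrite !linear0.
move=> [y hy xE]; have xZ : Z j.+1 x /\ D x = 0.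
  rewrite xE; split; first by apply: sm_sum => i _; apply: EZ; have [] := hy i.
  by rewrite linear_sum big1 // => i _; rewrite DE (proj2 (hy i)) linear0 oppr0.
have [{}xZ x0] := xZ; have kZ := kill_in (@subset_drop (index a vs).+1) xZ.
eexists; last by []; split; first exact: IZ.
by rewrite (DI av kZ) (kill_D _ xZ) ?x0 ?linear0 ?oppr0 //; exact: subset_drop.
Qed.

Lemma sum_koQ_ideal j x : uniq vs -> linear_ideal j x -> \sum_(i <- vs) koQ i x = x.
Proof.
move=> uv; rewrite sum_koQ //; case: j => [|j] /=; first by move=> ->; rewrite linear0 subr0.
move=> [y hy ->]; have -> : kill vs (\sum_(i <- vs) E i (y i)) = 0; last by rewrite subr0.
rewrite linear_sum big_seq big1 // => i iv.
by rewrite (kill_E _ iv (proj1 (hy i))) // iv.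
Qed.

End Koszul.

Section Points.
Context {R : realType} {k : comUnitRingType} {X : topologicalType}.

Lemma gen_point (a : simplex R 0 -> X) : gen (mk_sing a) = gen (mk_sing (fun _ : simplex R 0 => ext a (@vert R 0 ord0))) :> @chain R k X.
Proof.
congr (gen (mk_sing _)); apply/funext => t; rewrite /ext; congr a.
rewrite -[LHS]set_valK; congr to_simplex.
apply/rowP => i; have := simplex_sum1 t; rewrite big_ord_recl big_ord0 addr0 => h.
by rewrite (ord1 i) -[LHS]/(set_val t 0 ord0) h mxE.
Qed.

Lemma bd_edge (a : simplex R 1 -> X) : chain_bd (gen (mk_sing a)) =
  gen (mk_sing (fun _ : simplex R 0 => ext a (@vert R 1 ord_max))) -
  gen (mk_sing (fun _ : simplex R 0 => ext a (@vert R 1 ord0))) :> @chain R k X.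
Proof.
rewrite chain_bd_gen /= !big_ord_recl big_ord0 addr0 expr0 expr1 scale1r scaleN1r (gen_point (a \o simplex_op (fintype.lift ord0))).
rewrite (gen_point (a \o simplex_op (fintype.lift (fintype.lift ord0 ord0)))) !ext_vert_op.
have -> : fintype.lift (fintype.lift ord0 ord0) ord0 = ord0 :> 'I_2 by exact: val_inj.
by have -> : fintype.lift ord0 ord0 = ord_max :> 'I_2 by exact: val_inj.
Qed.

End Points.

(** * Cochains on the torus *)

Section TorusCochains.
Context {R : realType} {k : comUnitRingType} {N : nat}.
Local Notation C := (R[i]^o).
Local Notation V := 'rV[C]_N.
Local Notation T := (@torus R N).
Local Notation one := (torus_one R N).
Local Notation mul := (@torus_mul R N).

Lemma torus_mulCA (x y z : V) : mul x (mul y z) = mul y (mul x z).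
Proof. by rewrite !torus_mulA (torus_mulC x). Qed.

Definition torus_arc (x : V) : simplex R 1 -> V :=
  xget (fun=> one) [set a | path_to T one x a].

Lemma torus_arcP x : T x -> path_to T one x (torus_arc x).
Proof.
move=> tx; have [a ha] := torus_path tx.
by apply: (@xgetI _ (fun=> one) [set a | path_to T one x a] a).
Qed.

Definition base_path : @chain R k V -> @chain R k V := lin_ext (fun s : @sing R V =>
  match s with existT 0 a => gen (mk_sing (torus_arc (ext a (@vert R 0 ord0)))) | _ => 0 end).
HB.instance Definition _ := GRing.Linear.on base_path.

Lemma base_path_in z : chains_in R k 0 T z -> chains_in R k 1 T (base_path z).
Proof.
apply: (chains_in_ind (U := submod_preim (base_path : {linear _ -> _}) (chains_in R k 1 T))) => a ac aT.
rewrite sm_preimE /= /base_path lin_ext_gen /=.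
by have [? ? _ _] := torus_arcP (ext_maps (@vert R 0 ord0) aT); exact: gen_in.
Qed.

Lemma bd_base_path z : chains_in R k 1 T z -> chain_bd (base_path (chain_bd z)) = chain_bd z.
Proof.
apply: (chains_in_ind (U := eq_sub (@chain_bd R k V \o (base_path \o @chain_bd R k V)) (@chain_bd R k V))) => a ac aT.
rewrite /eq_sub /submod_set /= bd_edge linearB /= /base_path !lin_ext_gen /= linearB /= !bd_edge.
have [_ _ -> ->] := torus_arcP (ext_maps (@vert R 1 ord0) aT).
have [_ _ -> ->] := torus_arcP (ext_maps (@vert R 1 ord_max) aT).
by rewrite opprB addrA subrK.
Qed.

Lemma based_cyc z : chains_in R k 1 T z -> cyc 1 T (z - base_path (chain_bd z)).
Proof.
move=> h; split; last by rewrite linearB /= bd_base_path // subrr.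
by apply: smB => //; apply: base_path_in; exact: chains_in_bd.
Qed.

Section Cochain.
Variable phi : {linear homology R k 1 T set0 -> k^o}.

(* A functional on H_1 extends to all 1-chains by closing these up with the paths from 1. *)
Definition cochain : @chain R k V -> k^o := lin_ext (fun s : @sing R V =>
  phi (hcl 1 T (gen s - base_path (chain_bd (gen s))))).
HB.instance Definition _ := GRing.Linear.on cochain.

Lemma cochainE z : chains_in R k 1 T z -> cochain z = phi (hcl 1 T (z - base_path (chain_bd z))).
Proof.
move=> h; suff [] : chains_in R k 1 T z /\ cochain z = phi (hcl 1 T (z - base_path (chain_bd z))) by [].
pose P z := chains_in R k 1 T z /\ cochain z = phi (hcl 1 T (z - base_path (chain_bd z))).
have P0 : P 0.
  split; first exact: sm0.
  by rewrite (linear0 (@chain_bd R k V)) (linear0 base_path) subr0 hcl0 !linear0.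
have PP a x y : P x -> P y -> P (a *: x + y).
  move=> [xT xe] [yT ye]; split; first exact: submod_setP.
  have -> : cochain (a *: x + y) = a *: cochain x + cochain y by exact: linearP.
  rewrite xe ye -linearP -hcl_linear; try exact: based_cyc.
  have -> : base_path (chain_bd (a *: x + y)) = a *: base_path (chain_bd x) + base_path (chain_bd y).
    by rewrite !linearP.
  by rewrite opprD addrACA -scalerBr.
apply: (chains_in_ind (U := Submod P0 PP)) h => s cs sT.
by split; [exact: gen_in|rewrite /cochain lin_ext_gen].
Qed.

Lemma cochain_cyc z : cyc 1 T z -> cochain z = phi (hcl 1 T z).
Proof. by move=> [h z0]; rewrite cochainE // z0 linear0 subr0. Qed.

Lemma cochain_bd b : chains_in R k 2 T b -> cochain (chain_bd b) = 0.
Proof.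
move=> bT; have h := chains_in_bd bT; rewrite cochain_cyc; last by split => //; exact: chain_bdK.
rewrite -[RHS](linear0 phi); congr (phi _).
rewrite -(hcl0 (k := k) 1 T).
apply/hcl_eqP; [by split => //; exact: chain_bdK|exact: sm0|].
by exists b => //; rewrite subr0.
Qed.

(** Along a path from [one] to [y] the translate is homologous to the loop, so the value is
    independent of [y], as [cap_cr1] requires. *)
Lemma cochain_trl y a : T y -> path_to T one one a -> cochain (trl mul y (gen (mk_sing a))) = phi (hcl 1 T (gen (mk_sing a))).
Proof.
move=> ty [ac aT a0 a1].
have aC : cyc 1 T (@gen k _ (mk_sing a)) by apply: cyc_gen => //; rewrite bd_edge a0 a1 subrr.
have [aC1 aC2] := aC; have [p pP] := torus_path ty.
have tC : cyc (k := k) 1 T (trl mul y (gen (mk_sing a))).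
  split; first by apply: (trl_in (@torus_mul_continuous R N) (@torus_mul_in R N)).
  by rewrite chain_bd_push aC2 linear0.
rewrite (cochain_cyc tC); congr (phi _); apply/(hcl_eqP tC aC).
have [b bT e] := trl_homologous (@torus_mul_continuous R N) (@torus_mul_in R N) (@torus_mul1 R N) pP aC1 aC2.
by exists b.
Qed.

End Cochain.

End TorusCochains.

Lemma within_eq (T U : topologicalType) (A : set T) (f g : T -> U) :
  (forall x, A x -> f x = g x) -> {within A, continuous g} -> {within A, continuous f}.
Proof.
move=> fg /withinP h; apply/withinP => x Ax W; rewrite fg // => /(h x Ax).
by apply: filterS => y hy Ay; rewrite fg //; exact: hy.
Qed.

(** * Functionals dual to the characteristic map *)

Section CharacteristicFunctionals.
Context {R : realType} {k : comUnitRingType} {N : nat}.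
Local Notation C := (R[i]^o).
Local Notation V := 'rV[C]_N.
Local Notation T := (@torus R N).
Local Notation one := (torus_one R N).
Local Notation mul := (@torus_mul R N).
Context {disp : Order.disp_t} {S : finBPOrderType disp}.
Variables (rk : S -> nat) (tr : S -> S -> V -> V) (lam : S -> set V) (theta : S -> C -> V).
Hypothesis htr : forall I J, I != \bot%O -> (I <= J)%O ->
  exists2 g, T g & forall x, T x -> tr I J x = mul g x.
Hypothesis hlam : characteristic_map k rk tr lam theta.
Hypothesis rk_bot : rk \bot%O = 0%N.

(** The constant loop is a junk value for elements that are not vertices; with it [lp_path] and the
    relations between products with loops hold for all indices. *)
Definition lp (i : S) : simplex R 1 -> V := fun t => if vertex rk i then theta i (loop t) else one.

Lemma one_torus : T one.
Proof. by move=> i; rewrite mxE normr1. Qed.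

Lemma vertex_bot i : vertex rk i -> i != \bot%O.
Proof. by rewrite /vertex; apply: contraL => /eqP ->; rewrite rk_bot. Qed.

Lemma vert_coord (i j : 'I_2) : (@vert R 1 i) 0 j = (i == j)%:R.
Proof. by rewrite mxE eqxx eq_sym. Qed.

Lemma loop_expi (t : simplex R 1) : loop t = expi (2 * pi * set_val t 0 ord_max).
Proof. by []. Qed.

Lemma lp_path i : path_to T one one (lp i).
Proof.
rewrite /lp; case: (boolP (vertex rk i)) => iv; last first.
  by split => //; [exact: cont_cst|move=> _; exact: one_torus].
have hth := char_subtorus hlam iv; split.
- pose g (v : 'rV[R]_2) : R^o := 2 * pi * v 0 ord_max.
  have gc : continuous g by move=> v; apply: (@cvgMl_tmp R^o _ (nbhs v) _ (fun v : 'rV[R]_2 => v 0 ord_max)); exact: coord_continuous.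
  move=> t; apply: (@continuous_comp _ _ _ (g \o set_val) (theta i \o expi)); last exact: (theta_expi_continuous hth).
  by apply: continuous_comp; [exact: initial_continuous|exact: gc].
- by move=> t; apply: (theta_torus hth); exact: norm_expi.
- rewrite /ext loop_expi to_simplexK; last exact: simplex_vert.
  by rewrite vert_coord mulr0 expi0 (theta1 hth).
- rewrite /ext loop_expi to_simplexK; last exact: simplex_vert.
  rewrite vert_coord mulr1 mulr_natl /expi cos2pi sin2pi; exact: (theta1 hth).
Qed.

Lemma lp_cyc i : cyc (k := k) 1 T (gen (mk_sing (lp i))).
Proof.
have [h1 h2 h3 h4] := lp_path i; apply: cyc_gen => //.
by rewrite bd_edge h3 h4 subrr.
Qed.

Lemma torus_atE I : I != \bot%O -> @torus_at R N _ S I = T.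
Proof. by move=> I0; apply/seteqP; split => x; [case|]. Qed.

Lemma torus_at_sub I : @torus_at R N _ S I `<=` T.
Proof. by move=> x []. Qed.

Lemma trans_continuous (g : V) : continuous (mul g).
Proof.
apply: row_continuous => i.
have -> : (fun x => mul g x 0 i) = (fun x : V => g 0 i * x 0 i : C) by apply/funext => x; rewrite mxE.
by move=> x; apply: (@cvgMl_tmp C _ (nbhs x) _ (fun x : V => x 0 i : C)); exact: (@coord_continuous C).
Qed.

Lemma trans_within g : {within T, continuous (mul g)}.
Proof. exact: within_cont (trans_continuous (g := g)). Qed.

Lemma tr_within I J : I != \bot%O -> (I <= J)%O -> {within T, continuous (tr I J)}.
Proof. by move=> I0 IJ; have [g _ e] := htr I0 IJ; exact: (within_eq e (trans_within (g := g))). Qed.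

Lemma tr_torus I J x : I != \bot%O -> (I <= J)%O -> T x -> T (tr I J x).
Proof. by move=> I0 IJ tx; have [g gT e] := htr I0 IJ; rewrite e //; exact: torus_mul_in. Qed.

Lemma hcl_trl d g (z : @chain R k V) : T g -> cyc d T z -> hcl d T (trl mul g z) = hcl d T z.
Proof.
move=> gT zC; have [zT z0] := zC; have [p pP] := torus_path gT.
have tC : cyc d T (trl mul g z).
  split; last by rewrite chain_bd_push z0 linear0.
  exact: (trl_in (@torus_mul_continuous R N) (@torus_mul_in R N)).
apply/(hcl_eqP tC zC).
have [b bT e] := trl_homologous (@torus_mul_continuous R N) (@torus_mul_in R N) (@torus_mul1 R N) pP zT z0.
by exists b.
Qed.

Lemma push_eq (f g : V -> V) d (z : @chain R k V) : (forall x, T x -> f x = g x) -> chains_in R k d T z ->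
  chain_push f z = chain_push g z.
Proof.
move=> fg; apply: (chains_in_ind (U := eq_sub (chain_push f) (chain_push g))) => s _ sT.
rewrite /eq_sub /submod_set /= !chain_push_gen; congr (gen (mk_sing _)); apply/funext => t /=.
exact: fg.
Qed.

Lemma hcl_tr I J d (z : @chain R k V) : I != \bot%O -> (I <= J)%O -> cyc d T z -> hcl d T (chain_push (tr I J) z) = hcl d T z.
Proof.
move=> I0 IJ zC; have [g gT e] := htr I0 IJ.
by rewrite (push_eq e (proj1 zC)); exact: hcl_trl.
Qed.

Section Functional.
Variables (J : S) (J0 : J != \bot%O) (i : S) (iJ : verts rk J i).

Let iv : vertex rk i. Proof. by case/andP: iJ. Qed.
Let ileJ : (i <= J)%O. Proof. by case/andP: iJ. Qed.

(** Places [x] in the factor [l] of the product of subtori. The other factors are translates of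
    subtori, so [tr s J one] is the base point to insert there. *)
Definition inc (l : S) (x : V) : {ptws S -> V} := fun s : S =>
  if verts rk J s then (if s == l then x else tr s J one) else one.

Lemma inc_continuous l : continuous (inc l).
Proof.
move=> x; have FF : Filter (inc l @ x) by apply: fmap_filter; exact: nbhs_filter.
apply/cvg_sup => s W /= [_ [ [B Bop <-] Bx BW] ].
have sc : continuous (fun y => inc l y s).
  rewrite /inc; case: (verts rk J s); last exact: cont_cst.
  by case: (s == l); [move=> y; exact: cvg_id|exact: cont_cst].
have : nbhs x (fun y => B (inc l y s)) by apply: sc; exact: open_nbhs_nbhs.
by apply: filterS => y By; exact: BW.
Qed.

Lemma eval_continuous (s : S) : continuous (fun f : {ptws S -> V} => f s).
Proof. exact: (@proj_continuous S (fun=> V) s). Qed.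

Lemma inc_in l x : (tr l J @` lam l) x -> subtori_product rk tr lam J (inc l x).
Proof.
move=> hx s; rewrite /inc; case: (boolP (verts rk J s)) => sJ //; case: (eqVneq s l) => [sl|_]; first by subst.
have sv : vertex rk s by case/andP: sJ.
have hth := char_subtorus hlam sv; exists one => //.
have <- : theta s @` @circle R = lam s by case: hth.
by exists 1; [rewrite /circle /= normr1|exact: (theta1 hth)].
Qed.

Lemma subtori_mul_continuous : continuous (@subtori_mul R N _ S rk J).
Proof.
rewrite /subtori_mul; elim: (index_enum S) => [|s l IH].
  have -> : (fun f : {ptws S -> V} => \big[mul/one]_(i <- [::] | verts rk J i) f i) = fun=> one.
    by apply/funext => f; rewrite big_nil.
  exact: cont_cst.
have -> : (fun f : {ptws S -> V} => \big[mul/one]_(i <- s :: l | verts rk J i) f i) =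
    (fun f => if verts rk J s then mul (f s) (\big[mul/one]_(i <- l | verts rk J i) f i)
      else \big[mul/one]_(i <- l | verts rk J i) f i).
  by apply/funext => f; rewrite big_cons.
case: (verts rk J s); last exact: IH.
move=> f.
apply: (@continuous_comp _ _ _ (fun f : {ptws S -> V} => (f s, \big[mul/one]_(i <- l | verts rk J i) f i))
  (fun p : V * V => mul p.1 p.2)); last exact: torus_mul_continuous.
apply: cont_pair; [exact: eval_continuous|exact: IH].
Qed.

(** All the other factors are constant and combine to the translation by [h]. *)
Lemma subtori_mul_inc l : verts rk J l ->
  exists2 h, T h & forall x, subtori_mul rk J (inc l x) = mul h x.
Proof.
move=> lJ; exists (\big[mul/one]_(s | verts rk J s && (s != l)) tr s J one).
  elim/big_ind : _ => [|y z|s /andP[sJ _]]; [exact: one_torus|exact: torus_mul_in|].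
  have /andP[sv sJ'] := sJ; by apply: tr_torus => //; [exact: vertex_bot|exact: one_torus].
move=> y; rewrite /subtori_mul.
have : l \in index_enum S by rewrite mem_index_enum.
have := index_enum_uniq S; elim: (index_enum S) => [//|s r IH] /= /andP[sr ur].
rewrite inE !big_cons; case: eqVneq => [e _|ls /= lr]; first subst s.
  rewrite lJ andbF {1}/inc lJ eqxx torus_mulC; congr mul.
  rewrite [LHS]big_seq_cond [RHS]big_seq_cond; apply: eq_big => [j|j /andP[jr jJ]].
    case: (boolP (j \in r)) => //= jr; case: eqVneq => [e|]; last by rewrite andbT.
    by rewrite e (negbTE sr) in jr.
  by rewrite /inc jJ; case: eqVneq => // e; rewrite e (negbTE sr) in jr.
rewrite andbT; case: ifP => sJ; last exact: IH.
by rewrite (IH ur lr) torus_mulA /inc sJ eq_sym (negbTE ls).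
Qed.

(** A class is included into T^N(J), retracted to the product of the subtori by the splitting,
    projected to the factor [i], and its winding number is taken. The loop of the vertex [l] comes
    from the product, where its coordinate [i] goes once around if l = i and is constant
    otherwise. *)
Lemma char_functional : exists phi : {linear homology R k 1 T set0 -> k^o},
  forall l, verts rk J l -> phi (hcl 1 T (gen (mk_sing (lp l)))) = (i == l)%:R.
Proof.
have [g gT ge] := htr (vertex_bot iv) ileJ.
have hth := char_subtorus hlam iv.
pose th r := mul g (theta i (expi r)).
have thc : continuous th.
  move=> r; apply: (@continuous_comp _ _ _ (theta i \o expi) (mul g)); first exact: (theta_expi_continuous hth).
  exact: trans_continuous.
have thE r s : th r = th s <-> cos r = cos s /\ sin r = sin s.
  rewrite -(theta_expi_eq hth); split => [|h]; first exact: torus_mulKI.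
  by rewrite /th h.
have turnE : turn th = tr i J @` lam i.
  rewrite (theta_expi_turn hth) /turn; apply/seteqP; split => x.
    move=> [r r01 <-]; exists (theta i (expi r)); first by exists r.
    by rewrite ge //; apply: (theta_torus hth); exact: norm_expi.
  move=> [_ [r r01 <-] <-]; exists r => //; rewrite /th ge //.
  by apply: (theta_torus hth); exact: norm_expi.
have hV : hausdorff_space V by exact: norm_hausdorff.
have [psi psi1] := @winding_functional R k V hV th thc thE.
have [phiI [r rK]] := char_split hlam J0.
pose A := subtori_product rk tr lam J.
have evA f : A f -> turn th (f i) by move=> /(_ i); rewrite iJ turnE.
have evc : {within A, continuous (fun f : {ptws S -> V} => f i)} by apply: within_cont; exact: eval_continuous.
have inclc : linear (homology_incl (@torus_at R N _ S J) set0 : homology R k 1 T set0 -> _).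
  by apply: homology_incl_linear; rewrite torus_atE.
have evl := homology_map_linear (R := R) (k := k) (d := 1) evc evA.
pose phi : {linear _ -> _} := psi \o (pack_linear evl \o (r \o pack_linear inclc)).
exists phi => l lJ; rewrite /phi /=.
have lv : vertex rk l by case/andP: lJ.
have lleJ : (l <= J)%O by case/andP: lJ.
have hthl := char_subtorus hlam lv.
pose b : simplex R 1 -> {ptws S -> V} := inc l \o (tr l J \o lp l).
have [lpc lpT lp0 lp1] := lp_path l.
have bA t : A (b t).
  apply: inc_in; exists (lp l t) => //; rewrite /lp lv.
  by case: hthl => _ _ _ _ <-; exists (loop t) => //; exact: norm_expi.
have trc : continuous (tr l J \o lp l).
  exact: (continuous_comp_within lpc lpT (tr_within (vertex_bot lv) lleJ)).
have bc : continuous b by move=> t; apply: continuous_comp; [exact: trc|exact: inc_continuous].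
have b01 x : ext b x = inc l (tr l J (ext (lp l) x)) by [].
have bE : gen (mk_sing b) = chain_push (inc l \o tr l J) (gen (mk_sing (lp l))) :> @chain R k _.
  by rewrite chain_push_gen.
have bC : cyc (k := k) 1 A (gen (mk_sing b)).
  by split; [exact: gen_in|rewrite bE chain_bd_push (proj2 (lp_cyc l)) linear0].
have [h hT he] := subtori_mul_inc lJ.
have smc : {within A, continuous (subtori_mul rk J)} by apply: within_cont; exact: subtori_mul_continuous.
have smA f : A f -> @torus_at R N _ S J (subtori_mul rk J f).
  move=> fA; split=> //; rewrite /subtori_mul.
  elim/big_ind : _ => [|x y|s sJ]; [exact: one_torus|exact: torus_mul_in|].
  have /andP[sv sJ'] := sJ; have := fA s; rewrite sJ => -[x lx <-].
  apply: tr_torus => //; first exact: vertex_bot.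
  by have [_ h' _ _ _] := char_subtorus hlam sv; exact: h'.
(* The loop inserted in the product and the loop [lp l] have the same class in the torus, because
   multiplication and [tr] alter it by translations only. *)
have key : homology_map (subtori_mul rk J) (@torus_at R N _ S J) set0 (hcl (k := k) 1 A (gen (mk_sing b))) =
    homology_incl (@torus_at R N _ S J) set0 (hcl (k := k) 1 T (gen (mk_sing (lp l)))).
  rewrite (homology_map_hcl smc smA bC) (homology_incl_hcl _ (lp_cyc l)); last by rewrite torus_atE.
  rewrite torus_atE // -[RHS](hcl_tr (vertex_bot lv) lleJ (lp_cyc l)) -[RHS](hcl_trl hT); last first.
    exact: (push_cyc (tr_within (vertex_bot lv) lleJ) (fun x => tr_torus (vertex_bot lv) lleJ (x := x)) (lp_cyc l)).
  congr hcl; rewrite /trl !chain_push_gen; congr (gen (mk_sing _)); apply/funext => t.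
  exact: he.
rewrite -key rK (homology_map_hcl evc evA bC) chain_push_gen.
have [il|il] := eqVneq i l.
  rewrite -il in lp0 *; rewrite -[RHS]psi1; congr (psi (hcl _ _ (gen (mk_sing _)))).
  apply/funext => t; rewrite /b -il /= /inc iJ eqxx /th -ge.
    by rewrite /lp iv.
  exact: (theta_torus hth (norm_expi _)).
rewrite -[RHS](linear0 psi); congr (psi _).
have -> : (fun f : {ptws S -> V} => f i) \o b = fun=> tr i J one.
  by apply/funext => t; rewrite /b /= /inc iJ (negbTE il).
have cT : turn th (tr i J one).
  rewrite turnE; exists one => //; rewrite -(theta1 hth).
  by case: hth => _ _ _ _ <-; exists 1 => //; rewrite /circle /= normr1.
have c0 : chain_bd (gen (mk_sing (fun _ : simplex R 1 => tr i J one))) = 0 :> @chain R k V.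
  by rewrite bd_edge subrr.
have cC : cyc (k := k) 1 (turn th) (gen (mk_sing (fun _ : simplex R 1 => tr i J one))).
  by apply: cyc_gen; [exact: cont_cst|move=> t; exact: cT|exact: c0].
rewrite -(hcl0 (k := k) 1 (turn th)); apply/(hcl_eqP cC (sm0 _)).
(* A constant edge is the boundary of a constant triangle, whose faces enter with the signs 1, -1
   and 1. *)
exists (gen (mk_sing (fun _ : simplex R 2 => tr i J one))).
  by apply: gen_in; [exact: cont_cst|move=> t; exact: cT].
rewrite chain_bd_gen /= !big_ord_recl big_ord0 addr0 expr0 expr1 scale1r scaleN1r subr0.
by rewrite -signr_odd expr0 scale1r; exact: addNKr.
Qed.

End Functional.

End CharacteristicFunctionals.

(** * Ideals in the homology of the torus *)

Section IdealOperators.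
Context {R : realType} {k : comUnitRingType} {N : nat}.
Local Notation C := (R[i]^o).
Local Notation V := 'rV[C]_N.
Local Notation T := (@torus R N).
Local Notation one := (torus_one R N).
Local Notation mul := (@torus_mul R N).
Context {disp : Order.disp_t} {S : finBPOrderType disp}.
Variables (rk : S -> nat) (tr : S -> S -> V -> V) (lam : S -> set V) (theta : S -> C -> V).
Hypothesis htr : forall I J, I != \bot%O -> (I <= J)%O ->
  exists2 g, T g & forall x, T x -> tr I J x = mul g x.
Hypothesis hlam : characteristic_map k rk tr lam theta.
Hypothesis hS : simplicial_poset rk.
Local Notation chain := (@chain R k V).
Local Notation Ch := (@chains_in R k V).
Local Notation Hom j := (homology R k j T set0).
Local Notation lp := (lp rk theta).
Local Notation ver I := (enum (verts rk I)).
Local Notation Lv := (@L_val R N k disp S).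
Local Notation om := (omega k tr lam theta).
Let rk0 := rk_bot hS.
Local Opaque homology.

Definition koE (i : S) : {linear chain -> chain} := cr1 mul (lp i).

Let lpP i : path_to T one one (lp i). Proof. exact: (lp_path hlam). Qed.

Lemma koE_in i d x : Ch d T x -> Ch d.+1 T (koE i x).
Proof.
have [h1 h2 _ _] := lpP i.
exact: (cr1_in (@torus_mul_continuous R N) (@torus_mul_in R N)).
Qed.

Lemma koE_koE i l x : koE i (koE l x) = - koE l (koE i x).
Proof. by rewrite /= !(cr1_cr1 _ _ (@torus_mulCA R N)) opprB. Qed.

Lemma koE_sq i x : koE i (koE i x) = 0.
Proof. by rewrite /= (cr1_cr1 _ _ (@torus_mulCA R N)) subrr. Qed.

Lemma koE_bd i x : chain_bd (koE i x) = - koE i (chain_bd x).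
Proof. exact: (bd_cr1_loop _ _ (lpP i)). Qed.

Lemma dual_cochains J : J != \bot%O -> exists c : S -> {linear chain -> k^o},
  (forall i b, Ch 2 T b -> c i (chain_bd b) = 0) /\
  (forall i l y, verts rk J i -> verts rk J l -> T y -> c i (trl mul y (gen (mk_sing (lp l)))) = (i == l)%:R).
Proof.
move=> J0; have h i : exists phi : {linear Hom 1 -> k^o}, verts rk J i ->
    forall l, verts rk J l -> phi (hcl 1 T (gen (mk_sing (lp l)))) = (i == l)%:R.
  case: (boolP (verts rk J i)) => iJ; last by exists \0.
  by have [phi hp] := char_functional htr hlam rk0 J0 iJ; exists phi.
have [phi hp] := choice h; exists (fun i => cochain (phi i)); split => [i b bT|i l y iJ lJ Ty].
  exact: cochain_bd.
by rewrite -(hp i iJ l lJ); exact: (cochain_trl _ Ty (lpP l)).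
Qed.

(** Brings the values of L at all I into one module. For proper faces [torus_at I] equals the torus,
    though not by conversion, so the comparison is a map induced by inclusion. As transition maps
    are translations, restrictions become the identity under it. *)
Definition kap j I : Lv j I -> Hom j := homology_incl T set0.
Lemma kap_linear j I : linear (@kap j I).
Proof. exact: (homology_incl_linear (@torus_at_sub R N disp S I)). Qed.
HB.instance Definition _ j I := GRing.isLinear.Build k (Lv j I) (Hom j) *:%R (@kap j I) (@kap_linear j I).

Lemma kap0 j I : kap (0 : Lv j I) = 0. Proof. exact: linear0. Qed.
Lemma kapP j I a (x y : Lv j I) : kap (a *: x + y) = a *: kap x + kap y. Proof. exact: linearP. Qed.

Lemma kap_hcl j I z : cyc j (@torus_at R N disp S I) z -> kap (hcl j (torus_at I) z) = hcl j T z.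
Proof. exact: (homology_incl_hcl (@torus_at_sub R N disp S I)). Qed.

Lemma L_val_bot j (x : Lv j \bot%O) : x = 0.
Proof.
have [z [zC _] ->] := hcl_ex x; rewrite (chains_in_set0 (c := z) (d := j)) ?hcl0 //.
by move=> s /zC[h1 h2 h3]; split => // y /h3 [] /eqP.
Qed.

Lemma kap_inj j I : injective (@kap j I).
Proof.
move=> x y; case: (eqVneq I \bot%O) => [I0|I0]; first by subst I; rewrite (L_val_bot x) (L_val_bot y).
have [z zC ->] := hcl_ex x; have [w wC ->] := hcl_ex y; rewrite !kap_hcl //.
have zT := zC; have wT := wC; rewrite torus_atE // in zT; rewrite torus_atE // in wT.
move=> /(hcl_eqP zT wT)[b bT e]; apply/(hcl_eqP zC wC); exists b => //.
by rewrite torus_atE.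
Qed.

Lemma kap_onto j I (y : Hom j) : I != \bot%O -> exists x : Lv j I, kap x = y.
Proof.
move=> I0; have [z zC ->] := hcl_ex y; exists (hcl j (torus_at I) z).
by rewrite kap_hcl // torus_atE.
Qed.

Lemma kap_res (L : forall j, sheaf (Lv j)) (hL : locally_constant_sheaf tr L) j I J (x : Lv j I) :
  I != \bot%O -> (I <= J)%O -> kap (res (L j) I J x) = kap x.
Proof.
move=> I0 IJ; have J0 : J != \bot%O.
  by apply: contra I0 => /eqP J0; rewrite -lex0 -J0.
have [z zC ->] := hcl_ex x; rewrite hL //.
have zT : cyc j T z by rewrite -(torus_atE I0).
rewrite kap_hcl //.
have trw : {within torus_at I, continuous (tr I J)} by rewrite torus_atE //; exact: (tr_within htr).
have trT y : torus_at I y -> torus_at J (tr I J y).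
  by rewrite !torus_atE //; exact: (tr_torus htr).
rewrite (homology_map_hcl trw trT zC) kap_hcl; last exact: (push_cyc trw trT zC).
exact: (hcl_tr htr).
Qed.

Lemma kap_omega i I : verts rk I i -> I != \bot%O -> kap (om i I) = hcl 1 T (gen (mk_sing (lp i))).
Proof.
move=> iI I0; have /andP[iv iI'] := iI; have hth := char_subtorus hlam iv.
have i0 := vertex_bot rk0 iv.
have thw : {within @circle R, continuous (theta i)} by case: hth.
have thl z : circle z -> lam i (theta i z) by case: hth => _ _ _ _ <- ?; exists z.
have lc : cyc (k := k) 1 (@circle R) (gen (mk_sing (@loop R))).
  have [lc _ _ _] := lpP i; apply: cyc_gen.
  - move=> t; apply: (@continuous_comp _ _ _ (fun t : simplex R 1 => 2 * pi * set_val t 0 ord_max : R^o) expi); last exact: expi_continuous.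
    apply: (@cvgMl_tmp R^o _ (nbhs t) _ (fun t : simplex R 1 => set_val t 0 ord_max : R^o)).
    by apply: (@continuous_comp _ _ _ set_val (fun v : 'rV[R]_2 => v 0 ord_max)); [exact: initial_continuous|exact: coord_continuous].
  - by move=> t; exact: norm_expi.
  rewrite bd_edge /ext !loop_expi !to_simplexK; try exact: simplex_vert.
  by rewrite !vert_coord mulr0 mulr1 mulr_natl /expi cos2pi sin2pi cos0 sin0 subrr.
have trw : {within lam i, continuous (tr i I)}.
  by apply: continuous_subspaceW (tr_within htr i0 iI'); case: hth.
have trT y : lam i y -> torus_at I (tr i I y).
  by rewrite torus_atE // => ly; apply: (tr_torus htr) => //; case: hth => _ h _ _ _; exact: h.
have lpE : lp i = theta i \o @loop R by rewrite /lp iv.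
rewrite /omega (homology_map_hcl thw thl lc) (homology_map_hcl trw trT); last exact: push_cyc lc.
rewrite kap_hcl; last by apply: (push_cyc trw trT); exact: (push_cyc thw thl lc).
by rewrite chain_push_gen -lpE (hcl_tr htr i0 iI') //; exact: (lp_cyc hlam).
Qed.

(** Both factors get better representatives: that of [omega] is replaced by the loop through
    [product_homologous], that of [x] by [z] through the product of the loop with a chain between
    them. The shuffle product with the loop is [koE i]. *)
Lemma kap_mul i I j (x : Lv j I) z : verts rk I i -> I != \bot%O -> cyc j T z -> kap x = hcl j T z ->
  kap (L_mul (om i I) x : Lv j.+1 I) = hcl j.+1 T (koE i z).
Proof.
move=> iI I0 [zT z0] xz; rewrite /L_mul /pontryagin.
set u := cls_repr (om i I); set v := cls_repr x.
have uC : cyc 1 (@torus_at R N disp S I) u by apply/cycP; exact: cls_repr_in.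
have vC : cyc j (@torus_at R N disp S I) v by apply/cycP; exact: cls_repr_in.
have uT := uC; have vT := vC; rewrite torus_atE // in uT; rewrite torus_atE // in vT.
have uE : hcl 1 T u = hcl 1 T (gen (mk_sing (lp i))).
  by rewrite -(kap_omega iI I0) -(kap_hcl uC) /hcl cls_reprK.
have vE : hcl j T v = hcl j T z by rewrite -xz -(kap_hcl vC) /hcl cls_reprK.
have lC : cyc (k := k) 1 T (gen (mk_sing (lp i))) := lp_cyc hlam i.
have /(hcl_eqP uT lC)[b bT be] := uE; have /(hcl_eqP vT (conj zT z0))[b' bT' be'] := vE.
have [e eT ee] := product_homologous (@torus_mul_continuous R N) (@torus_mul_in R N)
  (proj1 uT) (proj1 lC) bT (proj1 vT) (proj2 vT) (esym be).
have pE : chain_product mul (gen (mk_sing (lp i))) v = koE i v.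
  by rewrite (chain_product_cr1z mul v (proj1 lC)) cr1z_gen.
rewrite pE in ee; have {}pE : chain_product mul u v = koE i v + chain_bd e by rewrite -ee addrC subrK.
have vEC : cyc j.+1 T (koE i v) by split; [exact: koE_in (proj1 vT)|rewrite koE_bd (proj2 vT) linear0 oppr0].
have zEC : cyc j.+1 T (koE i z) by split; [exact: koE_in zT|rewrite koE_bd z0 linear0 oppr0].
have pC : cyc j.+1 T (chain_product mul u v).
  by rewrite pE; apply: smD => //; split; [exact: chains_in_bd|exact: chain_bdK].
have pC' : cyc j.+1 (@torus_at R N disp S I) (chain_product mul u v) by rewrite torus_atE.
transitivity (hcl j.+1 T (chain_product mul u v)); first exact: kap_hcl pC'.
apply/(hcl_eqP pC zEC); exists (e - koE i b').
  by apply: smB => //; exact: koE_in bT'.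
rewrite linearB /= -[cr1 _ _ _]/(koE i b') koE_bd opprK be' linearB pE.
by rewrite addrA [chain_bd e + _]addrC.
Qed.

Local Notation wed := (wedges (fun d => Ch d T) (@chain_bd R k V) koE).
Local Notation lin := (linear_ideal (fun d => Ch d T) (@chain_bd R k V) koE).
Local Notation Pr j I := (@principal_ideal R N k disp S rk tr lam theta j I).
Local Notation Id j I := (@ideal R N k disp S rk tr lam theta j I).

Lemma wed_cyc s j z : wed s j z -> cyc j T z.
Proof. by move/(wedges_cycle koE_in koE_bd). Qed.

Lemma principal_set_wedges s j I x : I != \bot%O -> {subset s <= ver I} ->
  principal_set (j := j) [seq om i I | i <- s] x <-> exists2 z, wed s j z & kap x = hcl j T z.
Proof.
move=> I0; elim: s j x => [|i s IH] j x sI.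
  by split => // _; have [z zC xz] := hcl_ex (kap x); exists z.
have iI : verts rk I i by have := sI i (mem_head _ _); rewrite mem_enum.
have {}IH j' (y : Lv j' I) : principal_set (j := j') [seq om i I | i <- s] y <-> exists2 z, wed s j' z & kap y = hcl j' T z.
  by apply: IH => l ls; apply: sI; rewrite inE ls orbT.
case: j x => [|j] x /=.
  split => [->|[z -> xz]]; first by exists 0; [by []|rewrite kap0 hcl0].
  by apply: kap_inj; rewrite xz kap0 hcl0.
split => [[y /IH[z zs yz] ->]|[_ [z zs ->] xz]].
  by exists (koE i z); [exists z|rewrite (kap_mul iI I0 (wed_cyc zs) yz)].
have [y yz] := kap_onto (hcl j T z) I0; exists y; first by apply/IH; exists z.
by apply: kap_inj; rewrite xz (kap_mul iI I0 (wed_cyc zs) yz).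
Qed.

(** The sets [wedges] are closed under linear combinations, so the span in [principal_ideal] adds
    nothing to [principal_set]. *)
Lemma principalP j I x : I != \bot%O ->
  Pr j I x <-> exists2 z, wed (ver I) j z & kap x = hcl j T z.
Proof.
move=> I0; split => [h|hz]; last by move=> U; apply; apply/principal_set_wedges.
pose P (x : Lv j I) := exists2 z, wed (ver I) j z & kap x = hcl j T z.
have P0 : P 0 by exists 0; [exact: wedges0|rewrite kap0 hcl0].
have PP a y z : P y -> P z -> P (a *: y + z).
  move=> [y' hy ey] [z' hz ez]; exists (a *: y' + z'); first exact: wedges_lin.
  by rewrite kapP ey ez (hcl_linear _ (wed_cyc hy) (wed_cyc hz)).
by apply: (h (Submod P0 PP)) => y /principal_set_wedges; apply.
Qed.

Lemma idealP j I x : I != \bot%O -> Id j I x -> exists2 z, lin (ver I) j z & kap x = hcl j T z.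
Proof.
move=> I0; case: j x => [|j] x h; first by exists 0; rewrite ?h ?kap0 ?hcl0.
pose P (x : Lv j.+1 I) := exists2 z, lin (ver I) j.+1 z & kap x = hcl j.+1 T z.
have Ec i z : cyc j T z -> cyc j.+1 T (koE i z).
  by move=> [h1 h2]; split; [exact: koE_in|rewrite koE_bd h2 linear0 oppr0].
have P0 : P 0.
  exists 0; last by rewrite kap0 hcl0.
  exists (fun=> 0); first by move=> i; split; [exact: sm0|exact: linear0].
  by rewrite big1 // => i _; rewrite linear0.
have PP a y z : P y -> P z -> P (a *: y + z).
  move=> [_ [y' hy ->] ey] [_ [z' hz ->] ez].
  exists (\sum_(i <- ver I) koE i (a *: y' i + z' i)).
    exists (fun i => a *: y' i + z' i) => // i.
    exact: (submod_setP (s := cyc j T) a (hy i) (hz i)).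
  have hyc : cyc j.+1 T (\sum_(i <- ver I) koE i (y' i)).
    by apply: (sm_sum (U := cyc j.+1 T)) => i _; apply: Ec; exact: hy.
  have hzc : cyc j.+1 T (\sum_(i <- ver I) koE i (z' i)).
    by apply: (sm_sum (U := cyc j.+1 T)) => i _; apply: Ec; exact: hz.
  rewrite kapP ey ez -(hcl_linear a hyc hzc).
  congr hcl; rewrite scaler_sumr -big_split; apply: eq_bigr => i _.
  by rewrite [RHS]linearP.
apply: (h (Submod P0 PP)) => _ [i iI [y ->]]; have [z zC yz] := hcl_ex (kap y).
exists (koE i z); last exact: (kap_mul iI I0 zC yz).
exists (fun l => if l == i then z else 0).
  by move=> l; case: eqP => // _; split; [exact: sm0|exact: linear0].
rewrite (bigD1_seq i) ?enum_uniq ?mem_enum //= eqxx big1 ?addr0 // => l /negbTE ->.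
exact: linear0.
Qed.

Lemma ver_vertex a : vertex rk a -> ver a = [:: a].
Proof.
move=> av; have /eq_enum -> : verts rk a =i pred1 a; last by rewrite enum1.
move=> b; rewrite inE; apply/andP/eqP => [[bv bla]|->]; last by split.
apply/eqP; case: (eqVneq b a) => // ba; have /(rk_lt hS) : (b < a)%O by rewrite lt_neqAle ba.
by rewrite (eqP av) (eqP bv).
Qed.

(** At a vertex the principal ideal is generated by one linear form, which is among the generators
    of the ideal at [J]. *)
Lemma principal_ideal_vertex j a J x : verts rk J a -> Pr j a x -> exists2 y, Id j J y & kap y = kap x.
Proof.
move=> aJ; have /andP[av aleJ] := aJ; have a0 := vertex_bot rk0 av.
have J0 : J != \bot%O by apply: contra a0 => /eqP J0; rewrite -lex0 -J0.
move/(principalP _ a0); rewrite ver_vertex //.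
case: j x => [|j] x; first by move=> [_ -> xz]; exists 0; rewrite // xz kap0 hcl0.
move=> [_ [z zC ->] xz]; have [y yz] := kap_onto (hcl j T z) J0.
exists (L_mul (om a J) y); last by rewrite (kap_mul aJ J0 zC yz) xz.
by move=> U; apply; exists a => //; exists y.
Qed.

Lemma covers_verts I K a : covers rk I K -> verts rk K a -> ~~ (a <= I)%O -> perm_eq (a :: ver I) (ver K).
Proof.
move=> IK /andP[av aK] aI; have [f [fle fK fs frk]] := below_coord hS K.
have [A fA] := fs _ (covers_le IK); have [B fB] := fs _ aK.
have /cards1P[c Bc] : #|B| == 1%N by rewrite -frk fB.
have cA : c \notin A by rewrite -finset.sub1set -Bc -fle fA fB.
have AcT : (c |: A)%SET = finset.setT.
  apply/eqP; rewrite finset.eqEcard finset.subsetT /= cardsU1 cA cardsT card_ord.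
  by apply: eq_leq; rewrite -frk fA; exact: covers_rk IK.
apply: uniq_perm; rewrite ?enum_uniq //=; first by rewrite mem_enum enum_uniq andbT unfold_in /verts (negbTE aI) andbF.
move=> b; rewrite inE !mem_enum; apply/orP/idP => [[/eqP ->|/andP[bv bI]]|/andP[bv bK]].
- by rewrite unfold_in /verts av aK.
- by rewrite unfold_in /verts bv (le_trans bI (covers_le IK)).
have [E fE] := fs _ bK; have /cards1P[d Ed] : #|E| == 1%N by rewrite -frk fE.
have : d \in (c |: A)%SET by rewrite AcT inE.
rewrite inE finset.in_set1 => /orP[/eqP dc|dA]; [left|right].
  by rewrite -fE -fB Ed Bc dc.
by rewrite unfold_in /verts bv -fE -fA fle Ed finset.sub1set.
Qed.

Lemma vertex_below I : I != \bot%O -> exists a, verts rk I a.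
Proof.
move=> I0; have [f [fle fI fs frk]] := below_coord hS I.
have : (0 < rk I)%N by rewrite lt0n (rk_eq0 hS).
move=> r0; exists (f [set Ordinal r0]%SET); rewrite /verts fI andbT /vertex frk.
by rewrite cards1.
Qed.

(** [Q a] is induced by the chain map [koQ], built from the loops and from cochains dual to the
    vertices of [J]; hence it depends on [J]. The four properties are what the contraction of the
    row at [J] asks for. *)
Lemma ideal_operators j J : J != \bot%O -> exists Q : S -> {linear Hom j -> Hom j},
  [/\ forall I K a x, I != \bot%O -> covers rk I K -> (K <= J)%O -> verts rk K a -> ~~ (a <= I)%O ->
        Pr j I x -> exists2 y, Pr j K y & kap y = Q a (kap x),
      forall a x, verts rk J a -> Id j J x -> exists2 y, Pr j a y & kap y = Q a (kap x),
      forall x, Id j J x -> \sum_(a in verts rk J) Q a (kap x) = kap x &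
      forall I x, I != \bot%O -> (I <= J)%O -> Pr j I x -> \sum_(a in verts rk J) Q a (kap x) = kap x].
Proof.
move=> J0; have [c [cb cl]] := dual_cochains J0.
pose I (i : S) : {linear chain -> chain} := cap (c i).
have IZ i d x : i \in ver J -> Ch d.+1 T x -> Ch d T (I i x) by move=> _; exact: cap_in.
have I0 i x : i \in ver J -> Ch 0 T x -> I i x = 0 by move=> _; exact: cap_in0.
have IE i l d x : i \in ver J -> l \in ver J -> Ch d T x ->
    I i (koE l x) = (i == l)%:R *: x - koE l (I i x).
  rewrite !mem_enum => iJ lJ xT.
  exact: (cap_cr1 (@torus_mulC R N) (@torus_mul1 R N) (lpP l) (fun y => cl i l y iJ lJ) xT).
have DI i d x : i \in ver J -> Ch d T x -> chain_bd (I i x) = - I i (chain_bd x).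
  by move=> _ xT; rewrite [I i (chain_bd x)](cap_bd (cb i) xT) opprK.
pose Q0 a := koQ koE I (ver J) a.
have QZ a d x : a \in ver J -> Ch d T x -> Ch d T (Q0 a x).
  by move=> aJ h; exact: (koQ_in (Z := fun d => Ch d T) koE_in IZ I0 aJ h).
have QD a d x : a \in ver J -> Ch d T x -> chain_bd (Q0 a x) = Q0 a (chain_bd x).
  by move=> aJ h; exact: (koQ_D (Z := fun d => Ch d T) koE_in IZ I0 koE_bd DI aJ h).
have Qh a : exists q : {linear Hom j -> Hom j}, a \in ver J -> forall z, cyc j T z -> q (hcl j T z) = hcl j T (Q0 a z).
  case: (boolP (a \in ver J)) => aJ; last by exists \0.
  have ZZ (z : chain) : rel_cycles R k j T set0 z -> rel_cycles R k j T set0 (Q0 a z).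
    by move/cycP => -[h1 h2]; apply/cycP; split; [exact: QZ|rewrite (QD _ _ _ aJ h1) h2 linear0].
  have BB (z : chain) : rel_boundaries R k j T set0 z -> rel_boundaries R k j T set0 (Q0 a z).
    move/relbP => -[b bT <-]; apply/relbP; exists (Q0 a b); first exact: QZ.
    by rewrite (QD _ _ _ aJ bT).
  exists (pack_linear (subquot_map_linear ZZ BB)) => _ z /cycP zC /=.
  exact: subquot_map_cls.
have [Q QE] := choice Qh; exists Q.
have lin_sum z : lin (ver J) j z -> cyc j T z -> \sum_(a in verts rk J) Q a (hcl j T z) = hcl j T z.
  move=> zl zC; rewrite -big_enum /= big_seq.
  under eq_bigr => a aJ do rewrite (QE a aJ z zC).
  rewrite -cls_sum; last first.
    by move=> a aJ; apply/cycP; split; [apply: QZ aJ _; exact: (proj1 zC)|rewrite (QD _ _ _ aJ (proj1 zC)) (proj2 zC) linear0].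
  rewrite -big_seq -[RHS]/(cls _ _ z); congr (cls _ _ _).
  exact: (sum_koQ_ideal (Z := fun d => Ch d T) koE_in IZ I0 koE_koE koE_sq IE (enum_uniq _) zl).
have ver_sub I' : (I' <= J)%O -> {subset ver I' <= ver J}.
  by move=> IJ a; rewrite !mem_enum => /andP[av aI]; apply/andP; split => //; exact: le_trans IJ.
have lin_cyc z : lin (ver J) j z -> cyc j T z.
  case: (j) z => [|j'] z; first by move=> ->; exact: sm0.
  move=> [y hy ->]; apply: (sm_sum (U := cyc j'.+1 T)) => i _.
  by split; [exact: koE_in (proj1 (hy i))|rewrite koE_bd (proj2 (hy i)) linear0 oppr0].
have wed_lin I' z : I' != \bot%O -> (I' <= J)%O -> wed (ver I') j z -> lin (ver J) j z.
  move=> I'0 IJ; have : ver I' != [::].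
    have [a aI] := vertex_below I'0.
    by apply/eqP => e; have : a \in ver I'; [rewrite mem_enum|rewrite e].
  have := ver_sub I' IJ; case: (ver I') => [//|i s] sJ _.
  case: (j) z => [|j'] z; first by move=> ->.
  move=> [y /wed_cyc hy ->]; exists (fun l => if l == i then y else 0).
    by move=> l; case: eqP => // _; split; [exact: sm0|exact: linear0].
  rewrite (bigD1_seq i) ?enum_uniq ?(sJ i (mem_head _ _)) //= eqxx big1 ?addr0 // => l /negbTE ->.
  exact: linear0.
split.
- move=> I' K a x I'0 IK KJ aK aI' /(principalP _ I'0)[z zs ->].
  have K0 : K != \bot%O by apply: contra I'0 => /eqP K0; rewrite -lex0 -K0; exact: covers_le IK.
  have aJ : a \in ver J by apply: (ver_sub K KJ); rewrite mem_enum.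
  rewrite QE //; last exact: wed_cyc zs.
  have [y yz] := kap_onto (hcl j T (Q0 a z)) K0; exists y => //.
  apply/(principalP _ K0); exists (Q0 a z) => //.
  apply: (wedges_perm koE_koE (covers_verts IK aK aI')).
  apply: (wedges_Q (Z := fun d => Ch d T) koE_in IZ I0 koE_koE koE_sq IE koE_bd DI _ aJ _ zs).
    exact: ver_sub (le_trans (covers_le IK) KJ).
  by rewrite mem_enum unfold_in /verts (negbTE aI') andbF.
- move=> a x aJ' /(idealP J0)[z zl ->]; have /andP[av aleJ] := aJ'.
  have aJ : a \in ver J by rewrite mem_enum.
  have a0 := vertex_bot rk0 av; rewrite QE //; last exact: lin_cyc.
  have [y yz] := kap_onto (hcl j T (Q0 a z)) a0; exists y => //.
  apply/(principalP _ a0); exists (Q0 a z) => //; rewrite ver_vertex //.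
  exact: (linear_ideal_Q (Z := fun d => Ch d T) koE_in IZ I0 koE_bd DI aJ zl).
- by move=> x /(idealP J0)[z zl ->]; apply: lin_sum => //; exact: lin_cyc.
- move=> I' x I'0 I'J /(principalP _ I'0)[z zs ->].
  by apply: lin_sum; [exact: wed_lin zs|exact: wed_cyc zs].
Qed.

End IdealOperators.

(** The sign convention in a form that compares the two upper edges of a square of coverings with
    the two lower ones. *)
Lemma sign_square (p q r s : int) : p = 1 \/ p = -1 -> q = 1 \/ q = -1 -> r = 1 \/ r = -1 -> s = 1 \/ s = -1 ->
  p * q + r * s = 0 -> p * r = - (q * s).
Proof. by move=> [->|->] [->|->] [->|->] [->|->]. Qed.

(** * Contraction of the rows *)

Section BooleanHomotopy.
Context {k : comUnitRingType} {disp : Order.disp_t} {S : finBPOrderType disp} (rk : S -> nat).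
Hypothesis hS : simplicial_poset rk.
Variables (sgn : S -> S -> int) (hsgn : sign_convention rk sgn).
Variables (W : lmodType k) (J : S) (Q : S -> {linear W -> W}).
Local Notation sg I K := ((sgn I K)%:~R : k).

(* The vertex of K that is not below I, when I <_1 K (there is only one); the default is junk. *)
Definition vdiff (K I : S) : S := odflt \bot%O [pick a | verts rk K a && ~~ (a <= I)%O].

Lemma vdiffP I K : covers rk I K -> verts rk K (vdiff K I) && ~~ (vdiff K I <= I)%O.
Proof.
move=> IK; rewrite /vdiff; case: pickP => [a //|no] /=.
have [f [fle fK fs frk]] := below_coord hS K.
have [A fA] := fs _ (covers_le IK); have [T fT] := fs _ (lexx K).
have : (#|A| < #|T|)%N by rewrite -!frk fA fT (covers_rk IK).
move=> AT; have /subsetPn[c cT cA] : ~~ (T \subset A) by apply: contraL AT => /subset_leq_card; rewrite leqNgt.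
have := no (f [set c]%SET); rewrite /verts /vertex fK frk cards1 -fA fle finset.sub1set.
by rewrite (negbTE cA).
Qed.

Lemma covers_bot K : covers rk \bot%O K = vertex rk K.
Proof.
apply/idP/idP => [/covers_rk|/eqP h]; first by rewrite (rk_bot hS) => h; apply/eqP.
by apply: coversE; rewrite ?le0x // (rk_bot hS).
Qed.

Lemma vdiff_bot K : covers rk \bot%O K -> vdiff K \bot%O = K.
Proof.
move=> cK; have /andP[/andP[v le] _] := vdiffP cK.
apply/eqP; case: (eqVneq (vdiff K \bot%O) K) => // ne.
have /(rk_lt hS) : (vdiff K \bot < K)%O by rewrite lt_neqAle ne.
by rewrite (eqP v); rewrite covers_bot in cK; rewrite (eqP cK).
Qed.

(* kdown is the boundary, and kup adds a missing vertex a by means of Q a; by kdown_kup they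
   are related as wedge and contraction with a vector. *)
Definition kdown (Y : S -> W) (A : S) : W := \sum_(K | covers rk A K && (K <= J)%O) sg K A *: Y K.
Definition kup (Y : S -> W) (K : S) : W := \sum_(I | covers rk I K) sg K I *: Q (vdiff K I) (Y I).

Lemma sgk_sq I K : covers rk I K -> sg K I * sg K I = 1.
Proof. by case/(hsgn.1) => ->; rewrite -intrM. Qed.

(** Let X be the set of vertices of [A] in the Boolean lattice below [J]. Adding a vertex outside X
    and removing it, or removing a vertex of X and adding it back, gives each vertex operator once.
    The mixed terms, with [c] outside and [d] inside of X, cancel because their four signs belong to
    a square of coverings. *)
Lemma kdown_kup Y A : (A <= J)%O -> kdown (kup Y) A + kup (kdown Y) A = \sum_(a in verts rk J) Q a (Y A).
Proof.
move=> AJ; have [f [fle fJ fs frk]] := below_coord hS J.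
have finj : injective f by move=> B C e; apply/eqP; rewrite finset.eqEsubset -!fle e lexx.
have sumup (X : {set 'I_(rk J)}) (F : S -> W) :
    \sum_(K | covers rk (f X) K && (K <= J)%O) F K = \sum_(c in (~: X)%SET) F (f (c |: X)%SET).
  rewrite -(big_imset F (h := fun c => f (c |: X)%SET)) /=; last first.
    move=> c d; rewrite !finset.in_setC => cX dX /finj /setP /(_ c).
    by rewrite !inE eqxx (negbTE cX) /= orbF => /esym/eqP.
  apply: eq_bigl => K; apply/andP/imsetP => [[cK KJ]|[c]]; last first.
    rewrite finset.in_setC => cX ->; split; last exact: fJ.
    by apply: coversE; rewrite ?fle ?finset.subsetUr // !frk cardsU1 cX.
  have [Z fZ] := fs _ KJ; have XZ : X \subset Z by rewrite -fle fZ (covers_le cK).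
  have : #|Z :\: X|%SET == 1%N.
    by rewrite cardsD (finset.setIidPr XZ) -!frk fZ (covers_rk cK) subSnn.
  move/cards1P => [c ZX]; have : c \in (Z :\: X)%SET by rewrite ZX inE.
  rewrite inE => /andP[cX cZ]; exists c; first by rewrite inE.
  rewrite -fZ; congr f; apply/setP => x; rewrite !inE.
  have : (x \in (Z :\: X)%SET) = (x == c) by rewrite ZX inE.
  by rewrite inE => <-; have := fintype.subsetP XZ x; case: (x \in X) => [->|] //; rewrite orbF.
have sumdown (X : {set 'I_(rk J)}) (F : S -> W) :
    \sum_(I | covers rk I (f X)) F I = \sum_(c in X) F (f (X :\ c)%SET).
  rewrite -(big_imset F (h := fun c => f (X :\ c)%SET)) /=; last first.
    move=> c d cX dX /finj /setP /(_ c); rewrite !inE eqxx cX /=.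
    by case: eqP.
  apply: eq_bigl => I; apply/idP/imsetP => [cI|[c cX ->]]; last first.
    by apply: coversE; rewrite ?fle ?subD1set // !frk [LHS](cardsD1 c) cX.
  have [Z fZ] := fs _ (le_trans (covers_le cI) (fJ X)).
  have ZX : Z \subset X by rewrite -fle fZ (covers_le cI).
  have : #|X :\: Z|%SET == 1%N.
    by rewrite cardsD (finset.setIidPr ZX) -!frk fZ (covers_rk cI) subSnn.
  move/cards1P => [c XZ]; have : c \in (X :\: Z)%SET by rewrite XZ inE.
  rewrite inE => /andP[cZ cX]; exists c => //.
  rewrite -fZ; congr f; apply/setP => x; rewrite !inE.
  have : (x \in (X :\: Z)%SET) = (x == c) by rewrite XZ inE.
  by rewrite inE => <-; have := fintype.subsetP ZX x; case: (x \in Z) => [->|] //; case: (x \in X).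
have vert_f a : (a \in verts rk J) = (a \in [set f [set c]%SET | c : 'I_(rk J)]%SET).
  apply/andP/imsetP => [[av aJ]|[c _ ->]]; last by split; [rewrite /vertex frk cards1|exact: fJ].
  have [B fB] := fs _ aJ; have /cards1P[c Bc] : #|B| == 1%N by rewrite -frk fB.
  by exists c; rewrite // -fB Bc.
have sumvert (F : S -> W) : \sum_(a in verts rk J) F a = \sum_c F (f [set c]%SET).
  rewrite (eq_bigl _ _ vert_f) big_imset //= => c d _ _ /finj /setP /(_ c).
  by rewrite !inE eqxx => /esym/eqP.
have vdiffE (X : {set 'I_(rk J)}) c : c \in X -> vdiff (f X) (f (X :\ c)%SET) = f [set c]%SET.
  move=> cX; rewrite /vdiff; case: pickP => [a /andP[/andP[av aX] aI]|/(_ (f [set c]%SET))] /=.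
    have [B fB] := fs _ (le_trans aX (fJ X)); have /cards1P[d Bd] : #|B| == 1%N by rewrite -frk fB.
    move: aX aI; rewrite -fB Bd !fle !finset.sub1set !inE => dX; rewrite dX andbT negbK.
    by move/eqP->.
  by rewrite /verts /vertex frk cards1 !fle !finset.sub1set !inE cX !eqxx.
have [X fX] := fs _ AJ; rewrite -fX /kdown /kup sumup sumdown sumvert.
under eq_bigr => c cX do rewrite sumdown scaler_sumr.
under [X in _ + X]eq_bigr => d dX do rewrite sumup linear_sum scaler_sumr.
have E1 c : c \in (~: X)%SET -> \sum_(d in (c |: X)%SET)
    sg (f (c |: X)%SET) (f X) *: (sg (f (c |: X)%SET) (f ((c |: X) :\ d)%SET) *:
      Q (vdiff (f (c |: X)%SET) (f ((c |: X) :\ d)%SET)) (Y (f ((c |: X) :\ d)%SET))) =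
  Q (f [set c]%SET) (Y (f X)) - \sum_(d in X) sg (f X) (f (X :\ d)%SET) *:
    (sg (f (c |: (X :\ d))%SET) (f (X :\ d)%SET) *: Q (f [set d]%SET) (Y (f (c |: (X :\ d))%SET))).
  rewrite finset.in_setC => cX; have cW : c \in (c |: X)%SET by rewrite !inE eqxx.
  rewrite (bigD1 c) //= vdiffE //.
  have -> : ((c |: X) :\ c)%SET = X by rewrite finset.setU1K.
  have cov : covers rk (f X) (f (c |: X)%SET).
    by apply: coversE; rewrite ?fle ?finset.subsetUr // !frk cardsU1 cX.
  rewrite scalerA (sgk_sq cov) scale1r; congr (_ + _).
  rewrite -sumrN; apply: eq_big => d.
    by rewrite !inE; case: eqVneq => [->|]; rewrite ?(negbTE cX) ?andbT.
  rewrite !inE => /andP[/orP[/eqP->|dX]]; rewrite ?eqxx // => dc.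
  have dW : d \in (c |: X)%SET by rewrite !inE dX orbT.
  have WE : ((c |: X) :\ d)%SET = (c |: (X :\ d))%SET.
    by apply/setP => x; rewrite !inE; case: eqVneq => //= ->; rewrite (negbTE dc).
  rewrite vdiffE // WE !scalerA -scaleNr; congr (_ *: _); rewrite -!intrM -intrN; congr _%:~R.
  have cX' : c \notin (X :\ d)%SET by rewrite !inE (negbTE cX) andbF.
  have c1 : covers rk (f (X :\ d)%SET) (f X).
    by apply: coversE; rewrite ?fle ?subD1set // !frk [LHS](cardsD1 d) dX.
  have c2 : covers rk (f (X :\ d)%SET) (f (c |: (X :\ d))%SET).
    by apply: coversE; rewrite ?fle ?finset.subsetUr // !frk cardsU1 cX'.
  have c3 : covers rk (f (c |: (X :\ d))%SET) (f (c |: X)%SET).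
    rewrite -WE; apply: coversE; first by rewrite fle subD1set.
    by rewrite !frk [LHS](cardsD1 d) dW.
  have ne : f X != f (c |: (X :\ d))%SET.
    by apply/eqP => /finj /setP /(_ c); rewrite !inE eqxx (negbTE cX).
  exact: sign_square (hsgn.1 _ _ cov) (hsgn.1 _ _ c1) (hsgn.1 _ _ c3) (hsgn.1 _ _ c2) (hsgn.2 _ _ _ _ ne c1 cov c2 c3).
have E2 d : d \in X -> \sum_(c in (~: (X :\ d))%SET) sg (f X) (f (X :\ d)%SET) *:
    Q (vdiff (f X) (f (X :\ d)%SET)) (sg (f (c |: (X :\ d))%SET) (f (X :\ d)%SET) *: Y (f (c |: (X :\ d))%SET)) =
  Q (f [set d]%SET) (Y (f X)) + \sum_(c in (~: X)%SET) sg (f X) (f (X :\ d)%SET) *: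
    (sg (f (c |: (X :\ d))%SET) (f (X :\ d)%SET) *: Q (f [set d]%SET) (Y (f (c |: (X :\ d))%SET))).
  move=> dX; have dC : d \in (~: (X :\ d))%SET by rewrite !inE eqxx.
  have c1 : covers rk (f (X :\ d)%SET) (f X).
    by apply: coversE; rewrite ?fle ?subD1set // !frk [LHS](cardsD1 d) dX.
  rewrite (bigD1 d) //= vdiffE //; congr (_ + _).
    by rewrite finset.setD1K // linearZ /= scalerA (sgk_sq c1) scale1r.
  apply: eq_big => c.
    by rewrite !inE; case: eqVneq => [->|]; rewrite ?dX ?andbT.
  by rewrite linearZ.
rewrite (eq_bigr _ E1) (eq_bigr _ E2) !big_split /= sumrN.
rewrite [X in _ - X]exchange_big /= addrACA addrC addNr add0r.
rewrite [RHS](bigID (mem X)) /= addrC; congr (_ + _).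
by apply: eq_bigl => c; rewrite inE.
Qed.

End BooleanHomotopy.

Section RowHomotopy.
Context {k : comUnitRingType} {disp : Order.disp_t} {S : finBPOrderType disp} (rk : S -> nat).
Hypothesis hS : simplicial_poset rk.
Variables (sgn : S -> S -> int) (hsgn : sign_convention rk sgn).
Local Notation sg I K := ((sgn I K)%:~R : k).

(** Maps are constructed in the ambient module [W], into which the ideals embed by [kM] and [kB],
    and are then pulled back along these injections. *)
Lemma lift_image (A X W : lmodType k) (kp : {linear A -> W}) (f : {linear X -> W}) :
  injective kp -> (forall x, exists y, kp y = f x) -> exists g : {linear X -> A}, forall x, kp (g x) = f x.
Proof.
move=> ki im; have [g gE] := choice im; have gl : linear g.
  by move=> a x y; apply: ki; rewrite linearP !gE linearP.
by exists (pack_linear gl).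
Qed.

Variables (W : lmodType k) (M B : S -> lmodType k).
Variables (kM : forall I, {linear M I -> W}) (kB : forall I, {linear B I -> W}).
Hypothesis kM_inj : forall I, injective (kM I).
Hypothesis kB_inj : forall I, injective (kB I).
Hypothesis M_bot : forall x : M \bot%O, x = 0.
Hypothesis B_bot : forall x : B \bot%O, x = 0.
Variable Pi : cosheaf M.
Hypothesis kM_cores : forall I J y, I != \bot%O -> (I <= J)%O -> kM I (cores Pi I J y) = kM J y.

Variable J : S.
Hypothesis J0 : J != \bot%O.
Variable Q : S -> {linear W -> W}.
Hypothesis Q_up : forall I K a (x : M I), I != \bot%O -> covers rk I K -> (K <= J)%O -> verts rk K a ->
  ~~ (a <= I)%O -> exists y : M K, kM K y = Q a (kM I x).
Hypothesis Q_vert : forall a (x : B J), verts rk J a -> exists y : M a, kM a y = Q a (kB J x).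
Hypothesis Q_sumB : forall x : B J, \sum_(a in verts rk J) Q a (kB J x) = kB J x.
Hypothesis Q_sumM : forall I (x : M I), I != \bot%O -> (I <= J)%O -> \sum_(a in verts rk J) Q a (kM I x) = kM I x.
Hypothesis vert_sub : forall a (x : M a), verts rk J a -> exists y : B J, kB J y = kM a x.

Local Notation bd := (boundary rk sgn Pi).
Definition below (y : dsum M) : Prop := forall I, ~~ (I <= J)%O -> y I = 0.

(** [M] vanishes at the bottom element, and this slot is filled with [B J]: the augmented row is
    indexed by the full Boolean lattice below [J], where [kdown_kup] yields a contraction. *)
Let aug (b : B J) (y : dsum M) (I : S) : W := if I == \bot%O then kB J b else kM I (y I).
Let augP a b y b' y' I : aug (a *: b + b') (a *: y + y') I = a *: aug b y I + aug b' y' I.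
Proof. by rewrite /aug; case: ifP => _; rewrite linearP. Qed.

Local Notation kup := (kup rk sgn Q).
Local Notation kdown := (kdown rk sgn J).

Let kup_aug b y K : (K <= J)%O -> K != \bot%O -> exists z : M K, kM K z = kup (aug b y) K.
Proof.
move=> KJ K0; pose im (w : W) := exists z : M K, kM K z = w.
have im0 : im 0 by exists 0; rewrite linear0.
have imD w w' : im w -> im w' -> im (w + w').
  by move=> [z <-] [z' <-]; exists (z + z'); rewrite linearD.
rewrite /kup; apply: (big_ind im im0 imD) => I IK.
have /andP[vK vI] := vdiffP hS IK.
suff [z zE] : im (Q (vdiff rk K I) (aug b y I)) by exists ((sgn K I)%:~R *: z); rewrite linearZ /= zE.
rewrite /aug; case: eqVneq => [I0|I0]; last exact: Q_up vI.
have vJ : verts rk J (vdiff rk K I) by case/andP: vK => v le; apply/andP; split => //; exact: le_trans KJ.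
by have := Q_vert b vJ; rewrite I0 vdiff_bot // -I0.
Qed.

(** The maps are components of one differential and one homotopy on the augmented row: [e] is
    [kdown] at the bottom element, [h] and [w] are [kup] on families that vanish at, respectively
    are concentrated at, the bottom element. The homotopy identities are the components of
    [kdown_kup], the sum of the [Q a] being the identity on the ideals. *)
Lemma row_homotopy : exists (e : {linear dsum M -> B J}) (h : {linear dsum M -> dsum M}) (w : {linear B J -> dsum M}),
  [/\ forall y, kB J (e y) = \sum_(i in verts rk J) sg i \bot%O *: kM i (y i),
      forall y K, ~~ (K <= J)%O -> h y K = 0,
      forall y K r, (forall I, rk I != r -> y I = 0) -> rk K != r.+1 -> h y K = 0,
      forall b K, ~~ verts rk J K -> w b K = 0 &
      [/\ forall y, below y -> bd (h y) + h (bd y) + w (e y) = y,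
      forall b, e (w b) = b, forall y, below y -> e (bd y) = 0 & forall y, e (h y) = 0]].
Proof.
have eE : exists e : {linear dsum M -> B J}, forall y, kB J (e y) = \sum_(i in verts rk J) sg i \bot%O *: kM i (y i).
  have fl : linear (fun y : dsum M => \sum_(i in verts rk J) sg i \bot%O *: kM i (y i)).
    move=> a y y'; rewrite scaler_sumr -big_split; apply: eq_bigr => i _.
    by rewrite dsumDE dsumZE linearP scalerDr !scalerA mulrC.
  apply: (lift_image (f := pack_linear fl)) => // y /=.
  pose im (w : W) := exists z : B J, kB J z = w.
  have im0 : im 0 by exists 0; rewrite linear0.
  have imD w w' : im w -> im w' -> im (w + w').
    by move=> [z <-] [z' <-]; exists (z + z'); rewrite linearD.
  apply: (big_ind im im0 imD) => i iJ; have [z zE] := vert_sub (y i) iJ.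
  by exists (sg i \bot%O *: z); rewrite linearZ /= zE.
have [e eP] := eE.
have hK K : exists h : {linear dsum M -> M K},
    forall y, kM K (h y) = if (K <= J)%O && (K != \bot%O) then kup (aug 0 y) K else 0.
  case: (boolP ((K <= J)%O && (K != \bot%O))) => [/andP[KJ K0]|_]; last by exists \0 => y; rewrite linear0.
  have fl : linear (fun y => kup (aug 0 y) K).
    move=> a y y'; rewrite /kup scaler_sumr -big_split; apply: eq_bigr => I _.
    have := augP a 0 y 0 y' I; rewrite scaler0 addr0 => ->.
    by rewrite linearP scalerDr !scalerA mulrC.
  by apply: (lift_image (f := pack_linear fl)) => // y; exact: kup_aug.
have wK K : exists h : {linear B J -> M K},
    forall b, kM K (h b) = if (K <= J)%O && (K != \bot%O) then kup (aug b 0) K else 0.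
  case: (boolP ((K <= J)%O && (K != \bot%O))) => [/andP[KJ K0]|_]; last by exists \0 => y; rewrite linear0.
  have fl : linear (fun b => kup (aug b 0) K).
    move=> a b b'; rewrite /kup scaler_sumr -big_split; apply: eq_bigr => I _.
    have := augP a b 0 b' 0 I; rewrite scaler0 addr0 => ->.
    by rewrite linearP scalerDr !scalerA mulrC.
  by apply: (lift_image (f := pack_linear fl)) => // b; exact: kup_aug.
pose h0 (y : dsum M) : dsum M := fun K => sval (cid (hK K)) y.
have h0P y K : kM K (h0 y K) = if (K <= J)%O && (K != \bot%O) then kup (aug 0 y) K else 0.
  exact: (svalP (cid (hK K))).
have h0l : linear h0 by move=> a y y'; apply: functional_extensionality_dep => K; rewrite /h0 linearP.
pose w0 (b : B J) : dsum M := fun K => sval (cid (wK K)) b.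
have w0P b K : kM K (w0 b K) = if (K <= J)%O && (K != \bot%O) then kup (aug b 0) K else 0.
  exact: (svalP (cid (wK K))).
have w0l : linear w0 by move=> a y y'; apply: functional_extensionality_dep => K; rewrite /w0 linearP.
have aug0 I (b : B J) (y : dsum M) : (I = \bot%O -> b = 0) -> (I != \bot%O -> y I = 0) -> aug b y I = 0.
  by rewrite /aug; case: eqVneq => [_ -> // _|_ _ -> //]; rewrite linear0.
have c0 I K : covers rk I K -> K != \bot%O.
  by move=> /covers_rk r; apply/eqP => K0; move: r; rewrite K0 (rk_bot hS).
have sumJ (F : S -> W) : \sum_(i in verts rk J) F i = \sum_(i | covers rk \bot%O i && (i <= J)%O) F i.
  by apply: eq_bigl => i; rewrite covers_bot.
have kbd y I : I != \bot%O -> kM I (bd y I) = \sum_(K | covers rk I K) sg K I *: kM K (y K).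
  move=> I0; rewrite /boundary linear_sum; apply: eq_bigr => K IK.
  by rewrite linearZ /= (kM_cores _ I0 (covers_le IK)).
have kdE Y I (Y' : S -> W) : (forall K, covers rk I K -> (K <= J)%O -> Y K = Y' K) -> (forall K, ~~ (K <= J)%O -> Y K = 0) ->
    \sum_(K | covers rk I K) sg K I *: Y K = kdown Y' I.
  move=> YY Y0; rewrite /kdown [LHS](bigID (fun K => (K <= J)%O)) /= [X in _ + X]big1 ?addr0.
    by apply: eq_bigr => K /andP[c KJ]; rewrite YY.
  by move=> K /andP[_ KJ]; rewrite Y0 ?scaler0.
exists e, (pack_linear h0l), (pack_linear w0l); split => //=.
- by move=> y K KJ; apply: kM_inj; rewrite h0P (negbTE KJ) linear0.
- move=> y K r yr rK; apply: kM_inj; rewrite h0P linear0; case: ifP => // _.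
  rewrite /kup big1 // => I IK; rewrite aug0 ?linear0 ?scaler0 // => _; apply: yr.
  by apply: contra rK => /eqP <-; rewrite (covers_rk IK).
- move=> b K KJ; apply: kM_inj; rewrite w0P linear0; case: ifP => // /andP[le _].
  rewrite /kup big1 // => I IK; rewrite aug0 ?linear0 ?scaler0 // => I0.
  by rewrite I0 (covers_bot hS) in IK; move: KJ; rewrite /verts le andbT IK.
split.
- move=> y yJ; apply: functional_extensionality_dep => K.
  case: (eqVneq K \bot%O) => [K0|K0]; first by subst K; rewrite [RHS]M_bot; exact: M_bot.
  apply: kM_inj; rewrite !dsumDE !linearD /= h0P w0P K0 andbT kbd //.
  case: (boolP (K <= J)%O) => [KJ|KJ]; last first.
    rewrite yJ // linear0 !addr0 big1 // => L KL; rewrite h0P [(L <= J)%O]negbTE ?scaler0 //.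
    by apply: contra KJ; exact: le_trans (covers_le KL).
  have -> : \sum_(L | covers rk K L) sg L K *: kM L (h0 y L) = kdown (kup (aug 0 y)) K.
    apply: kdE => L; last by move=> nL; rewrite h0P (negbTE nL).
    by move=> KL LJ; rewrite h0P LJ (c0 _ _ KL).
  rewrite -addrA; have <- : kup (kdown (aug 0 y)) K = kup (aug 0 (bd y)) K + kup (aug (e y) 0) K.
    rewrite /kup -big_split /=; apply: eq_bigr => I IK; rewrite -scalerDr -linearD; congr (_ *: Q _ _).
    have := augP 1 0 (bd y) (e y) 0 I; rewrite !scale1r add0r addr0 => <-.
    rewrite /aug; case: eqVneq => [I0|I0].
      rewrite eP sumJ /kdown I0; apply: eq_bigr => L /andP[cL _].
      by rewrite (negbTE (c0 _ _ cL)).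
    rewrite kbd //; apply/esym/kdE => L; last by move=> nL; rewrite yJ ?linear0.
    by move=> cL _; rewrite (negbTE (c0 _ _ cL)).
  rewrite (kdown_kup hS hsgn) // -[RHS](Q_sumM _ K0 KJ); apply: eq_bigr => a _.
  by rewrite /aug (negbTE K0).
- move=> b; apply: kB_inj; rewrite eP sumJ -[RHS]Q_sumB.
  have := kdown_kup hS hsgn Q (aug b 0) (le0x J); rewrite [kup (kdown _) _]big_pred0 ?addr0; last first.
    by move=> I; apply/negbTE/negP => /c0; rewrite eqxx.
  rewrite {2}/aug eqxx => <-; rewrite /kdown; apply: eq_bigr => i /andP[ci iJ].
  by rewrite w0P iJ (c0 _ _ ci).
- move=> y yJ; apply: kB_inj; rewrite eP linear0 sumJ.
  under eq_bigr => i /andP[ci _] do rewrite kbd ?(c0 _ _ ci) // scaler_sumr.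
  rewrite (exchange_big_dep xpredT) //= big1 // => L _; case: (boolP (L <= J)%O) => LJ; last first.
    by rewrite big1 // => i _; rewrite yJ // linear0 !scaler0.
  rewrite (eq_bigl (fun i => covers rk \bot%O i && covers rk i L)); last first.
    move=> i; rewrite andbAC; case: (boolP (covers rk i L)) => iL; rewrite ?andbF // (le_trans (covers_le iL) LJ) ?andbT //.
  under eq_bigr => i _ do rewrite scalerA mulrC.
  by rewrite -scaler_suml (sgn_sum0k hS hsgn) scale0r.
- move=> y; apply: kB_inj; rewrite eP linear0 big1 // => i /andP[iv _].
  rewrite h0P; case: ifP => _; rewrite ?scaler0 // /kup big1 ?scaler0 // => I Ii.
  rewrite aug0 ?linear0 ?scaler0 // => I0; have := covers_rk Ii; rewrite (eqP iv) => -[r0].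
  by move: I0; rewrite -(rk_eq0 hS) -r0.
Qed.

End RowHomotopy.

(** * Tensor products *)

Section TensorTheory.
Context {k : comUnitRingType}.
Implicit Types M N P : lmodType k.

Definition pure M N (x : M) (y : N) : tensor M N := quot_pi _ (gen (x, y)).

Lemma quot_pi_linear M (U : submod M) : linear (@quot_pi k M U).
Proof. by move=> a x y; rewrite quot_piD quot_piZ. Qed.

Lemma pure_linearl M N (y : N) : linear (fun x : M => pure x y).
Proof.
move=> a x x'; rewrite /pure -[a *: quot_pi _ _](quot_piZ _ a) -quot_piD; apply/quot_eqP => U; apply.
by left; exists a, x, x', y; rewrite opprD addrA.
Qed.

Lemma pure_linearr M N (x : M) : linear (fun y : N => pure x y).
Proof.
move=> a y y'; rewrite /pure -[a *: quot_pi _ _](quot_piZ _ a) -quot_piD; apply/quot_eqP => U; apply.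
by right; exists a, x, y, y'; rewrite opprD addrA.
Qed.

Definition purel M N (y : N) : {linear M -> tensor M N} := pack_linear (@pure_linearl M N y).
Definition purer M N (x : M) : {linear N -> tensor M N} := pack_linear (@pure_linearr M N x).

Lemma pure0l M N (y : N) : pure (0 : M) y = 0. Proof. exact: (linear0 (purel M y)). Qed.
Lemma pure0r M N (x : M) : pure x (0 : N) = 0. Proof. exact: (linear0 (purer N x)). Qed.
Lemma pureDr M N (x : M) (y y' : N) : pure x (y + y') = pure x y + pure x y'. Proof. exact: (linearD (purer N x)). Qed.
Lemma pureDl M N (x x' : M) (y : N) : pure (x + x') y = pure x y + pure x' y. Proof. exact: (linearD (purel M y)). Qed.
Lemma pureZl M N a (x : M) (y : N) : pure (a *: x) y = a *: pure x y. Proof. by rewrite -[LHS]/(purel M y (a *: x)) linearZ. Qed.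
Lemma pureZr M N a (x : M) (y : N) : pure x (a *: y) = a *: pure x y. Proof. by rewrite -[LHS]/(purer N x (a *: y)) linearZ. Qed.
Lemma pure_suml M N (I : Type) (r : seq I) (Q : pred I) (f : I -> M) (y : N) :
  pure (\sum_(i <- r | Q i) f i) y = \sum_(i <- r | Q i) pure (f i) y.
Proof. exact: (linear_sum (purel M y)). Qed.
Lemma pure_sumr M N (I : Type) (r : seq I) (Q : pred I) (x : M) (f : I -> N) :
  pure x (\sum_(i <- r | Q i) f i) = \sum_(i <- r | Q i) pure x (f i).
Proof. exact: (linear_sum (purer N x)). Qed.

Lemma tensor_ind M N (U : submod (tensor M N)) : (forall x y, U (pure x y)) -> forall t, U t.
Proof.
move=> h t; rewrite -(quot_reprK t).
exact: (free_ind (U := submod_preim (pack_linear (@quot_pi_linear _ (submod_span (@bilinear_rels k M N)))) U)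
  (fun p => let: (x, y) := p in h x y)).
Qed.

Lemma tensor_ext M N P (f g : {linear tensor M N -> P}) :
  (forall x y, f (pure x y) = g (pure x y)) -> f =1 g.
Proof. by move=> h; apply: (tensor_ind (U := eq_sub f g)). Qed.

Lemma tensor_map_pure M N M' N' (f : {linear M -> M'}) (g : {linear N -> N'}) x y :
  tensor_map f g (pure x y) = pure (f x) (g y).
Proof. by rewrite /pure tensor_map_pi /tensor_free lin_ext_gen. Qed.

Lemma tensor_lift M N P (b : M -> N -> P) :
  (forall y, linear (b^~ y)) -> (forall x, linear (b x)) ->
  exists L : {linear tensor M N -> P}, forall x y, L (pure x y) = b x y.
Proof.
move=> bl br; pose l := lin_ext (fun p : M * N => b p.1 p.2).
have l0 u : submod_span (@bilinear_rels k M N) u -> l u = 0.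
  move=> h; apply: (h (submod_preim (l : {linear _ -> _}) (submod0 _))) => _ [[a [x [x' [y ->]]]]|[a [x [y [y' ->]]]]]; rewrite sm_preimE /= /submod_set /=;
    rewrite /l !linearB /= linearZ /= !lin_ext_gen /= ?bl ?br.
    by rewrite addrAC addrK subrr.
  by rewrite addrAC addrK subrr.
pose L (t : tensor M N) := l (quot_repr t).
have LE u : L (quot_pi _ u) = l u.
  by apply/eqP; rewrite -subr_eq0 -linearB; apply/eqP/l0/quot_eqP; rewrite quot_reprK.
have Ll : linear L.
  move=> a t t'; rewrite -(quot_reprK t) -(quot_reprK t') -quot_pi_linear !LE.
  exact: linearP.
by exists (pack_linear Ll) => x y /=; rewrite /pure LE /l lin_ext_gen.
Qed.

End TensorTheory.

(* D G + G D + U f differs from the identity by an operator that lowers the filtration TF, hence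
   is nilpotent. *)
Section FilteredContraction.
Context {k : comUnitRingType} {T C : lmodType k}.
Variables (TT : int -> submod T) (CC : int -> submod C) (TF : int -> nat -> submod T) (top : nat).
Variables (D G : {linear T -> T}) (d : {linear C -> C}) (f : {linear T -> C}) (U : {linear C -> T}).
Hypothesis DT : forall m t, TT m t -> TT (m + 1) (D t).
Hypothesis GT : forall m t, TT m t -> TT (m - 1) (G t).
Hypothesis UT : forall m c, CC m c -> TT m (U c).
Hypothesis fT : forall m t, TT m t -> CC m (f t).
Hypothesis DD : forall t, D (D t) = 0.
Hypothesis fD : forall m t, TT m t -> f (D t) = d (f t).
Hypothesis fU : forall c, f (U c) = c.
Hypothesis fG : forall m t, TT m t -> f (G t) = 0.
Hypothesis TF_TT : forall m r t, TF m r t -> TT m t.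
Hypothesis TT_TF : forall m t, TT m t -> TF m top t.
Hypothesis TF0 : forall m t, TF m 0 t -> t = 0.
Hypothesis contract : forall m r t, TF m r.+1 t -> TF m r (D (G t) + G (D t) + U (f t) - t).

(** If [D t] and [f t] vanish, then [t - D (G t)] lies one step lower in the filtration and still
    has both properties; after [top] steps nothing is left. *)
Lemma kernel_acyclic m t : TT m t -> D t = 0 -> f t = 0 ->
  exists t', [/\ TT (m - 1) t', f t' = 0 & D t' = t].
Proof.
move/TT_TF; elim: top t => [|r IH] t tF Dt ft.
  by exists 0; rewrite (TF0 tF) !linear0; split => //; exact: sm0.
have tT := TF_TT tF; have GtT := GT tT.
have := smN (contract tF); rewrite Dt ft !linear0 !addr0 opprB => t1F.
have [||t' [t'T ft' Dt']] := IH (t - D (G t)) t1F.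
- by rewrite linearB /= Dt DD subrr.
- by rewrite linearB /= ft (fD GtT) (fG tT) linear0 subrr.
exists (t' + G t); split; [exact: smD|by rewrite linearD /= ft' (fG tT) addr0|].
by rewrite linearD /= Dt' subrK.
Qed.

Lemma lift_cycle m c : CC m c -> d c = 0 -> exists t, [/\ TT m t, D t = 0 & f t = c].
Proof.
move=> cC dc; have UcT := UT cC.
have [||t' [t'T ft' Dt']] := kernel_acyclic (DT UcT); first exact: DD.
  by rewrite (fD UcT) fU.
exists (U c - t'); split; last by rewrite linearB /= fU ft' subr0.
  by apply: smB => //; move: t'T; rewrite addrK.
by rewrite linearB /= Dt' subrr.
Qed.

(** A chain bounding [f t] is lifted by [U], and [kernel_acyclic] bounds the difference that
    remains. *)
Lemma boundary_iff m t : TT m t -> D t = 0 ->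
  (exists2 c, CC (m - 1) c & d c = f t) <-> (exists2 t', TT (m - 1) t' & D t' = t).
Proof.
move=> tT Dt; split=> [[c cC dc]|[t' t'T <-]]; last first.
  by exists (f t'); [exact: fT|rewrite (fD t'T)].
have UcT := UT cC; have DUT := DT UcT; rewrite subrK in DUT.
have [|||t' [t'T ft' Dt']] := @kernel_acyclic m (t - D (U c)).
- exact: smB.
- by rewrite linearB /= Dt DD subrr.
- by rewrite linearB /= (fD UcT) fU dc subrr.
by exists (t' + U c); [exact: smD|rewrite linearD /= Dt' subrK].
Qed.

End FilteredContraction.

Lemma dep_choice (I : Type) (X : I -> Type) (P : forall i, X i -> Prop) :
  (forall i, exists x, P i x) -> exists f : forall i, X i, forall i, P i (f i).
Proof.
by move=> h; exists (fun i => projT1 (cid (h i))) => i; exact: (projT2 (cid (h i))).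
Qed.

Section CoboundarySupport.
Context {k : comUnitRingType} {disp : Order.disp_t} {S : finBPOrderType disp} (rk : S -> nat).
Variables (sgn : S -> S -> int) (A : S -> lmodType k).

Lemma dinj_supp I (x : A I) J : dinj x J != 0 -> J = I.
Proof. by apply: contra_neq_eq => /(dinj_ne x). Qed.

Variable F : sheaf A.

Lemma coboundary_supp J (x : A J) K : coboundary rk sgn F (dinj x) K != 0 -> covers rk J K.
Proof.
apply: contraNT => nc; rewrite /coboundary big1 // => I IK.
by rewrite dinj_ne ?linear0 ?scaler0 //; apply: contraNneq nc => <-.
Qed.

Lemma coboundary_dinj J (x : A J) K : covers rk J K ->
  coboundary rk sgn F (dinj x) K = (sgn K J)%:~R *: res F J K x.
Proof.
move=> JK; rewrite /coboundary (bigD1 J) //= dinjE big1 ?addr0 // => I /andP[_ IJ].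
by rewrite dinj_ne // linear0 scaler0.
Qed.

End CoboundarySupport.

(** * The double complex *)

Section DoubleComplex.
Context {k : comUnitRingType} {disp : Order.disp_t} {S : finBPOrderType disp} (rk : S -> nat).
Hypothesis hS : simplicial_poset rk.
Variables (sgn : S -> S -> int) (hsgn : sign_convention rk sgn).
Local Notation sg I K := ((sgn I K)%:~R : k).
Variables (fdim : S -> nat) (n : nat).
Hypothesis rkfdim : forall J, (rk J + fdim J = n)%N.
Variables (H M : S -> lmodType k).
Variables (H0 : sheaf H) (Pi : cosheaf M).
Hypothesis M_bot : forall x : M \bot%O, x = 0.
Local Notation delta := (coboundary rk sgn H0).
Local Notation bd := (boundary rk sgn Pi).
Local Notation T := (tensor (dsum H) (dsum M)).
Local Opaque tensor.

(* This sign makes the coboundary and the boundary anticommute in tot. *)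
Definition csign (x : dsum H) : dsum H := fun J => (-1) ^+ fdim J *: x J.
Lemma csign_linear : linear csign.
Proof.
move=> a x y; apply: functional_extensionality_dep => J.
by rewrite /csign !dsumDE !dsumZE scalerDr !scalerA mulrC.
Qed.
HB.instance Definition _ := GRing.isLinear.Build k (dsum H) (dsum H) *:%R csign csign_linear.

Lemma csign_dinj J (x : H J) : csign (dinj x) = dinj ((-1) ^+ fdim J *: x).
Proof.
apply: functional_extensionality_dep => K; rewrite /csign.
by have [->|KJ] := eqVneq K J; rewrite ?dinjE // !dinj_ne // scaler0.
Qed.

Lemma csignK x : csign (csign x) = x.
Proof.
apply: functional_extensionality_dep => J; rewrite /csign scalerA -signr_odd -expr2 sqrr_sign.
by rewrite scale1r.
Qed.

Lemma covers_fdim' I J : covers rk I J -> fdim I = (fdim J).+1.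
Proof. by move/covers_rk => r; have := rkfdim I; have := rkfdim J; rewrite r; lia. Qed.

Lemma delta_csign x : delta (csign x) = - csign (delta x).
Proof.
apply: functional_extensionality_dep => J; rewrite /csign.
rewrite [RHS](_ : _ = - ((-1) ^+ fdim J *: delta x J)) //.
rewrite /coboundary scaler_sumr -sumrN; apply: eq_bigr => I IJ.
by rewrite linearZ /= (covers_fdim' IJ) exprS mulN1r scaleNr scalerN !scalerA mulrC.
Qed.

Definition tot : T -> T := tensor_map delta idfun \+ tensor_map csign bd.
HB.instance Definition _ := GRing.Linear.on tot.

Lemma tot_pure x y : tot (pure x y) = pure (delta x) y + pure (csign x) (bd y).
Proof. by rewrite /tot /= !tensor_map_pure. Qed.

Lemma tot_tot t : tot (tot t) = 0.
Proof.
apply: (tensor_ext (f := tot \o tot) (g := \0)) => x y /=.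
rewrite tot_pure linearD /= !tot_pure (coboundaryK hS hsgn) (boundaryK hS hsgn) pure0l pure0r.
by rewrite add0r addr0 delta_csign -scaleN1r pureZl scaleN1r subrr.
Qed.

(** The degree fits both sides: for |I| = 1 it is the dimension of J, and for |J| = n the dimension
    of I is n - 1 - m. The predicate [P] cuts out the steps of a filtration. *)
Program Definition part (P : S -> S -> bool) (m : int) : submod T :=
  submod_span [set t | exists J I (x : H J) (y : M I),
    [/\ (I <= J)%O, (rk J)%:Z = (rk I)%:Z + m, P J I & t = pure (dinj x) (dinj y)]].

Lemma part_ind (P : S -> S -> bool) m (U : submod T) :
  (forall J I (x : H J) (y : M I), (I <= J)%O -> (rk J)%:Z = (rk I)%:Z + m -> P J I ->
    U (pure (dinj x) (dinj y))) ->
  forall t, part P m t -> U t.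
Proof. by move=> h t; apply => _ [J [I [x [y [h1 h2 h3 ->]]]]]; exact: h. Qed.

Lemma part_pure (P : S -> S -> bool) m (x : dsum H) (y : dsum M) :
  (forall J I, x J != 0 -> y I != 0 -> [/\ (I <= J)%O, (rk J)%:Z = (rk I)%:Z + m & P J I]) ->
  part P m (pure x y).
Proof.
move=> h; rewrite (dinj_sum x) (dinj_sum y) pure_suml; apply: sm_sum => J _.
rewrite pure_sumr; apply: sm_sum => I _.
have [->|xJ] := eqVneq (x J) 0; first by rewrite linear0 pure0l; exact: sm0.
have [->|yI] := eqVneq (y I) 0; first by rewrite linear0 pure0r; exact: sm0.
by have [h1 h2 h3] := h J I xJ yI; move=> U; apply; exists J, I, (x J), (y I).
Qed.

Lemma partS (P P' : S -> S -> bool) m t : (forall J I, P J I -> P' J I) -> part P m t -> part P' m t.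
Proof.
move=> PP; apply: part_ind => J I x y IJ r PJI U; apply.
by exists J, I, x, y; split => //; exact: PP.
Qed.

Lemma bd_supp I (y : M I) A : bd (dinj y) A != 0 -> covers rk A I.
Proof.
apply: contraNT => nc; rewrite /boundary big1 // => K AK.
by rewrite dinj_ne ?linear0 ?scaler0 //; apply: contraNneq nc => <-.
Qed.

Lemma csign_supp x J : csign x J != 0 -> x J != 0.
Proof. by apply: contra_neq => x0; rewrite /csign x0 scaler0. Qed.

Lemma tot_part m t : part (fun _ _ => true) m t -> part (fun _ _ => true) (m + 1) (tot t).
Proof.
apply: (part_ind (U := submod_preim (tot : {linear _ -> _}) (part _ (m + 1)))) => J I x y IJ r _.
rewrite sm_preimE /= tot_pure; apply: smD; apply: part_pure => K A.
  move=> /coboundary_supp JK /dinj_supp ->; split => //; first exact: le_trans (covers_le JK).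
  by rewrite (covers_rk JK); lia.
move=> /csign_supp /dinj_supp -> /bd_supp AI; split => //; first exact: le_trans (covers_le AI) IJ.
by have := covers_rk AI; lia.
Qed.

Section Columns.
Variable alpha : {linear dsum H -> k^o}.
Hypothesis alpha_top : forall x : dsum H, (forall J, fdim J = 0%N -> x J = 0) -> alpha x = 0.
Definition upsupp (I : S) (q : nat) (x : dsum H) := forall J, ~~ ((I <= J)%O && (fdim J == q)) -> x J = 0.
Hypothesis alpha_delta : forall I x, I != \bot%O -> upsupp I 1 x -> alpha (delta x) = 0.
Hypothesis columns : forall I, I != \bot%O -> exists (u : dsum H) (s : {linear dsum H -> dsum H}),
  [/\ upsupp I 0 u, alpha u = 1,
    forall q y, upsupp I q y -> upsupp I q.+1 (s y),
    forall y, upsupp I 0 y -> delta (s y) + (alpha y : k) *: u = y &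
    forall q y, upsupp I q.+1 y -> delta (s y) + s (delta y) = y].

Lemma upsupp_dinj I J (x : H J) : (I <= J)%O -> upsupp I (fdim J) (dinj x).
Proof.
by move=> IJ K; apply: contraNeq => /dinj_supp ->; rewrite IJ eqxx.
Qed.

Lemma upsupp_ne I q x J : upsupp I q x -> x J != 0 -> (I <= J)%O /\ fdim J = q.
Proof.
move=> h; case: (boolP ((I <= J)%O && (fdim J == q))) => [/andP[h1 /eqP h2] //|/h ->].
by rewrite eqxx.
Qed.

Lemma upsupp_csign I q x : upsupp I q x -> upsupp I q (csign x).
Proof. by move=> h J /h; rewrite /csign => ->; rewrite scaler0. Qed.

Lemma columns_homology (m : int) : exists f : {linear T -> dsum M},
  [/\ forall t, part (fun _ _ => true) m t -> dim_part rk M (n%:Z - 1 - m) (f t),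
      forall c, dim_part rk M (n%:Z - 1 - m) c -> bd c = 0 ->
        exists t, [/\ part (fun _ _ => true) m t, tot t = 0 & f t = c],
      forall t, part (fun _ _ => true) m t -> bd (f t) = f (tot t) &
      forall t, part (fun _ _ => true) m t -> tot t = 0 ->
        (exists2 c, dim_part rk M (n%:Z - 1 - (m - 1)) c & bd c = f t) <->
        (exists2 t', part (fun _ _ => true) (m - 1) t' & tot t' = t)].
Proof.
have us I : exists p : dsum H * {linear dsum H -> dsum H}, I != \bot%O ->
  [/\ upsupp I 0 p.1, alpha p.1 = 1,
    forall q y, upsupp I q y -> upsupp I q.+1 (p.2 y),
    forall y, upsupp I 0 y -> delta (p.2 y) + (alpha y : k) *: p.1 = y &
    forall q y, upsupp I q.+1 y -> delta (p.2 y) + p.2 (delta y) = y].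
  case: (eqVneq I \bot%O) => [->|/columns [u [s h]]]; first by exists (0 : dsum H, \0 : {linear dsum H -> dsum H}).
  by exists (u, s).
have {us} [us usP] := choice us; pose u I := (us I).1; pose s I := (us I).2.
have [f fE] : exists f : {linear T -> dsum M}, forall x y, f (pure x y) = (alpha x : k) *: y.
  apply: tensor_lift => [y a x x'|x a y y'].
    by rewrite linearP /= scalerDl scalerA.
  by rewrite scalerDr !scalerA mulrC.
have Gl : linear (fun t : T => \sum_I tensor_map (s I) (dmask (pred1 I)) t).
  by move=> a t t'; rewrite scaler_sumr -big_split; apply: eq_bigr => I _; exact: linearP.
pose G : {linear T -> T} := pack_linear Gl.
have GE x I (y : M I) : G (pure x (dinj y)) = pure (s I x) (dinj y).
  rewrite /= (bigD1 I) //= tensor_map_pure big1 ?addr0.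
    by congr pure; apply: dmask_id => K /= KI; exact: dinj_ne.
  move=> K KI; rewrite tensor_map_pure /= dmask0 ?pure0r // => L /eqP ->; exact: dinj_ne.
have Ul : linear (fun c : dsum M => \sum_I pure (u I) (dinj (c I)) : T).
  move=> a c c'; rewrite scaler_sumr -big_split; apply: eq_bigr => I _.
  by rewrite dsumDE dsumZE linearP pureDr pureZr.
pose U : {linear dsum M -> T} := pack_linear Ul.
have UE I (y : M I) : U (dinj y) = pure (u I) (dinj y).
  rewrite /= (bigD1 I) //= dinjE big1 ?addr0 // => K KI.
  by rewrite dinj_ne // linear0 pure0r.
have sP I q x : I != \bot%O -> upsupp I q x -> upsupp I q.+1 (s I x).
  by move=> I0; have [_ _ h _ _] := usP I I0; exact: h.
have al0 I q x : upsupp I q.+1 x -> alpha x = 0.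
  by move=> h; apply: alpha_top => J J0; apply: h; rewrite J0 andbF.
have al1 (J : S) (x : H J) : fdim J != 0%N -> alpha (dinj x) = 0.
  by move=> J0; apply: alpha_top => K K0; apply: dinj_ne; apply: contraNneq J0 => <-; rewrite K0.
have d0 (J : S) (x : H J) : fdim J = 0%N -> delta (dinj x) = 0.
  move=> J0; apply: functional_extensionality_dep => K; apply/eqP.
  have [//|/coboundary_supp/covers_fdim'] := eqVneq (delta (dinj x) K) 0.
  by rewrite J0.
have fG m' t : part (fun _ _ => true) m' t -> f (G t) = 0.
  apply: (part_ind (U := eq_sub (f \o G) \0)) => J I x y IJ _ _; rewrite /eq_sub /submod_set /=.
  rewrite -[X in f X]/(G _) GE fE; case: (eqVneq I \bot%O) => [I0|I0].
    by subst I; rewrite (M_bot y) linear0 scaler0.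
  by rewrite (al0 _ _ _ (sP _ _ _ I0 (upsupp_dinj x IJ))) scale0r.
have contract m' r t : part (fun _ I => (rk I <= r.+1)%N) m' t ->
    part (fun _ I => (rk I <= r)%N) m' (tot (G t) + G (tot t) + U (f t) - t).
  pose E : {linear T -> T} := (((tot \o G) \+ (G \o tot)) \+ (U \o f)) \- idfun.
  apply: (part_ind (U := submod_preim E (part _ m'))) => J I x y IJ rJ rI.
  rewrite sm_preimE -[E _]/(tot (G _) + G (tot _) + U (f _) - _).
  case: (eqVneq I \bot%O) => [I0|I0].
    by subst I; rewrite (M_bot y) linear0 pure0r !linear0 !addr0; exact: sm0.
  have [_ _ _ h0 h1] := usP I I0; rewrite -/(s I) -/(u I) in h0 h1.
  have e : delta (s I (dinj x)) + s I (delta (dinj x)) + (alpha (dinj x) : k) *: u I = dinj x.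
    have xs := upsupp_dinj x IJ; case: (posnP (fdim J)) => [J0|J0].
      by rewrite d0 // linear0 addr0; apply: h0; rewrite -J0.
    rewrite al1 ?scale0r ?addr0; last by rewrite -lt0n.
    by apply: (h1 (fdim J).-1); rewrite prednK.
  have -> : U (f (pure (dinj x) (dinj y))) = pure ((alpha (dinj x) : k) *: u I) (dinj y).
    by rewrite fE pureZl -UE; exact: linearZ.
  rewrite GE !tot_pure (linearD G) GE.
  have e' : pure (dinj x) (dinj y) = pure (delta (s I (dinj x))) (dinj y) + pure (s I (delta (dinj x))) (dinj y) +
    pure ((alpha (dinj x) : k) *: u I) (dinj y) by rewrite -!pureDl e.
  (* Only the two terms with the boundary of Pi survive; they use the contractions of different
     columns and need not cancel. *)
  rewrite -[X in _ - X]/(pure (dinj x) (dinj y)) [X in _ - X]e' (_ : _ - _ = pure (csign (s I (dinj x))) (bd (dinj y)) + G (pure (csign (dinj x)) (bd (dinj y)))); last by module k (@tensor k (dsum H) (dsum M)).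
  apply: smD.
    apply: part_pure => K A /csign_supp /(upsupp_ne (sP _ _ _ I0 (upsupp_dinj x IJ)))[IK fK] /bd_supp AI.
    have := covers_rk AI; have := rkfdim K; have := rkfdim J; rewrite fK => h2 h3 h4.
    split; [exact: le_trans (covers_le AI) IK|lia|lia].
  rewrite /=; apply: sm_sum => I' _; rewrite tensor_map_pure; apply: part_pure => K A xK.
  rewrite [X in X != _](_ : _ = if A == I' then bd (dinj y) A else 0) //; case: (eqVneq A I') => [->|_] /= yA; last by rewrite eqxx in yA.
  have I'I : covers rk I' I := bd_supp yA.
  have I'0 : I' != \bot%O.
    by apply: contraNneq yA => I'0; subst I'; rewrite (M_bot (bd _ _)).
  have I'J := le_trans (covers_le I'I) IJ.
  have [I'K fK] := upsupp_ne (sP _ _ _ I'0 (upsupp_csign (upsupp_dinj x I'J))) xK.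
  have := covers_rk I'I; have := rkfdim K; have := rkfdim J; rewrite fK => h2 h3 h4.
  by clear - rJ rI fK h2 h3 h4 I'K; split; [exact: I'K|lia|lia].
have fT m' t : part (fun _ _ => true) m' t -> dim_part rk M (n%:Z - 1 - m') (f t).
  apply: (part_ind (U := submod_preim f (dim_part rk M (n%:Z - 1 - m')))) => J I x y IJ rJ _.
  rewrite sm_preimE fE => A sA; rewrite dsumZE; case: (eqVneq (fdim J) 0%N) => J0; last by rewrite al1 ?scale0r.
  rewrite dinj_ne ?scaler0 //; apply/eqP => AI; apply: sA; rewrite AI /sdim.
  by have := rkfdim J; rewrite J0 addn0 => rn; rewrite -rn rJ; lia.
have UT m' c : dim_part rk M (n%:Z - 1 - m') c -> part (fun _ _ => true) m' (U c).
  move=> hc; apply: sm_sum => I _; case: (eqVneq I \bot%O) => [I0|I0].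
    by subst I; rewrite (M_bot (c _)) linear0 pure0r; exact: sm0.
  have [su _ _ _ _] := usP I I0; rewrite -/(u I) in su.
  apply: part_pure => K A /(upsupp_ne su)[IK fK] yA.
  have AI := dinj_supp yA; rewrite AI dinjE in yA *; split => //.
  have : sdim rk I = n%:Z - 1 - m' by apply: contra_neq_eq yA => sI; apply: hc; apply/eqP.
  by rewrite /sdim => h; have := rkfdim K; rewrite fK addn0 => ->; lia.
have GT m' t : part (fun _ _ => true) m' t -> part (fun _ _ => true) (m' - 1) (G t).
  apply: (part_ind (U := submod_preim G (part _ (m' - 1)))) => J I x y IJ rJ _.
  rewrite sm_preimE GE; case: (eqVneq I \bot%O) => [I0|I0].
    by subst I; rewrite (M_bot y) linear0 pure0r; exact: sm0.
  apply: part_pure => K A /(upsupp_ne (sP _ _ _ I0 (upsupp_dinj x IJ)))[IK fK] /dinj_supp ->.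
  by split => //; have := rkfdim K; have := rkfdim J; rewrite fK; lia.
have fD m' t : part (fun _ _ => true) m' t -> f (tot t) = bd (f t).
  apply: (part_ind (U := eq_sub (f \o tot) (bd \o f))) => J I x y IJ rJ _; rewrite /eq_sub /submod_set /=.
  rewrite tot_pure linearD /= !fE linearZ /=; case: (eqVneq I \bot%O) => [I0|I0].
    subst I; have -> : dinj y = 0 by rewrite (M_bot y); exact: linear0.
    have -> : bd 0 = 0 by exact: linear0.
    by rewrite !scaler0 addr0.
  have -> : alpha (delta (dinj x)) = 0.
    case: (posnP (fdim J)) => [J0|J0]; first by rewrite d0 // linear0.
    case: (eqVneq (fdim J) 1%N) => [J1|J1]; first by apply: (alpha_delta I0); rewrite -J1; exact: upsupp_dinj.
    apply: alpha_top => K K0; apply/eqP; have [//|/coboundary_supp/covers_fdim'] := eqVneq (delta (dinj x) K) 0.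
    by rewrite K0 => e; rewrite e in J1.
  rewrite scale0r add0r; congr (_ *: _); apply/eqP; rewrite -subr_eq0 -linearB; apply/eqP/alpha_top => K K0.
  rewrite [LHS](_ : _ = csign (dinj x) K - dinj x K) // /csign K0 expr0 scale1r.
  exact: subrr.
have fU c : f (U c) = c.
  rewrite /= linear_sum [RHS]dinj_sum; apply: eq_bigr => I _; rewrite fE.
  case: (eqVneq I \bot%O) => [I0|I0]; last by have [_ -> _ _ _] := usP I I0; rewrite scale1r.
  by subst I; rewrite (M_bot (c _)) linear0 scaler0.
have TF0 m' t : part (fun _ I => (rk I <= 0)%N) m' t -> t = 0.
  apply: (part_ind (U := submod0 _)) => J I x y _ _; rewrite leqn0 (rk_eq0 hS) => /eqP I0.
  by subst I; rewrite (M_bot y) linear0 pure0r.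
have TT_TF m' t : part (fun _ _ => true) m' t -> part (fun _ I => (rk I <= n)%N) m' t.
  by apply: partS => J I _; rewrite -(rkfdim I) leq_addr.
have TF_TT m' r t : part (fun _ I => (rk I <= r)%N) m' t -> part (fun _ _ => true) m' t.
  exact: partS.
exists f; split; first exact: fT.
- exact: (lift_cycle (TT := part (fun _ _ => true)) (CC := fun m => dim_part rk M (n%:Z - 1 - m))
    (TF := fun m r => part (fun _ I => (rk I <= r)%N) m) (d := bd) (top := n) tot_part GT UT tot_tot fD fU fG TF_TT TT_TF TF0 contract).
- by move=> t tT; rewrite (fD _ _ tT).
- exact: (boundary_iff (TT := part (fun _ _ => true)) (CC := fun m => dim_part rk M (n%:Z - 1 - m))
    (TF := fun m r => part (fun _ I => (rk I <= r)%N) m) (d := bd) (top := n) tot_part GT UT fT tot_tot fD fU fG TF_TT TT_TF TF0 contract).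
Qed.

End Columns.

Section Rows.
Variables (W : lmodType k) (B : S -> lmodType k) (Bs : sheaf B).
Variables (kM : forall I, {linear M I -> W}) (kB : forall I, {linear B I -> W}).
Hypothesis kB_inj : forall I, injective (kB I).
Hypothesis B_bot : forall x : B \bot%O, x = 0.
Hypothesis kB_res : forall I J x, I != \bot%O -> (I <= J)%O -> kB J (res Bs I J x) = kB I x.
Hypothesis rows : forall J, J != \bot%O ->
  exists (e : {linear dsum M -> B J}) (h : {linear dsum M -> dsum M}) (w : {linear B J -> dsum M}),
  [/\ forall y, kB J (e y) = \sum_(i in verts rk J) sg i \bot%O *: kM i (y i),
      forall y K, ~~ (K <= J)%O -> h y K = 0,
      forall y K r, (forall I, rk I != r -> y I = 0) -> rk K != r.+1 -> h y K = 0,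
      forall b K, ~~ verts rk J K -> w b K = 0 &
      [/\ forall y, below J y -> bd (h y) + h (bd y) + w (e y) = y,
      forall b, e (w b) = b, forall y, below J y -> e (bd y) = 0 & forall y, e (h y) = 0]].
Local Notation HB J := (tensor (H J) (B J)).
Local Notation cobd := (coboundary rk sgn (tensor_sheaf H0 Bs)).

Lemma below_dinj I J (y : M I) : (I <= J)%O -> below J (dinj y).
Proof. by move=> IJ K; apply: contraNeq => /dinj_supp ->. Qed.

(** The row of J is contracted by [e], [h] and [w], exactly so for the boundary of Pi. The
    differential of H_0 leads to rows K with J <_1 K, so the error lowers the dimension of J. [G]
    carries [csign] because the boundary does so in [tot], and the two signs cancel. *)
Lemma rows_homology (m : int) : exists f : {linear T -> dsum (fun J => HB J)},
  [/\ forall t, part (fun _ _ => true) m t -> dim_part rk (fun J => HB J) m (f t),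
      forall c, dim_part rk (fun J => HB J) m c -> cobd c = 0 ->
        exists t, [/\ part (fun _ _ => true) m t, tot t = 0 & f t = c],
      forall t, part (fun _ _ => true) m t -> cobd (f t) = f (tot t) &
      forall t, part (fun _ _ => true) m t -> tot t = 0 ->
        (exists2 c, dim_part rk (fun J => HB J) (m - 1) c & cobd c = f t) <->
        (exists2 t', part (fun _ _ => true) (m - 1) t' & tot t' = t)].
Proof.
have hJ J : exists p : {linear dsum M -> B J} * {linear dsum M -> dsum M} * {linear B J -> dsum M}, J != \bot%O ->
  [/\ forall y, kB J (p.1.1 y) = \sum_(i in verts rk J) sg i \bot%O *: kM i (y i),
      forall y K, ~~ (K <= J)%O -> p.1.2 y K = 0,
      forall y K r, (forall I, rk I != r -> y I = 0) -> rk K != r.+1 -> p.1.2 y K = 0,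
      forall b K, ~~ verts rk J K -> p.2 b K = 0 &
      [/\ forall y, below J y -> bd (p.1.2 y) + p.1.2 (bd y) + p.2 (p.1.1 y) = y,
      forall b, p.1.1 (p.2 b) = b, forall y, below J y -> p.1.1 (bd y) = 0 & forall y, p.1.1 (p.1.2 y) = 0]].
  case: (eqVneq J \bot%O) => [->|/rows [e [h [w ehw]]]]; last by exists (e, h, w).
  by exists (\0 : {linear dsum M -> B \bot%O}, \0 : {linear dsum M -> dsum M}, \0 : {linear B \bot%O -> dsum M}).
have {hJ} [p pP] := dep_choice hJ; pose e J := (p J).1.1; pose h J := (p J).1.2; pose w J := (p J).2.
have eP J : J != \bot%O -> forall y, kB J (e J y) = \sum_(i in verts rk J) sg i \bot%O *: kM i (y i).
  by move=> J0; have [] := pP J J0.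
have hP J : J != \bot%O -> forall I (y : M I) A, h J (dinj y) A != 0 -> (A <= J)%O /\ rk A = (rk I).+1.
  move=> J0 I y A; have [_ h1 h2 _ _] := pP J J0; rewrite -/(h J) in h1 h2 => yA.
  split; first by apply: contraNT yA => /h1 ->.
  apply/eqP; apply: contraNT yA => /h2 -> // K; apply: contraNeq => /dinj_supp ->.
  exact: eqxx.
have wP J : J != \bot%O -> forall b A, w J b A != 0 -> verts rk J A.
  move=> J0 b A; have [_ _ _ h1 _] := pP J J0; rewrite -/(w J) in h1.
  by apply: contraNT => /h1 ->.
have hw J : J != \bot%O -> forall y, below J y -> bd (h J y) + h J (bd y) + w J (e J y) = y.
  by move=> J0; have [_ _ _ _ []] := pP J J0.
have ew J b : e J (w J b) = b.
  case: (eqVneq J \bot%O) => [J0|J0]; first by subst J; rewrite [LHS]B_bot [RHS]B_bot.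
  by have [_ _ _ _ [_ h1 _ _]] := pP J J0; exact: h1.
have ebd J : J != \bot%O -> forall y, below J y -> e J (bd y) = 0.
  by move=> J0; have [_ _ _ _ []] := pP J J0.
have eh J : J != \bot%O -> forall y, e J (h J y) = 0.
  by move=> J0; have [_ _ _ _ []] := pP J J0.
move: (e) (h) (w) eP hP wP hw ew ebd eh => {p pP} {}e {}h {}w eP hP wP hw ew ebd eh.
have fl : linear (fun t : T => (fun J => tensor_map (@dproj k S H J) (e J) t) : dsum (fun J => HB J)).
  by move=> a t t'; apply: functional_extensionality_dep => J; exact: linearP.
pose f : {linear T -> dsum (fun J => HB J)} := pack_linear fl.
have fE (x : dsum H) y J : f (pure x y) J = pure (x J) (e J y) by exact: tensor_map_pure.
have fdE J (x : H J) y : f (pure (dinj x) y) = dinj (pure x (e J y) : HB J).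
  apply: functional_extensionality_dep => K; rewrite fE.
  have [->|KJ] := eqVneq K J; first by rewrite !dinjE.
  by rewrite !dinj_ne // pure0l.
have Ul : linear (fun c : dsum (fun J => HB J) => \sum_J tensor_map (@dinj k S H J) (w J) (c J) : T).
  move=> a c c'; rewrite scaler_sumr -big_split; apply: eq_bigr => J _.
  by rewrite dsumDE dsumZE; exact: linearP.
pose U : {linear dsum (fun J => HB J) -> T} := pack_linear Ul.
have UE J (x : H J) (b : B J) : U (dinj (pure x b : HB J)) = pure (dinj x) (w J b).
  rewrite /= (bigD1 J) //= dinjE tensor_map_pure big1 ?addr0 // => K KJ.
  by rewrite dinj_ne //; exact: linear0.
have Gl : linear (fun t : T => \sum_J tensor_map (csign \o dmask (pred1 J)) (h J) t).
  by move=> a t t'; rewrite scaler_sumr -big_split; apply: eq_bigr => J _; exact: linearP.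
pose G : {linear T -> T} := pack_linear Gl.
have GE x y : G (pure x y) = \sum_J pure (csign (dmask (pred1 J) x)) (h J y).
  by apply: eq_bigr => J _; rewrite tensor_map_pure.
have dmE J (x : H J) K : dmask (pred1 K) (dinj x) = if K == J then dinj x else 0.
  have [->|KJ] := eqVneq K J; first by apply: dmask_id => L /= LJ; exact: dinj_ne.
  by apply: dmask0 => L /= /eqP ->; exact: dinj_ne.
have GdE J (x : H J) y : G (pure (dinj x) y) = pure (csign (dinj x)) (h J y).
  rewrite GE (bigD1 J) //= dmE eqxx big1 ?addr0 // => K KJ.
  by rewrite dmE (negPf KJ) linear0 pure0l.
have bot0 (J I : S) (y : M I) : (I <= J)%O -> J = \bot%O -> dinj y = 0 :> dsum M.
  by move=> IJ J0; subst J; move: IJ; rewrite lex0 => /eqP I0; subst I; rewrite (M_bot y); exact: linear0.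
have fG m' t : part (fun _ _ => true) m' t -> f (G t) = 0.
  apply: (part_ind (U := eq_sub (f \o G) \0)) => J I x y IJ _ _; rewrite /eq_sub /submod_set /=.
  rewrite -[LHS]/(f (G _)); case: (eqVneq J \bot%O) => [J0|J0].
    by rewrite (bot0 J I y IJ J0) pure0r !linear0.
  rewrite GdE csign_dinj fdE eh // pure0r; exact: linear0.
have contract m' r t : part (fun J _ => (fdim J < r.+1)%N) m' t ->
    part (fun J _ => (fdim J < r)%N) m' (tot (G t) + G (tot t) + U (f t) - t).
  pose E : {linear T -> T} := (((tot \o G) \+ (G \o tot)) \+ (U \o f)) \- idfun.
  apply: (part_ind (U := submod_preim E (part _ m'))) => J I x y IJ rJ Jr.
  rewrite sm_preimE -[E _]/(tot (G _) + G (tot _) + U (f _) - _).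
  case: (eqVneq J \bot%O) => [J0|J0].
    by rewrite (bot0 J I y IJ J0) pure0r !linear0 !addr0; exact: sm0.
  have -> : tot (G (pure (dinj x) (dinj y))) =
      pure (delta (csign (dinj x))) (h J (dinj y)) + pure (dinj x) (bd (h J (dinj y))).
    by rewrite GdE tot_pure csignK.
  have -> : G (tot (pure (dinj x) (dinj y))) =
      G (pure (delta (dinj x)) (dinj y)) + pure (dinj x) (h J (bd (dinj y))).
    by rewrite tot_pure (linearD G) [in X in _ + X]csign_dinj GdE -csign_dinj csignK.
  rewrite fdE UE.
  have e' : pure (dinj x) (dinj y) = pure (dinj x) (bd (h J (dinj y))) + pure (dinj x) (h J (bd (dinj y))) +
    pure (dinj x) (w J (e J (dinj y))) by rewrite -!pureDr hw //; exact: below_dinj.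
  rewrite [X in _ - X]e' (_ : _ - _ = pure (delta (csign (dinj x))) (h J (dinj y)) + G (pure (delta (dinj x)) (dinj y))); last by module k (@tensor k (dsum H) (dsum M)).
  apply: smD.
    rewrite csign_dinj; apply: part_pure => K A /coboundary_supp JK /(hP _ J0)[AJ rA].
    have r1 := covers_fdim' JK; have r2 := covers_rk JK.
    by clear - AJ rA r1 r2 rJ Jr JK; split; [exact: le_trans AJ (covers_le JK)|lia|lia].
  rewrite GE; apply: sm_sum => K _; apply: part_pure => K' A /csign_supp.
  rewrite [X in X != _](_ : _ = if K' == K then delta (dinj x) K' else 0) //.
  case: (eqVneq K' K) => [->|_] /= xK; last by rewrite eqxx in xK.
  have JK : covers rk J K := coboundary_supp xK.
  have K0 : K != \bot%O by apply: contraNneq J0 => K0; move: (covers_le JK); rewrite K0 lex0.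
  move=> /(hP _ K0)[AK rA]; have r1 := covers_fdim' JK; have r2 := covers_rk JK.
  by clear - AK rA r1 r2 rJ Jr; split; [exact: AK|lia|lia].
have fT m' t : part (fun _ _ => true) m' t -> dim_part rk (fun J => HB J) m' (f t).
  apply: (part_ind (U := submod_preim f (dim_part rk (fun J => HB J) m'))) => J I x y IJ rJ _.
  rewrite sm_preimE => L sL; rewrite fE.
  case: (eqVneq L J) => [LJ|LJ]; last by rewrite dinj_ne // pure0l.
  subst L; case: (eqVneq J \bot%O) => [J0|J0].
    by rewrite (bot0 J I y IJ J0) linear0 pure0r.
  rewrite (_ : e J (dinj y) = 0) ?pure0r //; apply: kB_inj; rewrite eP // linear0 big1 // => i /andP[iv _].
  rewrite dinj_ne ?linear0 ?scaler0 //; apply: contra_not_neq sL => iI.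
  by move: iv; rewrite iI /vertex /sdim rJ => /eqP ->; rewrite addrAC subrr add0r.
have UT m' c : dim_part rk (fun J => HB J) m' c -> part (fun _ _ => true) m' (U c).
  move=> hc; apply: sm_sum => J _; case: (eqVneq (sdim rk J) m') => [sJ|/eqP sJ]; last first.
    suff -> : tensor_map (@dinj k S H J) (w J) (c J) = 0 by exact: sm0.
    by rewrite hc //; exact: linear0.
  apply: (tensor_ind (U := submod_preim (tensor_map (@dinj k S H J) (w J)) (part (fun _ _ => true) m'))) => x b.
  rewrite sm_preimE /= tensor_map_pure; case: (eqVneq J \bot%O) => [J0|J0].
    by subst J; rewrite (B_bot b) linear0 pure0r; exact: sm0.
  apply: part_pure => K A /dinj_supp -> /(wP _ J0) /andP[/eqP rA AJ]; split => //.
  by rewrite rA -sJ /sdim addrC subrK.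
have GT m' t : part (fun _ _ => true) m' t -> part (fun _ _ => true) (m' - 1) (G t).
  apply: (part_ind (U := submod_preim G (part _ (m' - 1)))) => J I x y IJ rJ _.
  rewrite sm_preimE GdE; case: (eqVneq J \bot%O) => [J0|J0].
    by rewrite (bot0 J I y IJ J0) linear0 pure0r; exact: sm0.
  apply: part_pure => K A /csign_supp /dinj_supp -> /(hP _ J0)[AJ rA].
  by clear - AJ rA rJ; split; [exact: AJ|lia|].
(* On the summand of [I] the map [e] is 0 or a sign times the inclusion in the ambient module,
   according to whether [I] is a vertex, whichever face above [I] is considered. *)
have eres J K I (y : M I) : J != \bot%O -> (I <= J)%O -> (J <= K)%O ->
    e K (dinj y) = res Bs J K (e J (dinj y)).
  move=> J0 IJ JK; have K0 : K != \bot%O by apply: contraNneq J0 => K0; move: JK; rewrite K0 lex0.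
  apply: kB_inj; rewrite kB_res // !eP // big_mkcond [RHS]big_mkcond; apply: eq_bigr => i _.
  have [iI|iI] := eqVneq i I; last by rewrite dinj_ne // linear0 scaler0 !if_same.
  by rewrite !unfold_in /= iI IJ (le_trans IJ JK).
have fD m' t : part (fun _ _ => true) m' t -> f (tot t) = cobd (f t).
  apply: (part_ind (U := eq_sub (f \o tot) (cobd \o f))) => J I x y IJ rJ _; rewrite /eq_sub /submod_set /=.
  rewrite -[LHS]/(f (tot _)) -[RHS]/(cobd (f _)); case: (eqVneq J \bot%O) => [J0|J0].
    by rewrite (bot0 J I y IJ J0) pure0r !linear0.
  rewrite fdE tot_pure (linearD f) csign_dinj fdE ebd ?pure0r; [|exact: J0|exact: below_dinj].
  rewrite linear0 addr0; apply: functional_extensionality_dep => K; rewrite fE.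
  have [JK|nJK] := boolP (covers rk J K).
    rewrite !coboundary_dinj //= tensor_map_pure -(eres J K I) ?pureZl //; exact: covers_le JK.
  rewrite [delta _ _](_ : _ = 0) ?pure0l; last by apply/eqP; apply: contraNT nJK => /coboundary_supp.
  by apply/esym/eqP; apply: contraNT nJK => /coboundary_supp.
have fU c : f (U c) = c.
  apply: functional_extensionality_dep => L.
  have -> : f (U c) L = \sum_J tensor_map (@dproj k S H L) (e L) (tensor_map (@dinj k S H J) (w J) (c J)).
    exact: linear_sum.
  rewrite (bigD1 L) // big1 /= ?addr0.
    apply: (tensor_ext (f := tensor_map (@dproj k S H L) (e L) \o tensor_map (@dinj k S H L) (w L)) (g := idfun)) => x b.
    by rewrite /= !tensor_map_pure /= /dproj dinjE ew.
  move=> K KL; apply: (tensor_ext (f := tensor_map (@dproj k S H L) (e L) \o tensor_map (@dinj k S H K) (w K)) (g := \0)) => x b.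
  by rewrite /= !tensor_map_pure /= /dproj dinj_ne 1?eq_sym // pure0l.
have TF0 m' t : part (fun J _ => (fdim J < 0)%N) m' t -> t = 0.
  by apply: (part_ind (U := submod0 _)).
have TT_TF m' t : part (fun _ _ => true) m' t -> part (fun J _ => (fdim J < n.+1)%N) m' t.
  by apply: partS => J I _; rewrite ltnS -(rkfdim J) leq_addl.
have TF_TT m' r t : part (fun J _ => (fdim J < r)%N) m' t -> part (fun _ _ => true) m' t.
  exact: partS.
exists f; split; first exact: fT.
- exact: (lift_cycle (TT := part (fun _ _ => true)) (CC := dim_part rk (fun J => HB J))
    (TF := fun m r => part (fun J _ => (fdim J < r)%N) m) (d := cobd) (top := n.+1) tot_part GT UT tot_tot fD fU fG TF_TT TT_TF TF0 contract).
- by move=> t tT; rewrite (fD _ _ tT).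
- exact: (boundary_iff (TT := part (fun _ _ => true)) (CC := dim_part rk (fun J => HB J))
    (TF := fun m r => part (fun J _ => (fdim J < r)%N) m) (d := cobd) (top := n.+1) tot_part GT UT fT tot_tot fD fU fG TF_TT TT_TF TF0 contract).
Qed.

End Rows.

Lemma double_complex_iso (B : S -> lmodType k) (Bs : sheaf B) (m : int) :
  (exists f : {linear T -> dsum (fun J => tensor (H J) (B J))},
  [/\ forall t, part (fun _ _ => true) m t -> dim_part rk (fun J => tensor (H J) (B J)) m (f t),
      forall c, dim_part rk (fun J => tensor (H J) (B J)) m c -> coboundary rk sgn (tensor_sheaf H0 Bs) c = 0 ->
        exists t, [/\ part (fun _ _ => true) m t, tot t = 0 & f t = c],
      forall t, part (fun _ _ => true) m t -> coboundary rk sgn (tensor_sheaf H0 Bs) (f t) = f (tot t) &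
      forall t, part (fun _ _ => true) m t -> tot t = 0 ->
        (exists2 c, dim_part rk (fun J => tensor (H J) (B J)) (m - 1) c & coboundary rk sgn (tensor_sheaf H0 Bs) c = f t) <->
        (exists2 t', part (fun _ _ => true) (m - 1) t' & tot t' = t)]) ->
  (exists f : {linear T -> dsum M},
  [/\ forall t, part (fun _ _ => true) m t -> dim_part rk M (n%:Z - 1 - m) (f t),
      forall c, dim_part rk M (n%:Z - 1 - m) c -> bd c = 0 ->
        exists t, [/\ part (fun _ _ => true) m t, tot t = 0 & f t = c],
      forall t, part (fun _ _ => true) m t -> bd (f t) = f (tot t) &
      forall t, part (fun _ _ => true) m t -> tot t = 0 ->
        (exists2 c, dim_part rk M (n%:Z - 1 - (m - 1)) c & bd c = f t) <->
        (exists2 t', part (fun _ _ => true) (m - 1) t' & tot t' = t)]) ->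
  exists g : {linear cohomology_sheaf rk sgn (tensor_sheaf H0 Bs) m -> homology_cosheaf rk sgn Pi (n%:Z - 1 - m)},
    bijective g.
Proof.
move=> [e [eT el eD eB]] [h [hT hl hD hB]].
apply: (subquot_zigzag (ZT := submod_cap (part (fun _ _ => true) m) (submod_preim (tot : {linear T -> T}) (submod0 T))) (e := e) (h := h)).
- move=> t [tT t0]; split; first exact: eT.
  have t0' : tot t = 0 := t0; suff : coboundary rk sgn (tensor_sheaf H0 Bs) (e t) = 0 by [].
  by rewrite eD // t0' linear0.
- move=> t [tT t0]; split; first exact: hT.
  have t0' : tot t = 0 := t0; suff : bd (h t) = 0 by [].
  by rewrite hD // t0' linear0.
- by move=> c [cT c0]; have [t [t1 t2 t3]] := el c cT c0; exists t.
- by move=> c [cT c0]; have [t [t1 t2 t3]] := hl c cT c0; exists t.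
- move=> t [tT t0]; have e1 : n%:Z - 1 - (m - 1) = n%:Z - 1 - m + 1 by rewrite opprB addrA addrAC.
  have := hB t tT t0; rewrite e1 => hB'; apply: iff_trans (iff_sym hB'); exact: eB.
Qed.

End DoubleComplex.

(** * Assembly of the isomorphism *)

Section IdealSubsheaves.
Context {R : realType} {k : comUnitRingType} {N : nat} {disp : Order.disp_t} {S : finBPOrderType disp}.
Variables (j : nat) (U : forall I, submod (@L_val R N k disp S j I)).
Local Opaque homology.

Definition kapv I (x : submod_type (U I)) : homology R k j (@torus R N) set0 := kap (val x).
Lemma kapv_linear I : linear (@kapv I).
Proof.
move=> a x y; have e : val (a *: x + y) = a *: val x + val y := linearP val a x y.
by rewrite /kapv e; exact: kapP.
Qed.
HB.instance Definition _ I :=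
  GRing.isLinear.Build k (submod_type (U I)) (homology R k j (@torus R N) set0) *:%R (@kapv I) (@kapv_linear I).

Lemma kapv_inj I : injective (@kapv I).
Proof. by move=> x y /kap_inj /val_inj. Qed.

Lemma kapv_in I (x : submod_type (U I)) : U I (val x).
Proof. by have /asboolP := valP x. Qed.

Lemma kapv_onto I (x : @L_val R N k disp S j I) : U I x -> exists y : submod_type (U I), kapv y = kap x.
Proof. by move=> Ux; exists (exist _ x (asboolT Ux)). Qed.

Lemma kapv_bot (x : submod_type (U \bot%O)) : x = 0.
Proof. by apply: val_inj; exact: etrans (L_val_bot _) (esym (L_val_bot _)). Qed.

End IdealSubsheaves.

Section Transition.
Context {R : realType} {N : nat} {Y Q : topologicalType} {disp : Order.disp_t} {S : finBPOrderType disp}.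
Variables (act : Y -> 'rV[R[i]^o]_N -> Y) (rho : Y -> Q) (F : S -> set Q).
Variables (xi : S -> Y -> 'rV[R[i]^o]_N) (tr : S -> S -> 'rV[R[i]^o]_N -> 'rV[R[i]^o]_N).

(* Equivariance of the trivializations makes the transition maps translations. *)
Lemma transition_translation : principal_torus_bundle act rho ->
  (forall I, I != \bot%O -> trivialization act rho (F I) (xi I)) -> transition_maps rho F xi tr ->
  (forall I J : S, (I <= J)%O -> F J `<=` F I) ->
  forall I J, I != \bot%O -> (I <= J)%O ->
  exists2 g, torus g & forall x, torus x -> tr I J x = torus_mul g x.
Proof.
move=> hY hxi htr FS I J I0 IJ; have [q qJ trq] := htr I J I0 IJ.
have J0 : J != \bot%O by apply: contraNneq I0 => J0; move: IJ; rewrite J0 lex0.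
have [[g [_ _ _ gP]] xiI] := hxi I I0; have [[g' [_ _ g'P _]] xiJ] := hxi J J0.
have oneT : torus (torus_one R N) by move=> a; rewrite mxE normr1.
have [_ [ry xy]] := gP (q, torus_one R N) (conj (FS I J IJ q qJ) oneT).
set y := g _ in ry xy.
have yJ : F J (rho y) by rewrite ry.
exists (xi J y); first by have [[]] := g'P y yJ.
move=> x xT; have ra := ptb_act_fiber hY y xT.
rewrite -(xiJ y x) // -(trq (act y x)) ?ra // xiI //; last by rewrite ry; exact: FS IJ q qJ.
by rewrite xy; congr (tr I J _); apply/rowP => a; rewrite !mxE mul1r.
Qed.

End Transition.

Section Augmentation.
Context {R : realType} {k : comUnitRingType} {Q : topologicalType} {disp : Order.disp_t} {S : finBPOrderType disp}.
Variables (F dF : S -> set Q) (fdim rk : S -> nat) (n : nat).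
Hypothesis hQ : buchsbaum_complex R k F dF fdim rk n.
Variables (sgn : S -> S -> int) (hsgn : sign_convention rk sgn).
Local Notation H := (structure_val R k F dF fdim).
Variables (H0 : sheaf H) (hH0 : structure_sheaf rk sgn H0).
Local Notation delta := (coboundary rk sgn H0).

Lemma supp_upsupp I q (y : dsum H) : supp (up I) q y <-> upsupp fdim I q y.
Proof. by split=> h J hJ; apply: h; move: hJ; rewrite inE. Qed.

Lemma face_aug0 J : face_aug (0 : H J) = 0.
Proof. exact: (linear0 (pack_linear (@face_aug_linear _ _ _ _ _ _ _ _ _ _ hQ J))). Qed.

(** Allows one functional, the sum over all faces, to augment all columns at once. *)
Lemma aug_up_bot I q (y : dsum H) : upsupp fdim I q y -> aug_up \bot%O y = aug_up I y.
Proof.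
move=> h; rewrite /aug_up [RHS]big_mkcond; apply: eq_big => [J|J _]; first exact: le0x.
by case: ifPn => // IJ; rewrite h ?face_aug0 // (negPf IJ).
Qed.

Lemma augmented_columns : exists alpha : {linear dsum H -> k^o},
  [/\ forall x : dsum H, (forall J, fdim J = 0%N -> x J = 0) -> alpha x = 0,
      forall I x, I != \bot%O -> upsupp fdim I 1 x -> alpha (delta x) = 0 &
      forall I, I != \bot%O -> exists (u : dsum H) (s : {linear dsum H -> dsum H}),
  [/\ upsupp fdim I 0 u, alpha u = 1,
    forall q y, upsupp fdim I q y -> upsupp fdim I q.+1 (s y),
    forall y, upsupp fdim I 0 y -> delta (s y) + (alpha y : k) *: u = y &
    forall q y, upsupp fdim I q.+1 y -> delta (s y) + s (delta y) = y]].
Proof.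
have al : linear (fun y : dsum H => aug_up \bot%O y : k^o) by move=> a x y; exact: (aug_upP hQ).
exists (pack_linear al); split => /=.
- move=> x x0; rewrite /aug_up big1 // => J _; case: (eqVneq (fdim J) 0%N) => J0.
    by rewrite (x0 J J0); exact: face_aug0.
  by rewrite /face_aug (negPf J0).
- move=> I x I0 xI; rewrite (aug_up_bot (I := I) (q := 0)).
    by apply: (aug_delta hQ hsgn hH0 I0); apply/supp_upsupp.
  by apply/supp_upsupp; apply: (supp_delta hQ); apply/supp_upsupp.
move=> I I0; have [u [s [su au h1 h2 h3]]] := column_contraction hQ hsgn hH0 I0; exists u, s; split.
- exact/supp_upsupp.
- by rewrite (aug_up_bot (I := I) (q := 0)) //; apply/supp_upsupp.
- by move=> q y /supp_upsupp /h1 /supp_upsupp.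
- by move=> y yI; rewrite (aug_up_bot yI); apply: h2; apply/supp_upsupp.
- by move=> q y /supp_upsupp; exact: h3.
Qed.

End Augmentation.

Section Main.
Context {R : realType} {k : comUnitRingType} {N : nat} {disp : Order.disp_t} {S : finBPOrderType disp}.
Local Notation C := (R[i]^o).
Local Notation V := 'rV[C]_N.
Variables (rk : S -> nat) (tr : S -> S -> V -> V) (lam : S -> set V) (theta : S -> C -> V).
Hypothesis htr : forall I J, I != \bot%O -> (I <= J)%O ->
  exists2 g, (@torus R N) g & forall x, (@torus R N) x -> tr I J x = torus_mul g x.
Hypothesis hlam : characteristic_map k rk tr lam theta.
Hypothesis hS : simplicial_poset rk.
Variables (sgn : S -> S -> int) (hsgn : sign_convention rk sgn).
Variables (L : forall j : nat, sheaf (@L_val R N k disp S j)) (hL : locally_constant_sheaf tr L).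
Variables (Lhat : forall j : nat, cosheaf (@L_val R N k disp S j)) (hLhat : inverse_cosheaf L Lhat).
Variable (j : nat).
Local Notation Pr := (principal_ideal k rk tr lam theta j).
Local Notation Id := (ideal k rk tr lam theta j).
Variables (Ideal : sheaf (fun I => submod_type (Id I))) (hIdeal : subsheaf (L j) Ideal).
Variables (Pihat : cosheaf (fun I => submod_type (Pr I))) (hPihat : subcosheaf (Lhat j) Pihat).

Local Opaque homology.

Lemma kapv_cores I J y : I != \bot%O -> (I <= J)%O -> kapv (cores Pihat I J y) = kapv y.
Proof.
move=> I0 IJ; rewrite /kapv (hPihat _ IJ) -(kap_res htr hL _ I0 IJ).
by congr kap; exact: (hLhat j I0 IJ).2.
Qed.

Lemma kapv_res I J x : I != \bot%O -> (I <= J)%O -> kapv (res Ideal I J x) = kapv x.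
Proof. by move=> I0 IJ; rewrite /kapv (hIdeal _ IJ) (kap_res htr hL _ I0 IJ). Qed.

Lemma ideal_rows J : J != \bot%O ->
  exists (e : {linear dsum (fun I => submod_type (Pr I)) -> submod_type (Id J)})
    (h : {linear dsum (fun I => submod_type (Pr I)) -> dsum (fun I => submod_type (Pr I))})
    (w : {linear submod_type (Id J) -> dsum (fun I => submod_type (Pr I))}),
  [/\ forall y, kapv (e y) = \sum_(i in verts rk J) ((sgn i \bot%O)%:~R : k) *: kapv (y i),
      forall y K, ~~ (K <= J)%O -> h y K = 0,
      forall y K r, (forall I, rk I != r -> y I = 0) -> rk K != r.+1 -> h y K = 0,
      forall b K, ~~ verts rk J K -> w b K = 0 &
      [/\ forall y, below J y -> boundary rk sgn Pihat (h y) + h (boundary rk sgn Pihat y) + w (e y) = y,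
      forall b, e (w b) = b, forall y, below J y -> e (boundary rk sgn Pihat y) = 0 & forall y, e (h y) = 0]].
Proof.
move=> J0; have [Qo [q1 q2 q3 q4]] := ideal_operators htr hlam hS j J0.
apply: (row_homotopy hS hsgn (kM := fun I => @kapv R k N disp S j Pr I) (kB := fun I => @kapv R k N disp S j Id I) _ _ _ _ _ _ (Q := Qo)).
- exact: kapv_inj.
- exact: kapv_inj.
- exact: kapv_bot.
- exact: kapv_cores.
- move=> I K a x I0 IK KJ aK aI; have [y yK <-] := q1 I K a (val x) I0 IK KJ aK aI (kapv_in x).
  exact: kapv_onto.
- by move=> a x aJ; have [y ya <-] := q2 a (val x) aJ (kapv_in x); exact: kapv_onto.
- by move=> x; exact: q3 (kapv_in x).
- by move=> I x I0 IJ; exact: q4 I0 IJ (kapv_in x).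
- move=> a x aJ; have [y yJ e] := principal_ideal_vertex htr hlam hS aJ (kapv_in x).
  by have [z ze] := kapv_onto yJ; exists z; exact: etrans ze e.
Qed.

End Main.

Theorem theorem6
  (R : realType) (k : comUnitRingType) (hk : field_or_int k)
  (* the Buchsbaum pseudo-cell complex Q and its face poset S *)
  (Q : topologicalType) (disp : Order.disp_t) (S : finBPOrderType disp)
  (F dF : S -> set Q) (fdim rk : S -> nat) (n : nat)
  (hQ : buchsbaum_complex R k F dF fdim rk n)
  (sgn : S -> S -> int) (hsgn : sign_convention rk sgn)
  (* its structure sheaf *)
  (H0 : sheaf (structure_val R k F dF fdim))
  (hH0 : structure_sheaf rk sgn H0)
  (* the principal torus bundle, its trivializations over the proper faces and
     the transition maps *)
  (N : nat) (Y : topologicalType) (act : Y -> 'rV[R[i]^o]_N -> Y) (rho : Y -> Q)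
  (hY : principal_torus_bundle act rho)
  (xi : S -> Y -> 'rV[R[i]^o]_N)
  (hxi : forall I : S, I != \bot%O -> trivialization act rho (F I) (xi I))
  (tr : S -> S -> 'rV[R[i]^o]_N -> 'rV[R[i]^o]_N)
  (htr : transition_maps rho F xi tr)
  (* the characteristic map *)
  (lam : S -> set 'rV[R[i]^o]_N) (theta : S -> R[i]^o -> 'rV[R[i]^o]_N)
  (hlam : characteristic_map k rk tr lam theta)
  (* L and its inverse cosheaf, the sheaf and the cosheaf of ideals *)
  (L : forall j : nat, sheaf (@L_val R N k disp S j))
  (hL : locally_constant_sheaf tr L)
  (Lhat : forall j : nat, cosheaf (@L_val R N k disp S j))
  (hLhat : inverse_cosheaf L Lhat)
  (Ideal : forall j : nat,
     sheaf (fun I => submod_type (ideal k rk tr lam theta j I)))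
  (hIdeal : forall j : nat, subsheaf (L j) (Ideal j))
  (Pihat : forall j : nat,
     cosheaf (fun I => submod_type (principal_ideal k rk tr lam theta j I)))
  (hPihat : forall j : nat, subcosheaf (Lhat j) (Pihat j)) :
  forall m : int, exists f : forall j : nat,
    {linear cohomology_sheaf rk sgn (tensor_sheaf H0 (Ideal j)) m ->
            homology_cosheaf rk sgn (Pihat j) (n%:Z - 1 - m)},
    forall j : nat, bijective (f j).
Proof.
(* Respecting the gradings means one isomorphism for each degree [j] of the exterior algebra, so the
   degrees are treated separately. *)
move=> m; suff h j : exists f : {linear cohomology_sheaf rk sgn (tensor_sheaf H0 (Ideal j)) m ->
    homology_cosheaf rk sgn (Pihat j) (n%:Z - 1 - m)}, bijective f by exact: dep_choice h.
have hs := buchsbaum_simple hQ; have hS := simple_poset hs.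
have htr' := transition_translation hY hxi htr (fun I J => (pcc_order (simple_pcc hs) I J).1).
have rkfdim J : (rk J + fdim J = n)%N by rewrite addnC; exact: fdimE hs J.
have [alpha [a1 a2 a3]] := augmented_columns hQ hsgn hH0.
have cols := columns_homology hS hsgn rkfdim (Pihat j) (@kapv_bot R k N disp S j _) a1 a2 a3 m.
apply: (double_complex_iso _ cols).
exact: (rows_homology hS hsgn rkfdim H0 (M := fun I => submod_type (principal_ideal k rk tr lam theta j I))
  (B := fun I => submod_type (ideal k rk tr lam theta j I)) (@kapv_bot R k N disp S j _)
  (@kapv_inj R k N disp S j (ideal k rk tr lam theta j)) (@kapv_bot R k N disp S j _)
  (kapv_res htr' hL (hIdeal j)) (ideal_rows htr' hlam hS hsgn hL hLhat (hPihat j)) m).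
Qed.
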